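(* There is a randomized algorithm for the 0-1 Knapsack problem that runs in time \[\widetilde{O}\big((p_{\max} W)^{2/3} (n\, w_{\max})^{1/3} + n\, w_{\max}\big)\] and outputs $\mathrm{OPT}$ correctly with high probability (for any fixed constant $c$, with probability at least $1-n^{-c}$). In particular, since one may assume $W \le n\, w_{\max}$, the running time is at most $\widetilde{O}(n\, w_{\max}\, p_{\max}^{2/3})$.
   Context: In 0-1 Knapsack one is given $n$ items $(p_1,w_1),\dots,(p_n,w_n)$ with profits $p_i\in\mathbb{N}$ and weights $w_i\in\mathbb{N}$ and a weight budget $W\in\mathbb{N}$; the goal is to compute $\mathrm{OPT}=\max\{\sum_i p_i x_i : \sum_i w_i x_i \le W,\ x\in\{0,1\}^n\}$. Here $p_{\max}=\max_i p_i$ and $w_{\max}=\max_i w_i$. The notation $\widetilde{O}(T)$ means $O(T\log^c(NU))$ for some constant $c$, where the input consists of $N$ numbers bounded in absolute value by $U$. *)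

(* Defs.v *)
From mathcomp Require Import all_boot.
Set Implicit Arguments. Unset Strict Implicit. Unset Printing Implicit Defensive.

Definition profit (items : seq (nat * nat)) (i : nat) := (nth (0,0) items i).1.
Definition weight (items : seq (nat * nat)) (i : nat) := (nth (0,0) items i).2.

Definition OPT (items : seq (nat * nat)) (W : nat) : nat :=
  \max_(S : {set 'I_(size items)} | \sum_(i in S) weight items i <= W)
     \sum_(i in S) profit items i.

Definition pmax (items : seq (nat * nat)) := \max_(it <- items) it.1.
Definition wmax (items : seq (nat * nat)) := \max_(it <- items) it.2.

Definition cbrt (x : nat) : nat := \max_(a < x.+1 | a ^ 3 <= x) a.

(* The input consists of N = 2n+1 numbers bounded by U; logNU is
   (roughly) log2(N*U), at least 1. *)
Definition Ubound (items : seq (nat * nat)) (W : nat) :=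
  maxn 2 (maxn W (maxn (pmax items) (wmax items))).
Definition logNU (items : seq (nat * nat)) (W : nat) :=
  (trunc_log 2 ((size items).*2.+1 * Ubound items W)).+1.

(* Memory: nat -> nat.  Register arguments d a b are direct addresses;
   ILoad/IStore are indirect.  Every value written must be < 2^wsize,
   otherwise the machine aborts (word-size restriction). *)
Inductive instr :=
| IConst of nat & nat
| IAdd of nat & nat & nat
| ISub of nat & nat & nat      (* truncated subtraction *)
| IMul of nat & nat & nat
| IDiv of nat & nat & nat      (* x / 0 = 0 *)
| IMod of nat & nat & nat
| ILt of nat & nat & nat
| IEq of nat & nat & nat
| ILoad of nat & nat
| IStore of nat & nat
| IJz of nat & nat
| IRand of nat
| IHalt.

Definition program := seq instr.

Definition upd (m : nat -> nat) (a v : nat) : nat -> nat :=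
  fun x => if x == a then v else m x.

(* exec wsize P fuel pc m bits = Some (output, steps) if the machine halts
   within fuel steps (each instruction, including Halt, costs 1).
   A pc outside the program halts. *)
Fixpoint exec (wsize : nat) (P : program) (fuel pc : nat) (m : nat -> nat)
    (bits : seq bool) : option (nat * nat) :=
  match fuel with
  | 0 => None
  | fuel'.+1 =>
    let tick r := omap (fun o => (o.1, o.2.+1)) r in
    let wr d v := if v < 2 ^ wsize
                  then tick (exec wsize P fuel' pc.+1 (upd m d v) bits)
                  else None in
    match nth IHalt P pc with
    | IHalt => Some (m 0, 1)
    | IConst d c => wr d c
    | IAdd d a b => wr d (m a + m b)
    | ISub d a b => wr d (m a - m b)
    | IMul d a b => wr d (m a * m b)
    | IDiv d a b => wr d (m a %/ m b)
    | IMod d a b => wr d (m a %% m b)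
    | ILt d a b => wr d (m a < m b : nat)
    | IEq d a b => wr d (m a == m b : nat)
    | ILoad d a => wr d (m (m a))
    | IStore a b => wr (m a) (m b)
    | IJz a l => tick (exec wsize P fuel' (if m a == 0 then l else pc.+1) m bits)
    | IRand d => match bits with
                 | [::] => None
                 | bt :: bs => tick (exec wsize P fuel' pc.+1 (upd m d bt) bs)
                 end
    end
  end.

(* Input layout: M[0] = n, M[1] = W, M[2+2i] = p_i, M[3+2i] = w_i. *)
Definition init_mem (items : seq (nat * nat)) (W : nat) : nat -> nat :=
  fun a => if a == 0 then size items
           else if a == 1 then W
           else if (a - 2) < (size items).*2 then
             (if odd (a - 2) then weight items ((a - 2)./2)
              else profit items ((a - 2)./2))
           else 0.

Definition succeeds (P : program) (k : nat) (items : seq (nat * nat)) (W T : nat)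
    (bits : T.-tuple bool) : bool :=
  if exec (k * logNU items W) P T 0 (init_mem items W) bits is Some (out, _)
  then out == OPT items W else false.

(* Time bounds  O~((pmax W)^{2/3} (n wmax)^{1/3} + n wmax)  and
   O~(n wmax pmax^{2/3}), with explicit constant K and polylog factor
   logNU^K (an additive n term accounts for reading the input). *)
Definition time_bound1 (K : nat) (items : seq (nat * nat)) (W : nat) :=
  K * logNU items W ^ K *
  (cbrt ((pmax items * W) ^ 2 * (size items * wmax items))
   + size items * wmax items + size items + 1).

Definition time_bound2 (K : nat) (items : seq (nat * nat)) (W : nat) :=
  K * logNU items W ^ K *
  (size items * wmax items * cbrt (pmax items ^ 2)
   + size items * wmax items + size items + 1).

(* Main.v *)
(* The program is deterministic; the random bits are not used.
   It runs a dynamic program whose cost is, up to logarithmic factors, n + wmax + X with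
   X = min(pmax^2, min(n, wmax) W); since X^3 <= pmax^2 (min(n, wmax) W)^2, X is at most the cube
   root of (pmax W)^2 n wmax.  If min(n, wmax) W is the smaller term, the items are grouped by
   weight and each class is added to a table indexed by the weight by a (min,+) convolution with
   the convex cost of leaving out the t cheapest items of the class.
   Otherwise the table is indexed by the profit, near the profit of the greedy solution, and stores
   least weights.  An exchange argument bounds the distance between a suitable optimal solution and the
   greedy one: if among the items skipped there are s profits with r copies each, r s^2 >> pmax,
   and the items added beyond them have total profit >> pmax^2 / s, then a nonempty set of the former and one of the
   latter have equal profit and can be exchanged.  (The first sums contain a long arithmetic
   progression because sumsets in cyclic groups grow.)  Scanning outwards from the break item for
   s = 2^l profits with pmax / 4^l copies assigns a level to every profit class; the classes of
   level l number at most 2^(l+1), and their deviations from the greedy solution are at most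
   about pmax^2 / 2^l, so processing the classes by decreasing level in windows of that width costs
   about pmax^2 per level. *)

From Stdlib Require Import FunctionalExtensionality.
Require Import Defs.
From mathcomp Require Import all_boot ssralg finalg zmodp zify.
Set Implicit Arguments. Unset Strict Implicit. Unset Printing Implicit Defensive.

(** * Fast growth of sumsets in cyclic groups *)

Import GRing.Theory.

Section Growth.
Local Open Scope ring_scope.
Variable G : finZmodType.
Implicit Types (S B : {set G}) (H : {set G}).

(** Why the threshold compares [r * s ^ 2] with [m]: [s] values have about [s ^ 2] differences, and
    a dyadic pigeonhole keeps [h] of them of one magnitude, each with [c] representations, where
    [h * c] is about [s ^ 2]. A represented difference is a toggle: two items differing by it,
    exactly one of which is taken. About [m / h] toggles make a progression, since [h] differences
    spread fast over the residues modulo one of them; about [r * c] disjoint toggles are available.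
    So [m / h] below [r * c] suffices. The obstacle is the sum of the untoggled items, which need
    not be divisible by the gcd of the differences; a second, slower growth argument repairs its
    residue with few more items. Both tables come from one program on pairs [(u, v)], indexed by
    [u]-sums and storing least [v]-sums. For the profit table [u] is the profit. For the weight
    table [u] is the weight and the multiplicities count the items left out; the greedy capacity is
    then the total profit, so that the greedy prefix is everything. The program is written in a
    while language whose weakest preconditions count steps. *)

Definition shift S z : {set G} := [set x + z | x in S].
Definition nshift S z : nat := #|shift S z :\: S|.

Lemma mem_shift S z x : (x \in shift S z) = (x - z \in S).
Proof.
apply/imsetP/idP => [[y yS ->]|xS]; first by rewrite addrK.
by exists (x - z); rewrite ?subrK.
Qed.

Lemma card_shift S z : #|shift S z| = #|S|.
Proof. by apply: card_imset; apply: addIr. Qed.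

(** A point of [S + y + z] outside [S] lies either in [S + z], or in the [z]-translate of the part
    of [S + y] outside [S]. *)
Lemma nshiftD S y z : (nshift S (y + z) <= nshift S y + nshift S z)%N.
Proof.
rewrite /nshift -(card_shift (shift S y :\: S) z) -cardsUI.
apply: leq_trans (leq_addr _ _); apply: subset_leq_card; apply/subsetP => x.
rewrite !inE !mem_shift !inE !mem_shift.
have -> : x - (y + z) = x - z - y by rewrite opprD addrA addrAC.
by case: (x \in S); case: (x - z \in S); case: (x - z - y \in S).
Qed.

Lemma nshiftN S z : nshift S (- z) = nshift S z.
Proof.
rewrite /nshift.
have := card_shift (shift S (- z) :\: S) z => <-.
have -> : shift (shift S (- z) :\: S) z = S :\: shift S z.
  apply/setP => x; rewrite !inE !mem_shift !inE !mem_shift opprK.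
  by rewrite -addrA [- z + z]addrC subrr addr0.
have := cardsID (shift S z) S; have := cardsID S (shift S z).
rewrite card_shift setIC; lia.
Qed.

Lemma nshift0 S : nshift S 0 = 0%N.
Proof.
rewrite /nshift; apply/eqP; rewrite cards_eq0 setD_eq0; apply/subsetP => x.
by rewrite mem_shift subr0.
Qed.

(** Double counting: a point of [S] and a point outside it determine the shift that carries the
    first to the second. *)
Lemma sum_nshift S : (\sum_(z : G) nshift S z)%N = (#|S| * (#|G| - #|S|))%N.
Proof.
have -> : (#|S| * (#|G| - #|S|) = \sum_(y in S) #|~: S|)%N.
  by rewrite sum_nat_const -(cardsC S) addKn.
transitivity (\sum_(z : G) \sum_(y in S) ((y + z)%R \notin S))%N.
  apply: eq_bigr => z _.
  have -> : nshift S z = #|[set y in S | y + z \notin S]|.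
    rewrite /nshift -(card_shift [set y in S | y + z \notin S] z).
    by apply: eq_card => x; rewrite !inE !mem_shift !inE subrK andbC.
  rewrite -sum1_card (eq_bigl (fun y => (y \in S) && (y + z \notin S))); last first.
    by move=> y; rewrite inE.
  by rewrite big_mkcondr; apply: eq_bigr => y _; case: (_ \notin _).
rewrite exchange_big; apply: eq_bigr => y _.
rewrite -sum1_card [RHS](eq_bigl (fun x => x \notin S)); last by move=> x; rewrite inE.
rewrite [RHS](reindex_inj (addrI y)) [RHS]big_mkcond.
by apply: eq_bigr => x _; case: (_ \notin _).
Qed.

Variables (H : {set G}).
(** Generation by [H]. Closure under adding elements of [H] is enough, because in a finite group the
    inverse of an element is one of its multiples. *)
Hypothesis gen : forall K : {set G}, 0 \in K ->
  (forall z h, z \in K -> h \in H -> z + h \in K) -> K = setT.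

(** The element [0] makes the balls nested; closure under negation makes distance symmetric, which
    separates the balls in [gball_grow]. *)
Definition stepset : {set G} := 0 |: (H :|: [set - h | h in H]).

Lemma stepsetN x : (- x \in stepset) = (x \in stepset).
Proof.
have aux y : y \in stepset -> - y \in stepset.
  rewrite !inE => /or3P[/eqP-> | yH | /imsetP[h hH ->]].
  - by rewrite oppr0 eqxx.
  - by rewrite (imset_f _ yH) !orbT.
  - by rewrite opprK hH orbT.
by apply/idP/idP => /aux; rewrite ?opprK.
Qed.

Fixpoint gball k : {set G} :=
  if k is k'.+1 then [set x + y | x in gball k', y in stepset] else [set 0].

Lemma gballS k x y : x \in gball k -> y \in stepset -> x + y \in gball k.+1.
Proof. by move=> xk yH; apply/imset2P; exists x y. Qed.

Lemma gball_sub k : gball k \subset gball k.+1.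
Proof.
by apply/subsetP => x xk; rewrite -[x]addr0; apply: gballS => //; rewrite !inE eqxx.
Qed.

Lemma gball0 k : 0 \in gball k.
Proof.
by elim: k => [|k IH]; [rewrite inE | apply: (subsetP (gball_sub k))].
Qed.

Lemma gball_mono j k : (j <= k)%N -> gball j \subset gball k.
Proof.
elim: k => [|k IH]; first by rewrite leqn0 => /eqP->.
rewrite leq_eqVlt => /orP[/eqP-> //|]; rewrite ltnS => /IH jk.
exact: subset_trans jk (gball_sub k).
Qed.

(** A ball that stops growing is closed under adding elements of [H]. *)
Lemma gball_stable k : gball k.+1 = gball k -> gball k = setT.
Proof.
move=> E; apply: gen (gball0 k) _ => z h zk hH.
by rewrite -E; apply: gballS => //; rewrite !inE hH orbT.
Qed.

(* Balls of radius 1 around points at distances 0, 3, 6, ... are disjoint. *)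
Lemma gball_grow j : gball (3 * j) = setT \/ (j * #|H| <= #|gball (3 * j)|)%N.
Proof.
elim: j => [|j [IH|IH]]; first by right; rewrite mul0n.
  by left; apply/eqP; rewrite -subTset -IH gball_mono //; lia.
have -> : (3 * j.+1 = (3 * j).+3)%N by lia.
set k := (3 * j)%N in IH *.
have [/eqP E|ne] := boolP (gball k.+2 == gball k.+1).
  left; apply/eqP; rewrite -subTset -(gball_stable E).
  exact: (subset_trans (gball_sub _) (gball_sub _)).
right.
have /subsetPn[y y2 y1] : ~~ (gball k.+2 \subset gball k.+1).
  by apply: contraNN ne => s; rewrite eqEsubset s gball_sub.
have sub : gball k :|: shift H y \subset gball k.+3.
  rewrite subUset gball_mono ?leq_addl; last by lia.
  apply/subsetP => x /imsetP[h hH ->]; rewrite addrC; apply: gballS => //.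
  by rewrite !inE hH orbT.
have dis : gball k :&: shift H y = set0.
  apply/setP => x; rewrite !inE mem_shift; apply/negP => /andP[xk xyH].
  case/negP: y1; have -> : y = x + - (x - y) by rewrite opprB addrC subrK.
  by apply: gballS => //; rewrite stepsetN !inE xyH orbT.
have := subset_leq_card sub; rewrite cardsU dis cards0 card_shift subn0; lia.
Qed.

Lemma nshift_gball S t k z : (forall h, h \in H -> nshift S h <= t)%N ->
  z \in gball k -> (nshift S z <= k * t)%N.
Proof.
move=> Ht; elim: k z => [|k IH] z; first by rewrite inE => /eqP->; rewrite nshift0.
case/imset2P => x y xk yH ->; apply: leq_trans (nshiftD _ _ _) _.
rewrite mulSn addnC leq_add ?IH //.
move: yH; rewrite !inE => /or3P[/eqP->|/Ht//|/imsetP[h /Ht hH ->]].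
  by rewrite nshift0.
by rewrite nshiftN.
Qed.

(** A bound for the diameter of the Cayley graph of [G] with generators [H]: every three steps gain
    [#|H|] points. *)
Definition diam := (3 * (#|G| %/ #|H|).+1)%N.

Lemma gball_diam : gball diam = setT.
Proof.
have [//|big] := gball_grow (#|G| %/ #|H|).+1.
(* For empty [H] the quotient by [0] is [0], so [diam] is [3]; then [0] is the only step and every
   ball is stable. *)
have [H0|Hpos] := posnP #|H|.
  have E : gball diam.-1.+1 = gball diam.-1.
    apply/eqP; rewrite eqEsubset gball_sub andbT; apply/subsetP => x /imset2P[a b ab].
    move/eqP: H0; rewrite cards_eq0 => /eqP H0; rewrite !inE H0 inE imset0 inE !orbF.
    by move=> /eqP-> ->; rewrite addr0.
  by move: (E); rewrite (gball_stable E); rewrite /diam /=.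
have := leq_trans (ltn_ceil #|G| Hpos) (leq_trans big (max_card _)).
by rewrite ltnn.
Qed.

(** Averaging: a random shift moves at least half of [S] out of [S] when [S] fills at most half of
    [G]. If all of [H] moved less than [#|S| / (2 * diam)] points, subadditivity along a path of
    [diam] steps would keep every shift below that average. *)
Lemma exists_shift S : S != set0 -> (2 * #|S| <= #|G|)%N ->
  exists2 h, h \in H & (#|S| <= 2 * diam * nshift S h)%N.
Proof.
move=> Sn0 Sle.
case: (pickP (fun h => (h \in H) && (#|S| <= 2 * diam * nshift S h)%N)).
  by move=> h /andP[]; exists h.
move=> none.
have lt h : h \in H -> (2 * diam * nshift S h < #|S|)%N.
  by move=> hH; have := none h; rewrite hH /= => /negbT; rewrite -ltnNge.
(* The largest shift size compatible with [lt]. *)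
pose t := ((#|S|).-1 %/ (2 * diam))%N.
have Spos : (0 < #|S|)%N by rewrite card_gt0.
have dpos : (0 < 2 * diam)%N by rewrite !muln_gt0.
have Ht h : h \in H -> (nshift S h <= t)%N.
  by move=> /lt Hlt; rewrite /t leq_divRL // mulnC -ltnS prednK.
have bound z : (nshift S z <= diam * t)%N.
  by apply: nshift_gball Ht _; rewrite gball_diam inE.
have := sum_nshift S => E.
have : (#|S| * (#|G| - #|S|) <= #|G| * (diam * t))%N.
  rewrite -E; apply: (@leq_trans (\sum_(z : G) diam * t)%N).
    by apply: leq_sum => z _; apply: bound.
  by rewrite sum_nat_const.
have : (2 * (diam * t) < #|S|)%N.
  rewrite mulnA mulnC -[ltnRHS](prednK Spos) ltnS; exact: leq_divM.
nia.
Qed.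

Fixpoint subsums (l : seq G) : {set G} :=
  if l is a :: l' then subsums l' :|: shift (subsums l') a else [set 0].

Lemma subsums0 l : 0 \in subsums l.
Proof. by elim: l => [|a l IH] /=; rewrite !inE ?IH. Qed.

Lemma subsums_cons a l : #|subsums (a :: l)| = (#|subsums l| + nshift (subsums l) a)%N.
Proof.
rewrite /= /nshift.
have -> : subsums l :|: shift (subsums l) a
        = subsums l :|: (shift (subsums l) a :\: subsums l).
  by apply/setP => x; rewrite !inE; case: (_ \in _).
rewrite cardsU; have -> : subsums l :&: (shift (subsums l) a :\: subsums l) = set0.
  by apply/setP => x; rewrite !inE; case: (_ \in _).
by rewrite cards0 subn0.
Qed.

Lemma subsums_cat l1 l2 x y :
  x \in subsums l1 -> y \in subsums l2 -> x + y \in subsums (l1 ++ l2).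
Proof.
elim: l1 x => [|a l IH] x /=; first by rewrite inE => /eqP->; rewrite add0r.
rewrite inE mem_shift => /orP[xl|xl] yl; rewrite inE mem_shift; first by rewrite IH.
by rewrite [x + y - a]addrAC (IH (x - a)) ?orbT.
Qed.

(** As long as at most half of [G] is filled, each further element of [H] gains a fraction
    [1 / (2 * diam)] of the initial size, so [2 * diam] of them double the set. *)
Lemma subsums_more l t : exists l', [/\ all (mem H) l', size l' <= t &
   #|G| < 2 * #|subsums (l' ++ l)| \/
   2 * diam * #|subsums l| + t * #|subsums l| <= 2 * diam * #|subsums (l' ++ l)|]%N.
Proof.
elim: t => [|t [l' [al sz [big|IH]]]].
- by exists [::]; split=> //=; right; lia.
- by exists l'; split=> //; [lia | left].
have [big|le] := ltnP #|G| (2 * #|subsums (l' ++ l)|).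
  by exists l'; split=> //; [lia | left].
have n0 : subsums (l' ++ l) != set0 by apply/set0Pn; exists 0; apply: subsums0.
have [h hH hS] := exists_shift n0 le.
exists (h :: l'); split; rewrite /= ?hH //; right.
have ->: #|subsums (l' ++ l) :|: shift (subsums (l' ++ l)) h|
   = #|subsums (h :: (l' ++ l))| by [].
rewrite subsums_cons.
have dpos : (0 < 2 * diam)%N by rewrite !muln_gt0.
have : (#|subsums l| <= #|subsums (l' ++ l)|)%N.
  by rewrite -(leq_pmul2l dpos); apply: leq_trans IH; rewrite leq_addr.
move=> le1; rewrite mulnDr mulSn addnCA addnC leq_add //.
exact: leq_trans le1 hS.
Qed.

Lemma subsums_double j : exists l', [/\ all (mem H) l', size l' <= j * (2 * diam) &
   #|G| < 2 * #|subsums l'| \/ 2 ^ j <= #|subsums l'|]%N.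
Proof.
elim: j => [|j [l [al sz [big|IH]]]].
- by exists [::]; split=> //; right; rewrite expn0 cards1.
- by exists l; split=> //; [nia | left].
have [l' [al' sz' alt]] := subsums_more l (2 * diam).
exists (l' ++ l); split; first by rewrite all_cat al' al.
  by rewrite size_cat; lia.
case: alt => [big|alt]; [by left | right].
have dpos : (0 < 2 * diam)%N by rewrite !muln_gt0.
rewrite expnS -(leq_pmul2l dpos); apply: leq_trans alt; nia.
Qed.

(** A set [S] with more than half of [G] satisfies [S + S = G], since [S] and [z - S] intersect;
    hence the list is doubled. The list may repeat elements of [H]: later every difference has many
    disjoint representations. *)
Lemma fast_growth : exists l, [/\ all (mem H) l,
  (size l <= 4 * diam * (trunc_log 2 #|G|).+1)%N & subsums l = setT].
Proof.
have [l [al sz alt]] := subsums_double (trunc_log 2 #|G|).+1.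
exists (l ++ l); rewrite all_cat al; split=> //.
  rewrite size_cat; apply: leq_trans (leq_add sz sz) _; lia.
have big : (#|G| < 2 * #|subsums l|)%N.
  case: alt => // alt; apply: leq_trans (@trunc_log_ltn 2 #|G| isT) _.
  by apply: leq_trans alt _; rewrite leq_pmull.
apply/setP => z; rewrite inE.
set S := subsums l in big *; pose S' := [set z - x | x in S].
have cS' : #|S'| = #|S| by apply: card_imset => a b /addrI /oppr_inj.
have h1 : (#|S :|: S'| <= #|G|)%N by apply: max_card.
have h2 := cardsUI S S'.
have : (0 < #|S :&: S'|)%N.
  rewrite -(ltn_add2l #|S :|: S'|) addn0 h2 cS' addnn -mul2n.
  exact: leq_ltn_trans h1 big.
rewrite card_gt0 => /set0Pn[w]; rewrite inE => /andP[wS /imsetP[x xS E]].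
have -> : z = w + x by rewrite E subrK.
exact: subsums_cat.
Qed.

End Growth.

Import GRing.Theory.

(** * Translation-invariant subsets of cyclic groups *)

Section Cyclic.
Variable N : nat.
Local Notation G := 'I_N.+1.

Lemma inZpD a b : (inZp (a + b) : G) = (inZp a + inZp b)%R.
Proof. by apply: val_inj; rewrite /= modnDm. Qed.

Lemma inZp_eq a b : ((inZp a : G) == inZp b) = (a == b %[mod N.+1]).
Proof. by rewrite -val_eqE. Qed.

Definition preserves (S : {set G}) (a : nat) := forall x, x \in S -> (x + inZp a)%R \in S.

Lemma preservesD S a b : preserves S a -> preserves S b -> preserves S (a + b).
Proof. by move=> pa pb x xS; rewrite inZpD addrA; apply/pb/pa. Qed.

Lemma preserves_eq S a b : a = b %[mod N.+1] -> preserves S a -> preserves S b.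
Proof.
by move=> E pa x xS; have -> : inZp b = inZp a :> G; [apply/eqP; rewrite inZp_eq E | apply: pa].
Qed.

Lemma preserves0 S : preserves S 0.
Proof.
move=> x xS; have -> : inZp 0 = 0%R :> G by apply: val_inj; rewrite /= mod0n.
by rewrite addr0.
Qed.

Lemma preservesM S a k : preserves S a -> preserves S (k * a).
Proof.
move=> pa; elim: k => [|k IH]; first by rewrite mul0n; apply: preserves0.
by rewrite mulSn; apply: preservesD.
Qed.

Lemma preserves_gcd S a b : preserves S a -> preserves S b -> preserves S (gcdn a b).
Proof.
move=> pa pb; case: (posnP a) => [->|a0]; first by rewrite gcd0n.
case: (egcdnP b a0) => ka kb E _.
(* Bezout without subtraction: the factor [N] acts as [-1] modulo [N.+1]. *)
apply: (@preserves_eq S (ka * a + (N * kb) * b)); last first.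
  by apply: preservesD; apply: preservesM.
rewrite E; have -> : kb * b + gcdn a b + N * kb * b = kb * b * N.+1 + gcdn a b by nia.
by rewrite modnMDl.
Qed.

Lemma preserves_biggcd (I : finType) (P : pred I) (f : I -> nat) S a :
  preserves S a -> (forall i, P i -> preserves S (f i)) ->
  preserves S (\big[gcdn/a]_(i | P i) f i).
Proof.
move=> pa pf; elim/big_rec: _ => // i x Pi px.
by apply: preserves_gcd => //; apply: pf.
Qed.

End Cyclic.

(** * Zero-sum subsets and residues of subset sums *)

Section Zerosum.
Variables (I : finType) (u : I -> nat).

(** Two of the [d + 1] prefix sums of [d] elements agree modulo [d], and the segment between them is
    the required set. *)
Lemma zerosum (C : {set I}) d : 0 < d -> d <= #|C| ->
  exists C' : {set I}, [/\ C' \subset C, C' != set0, #|C'| <= d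
    & d %| \sum_(i in C') u i].
Proof.
move=> d0 dC; pose s := take d (enum C).
have sz : size s = d by rewrite size_take -cardE; case: ltngtP dC.
have us : uniq s by rewrite take_uniq ?enum_uniq.
pose pf (i : 'I_d.+1) : 'I_d := Ordinal (ltn_pmod (\sum_(x <- take i s) u x) d0).
have /injectivePn[i [j ij E]] : ~~ injectiveb pf.
  by apply/negP => /injectiveP /leq_card; rewrite !card_ord ltnn.
wlog lt : i j ij E / i < j.
  move=> H; case: (ltngtP i j) => [lt|lt|/val_inj ee]; first exact: (H i j).
    by apply: (H j i) => //; rewrite eq_sym.
  by rewrite ee eqxx in ij.
pose t := drop i (take j s).
have ut : uniq t by apply: drop_uniq; apply: take_uniq.
have szt : size t = j - i by rewrite size_drop size_takel // sz -ltnS.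
have tin x : x \in t -> x \in C.
  by move=> /mem_drop/mem_take; rewrite /s => /mem_take; rewrite mem_enum.
exists [set x in t]; split.
- by apply/subsetP => x; rewrite inE; apply: tin.
- rewrite -card_gt0 cardsE (card_uniqP ut) szt; lia.
- rewrite cardsE (card_uniqP ut) szt; have := ltn_ord j; lia.
have -> : \sum_(x in [set x in t]) u x = \sum_(x <- t) u x.
  by rewrite big_uniq //=; apply: eq_bigl => x; rewrite inE.
have := congr1 val E; rewrite /=.
have -> : take j s = take i s ++ t.
  by rewrite /t -{1}(cat_take_drop i (take j s)) take_takel // ltnW.
rewrite big_cat /= -[X in X %% _ = _]addn0 => /eqP.
by rewrite eqn_modDl mod0n eq_sym.
Qed.

End Zerosum.

Section SlowGrowth.
Variables (I : finType) (u : I -> nat).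

(** For [E] with as many residues of subset sums as possible, each remaining element translates
    these residues into themselves, and so does the gcd [f] of [d] and the remaining elements. If
    [f] were a proper multiple of [e], some [e * q] would divide [f], and the [d] elements that
    [rob] provides would all lie in [E], which has fewer than [d]. *)
Lemma slow_growth (U : {set I}) d e : 0 < d -> e %| d ->
  (forall i, i \in U -> e %| u i) ->
  (forall q, prime q -> e * q %| d -> d <= #|[set i in U | ~~ (e * q %| u i)]|) ->
  exists E : {set I}, [/\ E \subset U, #|E| < d & forall t, e %| t ->
    exists2 E' : {set I}, E' \subset E & \sum_(i in E') u i = t %[mod d]].
Proof.
case: d => // N _ ed eU rob.
pose sm (F : {set I}) : 'I_N.+1 := inZp (\sum_(i in F) u i).
pose R (E : {set I}) := [set sm F | F in powerset E].
have R0 E : 0%R \in R E.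
  apply/imsetP; exists set0; first by rewrite powersetE sub0set.
  by apply: val_inj; rewrite /sm big_set0 /= mod0n.
(* Demanding more residues than elements bounds [#|E|] by [d] at the maximum; an element that adds a
   residue preserves the inequality. *)
pose ok (E : {set I}) := (E \subset U) && (#|E| < #|R E|).
have ok0 : ok set0.
  by rewrite /ok sub0set cards0 card_gt0; apply/set0Pn; exists 0%R.
case: (arg_maxnP (fun E => #|R E|) ok0) => E /andP[EU EltR] Emax.
have pres i : i \in U :\: E -> preserves (R E) (u i).
  rewrite inE => /andP[iE iU] x xR; apply/negP => /negP nR.
  have sub : (x + inZp (u i))%R |: R E \subset R (i |: E).
    apply/subsetP => y; rewrite !inE => /orP[/eqP->|].
      case/imsetP: xR => F; rewrite powersetE => FE ->.
      apply/imsetP; exists (i |: F); first by rewrite powersetE setUS.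
      rewrite /sm big_setU1 /=; first by rewrite addnC inZpD.
      by apply: contraNN iE; apply: (subsetP FE).
    case/imsetP => F; rewrite powersetE => FE ->; apply/imsetP; exists F => //.
    by rewrite powersetE; apply: subset_trans FE (subsetUr _ _).
  have := subset_leq_card sub; rewrite cardsU1 nR /= add1n => gr.
  have oki : ok (i |: E).
    by rewrite /ok subUset sub1set iU EU cardsU1 iE /= (leq_trans _ gr).
  by have := leq_trans gr (Emax _ oki); rewrite ltnn.
have RN : #|R E| <= N.+1.
  by apply: leq_trans (max_card _) _; rewrite card_ord.
exists E; split=> //; first exact: leq_trans EltR RN.
pose f := \big[gcdn/N.+1]_(i in U :\: E) u i.
have pf : preserves (R E) f.
  apply: preserves_biggcd => //; apply: (@preserves_eq _ _ 0); last exact: preserves0.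
  by rewrite mod0n modnn.
have fdiv i : i \in U :\: E -> f %| u i.
  by move=> iUE; rewrite /f (bigD1 i) //= dvdn_gcdl.
have ef : e %| f.
  rewrite /f; elim/big_rec: _ => // i x; rewrite inE => /andP[_ iU] ex.
  by rewrite dvdn_gcd eU.
have fd : f %| N.+1.
  rewrite /f; elim/big_rec: _ => // i x _ xd.
  exact: dvdn_trans (dvdn_gcdr _ _) xd.
have e0 : 0 < e by apply: dvdn_gt0 ed.
have fe : f = e.
  apply/eqP; rewrite -[f](divnK ef); have [->|n1] := eqVneq (f %/ e) 1.
    by rewrite mul1n.
  have f0 : 0 < f by apply: dvdn_gt0 fd.
  have big : 1 < f %/ e by rewrite ltn_neqAle eq_sym n1 divn_gt0 // dvdn_leq.
  have pq := pdiv_prime big.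
  have eqf : e * pdiv (f %/ e) %| f.
    by rewrite -{2}[f](divnK ef) mulnC dvdn_mul // pdiv_dvd.
  have := rob _ pq (dvdn_trans eqf fd).
  have : [set i in U | ~~ (e * pdiv (f %/ e) %| u i)] \subset E.
    apply/subsetP => i; rewrite inE => /andP[iU]; apply: contraNT => iE.
    by apply: dvdn_trans eqf _; apply: fdiv; rewrite inE iE.
  move/subset_leq_card; lia.
move=> t /dvdnP[k ->].
have := preservesM k pf (R0 E); rewrite fe add0r => /imsetP[F FE EF].
exists F; first by rewrite -powersetE.
by apply/eqP; rewrite -inZp_eq /sm in EF *; rewrite -EF.
Qed.

End SlowGrowth.

(** * Equal subset sums in dense sets *)

Lemma pigeonhole_class (T C : finType) (A : {set T}) (f : T -> C) (c0 : C) :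
  exists c, #|A| <= #|C| * #|[set x in A | f x == c]|.
Proof.
pose a c := #|[set x in A | f x == c]|.
case: (@arg_maxnP _ c0 xpredT a isT) => c _ cmax; exists c.
have -> : #|A| = \sum_(c : C) a c.
  rewrite -sum1_card (partition_big f xpredT) //=; apply: eq_bigr => c' _.
  by rewrite /a -sum1_card; apply: eq_bigl => x; rewrite inE.
rewrite -sum_nat_const; apply: leq_sum => c' _; exact: cmax.
Qed.

(** * Popular differences *)

Section Popular.
Variables (M : nat) (V : {set 'I_M}).

Definition rep (d : nat) := #|[set v in V | [exists w in V, val w == v + d]]|.

Lemma rep_le d : rep d <= #|V|.
Proof. by apply: subset_leq_card; apply/subsetP => v; rewrite inE => /andP[]. Qed.

(** The increasing pairs are classified by the binary logarithms of their difference and of its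
    number of representations, giving [l * l] classes. The factor [8] is [4 * 2]: at least a quarter
    of all pairs are increasing because [1 < #|V|], and representation numbers in a class are below
    [2 * c]. *)
Lemma popular : 1 < #|V| -> let l := (trunc_log 2 M).+1 in
  exists (D : {set 'I_M}) (x c : nat), [/\ D != set0,
    forall d, d \in D -> [/\ 0 < val d, x <= val d, val d < 2 * x & c <= rep d],
    #|V| ^ 2 <= 8 * #|D| * c * l ^ 2 & 0 < c <= #|V|].
Proof.
move=> V1 l.
pose T := [set p : 'I_M * 'I_M | [&& p.1 \in V, p.2 \in V & p.1 < p.2]].
(* A pair is diagonal, increasing, or the reversal of an increasing pair. *)
have cT : #|V| ^ 2 <= #|V| + 2 * #|T|.
  pose Dg := [set (v, v) | v in V]; pose T' := [set (p.2, p.1) | p in T].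
  have sub : setX V V \subset Dg :|: (T :|: T').
    apply/subsetP => -[v w]; rewrite !inE /= => /andP[vV wV].
    case: (ltngtP v w) => [lt|lt|/val_inj->].
    - by rewrite vV wV /= orbT.
    - rewrite vV wV /=; apply/orP; right; apply/imsetP; exists (w, v) => //.
      by rewrite inE /= vV wV.
    - by apply/orP; left; apply/imsetP; exists w.
  have c1 : #|Dg| <= #|V| by apply: leq_imset_card.
  have c2 : #|T'| <= #|T| by apply: leq_imset_card.
  have := subset_leq_card sub; rewrite cardsX mulnn => /leq_trans; apply.
  apply: leq_trans (leq_card_setU _ _) _; rewrite leq_add //.
  by apply: leq_trans (leq_card_setU _ _) _; rewrite mul2n -addnn leq_add.
have Vle : #|V| <= M by apply: leq_trans (max_card _) _; rewrite card_ord.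
have lg y : y <= M -> trunc_log 2 y < l by move=> yM; rewrite ltnS leq_trunc_log.
pose f (p : 'I_M * 'I_M) : 'I_l * 'I_l :=
  (inord (trunc_log 2 (p.2 - p.1)), inord (trunc_log 2 (rep (p.2 - p.1)))).
have [[a b]] := @pigeonhole_class _ _ T f (ord0, ord0).
set Tc := [set p in T | _]; rewrite card_prod !card_ord => big.
pose D := [set d : 'I_M | [&& 0 < val d, 0 < rep d, trunc_log 2 d == a & trunc_log 2 (rep d) == b]].
have Dd p : p \in Tc -> exists2 d : 'I_M, d \in D & val d = p.2 - p.1.
  case: p => v w; rewrite inE /= => /andP[]; rewrite inE /= => /and3P[vV wV lt] /eqP[Ea Eb].
  have dM : w - v < M by apply: leq_ltn_trans (leq_subr _ _) _.
  have r0 : 0 < rep (w - v).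
    rewrite card_gt0; apply/set0Pn; exists v; rewrite inE vV /=.
    by apply/existsP; exists w; rewrite wV /= subnKC // ltnW.
  exists (Ordinal dM) => //; rewrite inE /= r0 subn_gt0 lt -Ea -Eb /=.
  rewrite !inordK ?eqxx //; apply: lg; last exact: ltnW.
  exact: leq_trans (rep_le _) Vle.
have cTc : #|Tc| <= #|D| * (2 * 2 ^ b).
  have -> : #|Tc| = \sum_(d : 'I_M) #|[set p in Tc | p.2 - p.1 == d]|.
    rewrite -sum1_card.
    pose g (p : 'I_M * 'I_M) : 'I_M := if insub (p.2 - p.1) is Some d then d else p.1.
    rewrite (partition_big g xpredT) //=; apply: eq_bigr => d _.
    rewrite -sum1_card; apply: eq_bigl => p; rewrite inE.
    case pT: (p \in Tc) => //=; have [d' _ Ed'] := Dd p pT.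
    by rewrite /g -Ed' valK.
  apply: (@leq_trans (\sum_(d in D) 2 * 2 ^ b)); last by rewrite sum_nat_const.
  rewrite [leqRHS]big_mkcond; apply: leq_sum => d _.
  case: ifP => [|dD].
    rewrite inE => /and4P[_ r0 _ /eqP <-].
    apply: (@leq_trans (rep d)); last first.
      by apply: ltnW; rewrite -expnS; apply: trunc_log_ltn.
    have inj : {in [set p in Tc | p.2 - p.1 == d] &, injective (fun p : 'I_M * 'I_M => p.1)}.
      move=> [v w] [v' w']; rewrite !inE /= => /andP[/andP[/and3P[_ _ lt] _] /eqP E].
      move=> /andP[/andP[/and3P[_ _ lt'] _] /eqP E'] Ev; subst v'.
      by congr pair; apply: val_inj => /=; lia.
    rewrite -(card_in_imset inj); apply: subset_leq_card; apply/subsetP => v.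
    case/imsetP => -[v' w]; rewrite !inE /= => /andP[/andP[/and3P[vV wV lt] _] /eqP E] ->.
    by rewrite vV /=; apply/existsP; exists w; rewrite wV /=; lia.
  rewrite leqn0 cards_eq0; apply/eqP/setP => p; rewrite in_set0; apply/negP.
  rewrite inE => /andP[pT /eqP E]; have [d' d'D Ed'] := Dd p pT.
  have ed : d' = d by apply: val_inj; rewrite Ed'.
  by rewrite -ed d'D in dD.
have T0 : 0 < #|T| by move: cT V1; clear; nia.
exists D, (2 ^ a), (2 ^ b); split.
- by apply/eqP => D0; move: big cTc T0; rewrite D0 cards0; clear; nia.
- move=> d; rewrite inE => /and4P[d0 r0 /eqP <- /eqP <-]; split=> //.
  + exact: trunc_logP.
  + by rewrite -expnS; apply: trunc_log_ltn.
  + exact: trunc_logP.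
- move: cT big cTc V1; clear.
  move: #|V| #|T| #|Tc| #|D| (2 ^ b) => s t tc h c h1 h2 h3 h4.
  have : t <= l * l * (h * (2 * c)) by apply: leq_trans h2 _; rewrite leq_mul2l h3 orbT.
  nia.
- rewrite expn_gt0 /=.
  have [d dD] : exists d, d \in D.
    by apply/set0Pn/eqP => D0; move: big cTc T0; rewrite D0 cards0; clear; nia.
  apply: leq_trans (rep_le d); move: dD; rewrite inE => /and4P[_ r0 _ /eqP <-].
  exact: trunc_logP.
Qed.

End Popular.

(** * Toggles: disjoint pairs of items with prescribed differences *)

Section Toggles.
Variables (I : finType) (u : I -> nat) (m r : nat) (A : {set I}).
Hypothesis u_le : forall i, i \in A -> u i <= m.

Definition rich : {set 'I_m.+1} := [set v : 'I_m.+1 | r <= #|[set i in A | u i == v]|].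

Lemma fibers_le (Q : {set 'I_m.+1}) (Z : {set I}) k :
  \sum_(v in Q) #|[set i in Z | u i == v + k]| <= #|Z|.
Proof.
rewrite -[X in _ <= X]sum1_card.
apply: (@leq_trans (\sum_(i in Z) \sum_(v in Q) (u i == v + k))).
  rewrite exchange_big; apply: leq_sum => v _ /=.
  rewrite -sum1_card (eq_bigl (fun i => (i \in Z) && (u i == v + k))); last first.
    by move=> i; rewrite inE.
  by rewrite big_mkcondr; apply: leq_sum => i _; case: (u i == _).
apply: leq_sum => i _; case: (pickP (fun v : 'I_m.+1 => u i == v + k)) => [v Ev|none].
  have [vQ|vQ] := boolP (v \in Q); last first.
    rewrite big1 // => w wQ; case: eqP => // Ew; case/negP: vQ.
    have -> // : v = w by apply/ord_inj/(@addIn k); rewrite -Ew (eqP Ev).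
  rewrite (bigD1 v) //= Ev big1 // => w /andP[wQ wv]; case: eqP => // Ew.
  by case/eqP: wv; apply/ord_inj/(@addIn k); rewrite -Ew (eqP Ev).
by rewrite big1 // => w _; rewrite none.
Qed.

(** Otherwise every representation [(v, v + d)] has all copies of one of its two values, at least
    [r] of them, inside [Z]; and an item of [Z] is charged at most twice, once as [v] and once as
    [v + d]. *)
Lemma toggle_exists (Z : {set I}) d : 2 * #|Z| < r * rep rich d ->
  exists i j, [/\ i \in A :\: Z, j \in A :\: Z & u j = u i + d].
Proof.
move=> lt; set Q := [set v in rich | [exists w in rich, val w == v + d]].
have cQ : #|Q| = rep rich d by [].
pose fib v := [set i in A :\: Z | u i == v].
case: (pickP (fun v : 'I_m.+1 => [&& v \in Q, fib v != set0 & fib (v + d) != set0])).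
  move=> v /and3P[_ /set0Pn[i] + /set0Pn[j]].
  rewrite [i \in fib _]inE [j \in fib _]inE => /andP[iA /eqP Ei] /andP[jA /eqP Ej].
  by exists i, j; split=> //; rewrite Ei Ej.
move=> none; exfalso.
have full (a : nat) : r <= #|[set i in A | u i == a]| -> fib a = set0 ->
    r <= #|[set i in Z | u i == a]|.
  move=> ra f0; apply: leq_trans ra _; apply: subset_leq_card; apply/subsetP => i.
  rewrite !inE => /andP[iA Ea]; rewrite Ea andbT; apply: contraT => iZ.
  by have : i \in fib a; [rewrite !inE iZ iA | rewrite f0 inE].
have : \sum_(v in Q) r <= \sum_(v in Q) (#|[set i in Z | u i == v + 0]| + #|[set i in Z | u i == v + d]|).
  apply: leq_sum => v vQ; have := none v; rewrite vQ /=; rewrite addn0.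
  move: vQ; rewrite !inE => /andP[rv /existsP[w /andP[]]]; rewrite inE => rw /eqP Ew.
  rewrite Ew in rw; case: eqP => [f0 _|_ /=].
    by apply: leq_trans (full _ rv f0) (leq_addr _ _).
  by move/negbT; rewrite negbK => /eqP f0; apply: leq_trans (full _ rw f0) (leq_addl _ _).
rewrite big_split /= sum_nat_const cQ.
move=> h; have := leq_trans h (leq_add (fibers_le Q Z 0) (fibers_le Q Z d)).
by rewrite addnn -mul2n mulnC leqNgt lt.
Qed.

Fixpoint msum (l : seq nat) (t : nat) : Prop :=
  if l is a :: l' then msum l' t \/ exists2 t', t = t' + a & msum l' t' else t = 0.

Lemma msum_cat l1 l2 t1 t2 : msum l1 t1 -> msum l2 t2 -> msum (l1 ++ l2) (t1 + t2).
Proof.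
elim: l1 t1 => [|a l1 IH] t1 /=; first by move=> ->.
case=> [h1 h2|[t' -> h1] h2]; first by left; apply: IH.
by right; exists (t' + t2); [rewrite addnAC | apply: IH].
Qed.

Lemma msum_nseq k g j : j <= k -> msum (nseq k g) (j * g).
Proof.
elim: k j => [|k IH] [|j] //=; first by left; apply: (IH 0).
by move=> jk; right; exists (j * g); [rewrite mulSn addnC | apply: IH].
Qed.

Definition reach (U : {set I}) t := exists2 F : {set I}, F \subset U & \sum_(i in F) u i = t.

(** Pairs are chosen one at a time, avoiding [Z] and all earlier pairs. [y] is the sum of the lower
    items, and switching a pair to its upper item adds its difference. The two items per pair
    account for [2 * size l]. *)
Lemma toggles (Z : {set I}) e c l :
  (forall i, i \in A :\: Z -> e %| u i) -> {in l, forall d, 0 < d /\ c <= rep rich d} ->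
  2 * (#|Z| + 2 * size l) < r * c ->
  exists (U : {set I}) y, [/\ U \subset A :\: Z, #|U| <= 2 * size l, e %| y, y <= size l * m &
    forall t, msum l t -> reach U (y + t)].
Proof.
move=> eA; elim: l => [|d l IH] /= hl hr.
  exists set0, 0; rewrite cards0 sub0set dvdn0; split=> // t ->.
  by exists set0; rewrite ?sub0set // big_set0.
have [U [y [UA cU ey yle HU]]] : exists (U : {set I}) y, [/\ U \subset A :\: Z, #|U| <= 2 * size l,
    e %| y, y <= size l * m & forall t, msum l t -> reach U (y + t)].
  apply: IH; first by move=> d' d'l; apply: hl; rewrite inE d'l orbT.
  by apply: leq_ltn_trans hr; rewrite leq_mul2l leq_add2l leq_mul2l leqnSn.
have [d0 dc] : 0 < d /\ c <= rep rich d by apply: hl; rewrite inE eqxx.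
have [] := @toggle_exists (Z :|: U) d.
  apply: leq_trans (leq_mul (leqnn r) dc); apply: leq_ltn_trans hr.
  rewrite leq_mul2l /=; apply: leq_trans (leq_card_setU _ _) _.
  by rewrite leq_add2l (leq_trans cU) // leq_mul2l leqnSn orbT.
move=> i [j [iA jA E]].
have iAZ : i \in A :\: Z by move: iA; rewrite !inE => /andP[/norP[-> _] ->].
have jAZ : j \in A :\: Z by move: jA; rewrite !inE => /andP[/norP[-> _] ->].
have iU : i \notin U by move: iA; rewrite !inE => /andP[/norP[_ ->] _].
have jU : j \notin U by move: jA; rewrite !inE => /andP[/norP[_ ->] _].
exists (i |: (j |: U)), (u i + y); split.
- by rewrite !subUset !sub1set iAZ jAZ.
- apply: leq_trans (leq_card_setU _ _) _; rewrite cards1 mulnS leq_add2l.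
  by apply: leq_trans (leq_card_setU _ _) _; rewrite cards1 leq_add2l.
- by rewrite dvdn_add ?eA.
- by rewrite mulSn leq_add // u_le //; move: iAZ; rewrite inE => /andP[].
move=> t [mt|[t' -> mt]]; have [F FU EF] := HU _ mt.
  exists (i |: F); first by apply: setUS; apply: subset_trans FU (subsetUr _ _).
  have iF : i \notin F by apply: contraNN iU; apply: (subsetP FU).
  by rewrite big_setU1 //= EF addnA.
exists (j |: F).
  by apply: subset_trans (subsetUr [set i] _); apply: setUS.
have jF : j \notin F by apply: contraNN jU; apply: (subsetP FU).
by rewrite big_setU1 //= EF E; lia.
Qed.

End Toggles.

Lemma msum_le l t b : msum l t -> {in l, forall a, a <= b} -> t <= size l * b.
Proof.
elim: l t => [|a l IH] t /=; first by move=> ->.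
move=> ml bl; have ab : a <= b by apply: bl; rewrite inE eqxx.
have IH' t' : msum l t' -> t' <= size l * b.
  by move=> h; apply: IH => // y yl; apply: bl; rewrite inE yl orbT.
by case: ml => [/IH' h|[t' -> /IH' h]]; rewrite mulSn; lia.
Qed.

Lemma biggcd_dvd (T : finType) (D : {set T}) (f : T -> nat) i :
  i \in D -> \big[gcdn/0]_(j in D) f j %| f i.
Proof. by move=> iD; rewrite (bigD1 i) //= dvdn_gcdl. Qed.

Lemma dvd_biggcd (T : finType) (D : {set T}) (f : T -> nat) q :
  (forall i, i \in D -> q %| f i) -> q %| \big[gcdn/0]_(j in D) f j.
Proof.
move=> qD; elim/big_rec: _ => // i x iD qx.
by rewrite dvdn_gcd qD.
Qed.

(** Divided by [d], the differences generate the cyclic group of order [g / d]. They stay distinct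
    there, because they lie in [[x, 2 * x)] and [x <= g]; so [fast_growth] applies to a generating
    set as large as [D]. *)
Lemma cover_residues m (D : {set 'I_m.+1}) x (g : 'I_m.+1) : g \in D ->
  (forall d, d \in D -> [/\ 0 < val d, x <= val d & val d < 2 * x]) ->
  let d := \big[gcdn/0]_(a in D) val a in
  exists l : seq nat, [/\ {in l, forall a, exists2 b, b \in D & a = val b},
    #|D| * size l <= 24 * m * (trunc_log 2 m.+1).+1 &
    forall t, d %| t -> exists2 t', msum l t' & t' = t %[mod g]].
Proof.
move=> gD HD d.
have dD (a : 'I_m.+1) : a \in D -> d %| a by move=> aD; apply: (biggcd_dvd val aD).
have g0 : 0 < g by case: (HD _ gD).
have d0 : 0 < d by apply: dvdn_gt0 g0 (dD _ gD).
have dg := dvdn_leq g0 (dD _ gD).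
have N0 : 0 < g %/ d by rewrite divn_gt0.
pose n := (g %/ d).-1; have En : n.+1 = g %/ d by rewrite prednK.
have Eg : n.+1 * d = g by rewrite En divnK ?dD.
pose ph (a : nat) : 'I_n.+1 := inZp (a %/ d).
pose H := [set ph (val a) | a in D].
have cH : #|H| = #|D|.
  apply: card_in_imset => a b aD bD /eqP; rewrite inZp_eq => E.
  have {E} : a == b %[mod g].
    by rewrite -Eg -[val a](divnK (dD _ aD)) -[val b](divnK (dD _ bD)) -!muln_modl (eqP E).
  have [_ xa a2] := HD _ aD; have [_ xb b2] := HD _ bD; have [_ xg _] := HD _ gD.
  move=> E; apply: val_inj; case: (ltngtP (val a) (val b)) => // lt; exfalso.
    move: E; rewrite eq_sym (eqn_mod_dvd _ (ltnW lt)) => /(dvdn_leq _) le.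
    by have := le; rewrite subn_gt0 lt => /(_ isT); move: xa b2 xg => /=; lia.
  move: E; rewrite (eqn_mod_dvd _ (ltnW lt)) => /(dvdn_leq _) le.
  by have := le; rewrite subn_gt0 lt => /(_ isT); move: xb a2 xg => /=; lia.
have gen (K : {set 'I_n.+1}) : 0%R \in K ->
    (forall z h, z \in K -> h \in H -> (z + h)%R \in K) -> K = setT.
  move=> K0 KH.
  have p1 : preserves K (\big[gcdn/0]_(a in D) (val a %/ d)).
    apply: preserves_biggcd; first exact: preserves0.
    by move=> a aD z zK; apply: KH => //; apply: imset_f.
  have E1 : \big[gcdn/0]_(a in D) (val a %/ d) = 1.
    set f := \big[_/_]_(a in D) _.
    have : f * d %| d.
      rewrite {2}/d; apply: dvd_biggcd => a aD.
      by rewrite -[val a](divnK (dD _ aD)) dvdn_mul // (biggcd_dvd (fun a => val a %/ d) aD).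
    by rewrite -{2}[d]mul1n dvdn_pmul2r // dvdn1 => /eqP.
  apply/setP => z; rewrite inE; rewrite E1 in p1.
  have := preservesM (val z) p1 K0; rewrite muln1 GRing.add0r valZpK; exact: id.
have [ls [al sz full]] := fast_growth gen.
(* A representative in [D]; the default [0] is never met, since only elements of [H] occur in
   [ls]. *)
pose pre (z : 'I_n.+1) : nat := if [pick a in D | ph (val a) == z] is Some a then val a else 0.
have preP z : z \in H -> exists2 a : 'I_m.+1, a \in D & pre z = val a /\ ph (val a) = z.
  case/imsetP => a aD ->; rewrite /pre; case: pickP => [b /andP[bD /eqP Eb]|/(_ a)].
    by exists b.
  by rewrite aD eqxx.
exists (map pre ls); split.
- move=> a /mapP[z zl ->]; have /preP[b bD [Eb _]] := allP al _ zl; by exists b.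
(* [24 = 4 * 3 * 2]: the factor [4] of [fast_growth], the [3] of [diam], and [2] because both [n.+1]
   and [#|D|] are at most [m]. *)
- rewrite size_map; apply: leq_trans (leq_mul (leqnn _) sz) _.
  rewrite /diam cH card_ord.
  have h0 : 0 < #|D| by rewrite card_gt0; apply/set0Pn; exists g.
  have gm : g <= m by rewrite -ltnS.
  have Dm : #|D| <= m.
    have : #|D| <= #|[set~ (ord0 : 'I_m.+1)]|.
      apply: subset_leq_card; apply/subsetP => a /HD[a0 _ _]; rewrite !inE.
      by apply/eqP => E; rewrite E in a0.
    by rewrite cardsC1 card_ord.
  have nm : n.+1 <= m by apply: leq_trans gm; rewrite En leq_div.
  have lg : trunc_log 2 n.+1 <= trunc_log 2 m.+1 by apply: leq_trunc_log; lia.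
  have := leq_divM n.+1 #|D|.
  move: lg; move: (trunc_log _ _) => p; move: (trunc_log _ _) => q.
  move: (n.+1 %/ #|D|) => y; move: #|D| Dm => h; move: nm; clear; nia.
- move=> t dt.
  have main (l' : seq 'I_n.+1) z : all (mem H) l' -> z \in subsums l' ->
      exists2 t', msum (map pre l') t' & d %| t' /\ ph t' = z.
    elim: l' z => [|a l' IH] z /=.
      rewrite inE => _ /eqP->; exists 0 => //; split=> //.
      by apply: val_inj; rewrite /= div0n mod0n.
    case/andP => aH al'; rewrite inE mem_shift => /orP[] /(IH _ al')[t' mt [dt' Et]].
      by exists t' => //; left.
    have [b bD [Eb Eb']] := preP _ aH.
    exists (t' + pre a); first by right; exists t'.
    rewrite Eb dvdn_add ?dD //; split=> //.
    by rewrite /ph divnDl // inZpD -/(ph t') Et -/(ph b) Eb' GRing.subrK.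
  have [t' mt [dt' Et]] : exists2 t', msum (map pre ls) t' & d %| t' /\ ph t' = ph t.
    by apply: main al _; rewrite full inE.
  exists t' => //; move/eqP: Et; rewrite /ph inZp_eq => /eqP Et.
  by rewrite -Eg -[t'](divnK dt') -[t](divnK dt) -!muln_modl Et.
Qed.

Lemma subset_of_card (T : finType) (F : {set T}) k : k <= #|F| ->
  exists2 B : {set T}, B \subset F & #|B| = k.
Proof.
move=> kF; exists [set x in take k (enum F)].
  by apply/subsetP => x; rewrite inE => /mem_take; rewrite mem_enum.
by rewrite cardsE (card_uniqP _) ?take_uniq ?enum_uniq // size_takel // -cardE.
Qed.

(** [e] is the largest divisor that loses at most [K * trunc_log 2 e] elements. If passing to
    [e * q] lost at most [K] more, [e * q] would qualify as well, since a prime factor raises the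
    logarithm by at least one. *)
Lemma prune (T : finType) (u : T -> nat) (A : {set T}) d K : 0 < d ->
  exists e, [/\ e %| d, #|[set i in A | ~~ (e %| u i)]| <= K * trunc_log 2 d &
    forall q, prime q -> e * q %| d ->
      K < #|[set i in [set i in A | e %| u i] | ~~ (e * q %| u i)]|].
Proof.
move=> d0; pose bad e := [set i in A | ~~ (e %| u i)].
pose ok (e : 'I_d.+1) := (e %| d) && (#|bad e| <= K * trunc_log 2 e).
have d1 : 1 < d.+1 by [].
have ok1 : ok (Ordinal d1).
  rewrite /ok dvd1n /= /bad; have -> : [set i in A | ~~ (1 %| u i)] = set0.
    by apply/setP => i; rewrite !inE dvd1n andbF.
  by rewrite cards0.
case: (@arg_maxnP _ (Ordinal d1) ok (fun e => e) ok1) => e /andP[ed be] emax.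
exists e; split=> //.
  by apply: leq_trans be _; rewrite leq_mul2l leq_trunc_log ?orbT // dvdn_leq.
move=> q pq eqd; rewrite ltnNge; apply/negP => few.
have e0 : 0 < e by apply: dvdn_gt0 ed.
have lt : e * q < d.+1 by rewrite ltnS dvdn_leq.
have q1 := prime_gt1 pq.
suff okq : ok (Ordinal lt).
  have := emax _ okq; rewrite /= => le; move: le e0 q1; clear; nia.
rewrite /ok eqd /=.
have sub : bad (e * q) \subset bad e :|: [set i in [set i in A | e %| u i] | ~~ (e * q %| u i)].
  by apply/subsetP => i; rewrite !inE => /andP[-> ->]; case: (e %| u i).
apply: leq_trans (subset_leq_card sub) _; apply: leq_trans (leq_card_setU _ _) _.
have : trunc_log 2 e < trunc_log 2 (e * q).
  apply: (@leq_trans (trunc_log 2 (2 * e))); first by rewrite trunc_logMp.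
  by apply: leq_trunc_log; rewrite [e * q]mulnC leq_mul2r q1 orbT.
move=> h; apply: leq_trans (leq_add be few) _; rewrite -mulnSr leq_mul2l h orbT //.
Qed.

Lemma sum_setU (I : finType) (f : I -> nat) (U V : {set I}) : [disjoint U & V] ->
  \sum_(i in U :|: V) f i = \sum_(i in U) f i + \sum_(i in V) f i.
Proof.
move=> dis; rewrite -bigU //=; apply: eq_bigl => i; by rewrite !inE.
Qed.

(** * Progressions of subset sums *)

Section Reach.
Variables (I : finType) (u : I -> nat).

Lemma reach_sub (U U' : {set I}) t : U \subset U' -> reach u U t -> reach u U' t.
Proof. by move=> UU' [F FU E]; exists F => //; apply: subset_trans UU'. Qed.

Lemma reachD (U U' : {set I}) t t' : [disjoint U & U'] -> reach u U t -> reach u U' t' ->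
  reach u (U :|: U') (t + t').
Proof.
move=> dis [F FU <-] [F' FU' <-]; exists (F :|: F'); first exact: setUSS.
by apply: sum_setU; apply: disjointW FU FU' dis.
Qed.

End Reach.

(** A single rich value has no differences to toggle, but its copies alone reach its multiples. *)
Lemma dense_single (I : finType) (u : I -> nat) (m r l : nat) (A : {set I}) :
  (forall i, i \in A -> 0 < u i) -> (forall i, i \in A -> u i <= m) -> 0 < l ->
  2600 * l ^ 3 * m <= r -> #|rich u m r A| = 1 -> 0 < m ->
  exists2 v, 0 < v <= m & forall t, v %| t -> t <= v * m + v -> reach u A t.
Proof.
move=> u_gt0 u_le l0 dense s1 m0.
have r0 : m < r.
  have : 0 < l ^ 3 by rewrite expn_gt0 l0.
  by move: dense m0; clear; move: (l ^ 3) => p; nia.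
have /cards1P[v Ev] : #|rich u m r A| == 1 by rewrite s1.
have : v \in rich u m r A by rewrite Ev inE.
rewrite inE; set F := [set i in A | u i == v] => rF.
have [i] : exists i, i \in F by apply/set0Pn; rewrite -card_gt0; lia.
rewrite inE => /andP[iA /eqP Ei].
exists v; first by rewrite -Ei u_gt0 ?u_le.
move=> t /dvdnP[k ->] le.
have v0 : 0 < v by rewrite -Ei u_gt0.
have [|B BF cB] := @subset_of_card _ F k.
  by move: le v0 r0 rF; clear; move: #|F| => f; nia.
exists B; first by apply: subset_trans BF _; apply/subsetP => j; rewrite inE => /andP[].
rewrite (eq_bigr (fun=> val v)); first by rewrite sum_nat_const cB.
by move=> j /(subsetP BF); rewrite inE => /andP[_ /eqP].
Qed.

(** Toggles for [ld] reach every multiple of [d] modulo [g], toggles for copies of [g] fill the gaps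
    of length [g], and a subset of [E] makes the base divisible by [d]. The length [d * m + d] of
    the progression is what adding up to [d] items at once in [equal_subsums] requires. *)
Lemma dense_ap (I : finType) (u : I -> nat) (m r : nat) (A : {set I}) :
  (forall i, i \in A -> 0 < u i) -> (forall i, i \in A -> u i <= m) ->
  let s := #|rich u m r A| in let l := (trunc_log 2 m.+1).+1 in
  0 < s -> 2600 * l ^ 3 * m <= r * s ^ 2 -> 0 < m -> exists d Y, [/\ 0 < d, s * (Y + 2 * d * m) <= 1100 * l ^ 3 * m ^ 2
  & forall t, d %| t -> Y <= t -> t <= Y + d * m + d -> reach u A t].
Proof.
move=> u_gt0 u_le s l s_gt0 dense m0; have l0 : 0 < l by [].
have El : (trunc_log 2 m.+1).+1 = l by []; clearbody l.
have [s1|sn1] := eqVneq s 1.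
  have ds : 2600 * l ^ 3 * m <= r by rewrite s1 muln1 in dense.
  have [v /andP[v0 vm] Hv] := dense_single u_gt0 u_le l0 ds s1 m0.
  exists v, 0; split=> //; last by move=> t vt _; apply: Hv.
  rewrite s1 mul1n add0n; have : 0 < l ^ 3 by rewrite expn_gt0 l0.
  by move: vm m0; clear; move: (l ^ 3) => p; nia.
have [|D [x [c [D0 HD big /andP[c0 cs]]]]] := @popular m.+1 (rich u m r A).
  by rewrite -/s; lia.
rewrite -/s El in big cs.
have /set0Pn[g gD] := D0.
have HD' a : a \in D -> [/\ 0 < val a, x <= val a & val a < 2 * x] by case/HD.
have [ld [ldD szl cov]] := cover_residues gD HD'.
rewrite El in szl.
set d := \big[_/_]_(a in D) _ in cov.
have g0 : 0 < g by case: (HD' _ gD).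
have dD (a : 'I_m.+1) : a \in D -> d %| a by move=> aD; apply: (biggcd_dvd val aD).
have d0 : 0 < d by apply: dvdn_gt0 g0 (dD _ gD).
have gm : g <= m by rewrite -ltnS.
have xg : x <= g by case: (HD' _ gD).
have x0 : 0 < x by case: (HD' _ gD); lia.
set h := #|D| in szl big.
have h0 : 0 < h by rewrite card_gt0.
(* [D] consists of distinct positive multiples of [d] below [2 * x]. *)
have dh : d * h <= 2 * x.
  pose q (a : 'I_m.+1) : 'I_(2 * x %/ d).+1 := inord (a %/ d).
  have : #|[set q a | a in D]| <= #|[set~ (ord0 : 'I_(2 * x %/ d).+1)]|.
    apply: subset_leq_card; apply/subsetP => _ /imsetP[a aD ->]; rewrite !inE.
    have [a0 _ a2] := HD' _ aD; apply/eqP => /(congr1 val).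
    rewrite /= inordK; last by rewrite ltnS leq_div2r // ltnW.
    by move/eqP; rewrite -leqn0 leqNgt divn_gt0 // dvdn_leq ?dD.
  rewrite cardsC1 card_ord card_in_imset.
    by move=> hq; rewrite mulnC; apply: leq_trans (leq_mul hq (leqnn d)) (leq_divM _ _).
  move=> a b aD bD /(congr1 val); rewrite /= !inordK; first last.
  - by have [_ _ a2] := HD' _ aD; rewrite ltnS leq_div2r // ltnW.
  - by have [_ _ b2] := HD' _ bD; rewrite ltnS leq_div2r // ltnW.
  by move=> E; apply: val_inj; rewrite /= -(divnK (dD _ aD)) -(divnK (dD _ bD)) E.
(* Discarding [Z] leaves multiples of [e] only, robustly enough for [slow_growth]; the base of the
   toggles then is a multiple of [e] too, so its residue modulo [d] can be repaired. *)
have [e [ed badA rob]] := prune u A d d0.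
set Z := [set i in A | ~~ (e %| u i)] in badA.
have EA : [set i in A | e %| u i] = A :\: Z.
  by apply/setP => i; rewrite !inE; case: (i \in A); case: (e %| u i).
rewrite EA in rob.
have eA i : i \in A :\: Z -> e %| u i by rewrite -EA inE => /andP[].
have [|E [EA' cE HE]] := @slow_growth _ u (A :\: Z) d e d0 ed eA.
  by move=> q pq eqd; apply: ltnW; apply: rob.
have ZE i : i \in A :\: (Z :|: E) -> e %| u i.
  by rewrite in_setD in_setU negb_or => /andP[/andP[iZ _] iA]; apply: eA; rewrite in_setD iZ.
(* [f1] bounds every sub-sum of [ld], and [kap] copies of [g] bridge this slack together with the
   length of the progression. *)
pose f1 := size ld * (2 * x).
pose kap := ((f1 + d * m + d) %/ g).+1.
have kg : f1 + d * m + d <= kap * g by apply: ltnW; apply: ltn_ceil.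
(* [53 = 48 + 4 + 1]: the part of [f1], the part of [2 * d * m], and the rounding up in [kap], paid
   by [h <= m]. With the [24] of [cover_residues] this gives the [77] below. *)
have hkap : h * kap <= 53 * l * m.
  have q1 : (f1 + d * m + d) %/ g <= (f1 + 2 * (d * m)) %/ x.
    apply: leq_trans (leq_div2l _ x0 xg) _; apply: leq_div2r; clear -m0; nia.
  have q2 : h * ((f1 + 2 * (d * m)) %/ x) <= 48 * l * m + 4 * m.
    rewrite -(leq_pmul2r x0) -mulnA.
    apply: leq_trans (leq_mul (leqnn h) (leq_divM _ _)) _.
    move: szl dh; rewrite /f1; clear; move: (size ld) => L; nia.
  have hm : h <= m.
    have : #|D| <= #|[set~ (ord0 : 'I_m.+1)]|.
      apply: subset_leq_card; apply/subsetP => a /HD'[a0 _ _]; rewrite !inE.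
      by apply/eqP => Ea; rewrite Ea in a0.
    by rewrite cardsC1 card_ord.
  rewrite /kap mulnS; move: (leq_mul (leqnn h) q1) q2 hm l0 m0; clear.
  move: (_ %/ g) (_ %/ x) => y z; nia.
pose tl := ld ++ nseq kap (val g).
have htl : h * size tl <= 77 * l * m.
  by rewrite size_cat size_nseq; move: szl hkap; clear; nia.
have tlD a : a \in tl -> 0 < a /\ c <= rep (rich u m r A) a.
  rewrite mem_cat mem_nseq => /orP[/ldD[b bD ->]|/andP[_ /eqP->]].
    by case: (HD _ bD).
  by case: (HD _ gD).
have dx : d * h <= 2 * m by move: dh xg gm; clear; lia.
have lgd : trunc_log 2 d <= l.
  rewrite -El; apply: leqW; apply: leq_trunc_log; have := dvdn_leq g0 (dD _ gD).
  by move: gm; clear => /=; lia.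
have [|U [y [UA cU ey yle HU]]] := toggles u_le ZE tlD.
  have cZE : #|Z :|: E| <= d * l + d.
    apply: leq_trans (leq_card_setU _ _) _; rewrite leq_add ?(ltnW cE) //.
    by apply: leq_trans badA _; rewrite leq_mul2l lgd orbT.
  have bb : 2600 * l ^ 3 * m <= r * (8 * h * c * l ^ 2).
    by apply: leq_trans dense _; rewrite leq_mul2l big orbT.
  (* [325 = 2600 / 8], the [8] coming from [popular]. The demand is [2 * (4 + 2 * 77) = 316] times
     [l * m]: the [4] for [Z] and [E], the rest for the toggles. *)
  have b2 : 325 * l * m <= r * (h * c).
    have l2 : 0 < 8 * l ^ 2 by rewrite muln_gt0 expn_gt0 l0.
    rewrite -(leq_pmul2l l2); move: bb; clear; rewrite !expnS expn0; nia.
  rewrite -(ltn_pmul2l h0); move: b2 htl dx cZE l0 m0; clear.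
  move: #|Z :|: E| (size tl) => z t; nia.
(* The residue wanted is [- y] modulo [d], written as [y * d.-1]. *)
have [E' E'E HE'] := HE (y * d.-1) (dvdn_mulr _ ey).
set w := \sum_(i in E') u i in HE'.
have dyw : d %| y + w.
  by rewrite /dvdn -modnDmr HE' modnDmr -mulnS prednK // modnMl.
have wle : w <= d * m.
  apply: (@leq_trans (#|E'| * m)); last first.
    by rewrite leq_mul2r (leq_trans (subset_leq_card E'E)) ?orbT // ltnW.
  rewrite -sum_nat_const; apply: leq_sum => i /(subsetP E'E)/(subsetP EA').
  by rewrite inE => /andP[_]; apply: u_le.
exists d, (y + w + f1); split=> //.
  have sh : s <= 8 * h * l ^ 2.
    rewrite -(leq_pmul2l s_gt0) mulnn; apply: leq_trans big _.
    have -> : 8 * h * c * l ^ 2 = c * (8 * h * l ^ 2) by rewrite mulnAC [8 * h * l ^ 2 * c]mulnC.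
    by rewrite leq_mul2r cs orbT.
  apply: leq_trans (leq_mul sh (leqnn _)) _.
  (* [131 = 77 + 2 + 48 + 4], one summand for each of [a1] to [a4]; multiplied by the [8 * l ^ 2] of
     [sh] it stays below [1100 * l ^ 3]. *)
  have bb : h * (y + w + f1 + 2 * d * m) <= 131 * l * m ^ 2.
    have xm : x <= m by exact: leq_trans xg gm.
    have a1 : h * y <= 77 * l * m * m.
      by apply: leq_trans (leq_mul (leqnn h) yle) _; rewrite mulnA leq_mul2r htl orbT.
    have a2 : h * w <= 2 * m * m.
      by apply: leq_trans (leq_mul (leqnn h) wle) _; rewrite mulnA leq_mul2r [h * d]mulnC dx orbT.
    have a3 : h * f1 <= 48 * l * m * m.
      rewrite /f1 mulnA; apply: leq_trans (leq_mul szl (leqnn _)) _.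
      have -> : 24 * m * l * (2 * x) = 48 * l * m * x by clear; lia.
      by rewrite leq_mul2l xm orbT.
    have a4 : h * (2 * d * m) <= 4 * m * m.
      have -> : h * (2 * d * m) = 2 * m * (d * h) by clear; lia.
      have -> : 4 * m * m = 2 * m * (2 * m) by clear; lia.
      by rewrite leq_mul2l dx orbT.
    by move: a1 a2 a3 a4 l0; rewrite -mulnn; clear; nia.
  have -> : 8 * h * l ^ 2 * (y + w + f1 + 2 * d * m)
          = 8 * l ^ 2 * (h * (y + w + f1 + 2 * d * m)) by nia.
  apply: leq_trans (leq_mul (leqnn _) bb) _.
  by rewrite !expnS !expn0; clear; nia.
move=> t dt le1 le2.
have yt : y + w <= t := leq_trans (leq_addr _ _) le1.
have dtau : d %| t - (y + w) by rewrite dvdn_sub.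
have [t' mt' Et'] := cov _ dtau.
have t'f : t' <= f1.
  apply: msum_le mt' _ => a /ldD[b bD ->]; have [_ _] := HD' _ bD; exact: ltnW.
have t'le : t' <= t - (y + w) by apply: leq_trans t'f _; rewrite leq_subRL.
have /dvdnP[k Ek] : g %| t - (y + w) - t' by rewrite -(eqn_mod_dvd _ t'le) Et'.
have kk : k <= kap by rewrite -(leq_pmul2r g0) -Ek (leq_trans (leq_subr _ _)) // (leq_trans _ kg) // leq_subLR !addnA.
have := HU _ (msum_cat mt' (msum_nseq g kk)); rewrite -Ek subnKC // => HUt.
have reE : reach u E' w by exists E'.
have dis : [disjoint U & E'].
  rewrite disjoint_subset; apply/subsetP => i /(subsetP UA); rewrite !inE.
  by case/andP => /norP[_ iE] _; apply: contraNN iE; apply: (subsetP E'E).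
have := reachD dis HUt reE; rewrite addnAC subnKC //.
apply: reach_sub; rewrite subUset; apply/andP; split.
  by apply: subset_trans UA (subsetDl _ _).
apply: subset_trans E'E (subset_trans EA' (subsetDl _ _)).
Qed.

(** Take [F] in [B] of largest sum among those divisible by [d] and not beyond the progression. If
    it fell short of [Y + d], at least [d] items would remain, and a zero-sum subset of at most [d]
    of them, worth at most [d * m], could be added. So the sum of [F] is a term of the progression
    that [A] provides. *)
Lemma equal_subsums (I : finType) (u : I -> nat) (m r : nat) (A B : {set I}) s :
  (forall i, 0 < u i <= m) -> let l := (trunc_log 2 m.+1).+1 in
  0 < s -> 0 < m -> s <= #|rich u m r A| -> 2600 * l ^ 3 * m <= r * s ^ 2 ->
  1100 * l ^ 3 * m ^ 2 <= s * \sum_(i in B) u i ->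
  exists A' B' : {set I}, [/\ A' \subset A, B' \subset B, A' != set0, B' != set0 &
    \sum_(i in A') u i = \sum_(i in B') u i].
Proof.
move=> um l s0 m0 sA dense bigB.
have u0 i : 0 < u i by case/andP: (um i).
have ule i : u i <= m by case/andP: (um i).
set s' := #|rich u m r A| in sA.
have [|d [Y [d0 HY HA]]] := @dense_ap _ u m r A (fun i _ => u0 i) (fun i _ => ule i) (leq_trans s0 sA) _ m0.
  by apply: leq_trans dense _; rewrite leq_mul2l leq_exp2r // sA orbT.
rewrite -/s' -/l in HY.
have bigB' : Y + 2 * d * m <= \sum_(i in B) u i.
  rewrite -(leq_pmul2l s0); apply: leq_trans bigB; apply: leq_trans HY.
  by rewrite leq_mul2r sA orbT.
pose ok (F : {set I}) := [&& F \subset B, d %| \sum_(i in F) u i & \sum_(i in F) u i <= Y + d * m + d].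
have ok0 : ok set0 by rewrite /ok sub0set big_set0 dvdn0.
case: (arg_maxnP (fun F : {set I} => \sum_(i in F) u i) ok0) => F /and3P[FB dF Fle] Fmax.
have Fge : Y + d <= \sum_(i in F) u i.
  rewrite leqNgt; apply/negP => Flt.
  have rest : d * m <= \sum_(i in B :\: F) u i.
    have := @big_setID _ 0 addn _ B F u.
    have -> : B :&: F = F by apply/setIidPr.
    move=> /= EB; rewrite EB in bigB'; rewrite -(leq_add2l (Y + d * m)) -addnA.
    apply: leq_trans (leq_trans _ bigB') _; first by clear; lia.
    rewrite leq_add2r; apply: ltnW; apply: leq_trans Flt _.
    by rewrite leq_add2l leq_pmulr.
  (* Each item is worth at most [m]. *)
  have cr : d <= #|B :\: F|.
    rewrite -(leq_pmul2r m0); apply: leq_trans rest _; rewrite -sum_nat_const.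
    by apply: leq_sum => i _.
  have [C [CB C0 cC dC]] := zerosum u d0 cr.
  have dis : [disjoint F & C].
    rewrite disjoint_sym disjoint_subset; apply/subsetP => i /(subsetP CB); rewrite !inE.
    by case/andP.
  have Cle : \sum_(i in C) u i <= d * m.
    apply: (@leq_trans (#|C| * m)); last by rewrite leq_mul2r cC orbT.
    by rewrite -sum_nat_const; apply: leq_sum.
  have Cpos : 0 < \sum_(i in C) u i.
    by case/set0Pn: C0 => i iC; rewrite (bigD1 i) //= addn_gt0 u0.
  have := Fmax (F :|: C); rewrite /ok sum_setU // dvdn_add // subUset FB /=.
  rewrite (subset_trans CB (subsetDl _ _)) /=.
  have -> : \sum_(i in F) u i + \sum_(i in C) u i <= Y + d * m + d by lia.
  by move=> /(_ isT); lia.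
have [A' AA' EA'] := HA _ dF (leq_trans (leq_addr _ _) Fge) Fle.
have pos : 0 < \sum_(i in F) u i by lia.
exists A', F; split=> //; apply/eqP => E0.
  by rewrite E0 big_set0 in EA'; rewrite -EA' in pos.
by rewrite E0 big_set0 in pos.
Qed.

(** * Proximity of optimal and greedy solutions *)

Section Proximity.
Variables (N m k : nat) (u v : nat -> nat).
Hypothesis um : forall i : 'I_N, 0 < u i <= m.
Hypothesis m_gt0 : 0 < m.
(** Indices run from the most to the least efficient item, where [u] is what is gained and [v] what
    is paid. *)
Hypothesis ratio : forall i j : 'I_N, i <= j -> v i * u j <= v j * u i.
Implicit Types (x y A B : {set 'I_N}).
Local Notation l := (trunc_log 2 m.+1).+1.

Definition su A := \sum_(i in A) u i.
Definition sv A := \sum_(i in A) v i.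
Definition sidx A := \sum_(i in A) i * u i.

(** Ties between sets of equal [u]-sum and [v]-sum are broken by the index sum, so that exchanging
    equally efficient items is also excluded. *)
Definition tight x := forall y, su y = su x ->
  sv x < sv y \/ sv x = sv y /\ sidx x <= sidx y.

Lemma tight_exists x0 : exists2 x, tight x & su x = su x0 /\ sv x <= sv x0.
Proof.
have [x /eqP Ex xmin] := @arg_minnP _ x0 (fun x => su x == su x0) sv (eqxx _).
have ok : (su x == su x0) && (sv x == sv x) by rewrite Ex !eqxx.
have [y /andP[/eqP Ey /eqP Evy] ymin] :=
  @arg_minnP _ x (fun y => (su y == su x0) && (sv y == sv x)) sidx ok.
exists y; last by split=> //; rewrite Evy xmin.
move=> z Ez; rewrite Evy; have := xmin z; rewrite Ez Ey eqxx => /(_ isT).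
rewrite leq_eqVlt => /orP[/eqP E|]; last by left.
by right; split=> //; apply: ymin; rewrite Ez Ey -E !eqxx.
Qed.

Lemma su_setU A B : [disjoint A & B] -> su (A :|: B) = su A + su B.
Proof. exact: sum_setU. Qed.

(* Exchanging B' for A' keeps the u-sum, does not increase the v-sum because A' is at
   least as efficient, and strictly decreases the index sum. *)
Lemma no_exchange x tau A' B' : tight x ->
  (forall i, i \in A' -> i \notin x /\ i < tau) ->
  (forall i, i \in B' -> i \in x /\ tau <= i) ->
  A' != set0 -> su A' = su B' -> False.
Proof.
move=> tx HA HB A0 E.
have dA : [disjoint x :\: B' & A'].
  rewrite disjoint_sym disjoint_subset; apply/subsetP => i /HA[ix _].
  by rewrite !inE negb_and ix orbT.
have BX : B' \subset x by apply/subsetP => i /HB[].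
have split (f : 'I_N -> nat) : \sum_(i in x) f i = \sum_(i in B') f i + \sum_(i in x :\: B') f i.
  by rewrite (big_setID B') /=; move/setIidPr: BX => ->.
set y := (x :\: B') :|: A'.
have Ey (f : 'I_N -> nat) : \sum_(i in y) f i + \sum_(i in B') f i = \sum_(i in x) f i + \sum_(i in A') f i.
  by rewrite sum_setU // (split f); lia.
have Esu : su y = su x.
  by have := Ey (fun i => u i); rewrite -/(su _) -/(su _) -/(su _) -/(su _) E => /addIn.
have pos : 0 < su A'.
  case/set0Pn: A0 => i iA; rewrite /su (bigD1 i) //=; have /andP[+ _] := um i; lia.
have vAB : sv A' <= sv B'.
  rewrite -(leq_pmul2r pos) {1}E /sv /su !big_distrl /=.
  rewrite (eq_bigr (fun i : 'I_N => \sum_(j in B') v i * u j)); last first.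
    by move=> i _; rewrite big_distrr.
  rewrite exchange_big /=; apply: leq_sum => j jB; rewrite big_distrr /=.
  apply: leq_sum => i iA; apply: ratio; have [_ h1] := HA _ iA; have [_ h2] := HB _ jB.
  by rewrite ltnW // (leq_trans h1).
have iAB : sidx A' < sidx B'.
  have tau0 : 0 < tau by case/set0Pn: A0 => i /HA[_]; lia.
  apply: (@leq_ltn_trans (tau.-1 * su A')).
    by rewrite /su big_distrr /=; apply: leq_sum => i /HA[_ h]; rewrite leq_mul2r; lia.
  apply: (@leq_trans (tau * su B')); first by rewrite -E ltn_pmul2r // prednK.
  by rewrite /su big_distrr /=; apply: leq_sum => i /HB[_ h]; rewrite leq_mul2r h orbT.
have := Ey (fun i => v i); have := Ey (fun i => i * u i).
rewrite -!/(sidx _) -!/(sv _).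
by case: (tx _ Esu) => [lt|[Ev le]]; lia.
Qed.

Definition added x := [set i in x | k <= i].
Definition removed x := [set i : 'I_N | (i \notin x) && (i < k)].

Lemma rich_split r A x : rich (fun i : 'I_N => u i) m r A \subset
  rich (fun i : 'I_N => u i) m (uphalf r) (A :\: x) :|: rich (fun i : 'I_N => u i) m (uphalf r) (A :&: x).
Proof.
apply/subsetP => a; rewrite !inE => ra.
have := cardsID x [set i in A | u i == a].
have -> : [set i in A | u i == a] :&: x = [set i in A :&: x | u i == a].
  by apply/setP => i; rewrite !inE andbAC.
have -> : [set i in A | u i == a] :\: x = [set i in A :\: x | u i == a].
  by apply/setP => i; rewrite !inE andbA.
move: ra; move: #|_| #|_| #|_| => c1 c2 c3 h E.
have := uphalf_half r; have := odd_double_half r; case: (odd r) => /= *.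
  by case: (leqP (uphalf r) c3) => //= ?; lia.
by case: (leqP (uphalf r) c3) => //= ?; lia.
Qed.

(** Halving [r] and [s] costs a factor [8] in the density [r * s ^ 2], and a factor [2] in the
    bound: [2200 = 2 * 1100]. *)
Lemma dense_no_exchange r s A B :
  uphalf s <= #|rich (fun i : 'I_N => u i) m (uphalf r) A| -> 0 < s ->
  8 * 2600 * l ^ 3 * m <= r * s ^ 2 ->
  (forall A' B', A' \subset A -> B' \subset B -> A' != set0 -> B' != set0 -> su A' <> su B') ->
  s * su B <= 2200 * l ^ 3 * m ^ 2.
Proof.
move=> h s0 d none; rewrite leqNgt; apply/negP => big.
have s2 : s <= 2 * uphalf s by have := uphalf_half s; have := odd_double_half s; lia.
have r2 : r <= 2 * uphalf r by have := uphalf_half r; have := odd_double_half r; lia.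
have s0' : 0 < uphalf s by case: (s) s0.
have [||A' [B' [AA' BB' A0 B0 E]]] :=
    @equal_subsums _ (fun i : 'I_N => u i) m (uphalf r) A B (uphalf s) um s0' m_gt0 h.
- rewrite -(leq_pmul2l (isT : 0 < 8)); apply: (@leq_trans (r * s ^ 2)).
    by apply: leq_trans d; lia.
  apply: leq_trans (leq_mul r2 (_ : _ <= (2 * uphalf s) ^ 2)) _; first by rewrite leq_exp2r.
  by rewrite expnMn; lia.
- rewrite -(leq_pmul2l (isT : 0 < 2)) mulnA.
  apply: (@leq_trans (s * su B)); first by apply: ltnW; apply: leq_trans big; lia.
  by rewrite mulnA leq_mul2r s2 orbT.
exact: none AA' BB' A0 B0 E.
Qed.

Variable x : {set 'I_N}.
Hypothesis tx : tight x.
Hypothesis bal1 : su (added x) <= su (removed x) + m.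
Hypothesis bal2 : su (removed x) <= su (added x) + m.

Lemma su_sub A B : A \subset B -> su A <= su B.
Proof.
move=> AB; rewrite /su (big_setID A (A := B)) /=.
by move/setIidPr: AB => ->; rewrite leq_addr.
Qed.

(** Pigeonhole twice: half of the copies of each rich value lie on one side of [x], and half of the
    values agree on the side. *)
Lemma half_rich (A : {set 'I_N}) s r : s <= #|rich (fun i : 'I_N => u i) m r A| ->
  uphalf s <= #|rich (fun i : 'I_N => u i) m (uphalf r) (A :\: x)| \/
  uphalf s <= #|rich (fun i : 'I_N => u i) m (uphalf r) (A :&: x)|.
Proof.
move=> h; have := leq_trans h (leq_trans (subset_leq_card (rich_split r A x)) (leq_card_setU _ _)).
set a := #|rich _ _ (uphalf r) (A :\: x)|; set b := #|rich _ _ _ (A :&: x)| => hab.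
have e1 := uphalf_half s; have e2 := odd_double_half s.
case: (leqP (uphalf s) a) => lt; [by left | right].
by case: (odd s) e1 e2 => /= e1 e2; lia.
Qed.

(** If the skipped items up to [tau] are rich, they could be exchanged with the chosen items beyond
    [tau], whose total is therefore small. If the chosen ones are rich, they could be exchanged with
    the removed items before [k]; these are then small in total, and by [bal1] so are all added
    items, up to [m]. *)
Lemma tail_right tau s r : k <= tau -> 0 < s -> 8 * 2600 * l ^ 3 * m <= r * s ^ 2 ->
  s <= #|rich (fun i : 'I_N => u i) m r [set i : 'I_N | k <= i <= tau]| ->
  s * su [set i in x | tau < i] <= 2200 * l ^ 3 * m ^ 2 + s * m.
Proof.
move=> kt s0 d hr; have [h|h] := half_rich hr.
  apply: leq_trans (leq_addr _ _); apply: dense_no_exchange h s0 d _.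
  move=> A' B' /subsetP AA' /subsetP BB' A0 B0 E.
  apply: (@no_exchange x tau.+1 A' B') => // i.
    by move=> /AA'; rewrite !inE ltnS => /andP[-> /andP[_ ->]].
  by move=> /BB'; rewrite inE => /andP[].
have le : s * su (removed x) <= 2200 * l ^ 3 * m ^ 2.
  apply: dense_no_exchange h s0 d _ => A' B' /subsetP AA' /subsetP BB' A0 B0 E.
  apply: (@no_exchange x k B' A') => // i.
    by move=> /BB'; rewrite inE => /andP[].
  by move=> /AA'; rewrite !inE => /andP[/andP[-> _] ->].
apply: leq_trans (leq_add le (leqnn _)); rewrite -mulnDr leq_mul2l; apply/orP; right.
apply: leq_trans bal1; apply: su_sub; apply/subsetP => i; rewrite !inE => /andP[-> h2].
by rewrite (leq_trans kt) // ltnW.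
Qed.

Lemma tail_left tau s r : tau < k -> 0 < s -> 8 * 2600 * l ^ 3 * m <= r * s ^ 2 ->
  s <= #|rich (fun i : 'I_N => u i) m r [set i : 'I_N | tau <= i < k]| ->
  s * su [set i : 'I_N | (i \notin x) && (i < tau)] <= 2200 * l ^ 3 * m ^ 2 + s * m.
Proof.
move=> kt s0 d hr; have [h|h] := half_rich hr.
  have le : s * su (added x) <= 2200 * l ^ 3 * m ^ 2.
    apply: dense_no_exchange h s0 d _ => A' B' /subsetP AA' /subsetP BB' A0 B0 E.
    apply: (@no_exchange x k A' B') => // i.
      by move=> /AA'; rewrite !inE => /andP[-> /andP[_ ->]].
    by move=> /BB'; rewrite inE => /andP[].
  apply: leq_trans (leq_add le (leqnn _)); rewrite -mulnDr leq_mul2l; apply/orP; right.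
  apply: leq_trans bal2; apply: su_sub; apply/subsetP => i; rewrite !inE => /andP[-> h2].
  by rewrite (ltn_trans h2).
apply: leq_trans (leq_addr _ _); apply: dense_no_exchange h s0 d _.
move=> A' B' /subsetP AA' /subsetP BB' A0 B0 E.
apply: (@no_exchange x tau B' A') => // i.
  by move=> /BB'; rewrite inE => /andP[].
by move=> /AA'; rewrite !inE => /andP[/andP[-> _] ->].
Qed.

Lemma su_classes (Q : {set 'I_m.+1}) (A : {set 'I_N}) c :
  (forall a, a \in Q -> #|[set i in A | u i == a]| <= c) ->
  su [set i in A | inord (u i) \in Q] <= #|Q| * (c * m).
Proof.
move=> H; rewrite -sum_nat_const.
have -> : su [set i in A | inord (u i) \in Q] =
    \sum_(a in Q) \sum_(i in A | u i == a) u i.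
  rewrite /su (partition_big (fun i : 'I_N => inord (u i) : 'I_m.+1) (mem Q)) /=; last first.
    by move=> i; rewrite inE => /andP[].
  apply: eq_bigr => a aQ; apply: eq_bigl => i; rewrite inE.
  have um' : u i < m.+1 by have /andP[] := um i.
  rewrite -andbA; congr (_ && _); rewrite -(inj_eq val_inj) /= inordK //.
  case: eqP => [E|]; last by rewrite andbF.
  by rewrite andbT; have -> : inord (u i) = a by apply: val_inj; rewrite /= inordK.
apply: leq_sum => a aQ; rewrite (eq_bigr (fun=> nat_of_ord a)); last by move=> i /andP[_ /eqP].
rewrite sum_nat_const leq_mul //; last by rewrite -ltnS.
apply: leq_trans (H _ aQ); apply: eq_leq; apply: eq_card => i; by rewrite !inE.
Qed.

(* [marks a] records the values collected by a scan that stops just before the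
   s-th value would reach r copies. *)
Definition scanned_right (marks : pred nat) s r := exists2 tau, k <= tau &
  (forall a, ~~ marks a -> #|[set i : 'I_N | (k <= i < tau) && (u i == a)]| < r) /\
  (tau < N -> s <= #|rich (fun i : 'I_N => u i) m r [set i : 'I_N | k <= i <= tau]|).

Definition scanned_left (marks : pred nat) s r := exists2 tau, tau <= k &
  (forall a, ~~ marks a -> #|[set i : 'I_N | (tau <= i < k) && (u i == a)]| < r) /\
  (0 < tau -> s <= #|rich (fun i : 'I_N => u i) m r [set i : 'I_N | tau.-1 <= i < k]|).

(** The items split at the stopping point [tau]: before it each class of [Q] has at most [r.-1]
    copies, behind it [tail_right] applies. One [s * m] pays for the item at [tau], the other for
    the imbalance in [tail_right]. *)
Lemma classes_right marks s r (Q : {set 'I_m.+1}) : 0 < s -> 8 * 2600 * l ^ 3 * m <= r * s ^ 2 ->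
  scanned_right marks s r -> (forall a, a \in Q -> ~~ marks a) ->
  s * su [set i in added x | inord (u i) \in Q] <=
    s * (#|Q| * (r.-1 * m)) + 2200 * l ^ 3 * m ^ 2 + 2 * s * m.
Proof.
move=> s0 d [tau kt [few big]] HQ.
have sub : [set i in added x | inord (u i) \in Q] \subset
   [set i in [set i : 'I_N | k <= i < tau] | inord (u i) \in Q] :|:
   ([set i : 'I_N | nat_of_ord i == tau] :|: [set i in x | tau < i]).
  apply/subsetP => i; rewrite !inE => /andP[/andP[-> ->] ->] /=; rewrite andbT.
  by case: ltngtP.
have h1 : su [set i in [set i : 'I_N | k <= i < tau] | inord (u i) \in Q] <= #|Q| * (r.-1 * m).
  apply: su_classes => a /HQ/few.
  have -> : [set i in [set i : 'I_N | k <= i < tau] | u i == a] =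
            [set i : 'I_N | (k <= i < tau) && (u i == a)] by apply/setP => i; rewrite !inE.
  by case: (r).
have h2 : su [set i : 'I_N | nat_of_ord i == tau] <= m.
  have [tN|Nt] := ltnP tau N.
    have -> : [set i : 'I_N | nat_of_ord i == tau] = [set Ordinal tN].
      by apply/setP => i; rewrite !inE -val_eqE.
    by rewrite /su big_set1; have /andP[] := um (Ordinal tN).
  rewrite /su big1 // => i; rewrite inE => /eqP E; have := ltn_ord i; lia.
have h3 : s * su [set i in x | tau < i] <= 2200 * l ^ 3 * m ^ 2 + s * m.
  have [tN|Nt] := ltnP tau N; first exact: tail_right (big tN).
  rewrite /su big1 ?muln0 // => i; rewrite inE => /andP[_ ti]; have := ltn_ord i; lia.
have le3 A B : su (A :|: B) <= su A + su B.
  have -> : A :|: B = A :|: (B :\: A) by apply/setP => i; rewrite !inE; case: (i \in A).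
  rewrite su_setU ?leq_add2l ?su_sub ?subsetDl //.
  by rewrite disjoints_subset; apply/subsetP => i iA; rewrite !inE iA.
apply: leq_trans (leq_mul (leqnn s) (su_sub sub)) _.
apply: leq_trans (leq_mul (leqnn s) (le3 _ _)) _.
rewrite mulnDr -addnA leq_add ?leq_mul //.
apply: leq_trans (leq_mul (leqnn s) (le3 _ _)) _; rewrite mulnDr.
apply: leq_trans (leq_add (leq_mul (leqnn s) h2) h3) _; lia.
Qed.

Lemma classes_left marks s r (Q : {set 'I_m.+1}) : 0 < s -> 8 * 2600 * l ^ 3 * m <= r * s ^ 2 ->
  scanned_left marks s r -> (forall a, a \in Q -> ~~ marks a) ->
  s * su [set i in removed x | inord (u i) \in Q] <=
    s * (#|Q| * (r.-1 * m)) + 2200 * l ^ 3 * m ^ 2 + 2 * s * m.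
Proof.
move=> s0 d [tau kt [few big]] HQ.
(* The leftward scan stopped at item [tau.-1]; the guard [0 < tau] handles a scan that reached the
   beginning, where [tau.-1] would denote item [0] wrongly. *)
have sub : [set i in removed x | inord (u i) \in Q] \subset
   [set i in [set i : 'I_N | tau <= i < k] | inord (u i) \in Q] :|:
   ([set i : 'I_N | (0 < tau) && (nat_of_ord i == tau.-1)] :|:
    [set i : 'I_N | (i \notin x) && (i < tau.-1)]).
  apply/subsetP => i; rewrite !inE => /andP[/andP[-> ->] ->] /=; rewrite !andbT.
  case: tau {few big} kt => [|tau] kt //=.
  by case: ltngtP.
have h1 : su [set i in [set i : 'I_N | tau <= i < k] | inord (u i) \in Q] <= #|Q| * (r.-1 * m).
  apply: su_classes => a /HQ/few.
  have -> : [set i in [set i : 'I_N | tau <= i < k] | u i == a] =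
            [set i : 'I_N | (tau <= i < k) && (u i == a)] by apply/setP => i; rewrite !inE.
  by case: (r).
have h2 : su [set i : 'I_N | (0 < tau) && (nat_of_ord i == tau.-1)] <= m.
  have [tN|Nt] := ltnP tau.-1 N; last first.
    rewrite /su big1 // => i; rewrite inE => /andP[_ /eqP E]; have := ltn_ord i; lia.
  apply: (@leq_trans (su [set Ordinal tN])).
    by apply: su_sub; apply/subsetP => i; rewrite !inE -val_eqE /= => /andP[].
  by rewrite /su big_set1; have /andP[] := um (Ordinal tN).
have h3 : s * su [set i : 'I_N | (i \notin x) && (i < tau.-1)] <= 2200 * l ^ 3 * m ^ 2 + s * m.
  have [->|t0] := posnP tau.
    by rewrite /su big1 ?muln0 // => i; rewrite inE ltn0 andbF.
  by apply: tail_left (big t0) => //; lia.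
have le3 A B : su (A :|: B) <= su A + su B.
  have -> : A :|: B = A :|: (B :\: A) by apply/setP => i; rewrite !inE; case: (i \in A).
  rewrite su_setU ?leq_add2l ?su_sub ?subsetDl //.
  by rewrite disjoints_subset; apply/subsetP => i iA; rewrite !inE iA.
apply: leq_trans (leq_mul (leqnn s) (su_sub sub)) _.
apply: leq_trans (leq_mul (leqnn s) (le3 _ _)) _.
rewrite mulnDr -addnA leq_add ?leq_mul //.
apply: leq_trans (leq_mul (leqnn s) (le3 _ _)) _; rewrite mulnDr.
apply: leq_trans (leq_add (leq_mul (leqnn s) h2) h3) _; lia.
Qed.

End Proximity.

(** * Window widths *)

Lemma level_arith s YR YL X z m : s * YR <= X + 2200 * z + 2 * (s * m) ->
  s * YL <= X + 2200 * z + 2 * (s * m) -> X <= 4 * 8 * 2600 * z ->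
  s * (YR + YL) <= 2 * (4 * 8 * 2600 + 2200) * z + 4 * (s * m).
Proof. by rewrite mulnDr; move: (s * YR) (s * YL) (s * m); lia. Qed.

Lemma level_arith2 s Y z m : s * Y <= 2 * (4 * 8 * 2600 + 2200) * z + 4 * (s * m) ->
  Y * (2 * s) - 4 * m * (2 * s) <= 342 * 1000 * z.
Proof.
have -> : Y * (2 * s) = 2 * (s * Y) by lia.
have -> : 4 * m * (2 * s) = 8 * (s * m) by lia.
by move: (s * Y) (s * m); lia.
Qed.

Section Windows.
Variables (N m k W NL : nat) (u v alpha : nat -> nat).
Hypothesis um : forall i, i < N -> 0 < u i <= m.
Hypothesis m_gt0 : 0 < m.
Hypothesis ratio : forall i j, i <= j < N -> v i * u j <= v j * u i.
Hypothesis kN : k <= N.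
Hypothesis fits : \sum_(i < k) v i <= W.
Hypothesis breaks : k < N -> W < \sum_(i < k.+1) v i.

Definition loglen := (trunc_log 2 m.+1).+1.
(** The threshold on [r * s ^ 2] in [dense_no_exchange]. *)
Definition density := 8 * 2600 * loglen ^ 3 * m.
(** For [s = 2 ^ lv] this is a number of copies that reaches the threshold; the [+ 1] rounds up and
    keeps it positive when the quotient vanishes. *)
Definition copies lv := density %/ (2 ^ lv * 2 ^ lv) + 1.
(* 342 * 1000 exceeds 4 (4 * 8 * 2600 + 2200), the constant produced by [level_arith]. *)
Definition width b := NL * (342 * 1000 * loglen ^ 3 * m ^ 2 %/ 2 ^ b + 4 * m).

Definition count_all a := \sum_(i < N) (u i == a).
Definition count_pre a := \sum_(i < k) (u i == a).

Let sR := @scanned_right N m k u.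
Let sL := @scanned_left N m k u.

Hypothesis scans : forall lv, lv <= NL -> exists mR mL,
  [/\ sR mR (2 ^ lv) (copies lv), sL mL (2 ^ lv) (copies lv) &
      forall a, a <= m -> (alpha a == 0) || (lv < alpha a) -> ~~ mR a /\ ~~ mL a].
Hypothesis marked : forall lv, 0 < lv <= NL -> \sum_(a < m.+1) (alpha a == lv) <= 2 * (2 ^ lv).-1.
Hypothesis alpha_le : forall a, a <= m -> alpha a <= NL.
Hypothesis densityNL : density < 2 ^ NL.

Let um' : forall i : 'I_N, 0 < u i <= m. Proof. by move=> i; apply: um. Qed.
Let ratio' : forall i j : 'I_N, i <= j -> v i * u j <= v j * u i.
Proof. by move=> i j ij; apply: ratio; rewrite ij ltn_ord. Qed.

Lemma count_all_set a : count_all a = #|[set i : 'I_N | u i == a]|.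
Proof. by rewrite -sum1dep_card [RHS]big_mkcond; apply: eq_bigr => i _; case: eqP. Qed.

Lemma count_pre_set a : count_pre a = #|[set i : 'I_N | (i < k) && (u i == a)]|.
Proof.
rewrite /count_pre (big_ord_widen _ (fun i => nat_of_bool (u i == a)) kN) -sum1dep_card big_mkcondr /=.
by apply: eq_bigr => i _; case: eqP.
Qed.

Lemma count_pre_le a : count_pre a <= count_all a.
Proof.
rewrite count_pre_set count_all_set subset_leq_card //.
by apply/subsetP => i; rewrite !inE => /andP[].
Qed.

Lemma m_density : m <= density.
Proof. by rewrite /density leq_pmull // !muln_gt0 expn_gt0. Qed.

Lemma rich_le_m r (A : {set 'I_N}) : 0 < r -> #|rich (fun i : 'I_N => u i) m r A| <= m.
Proof.
move=> r0; rewrite -ltnS -[X in _ < X](card_ord m.+1) -cardsT proper_card // properT.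
apply/eqP => E; have : ord0 \in rich (fun i : 'I_N => u i) m r A by rewrite E inE.
rewrite inE leqNgt => /negP; apply; apply: leq_trans r0.
rewrite ltnS leqn0 cards_eq0; apply/eqP/setP => i; rewrite !inE.
by have /andP[+ _] := um' i; case: (u i) => [//|n] _; rewrite andbF.
Qed.

(** At level [NL] one copy counts as rich, and [2 ^ NL] exceeds the number of possible values, so
    the two scans never stop early. Every value that occurs has then been marked. *)
Lemma alpha_gt0 a : a <= m -> 0 < count_all a -> 0 < alpha a.
Proof.
move=> am ca; rewrite lt0n; apply/negP => /eqP a0.
have [mR [mL [[t1 k1 [f1 b1]] [t2 k2 [f2 b2]] no]]] := scans (leqnn NL).
have [nR nL] := no a am (introT orP (or_introl (introT eqP a0))).
have mNL : m < 2 ^ NL by apply: leq_ltn_trans m_density densityNL.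
have c1 : copies NL = 1.
  by rewrite /copies divn_small // (leq_trans densityNL) // leq_pmulr // expn_gt0.
rewrite c1 in f1 b1 f2 b2.
have t1N : N <= t1.
  rewrite leqNgt; apply/negP => /b1 h; have := leq_trans h (rich_le_m _ (isT : 0 < 1)); lia.
have t20 : t2 = 0.
  apply/eqP; rewrite -leqn0 leqNgt; apply/negP => /b2 h.
  have := leq_trans h (rich_le_m _ (isT : 0 < 1)); lia.
have e1 := f1 a nR; have e2 := f2 a nL.
rewrite ltnS leqn0 cards_eq0 in e1; rewrite ltnS leqn0 cards_eq0 in e2.
move: ca; rewrite count_all_set card_gt0 => /set0Pn[i]; rewrite inE => ua.
have [ki|ik] := leqP k i.
  by move/eqP/setP/(_ i): e1; rewrite !inE ki ua (leq_trans (ltn_ord i) t1N).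
by move/eqP/setP/(_ i): e2; rewrite !inE ik ua t20.
Qed.

Variable x : {set 'I_N}.
Hypothesis tx : tight u v x.
Hypothesis xfits : sv v x <= W.
Hypothesis zx : \sum_(i < k) u i <= su u x.

Let pre := [set i : 'I_N | i < k].

Lemma sum_pre (f : nat -> nat) : \sum_(i < k) f i = \sum_(i in pre) f i.
Proof.
rewrite (big_ord_widen _ f kN); apply: eq_bigl => i; by rewrite inE.
Qed.

Lemma sum_exchange (f : nat -> nat) :
  \sum_(i in x) f i + \sum_(i in removed k x) f i = \sum_(i < k) f i + \sum_(i in added k x) f i.
Proof.
rewrite sum_pre !(big_mkcond (fun i => i \in _)) /= -!big_split /=; apply: eq_bigr => i _.
by rewrite !inE; case: (i \in x) => /=; case: ltnP => /=; lia.
Qed.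

(** Feasibility of [x] and the break item give [sv (added) < sv (removed) + v k]. Added items are no
    more efficient than item [k] and removed ones no less, so dividing by the ratio [v k / u k]
    turns this into a bound on [u]-sums, with [u k <= m] to spare. *)
Lemma su_balance1 : su u (added k x) <= su u (removed k x) + m.
Proof.
have Ev : sv v x + sv v (removed k x) = \sum_(i < k) v i + sv v (added k x) := sum_exchange v.
have [/eqP Ek|kltN] := boolP (k == N).
  have -> : su u (added k x) = 0; last by [].
  rewrite /su big1 // => i; rewrite inE => /andP[_]; have := ltn_ord i; rewrite Ek; lia.
have {}kltN : k < N by rewrite ltn_neqAle kltN.
have := breaks kltN; rewrite big_ord_recr /= => br.
have /andP[uk0 ukm] := um kltN.
have h1 : v k * su u (added k x) <= u k * sv v (added k x).
  rewrite /su /sv !big_distrr /=; apply: leq_sum => i; rewrite inE => /andP[_ ki].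
  by rewrite [leqRHS]mulnC; apply: ratio; rewrite ki ltn_ord.
have h2 : u k * sv v (removed k x) <= v k * su u (removed k x).
  rewrite /su /sv !big_distrr /=; apply: leq_sum => i; rewrite inE => /andP[_ ki].
  by rewrite mulnC; apply: ratio; rewrite ltnW.
have h3 : sv v (added k x) < sv v (removed k x) + v k.
  move: xfits fits br Ev; move: (sv v x) (sv v (added k x)) (sv v (removed k x)) (\sum_(i < k) v i).
  by clear; lia.
apply: leq_trans (_ : _ <= su u (removed k x) + u k) _; last by rewrite leq_add2l.
rewrite leqNgt; apply/negP => h4.
have vk : 0 < v k by move: fits br; move: (\sum_(i < k) v i); clear; lia.
have := h4; rewrite -(ltn_pmul2l vk).
have := h3; rewrite -(ltn_pmul2l uk0).
rewrite !mulnDr; move: h1 h2; rewrite [v k * u k]mulnC; clear; lia.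
Qed.

(** By [zx] the solution gains at least as much as the greedy prefix. *)
Lemma su_balance2 : su u (removed k x) <= su u (added k x) + m.
Proof.
have : su u x + su u (removed k x) = \sum_(i < k) u i + su u (added k x) := sum_exchange u.
by move: zx; move: (su u x) (su u _) (su u _) (\sum_(i < k) u i); clear; lia.
Qed.

Definition count_in a := #|[set i in x | u i == a]|.

Lemma count_in_le a : count_in a <= count_all a.
Proof.
by rewrite count_all_set subset_leq_card //; apply/subsetP => i; rewrite !inE => /andP[].
Qed.

Lemma count_in_dev a : (count_in a - count_pre a + (count_pre a - count_in a)) * a <=
  su u [set i in added k x | u i == a] + su u [set i in removed k x | u i == a].
Proof.
have E : count_in a + #|[set i in removed k x | u i == a]| = count_pre a + #|[set i in added k x | u i == a]|.
  rewrite count_pre_set /count_in -!sum1_card !(big_mkcond (fun i => i \in _)) /= -!big_split /=.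
  by apply: eq_bigr => i _; rewrite !inE; case: (i \in x); case: ltnP; case: (u i == a).
have cs (A : {set 'I_N}) : su u [set i in A | u i == a] = #|[set i in A | u i == a]| * a.
  by rewrite -sum_nat_const /su; apply: eq_bigr => i; rewrite inE => /andP[_ /eqP].
rewrite !cs -mulnDl leq_mul2r; apply/orP; right; move: E.
by move: (count_in a) (count_pre a) #|_| #|_|; clear; lia.
Qed.

(** Classes of level [lv.+1] were left unmarked by both scans of level [lv], so [classes_right] and
    [classes_left] with [s = 2 ^ lv] bound what is added to and removed from them together. *)
Lemma level_dev b : 0 < b <= NL ->
  \sum_(a < m.+1 | (0 < count_all a) && (alpha a == b))
     (count_in a - count_pre a + (count_pre a - count_in a)) * a <=
  342 * 1000 * loglen ^ 3 * m ^ 2 %/ 2 ^ b + 4 * m.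
Proof.
case: b => [//|lv] lvN.
have [mR [mL [r1 r2 no]]] := scans (ltnW lvN).
set s := 2 ^ lv in r1 r2; set r := copies lv in r1 r2.
have s0 : 0 < s by rewrite expn_gt0.
pose Q := [set a : 'I_m.+1 | alpha a == lv.+1].
have dens : density <= r * s ^ 2.
  rewrite /r /copies -/s -mulnn; have := divn_eq density (s * s).
  have : density %% (s * s) < s * s by rewrite ltn_mod muln_gt0 s0.
  rewrite mulnDl mul1n; lia.
have nQ : (forall a : 'I_m.+1, a \in Q -> ~~ mR a) /\ (forall a : 'I_m.+1, a \in Q -> ~~ mL a).
  by split=> a; rewrite inE => /eqP ea; have [] := no a (ltn_ord a); rewrite ?ea ?ltnSn ?orbT.
have [nQR nQL] := nQ.
have h1 := classes_right um' m_gt0 ratio' tx su_balance1 su_balance2 s0 dens r1 nQR.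
have h2 := classes_left um' m_gt0 ratio' tx su_balance1 su_balance2 s0 dens r2 nQL.
set YR := su u _ in h1; set YL := su u _ in h2.
have byQ (A : {set 'I_N}) : \sum_(a < m.+1 | (0 < count_all a) && (alpha a == lv.+1)) su u [set i in A | u i == a] <=
   su u [set i in A | inord (u i) \in Q].
  apply: (@leq_trans (\sum_(a in Q) \sum_(i in A | u i == a) u i)).
    rewrite [leqLHS]big_mkcond [leqRHS]big_mkcond; apply: leq_sum => a _.
    rewrite inE; case: andP => [[_ ->]|//]; rewrite /su; apply: eq_leq.
    by apply: eq_bigl => i; rewrite inE.
  rewrite /su (partition_big (fun i : 'I_N => inord (u i) : 'I_m.+1) (mem Q)) /=; last first.
    by move=> i; rewrite inE => /andP[].
  apply: leq_sum => a aQ; apply: eq_leq; apply: eq_bigl => i; rewrite inE.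
  have umi : u i < m.+1 by have /andP[] := um' i.
  rewrite -andbA; congr (_ && _); rewrite -(inj_eq val_inj) /= inordK //.
  case: eqP => [E|]; last by rewrite andbF.
  by rewrite andbT; have -> : inord (u i) = a by apply: val_inj; rewrite /= inordK.
apply: (@leq_trans (YR + YL)).
  apply: leq_trans (leq_add (byQ _) (byQ _)); rewrite -big_split /=.
  by apply: leq_sum => a _; apply: count_in_dev.
(* Each of the two scans of level [lv.+1] marks fewer than [2 * s] classes. *)
have cQ : #|Q| <= 4 * s.
  have := marked (lvN : 0 < lv.+1 <= NL).
  have -> : \sum_(a < m.+1) (alpha a == lv.+1) = #|Q|.
    by rewrite -sum1dep_card [RHS]big_mkcond; apply: eq_bigr => a _; case: eqP.
  rewrite expnS -/s; lia.
have rs : r.-1 * (s * s) <= density.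
  by rewrite /r /copies addn1 /= -/s leq_trunc_div.
have e : s * (#|Q| * (r.-1 * m)) <= 4 * (density * m).
  apply: (@leq_trans (s * (4 * s * (r.-1 * m)))); first by rewrite leq_mul2l leq_mul2r cQ !orbT.
  have -> : s * (4 * s * (r.-1 * m)) = 4 * (r.-1 * (s * s) * m) by clear; lia.
  by rewrite leq_mul2l leq_mul2r rs !orbT.
have e2 : 4 * (density * m) = 4 * 8 * 2600 * (loglen ^ 3 * m ^ 2).
  rewrite /density; move: (loglen ^ 3) => z; clear; rewrite -mulnn; lia.
have tot : s * (YR + YL) <= 2 * (4 * 8 * 2600 + 2200) * (loglen ^ 3 * m ^ 2) + 4 * (s * m).
  rewrite -![2200 * _ * _]mulnA -![2 * s * m]mulnA in h1 h2; rewrite e2 in e.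
  exact: level_arith h1 h2 e.
rewrite [leqRHS]addnC -leq_subLR leq_divRL ?expn_gt0 // mulnBl.
rewrite -[342 * 1000 * _ * _]mulnA expnS -/s; exact: level_arith2 tot.
Qed.

(** At most [NL] levels contribute, and the bound of [level_dev] decreases with the level; this is
    the factor [NL] in [width]. *)
Lemma window_bound b : 0 < b <= NL ->
  \sum_(a < m.+1 | (0 < count_all a) && (b <= alpha a))
     (count_in a - count_pre a + (count_pre a - count_in a)) * a <= width b.
Proof.
move=> /andP[b0 bN]; pose d a := (count_in a - count_pre a + (count_pre a - count_in a)) * a.
rewrite (eq_bigr (fun a : 'I_m.+1 => d a)) //.
apply: (@leq_trans (\sum_(b' < NL.+1 | b <= b') \sum_(a < m.+1 | (0 < count_all a) && (alpha a == b')) d a)).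
  rewrite (partition_big (fun a : 'I_m.+1 => inord (alpha a) : 'I_NL.+1) (fun b' => b <= b')) /=; last first.
    by move=> a /andP[_ h]; rewrite inordK // ltnS alpha_le // -ltnS.
  apply: leq_sum => b' bb'; apply: eq_leq; apply: eq_bigl => a.
  have aN : alpha a < NL.+1 by rewrite ltnS alpha_le // -ltnS.
  rewrite -andbA; congr (_ && _); rewrite -(inj_eq val_inj) /= inordK //.
  by case: eqP => [->|]; rewrite ?andbF ?andbT.
apply: (@leq_trans (\sum_(b' < NL.+1 | b <= b') (342 * 1000 * loglen ^ 3 * m ^ 2 %/ 2 ^ b + 4 * m))).
  apply: leq_sum => b' bb'; apply: leq_trans (level_dev _) _.
    by rewrite (leq_trans b0 bb') -ltnS ltn_ord.
  by rewrite leq_add2r leq_div2l ?expn_gt0 // leq_pexp2l.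
rewrite sum_nat_const /width leq_mul2r; apply/orP; right.
rewrite -[X in _ <= X](card_ord NL) -(card_imset _ (@lift_inj NL.+1 ord0)) subset_leq_card //.
apply/subsetP => b' bb'; apply/imsetP.
have h : b'.-1 < NL by have := ltn_ord b'; rewrite unfold_in in bb'; lia.
exists (Ordinal h) => //; apply: val_inj; rewrite /= /bump leq0n add1n prednK //.
by apply: leq_trans b0 bb'.
Qed.

End Windows.

(** * Optimal values of multisets of items *)

(** Inclusion of multisets. Solutions are lists of pairs instead of sets of indices, so that
    clipping, sorting and swapping components need no reindexing. *)
Definition sub_ms (T : eqType) (t s : seq T) := forall x, count_mem x t <= count_mem x s.
Definition sum1 (s : seq (nat * nat)) := \sum_(x <- s) x.1.
Definition sum2 (s : seq (nat * nat)) := \sum_(x <- s) x.2.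

Lemma sub_ms_compl (T : eqType) (t s : seq T) : sub_ms t s -> exists r, perm_eq s (t ++ r).
Proof.
elim: t s => [|x t IH] s h; first by exists s.
have xs : x \in s by have := h x; rewrite /= eqxx -has_pred1 has_count; lia.
have ps := perm_to_rem xs.
have [|r pr] := IH (rem x s).
  move=> y; have := h y; have /permP/(_ (pred1 y)) /= -> := ps; lia.
by exists r; rewrite (permPl ps) /= perm_cons.
Qed.

Lemma sub_ms_cat (T : eqType) (t r s : seq T) : perm_eq s (t ++ r) -> sub_ms t s.
Proof. by move=> /permP h x; rewrite h count_cat leq_addr. Qed.

Lemma sub_ms_trans (T : eqType) (r t s : seq T) : sub_ms r t -> sub_ms t s -> sub_ms r s.
Proof. by move=> h1 h2 x; apply: leq_trans (h1 x) (h2 x). Qed.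

Lemma sub_ms_filter (T : eqType) (p : pred T) (s : seq T) : sub_ms (filter p s) s.
Proof. by move=> x; rewrite count_filter; apply: sub_count => y /= /andP[]. Qed.

Lemma count_mem_filter (T : eqType) (p : pred T) (s : seq T) x :
  count_mem x (filter p s) = if p x then count_mem x s else 0.
Proof.
rewrite count_filter; case: ifP => px; first by apply: eq_count => y /=; case: (y =P x) => // ->.
by rewrite (eq_count (a2 := pred0)) ?count_pred0 // => y /=; case: (y =P x) => // ->.
Qed.

Lemma sub_ms_mem (T : eqType) (t s : seq T) : sub_ms t s -> {subset t <= s}.
Proof. by move=> h x; rewrite -!has_pred1 !has_count => /leq_trans; apply. Qed.

Lemma sub_ms_perm (T : eqType) (t s s' : seq T) : perm_eq s s' -> sub_ms t s -> sub_ms t s'.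
Proof. by move=> /permP h1 h2 x; rewrite -h1. Qed.

Lemma sub_ms_sum (T : eqType) (F : T -> nat) (t s : seq T) : sub_ms t s ->
  \sum_(x <- t) F x <= \sum_(x <- s) F x.
Proof. by move=> /sub_ms_compl[r /(perm_big _)->]; rewrite big_cat leq_addr. Qed.

Lemma sub_ms_set (T : eqType) N (f : 'I_N -> T) (S : {set 'I_N}) :
  sub_ms [seq f i | i <- enum S] [seq f i | i <- enum 'I_N].
Proof.
apply: (@sub_ms_cat _ _ [seq f i | i <- enum (~: S)]); rewrite -map_cat; apply: perm_map.
apply: uniq_perm; rewrite ?enum_uniq //.
  rewrite cat_uniq !enum_uniq andbT /=; apply/hasPn => i; by rewrite !mem_enum inE.
by move=> i; rewrite mem_cat !mem_enum !inE orbN.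
Qed.

Lemma set_of_ms (T : eqType) N (f : 'I_N -> T) t : sub_ms t [seq f i | i <- enum 'I_N] ->
  exists S : {set 'I_N}, perm_eq t [seq f i | i <- enum S].
Proof.
move=> h; have /count_subseqP[s' ss' pt] : forall x, count_mem x t <= count_mem x [seq f i | i <- enum 'I_N] by [].
case/subseqP: ss' => mk _ E; exists [set i in mask mk (enum 'I_N)].
apply: perm_trans pt _; rewrite E -map_mask; apply: perm_map; apply: uniq_perm.
- by rewrite mask_uniq ?enum_uniq.
- exact: enum_uniq.
- by move=> i; rewrite mem_enum inE.
Qed.

Definition is_opt (s : seq (nat * nat)) W z :=
  (forall t, sub_ms t s -> sum2 t <= W -> sum1 t <= z) /\
  exists t, [/\ sub_ms t s, sum2 t <= W & sum1 t = z].

Lemma is_opt_perm s s' W z : perm_eq s s' -> is_opt s W z -> is_opt s' W z.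
Proof.
move=> p [ub [t [h1 h2 h3]]]; split; last by exists t; split=> //; apply: sub_ms_perm h1.
by move=> t' h; apply: ub; apply: sub_ms_perm h; rewrite perm_sym.
Qed.

Lemma items_enum (items : seq (nat * nat)) :
  items = [seq (profit items i, weight items i) | i : 'I_(size items) <- enum 'I_(size items)].
Proof.
rewrite (_ : [seq _ | i <- _] = [seq nth (0, 0) items (nat_of_ord i) | i <- enum 'I_(size items)]); last first.
  by apply: eq_map => i; rewrite /profit /weight; case: (nth _ _ _).
rewrite (map_comp (nth (0, 0) items) (@nat_of_ord _)) val_enum_ord.
by rewrite map_nth_iota0 // take_size.
Qed.

Lemma is_opt_OPT items W : is_opt items W (OPT items W).
Proof.
pose f (i : 'I_(size items)) := (profit items i, weight items i).
have Ei : items = [seq f i | i <- enum 'I_(size items)] := items_enum items.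
have sums (S : {set 'I_(size items)}) (t : seq (nat * nat)) :
   perm_eq t [seq f i | i <- enum S] ->
   sum1 t = \sum_(i in S) profit items i /\ sum2 t = \sum_(i in S) weight items i.
  by move=> p; rewrite /sum1 /sum2 !(perm_big _ p) !big_map -!big_enum.
split.
  move=> t; rewrite [X in sub_ms _ X]Ei => /set_of_ms[S /sums[E1 E2]].
  rewrite E1 E2 => h.
  exact: (@leq_bigmax_cond _ (fun S : {set 'I_(size items)} => \sum_(i in S) weight items i <= W)
    (fun S : {set 'I_(size items)} => \sum_(i in S) profit items i) S).
have [|S hS ES] := @eq_bigmax_cond _ [pred S : {set 'I_(size items)} | \sum_(i in S) weight items i <= W]
    (fun S : {set _} => \sum_(i in S) profit items i).
  by apply/card_gt0P; exists set0; rewrite inE big_set0.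
have [E1 E2] := sums S _ (perm_refl _).
exists [seq f i | i <- enum S]; split.
- by rewrite [X in sub_ms _ X]Ei; apply: sub_ms_set.
- by rewrite E2.
- by rewrite E1 -ES.
Qed.

Definition clip W (x : nat * nat) := if x.2 <= W then x else (0, 0).

(** An item heavier than [W] is in no feasible solution, and copies of [(0, 0)] change no sum.
    Replacing items instead of deleting them keeps the length [n] of the input arrays. *)
Lemma is_opt_clip s W z : is_opt s W z -> is_opt (map (clip W) s) W z.
Proof.
move=> [ub [t [h1 h2 h3]]]; split.
  move=> r rs rW; pose r' := [seq x <- r | x != (0, 0)].
  have E (F : nat * nat -> nat) : F (0, 0) = 0 -> \sum_(x <- r') F x = \sum_(x <- r) F x.
    by move=> F0; rewrite big_filter [RHS](bigID (fun x => x != (0,0))) /= [X in _ = _ + X]big1 ?addn0 // => x /negPn/eqP->.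
  rewrite /sum1 -E //; apply: ub; last by rewrite /sum2 E.
  move=> x; rewrite count_mem_filter; case: ifP => // x0.
  apply: leq_trans (rs x) _; rewrite count_map; apply: sub_count => y /=; rewrite /clip.
  by case: ifP => // _ /eqP E'; rewrite -E' eqxx in x0.
exists t; split=> // x; have [xW|Wx] := leqP x.2 W.
  apply: leq_trans (h1 x) _; rewrite count_map; apply: sub_count => y /= /eqP->.
  by rewrite /clip xW.
rewrite (count_memPn _) //; apply/negP => xt; move: h2; rewrite leqNgt => /negP; apply.
by rewrite /sum2 (big_rem x) //= (leq_trans Wx) // leq_addr.
Qed.

Lemma is_opt_pos s W z : is_opt s W z -> is_opt [seq x <- s | 0 < x.1] W z.
Proof.
move=> [ub [t [h1 h2 h3]]]; split.
  by move=> r rs; apply: ub; apply: sub_ms_trans rs (sub_ms_filter _ _).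
exists [seq x <- t | 0 < x.1]; split.
- by move=> x; rewrite !count_mem_filter; case: ifP.
- by apply: leq_trans h2; apply: sub_ms_sum; apply: sub_ms_filter.
- rewrite -h3 /sum1 big_filter big_mkcond /=; apply: eq_bigr => x _; by case: (x.1).
Qed.

(* The items left out of a solution: they must weigh enough and be worth as little as possible;
   weightless items are never left out. *)
Lemma is_opt_excluded s W z : is_opt s W z -> let r := [seq x <- s | 0 < x.2] in
  (forall e, sub_ms e r -> sum2 r <= W + sum2 e -> sum1 s <= z + sum1 e) /\
  exists e, [/\ sub_ms e r, sum2 r <= W + sum2 e & sum1 s = z + sum1 e].
Proof.
move=> [ub [t [h1 h2 h3]]] r.
have Er : sum2 r = sum2 s.
  by rewrite /sum2 big_filter big_mkcond /=; apply: eq_bigr => x _; case: (x.2).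
have main e : sub_ms e r -> sum2 r <= W + sum2 e -> sum1 s <= z + sum1 e.
  move=> er; rewrite Er; have es := sub_ms_trans er (sub_ms_filter _ _).
  have [t' p] := sub_ms_compl es.
  have p' : perm_eq s (t' ++ e) by rewrite (permPl p) perm_catC.
  rewrite /sum1 /sum2 !(perm_big _ p') !big_cat /= -!/(sum1 _) -!/(sum2 _) leq_add2r => le.
  by rewrite leq_add2r; apply: ub; [apply: sub_ms_cat p' | lia].
split=> //; have [e0 p] := sub_ms_compl h1.
have [E1 E2] : sum1 s = z + sum1 e0 /\ sum2 s = sum2 t + sum2 e0.
  by rewrite -h3 /sum1 /sum2 !(perm_big _ p) !big_cat.
pose e := [seq x <- e0 | 0 < x.2].
have Ee : sum2 e = sum2 e0.
  by rewrite /sum2 big_filter big_mkcond /=; apply: eq_bigr => x _; case: (x.2).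
have er : sub_ms e r.
  move=> x; rewrite !count_mem_filter; case: ifP => // _.
  by rewrite (permP p) count_cat leq_addl.
have le : sum2 r <= W + sum2 e by rewrite Er Ee E2 leq_add2r.
exists e; split=> //; apply/eqP; rewrite eqn_leq main //= E1 leq_add2l.
by apply: sub_ms_sum; apply: sub_ms_filter.
Qed.

(** * Classes of equal first components *)

(** The first elements of a sorted list are its cheapest sublist of that size. *)
Lemma sumn_take_sorted l t : sorted leq l -> sub_ms t l -> sumn (take (size t) l) <= sumn t.
Proof.
move=> sl /count_subseqP[t' ss p]; rewrite (perm_size p) (perm_sumn p) {t p}.
elim: l sl t' ss => [|x l IH] sl t' ss; first by case: t' ss.
case: t' ss => [|y t'] // ss; rewrite [size _]/= [take _ _]/= /=.
have sl' : sorted leq l by apply: path_sorted sl.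
have xy : x <= y.
  have : y \in x :: l by apply: (mem_subseq ss); rewrite mem_head.
  rewrite inE => /orP[/eqP->//|yl].
  by have := sl; rewrite /= (path_sortedE leq_trans) => /andP[/allP/(_ _ yl)].
apply: leq_add => //; apply: IH => //.
by move: ss => /=; case: eqP => // _ /(subseq_trans (subseq_cons _ _)).
Qed.

Section Classes.
Variables (ks : seq (nat * nat)) (m INF : nat).
Hypothesis km : all (fun x => 0 < x.1 <= m) ks.
Hypothesis kINF : sum2 ks <= INF.

Definition cls (s : seq (nat * nat)) a := [seq x.2 | x <- s & x.1 == a].
Definition scls a := sort leq (cls ks a).
Definition pfx a t := sumn (take t (scls a)).
Definition ccount a := count (fun x => x.1 == a) ks.

Lemma size_scls a : size (scls a) = ccount a.
Proof. by rewrite size_sort size_map size_filter. Qed.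

Lemma scls_sorted a : sorted leq (scls a). Proof. exact: sort_sorted leq_total _. Qed.

Lemma sumn_scls a : sumn (scls a) <= INF.
Proof.
rewrite (perm_sumn (permEl (perm_sort _ _))) sumnE big_map.
apply: leq_trans kINF; apply: (sub_ms_sum (fun x => x.2)); exact: sub_ms_filter.
Qed.

Lemma pfx0 a : pfx a 0 = 0. Proof. by rewrite /pfx take0. Qed.

Lemma pfxS a j : j < ccount a -> pfx a j.+1 = pfx a j + nth 0 (scls a) j.
Proof. by move=> h; rewrite /pfx (take_nth 0) ?size_scls // sumn_rcons. Qed.

Lemma pfx_inf a j : pfx a j <= INF.
Proof. by apply: leq_trans (sumn_scls a); rewrite -[in leqRHS](cat_take_drop j (scls a)) sumn_cat leq_addr. Qed.

Lemma pfx_step a j : j < ccount a -> pfx a j.+1 <= pfx a j + INF.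
Proof. by move=> h; apply: leq_trans (pfx_inf a _) (leq_addl _ _). Qed.

Lemma pfx_convex a j : j.+2 <= ccount a -> 2 * pfx a j.+1 <= pfx a j + pfx a j.+2.
Proof.
move=> h; rewrite (pfxS h) (pfxS (ltnW h)).
have : nth 0 (scls a) j <= nth 0 (scls a) j.+1.
  by apply: (sorted_leq_nth leq_trans leqnn 0 (scls_sorted a)); rewrite ?inE ?size_scls // ltnW.
by move: (nth _ _ _) (nth _ _ _) (pfx a j); clear; lia.
Qed.

Lemma sum_by_class (F : nat * nat -> nat) e : {subset e <= ks} ->
  \sum_(x <- e) F x = \sum_(a < m.+1 | 0 < ccount a) \sum_(x <- e | x.1 == a) F x.
Proof.
move=> es; rewrite (exchange_big_dep xpredT) //= big_seq [RHS]big_seq; apply: eq_bigr => x xe.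
have xk := es x xe; have /andP[x0 xm] := allP km x xk.
have xm' : x.1 < m.+1 by [].
rewrite (big_pred1 (Ordinal xm')) // => a; rewrite /= -val_eqE /= [RHS]eq_sym.
case: eqP => [<-|]; rewrite ?andbF // andbT -has_count; apply/hasP.
by exists x => /=.
Qed.

(** Only the number of items taken from a class matters for the first sum, and taking the cheapest
    ones can only lower the second. Together with [select_sound] this replaces selections by
    multiplicities. *)
Lemma select_complete e : sub_ms e ks -> let t a := count (fun x => x.1 == a) e in
  [/\ forall a, t a <= ccount a, sum1 e = \sum_(a < m.+1 | 0 < ccount a) t a * a &
   \sum_(a < m.+1 | 0 < ccount a) pfx a (t a) <= sum2 e].
Proof.
move=> es t; have sb := sub_ms_mem es; have [r p] := sub_ms_compl es; split.
- by move=> a; rewrite /ccount (permP p) count_cat leq_addr.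
- rewrite /sum1 (sum_by_class (fun x => x.1) sb); apply: eq_bigr => a _.
  rewrite (eq_bigr (fun=> nat_of_ord a)); last by move=> x /eqP.
  by rewrite big_const_seq iter_addn_0 mulnC.
- rewrite /sum2 (sum_by_class (fun x => x.2) sb); apply: leq_sum => a _.
  rewrite -big_filter -(big_map (fun x => x.2) xpredT id) -sumnE /pfx /t -size_filter.
  rewrite -(size_map (fun x => x.2)); apply: sumn_take_sorted; first exact: scls_sorted.
  move=> y; rewrite (permP (permEl (perm_sort _ _))).
  have p2 : perm_eq (cls ks a) (cls e a ++ cls r a).
    by rewrite /cls -map_cat -filter_cat; apply: perm_map; apply: perm_filter.
  by rewrite (permP p2) count_cat leq_addr.
Qed.

Lemma count_pair a l (x : nat * nat) : count_mem x [seq (a, y) | y <- l] = if x.1 == a then count_mem x.2 l else 0.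
Proof.
rewrite count_map; case: eqP => [E|ne].
  by apply: eq_count => y /=; rewrite -E; case: x {E} => x1 x2; rewrite /= xpair_eqE eqxx.
by rewrite (eq_count (a2 := pred0)) ?count_pred0 // => y /=; apply/eqP => E; case: ne; rewrite -E.
Qed.

Lemma count_cls s (x : nat * nat) : count_mem x.2 (cls s x.1) = count_mem x s.
Proof.
rewrite count_map count_filter; apply: eq_count => y /=.
by case: x y => x1 x2 [y1 y2]; rewrite /= xpair_eqE andbC.
Qed.

Lemma select_sound t : (forall a, t a <= ccount a) -> exists e, [/\ sub_ms e ks,
  sum1 e = \sum_(a < m.+1 | 0 < ccount a) t a * a &
  sum2 e = \sum_(a < m.+1 | 0 < ccount a) pfx a (t a)].
Proof.
move=> tc; pose bl a := [seq (a, y) | y <- take (t a) (scls a)].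
pose e := flatten [seq bl (nat_of_ord a) | a : 'I_m.+1 <- enum 'I_m.+1].
have es (F : nat * nat -> nat) : \sum_(x <- e) F x = \sum_(a < m.+1) \sum_(y <- take (t a) (scls a)) F (nat_of_ord a, y).
  rewrite /e big_flatten big_map -big_enum /=; apply: eq_bigr => a _; by rewrite big_map.
exists e; split.
- move=> x; rewrite /e count_flatten -map_comp sumnE big_map big_enum /=.
  have [xm|mx] := leqP x.1 m; last first.
    rewrite big1 // => a _; rewrite count_pair; case: eqP => // E.
    by have := ltn_ord a; rewrite -E ltnS leqNgt mx.
  have xm' : x.1 < m.+1 by [].
  rewrite (bigD1 (Ordinal xm')) //= big1 ?addn0; last first.
    move=> a ne; rewrite count_pair; case: eqP => // E; case/eqP: ne; exact: val_inj.
  rewrite count_pair eqxx -(count_cls ks).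
  rewrite -[leqRHS](permP (permEl (perm_sort leq _)) (pred1 x.2)) -/(scls x.1).
  by rewrite -[in leqRHS](cat_take_drop (t x.1) (scls x.1)) count_cat leq_addr.
- rewrite /sum1 es [RHS]big_mkcond /=; apply: eq_bigr => a _.
  rewrite big_const_seq iter_addn_0 count_predT size_take size_scls.
  have := tc a; case: posnP => [->|_]; first by rewrite leqn0 => /eqP->; rewrite muln0.
  by rewrite mulnC; case: ltnP => // h1 h2; congr (_ * _); apply/eqP; rewrite eqn_leq h1 h2.
- rewrite /sum2 es [RHS]big_mkcond /=; apply: eq_bigr => a _.
  rewrite /pfx sumnE; have := tc a; case: posnP => // ->.
  by rewrite leqn0 => /eqP->; rewrite take0 big_nil.
Qed.

End Classes.

(** * A while language and its compilation to the word RAM *)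

Inductive binop := OAdd | OSub | OMul | ODiv | OMod | OLt | OEq.

Definition bop (o : binop) (a b : nat) : nat :=
  match o with
  | OAdd => a + b | OSub => a - b | OMul => a * b | ODiv => a %/ b
  | OMod => a %% b | OLt => a < b | OEq => a == b
  end.

Definition iop (o : binop) : nat -> nat -> nat -> instr :=
  match o with
  | OAdd => IAdd | OSub => ISub | OMul => IMul | ODiv => IDiv
  | OMod => IMod | OLt => ILt | OEq => IEq
  end.

(** The array of a load is an expression too, taken modulo [16]: this allows one program text to
    exchange the roles of two arrays and to read an arbitrary memory cell. *)
Inductive expr :=
| Cst of nat
| Var of nat
| Bin of binop & expr & expr
| Ld of expr & expr.

Inductive cmd :=
| Skip
| Asg of nat & expr
| St of nat & expr & expr
| Seq of cmd & cmd
| If of expr & cmd & cmd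
| While of expr & cmd.

Record state := State { va : nat -> nat; ar : nat -> nat -> nat }.

(** Variables are compared by [eqn], which reduces on numerals, so that lookups after symbolic
    execution simplify by computation; array positions stay symbolic and use [==]. *)
Definition setv (s : state) x v := State (fun y => if eqn y x then v else va s y) (ar s).
Definition seta (s : state) j i v :=
  State (va s) (fun j' => if eqn j' j then fun i' => if i' == i then v else ar s j' i' else ar s j').

Fixpoint ev (s : state) (e : expr) : nat :=
  match e with
  | Cst n => n
  | Var x => va s x
  | Bin o a b => bop o (ev s a) (ev s b)
  | Ld a b => ar s (ev s a %% 16) (ev s b)
  end.

(** The number of iterations is an argument, so termination is part of the claim. The meaning of the
    body is passed as a function, which keeps [wp] structurally recursive. *)
Definition wloop (cond : state -> nat) (body : state -> (state -> nat -> Prop) -> Prop) :=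
  fix loop (n : nat) (s : state) (Q : state -> nat -> Prop) {struct n} : Prop :=
  if n is n'.+1 then
    cond s <> 0 /\ body s (fun s' t => loop n' s' (fun s2 t2 => Q s2 (t + t2).+1))
  else cond s = 0 /\ Q s 1.

Section WP.
Variable V : nat.

(** Total correctness with cost: [Q] receives the final state and the number of assignments and
    tests executed, and every value written must be below [V]. *)
Fixpoint wp (c : cmd) (s : state) (Q : state -> nat -> Prop) {struct c} : Prop :=
  match c with
  | Skip => Q s 0
  | Asg x e => ev s e < V /\ Q (setv s x (ev s e)) 1
  | St j e1 e2 => ev s e2 < V /\ Q (seta s j (ev s e1) (ev s e2)) 1
  | Seq a b => wp a s (fun s1 t1 => wp b s1 (fun s2 t2 => Q s2 (t1 + t2)))
  | If e a b => if ev s e is 0 then wp b s (fun s' t => Q s' t.+1)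
                else wp a s (fun s' t => Q s' t.+1)
  | While e b => exists n, wloop (fun s => ev s e) (wp b) n s Q
  end.

Lemma wp_while e b s Q : wp (While e b) s Q = exists n, wloop (fun s => ev s e) (wp b) n s Q.
Proof. by []. Qed.

Lemma wp_mono c s (Q Q' : state -> nat -> Prop) :
  (forall s' t, Q s' t -> Q' s' t) -> wp c s Q -> wp c s Q'.
Proof.
elim: c s Q Q' => [|x e|j e1 e2|a IHa b IHb|e a IHa b IHb|e b IHb] s Q Q' H.
- exact: H.
- by case=> h q; split=> //; apply: H.
- by case=> h q; split=> //; apply: H.
- by apply: IHa => s1 t1; apply: IHb => s2 t2; apply: H.
- by rewrite /=; case: (ev s e) => [|k]; [apply: IHb | apply: IHa] => s' t; apply: H.
rewrite !wp_while => -[n h]; exists n; elim: n s Q Q' H h => [|n IH] s Q Q' H /= [h1 h2].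
  by split=> //; apply: H.
by split=> //; apply: IHb h2 => s' t; apply: IH => s2 t2; apply: H.
Qed.

Fixpoint modv (c : cmd) (x : nat) : bool :=
  match c with
  | Skip | St _ _ _ => false
  | Asg y _ => eqn x y
  | Seq a b | If _ a b => modv a x || modv b x
  | While _ b => modv b x
  end.

Fixpoint moda (c : cmd) (j : nat) : bool :=
  match c with
  | Skip | Asg _ _ => false
  | St j' _ _ => eqn j j'
  | Seq a b | If _ a b => moda a j || moda b j
  | While _ b => moda b j
  end.

Definition frame (c : cmd) (s s' : state) : Prop :=
  (forall x, modv c x = false -> va s' x = va s x) /\
  (forall j, moda c j = false -> ar s' j = ar s j).

Lemma wp_frame c s (Q : state -> nat -> Prop) :
  wp c s Q -> wp c s (fun s' t => Q s' t /\ frame c s s').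
Proof.
elim: c s Q => [|x e|j e1 e2|a IHa b IHb|e a IHa b IHb|e b IHb] s Q.
- by move=> h; split.
- by case=> h q; split=> //=; split=> //; split=> //= y ->.
- by case=> h q; split=> //=; split=> //; split=> //= j' ->.
- move=> /IHa h /=; apply: wp_mono h => s1 t1 [/IHb h [fv fa]].
  apply: wp_mono h => s2 t2 [q [gv ga]]; split=> //; split=> [x|j] /= /norP/andP.
    by move/andP=> [/negbTE n1 /negbTE n2]; rewrite gv // fv.
  by move/andP=> [/negbTE n1 /negbTE n2]; rewrite ga // fa.
- rewrite /=; case: (ev s e) => [/IHb h|k /IHa h]; apply: wp_mono h => s' t [q [gv ga]];
  by split=> //; split=> [x|j] /= /norP/andP/andP[/negbTE n1 /negbTE n2]; rewrite ?gv ?ga.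
rewrite !wp_while => -[n h]; exists n.
suff {h} main s0 : frame (While e b) s0 s -> wloop (fun s => ev s e) (wp b) n s Q ->
    wloop (fun s => ev s e) (wp b) n s (fun s' t => Q s' t /\ frame (While e b) s0 s').
  by apply: main h; split.
elim: n s Q => [|n IH] s Q f0 /= [h1 h2]; first by [].
split=> //; apply: wp_mono (IHb _ _ h2) => s' t [q [gv ga]]; apply: IH => //.
by case: f0 => fv fa; split=> [x|j] /= n0; rewrite ?gv ?ga ?fv ?fa.
Qed.

(* The loop rule: [I i s t] holds after [i] iterations costing [t]. *)
Lemma wp_loop e b s n (I : nat -> state -> nat -> Prop) (Q : state -> nat -> Prop) :
  I 0 s 0 ->
  (forall i s' t, i < n -> I i s' t -> frame b s s' ->
     ev s' e <> 0 /\ wp b s' (fun s2 t2 => I i.+1 s2 (t + t2).+1)) ->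
  (forall s' t, I n s' t -> frame b s s' -> ev s' e = 0 /\ Q s' t.+1) ->
  wp (While e b) s Q.
Proof.
move=> I0 Istep Iend; rewrite wp_while; exists n.
have main k : forall s' t (Q' : state -> nat -> Prop), k <= n -> I (n - k) s' t -> frame b s s' ->
    (forall s2 t2, I n s2 (t + t2) -> frame b s s2 -> ev s2 e = 0 /\ Q' s2 t2.+1) ->
    wloop (fun s => ev s e) (wp b) k s' Q'.
  elim: k => [|k IH] s' t Q' kn h f hQ /=.
    by rewrite subn0 in h; apply: hQ => //; rewrite addn0.
  have [|h1 h2] := Istep _ _ _ _ h f; first by lia.
  split=> //; apply: wp_mono (wp_frame h2) => s2 t2 [h3 f2].
  have f3 : frame b s s2.
    by case: f f2 => fv fa [gv ga]; split=> [x|j] n0; rewrite ?gv ?ga ?fv ?fa.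
  apply: (IH _ (t + t2).+1) => //; first by lia.
    by move: h3; have -> : (n - k.+1).+1 = n - k by lia.
  move=> s4 t4 h4 f4; rewrite addnS; apply: hQ => //.
  by move: h4; have -> // : (t + t2).+1 + t4 = t + (t2 + t4).+1 by lia.
apply: (main n s 0) => //; first by rewrite subnn.
Qed.

End WP.

(** * Code generation and its simulation proof *)

Section Compile.

Notation nv := 48.

(** The result is left in temporary [k], and deeper subexpressions use higher temporaries. Copying a
    cell is addition to a zero, as there is no move instruction. *)
Fixpoint comp (e : expr) (k : nat) : program :=
  match e with
  | Cst n => [:: IConst (nv + k) n]
  | Var x => [:: IConst (nv + k) 0; IAdd (nv + k) (nv + k) x]
  | Bin o a b => comp a k ++ comp b k.+1 ++ [:: iop o (nv + k) (nv + k) (nv + k.+1)]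
  | Ld a b => comp a k ++ comp b k.+1 ++
      [:: IConst (nv + k.+2) 16; IMod (nv + k) (nv + k) (nv + k.+2);
          IMul (nv + k.+1) (nv + k.+1) (nv + k.+2); IAdd (nv + k) (nv + k) (nv + k.+1);
          IConst (nv + k.+1) 64; IAdd (nv + k) (nv + k) (nv + k.+1); ILoad (nv + k) (nv + k)]
  end.

(** An unconditional jump is a conditional jump on a temporary just set to [0]. *)
Fixpoint compc (c : cmd) (pc : nat) : program :=
  match c with
  | Skip => [::]
  | Asg x e => comp e 0 ++ [:: IConst (nv + 1) 0; IAdd x (nv + 0) (nv + 1)]
  | St j e1 e2 => comp e1 0 ++ comp e2 1 ++
      [:: IConst (nv + 2) 16; IMul (nv + 0) (nv + 0) (nv + 2); IConst (nv + 2) (64 + j);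
          IAdd (nv + 0) (nv + 0) (nv + 2); IStore (nv + 0) (nv + 1)]
  | Seq a b => let ca := compc a pc in ca ++ compc b (pc + size ca)
  | If e a b =>
      let ce := comp e 0 in
      let ca := compc a (pc + size ce).+1 in
      let pb := pc + size ce + 1 + size ca + 2 in
      let cb := compc b pb in
      ce ++ [:: IJz (nv + 0) pb] ++ ca ++ [:: IConst (nv + 0) 0; IJz (nv + 0) (pb + size cb)] ++ cb
  | While e b =>
      let ce := comp e 0 in
      let cb := compc b (pc + size ce).+1 in
      ce ++ [:: IJz (nv + 0) (pc + size ce + 1 + size cb + 2)] ++ cb ++
        [:: IConst (nv + 0) 0; IJz (nv + 0) pc]
  end.

(** Evaluation stays below [V ^ deg e], including the address computed for a load, which costs two
    further factors [V]. This determines the word size. *)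
Fixpoint deg (e : expr) : nat :=
  match e with
  | Cst _ | Var _ => 1
  | Bin _ a b => deg a + deg b
  | Ld a b => deg a + deg b + 2
  end.

Fixpoint depth (e : expr) : nat :=
  match e with
  | Cst _ | Var _ => 1
  | Bin _ a b => maxn (depth a) (depth b).+1
  | Ld a b => maxn (maxn (depth a) (depth b).+1) 3
  end.

Fixpoint wfe (e : expr) : bool :=
  match e with
  | Cst n => n < 4096
  | Var x => x < nv
  | Bin _ a b | Ld a b => wfe a && wfe b
  end.

(** The depth bound keeps evaluation within the sixteen temporaries [48] to [63]. [B] bounds the
    instructions per counted step; the [10] covers the jumps and moves around an expression. *)
Definition oke D B e := [&& wfe e, deg e <= D, depth e <= 14 & size (comp e 0) + 10 <= B].

Fixpoint wfc D B (c : cmd) : bool :=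
  match c with
  | Skip => true
  | Asg x e => (x < nv) && oke D B e
  | St j e1 e2 => [&& j < 16, oke D B e1, oke D B e2, (depth e2).+1 <= 14, deg e1 + 2 <= D &
      size (comp e1 0) + size (comp e2 0) + 10 <= B]
  | Seq a b => wfc D B a && wfc D B b
  | If e a b => [&& oke D B e, wfc D B a & wfc D B b]
  | While e b => oke D B e && wfc D B b
  end.

Variables (V D B w : nat) (P : program).
Hypothesis V4096 : 4096 <= V.
Hypothesis VD : V ^ D <= 2 ^ w.

(** Quantified over all fuel and all random bits: such a run consumes no bit. *)
Definition runs pc m t pc' m' := forall fuel bits,
  exec w P (t + fuel) pc m bits =
  omap (fun o => (o.1, t + o.2)) (exec w P fuel pc' m' bits).

Lemma runs0 pc m : runs pc m 0 pc m.
Proof. by move=> fuel bits; rewrite add0n; case: (exec _ _ _ _ _ _) => // -[]. Qed.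

Lemma runs_trans pc m t1 pc1 m1 t2 pc2 m2 :
  runs pc m t1 pc1 m1 -> runs pc1 m1 t2 pc2 m2 -> runs pc m (t1 + t2) pc2 m2.
Proof.
move=> h1 h2 fuel bits; rewrite -addnA h1 h2; case: (exec _ _ _ _ _ _) => //= -[a b] /=.
by rewrite addnA.
Qed.

Definition weff (i : instr) (m : nat -> nat) : option (nat * nat) :=
  match i with
  | IConst d c => Some (d, c)
  | IAdd d a b => Some (d, m a + m b)
  | ISub d a b => Some (d, m a - m b)
  | IMul d a b => Some (d, m a * m b)
  | IDiv d a b => Some (d, m a %/ m b)
  | IMod d a b => Some (d, m a %% m b)
  | ILt d a b => Some (d, m a < m b : nat)
  | IEq d a b => Some (d, m a == m b : nat)
  | ILoad d a => Some (d, m (m a))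
  | IStore a b => Some (m a, m b)
  | _ => None
  end.

Lemma runs_write pc m d v : weff (nth IHalt P pc) m = Some (d, v) -> v < 2 ^ w ->
  runs pc m 1 pc.+1 (upd m d v).
Proof.
move=> E vw fuel bits; rewrite add1n /=.
by case: (nth IHalt P pc) E => //= [d' c|d' a b|d' a b|d' a b|d' a b|d' a b|d' a b|d' a b|d' a|a b] [<- <-] in vw *; rewrite vw.
Qed.

Definition code_at pc (c : program) := forall i, i < size c -> nth IHalt P (pc + i) = nth IHalt c i.

Lemma code_at_cat pc a b : code_at pc (a ++ b) -> code_at pc a /\ code_at (pc + size a) b.
Proof.
move=> h; split=> i ib.
  by have := h i; rewrite size_cat nth_cat ib; apply; rewrite ltn_addr.
have := h (size a + i); rewrite size_cat nth_cat addnA => ->; last by rewrite ltn_add2l.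
by rewrite ltnNge leq_addr /= addKn.
Qed.

Lemma code_at_cons pc i c : code_at pc (i :: c) -> nth IHalt P pc = i /\ code_at pc.+1 c.
Proof.
move=> h; split; first by have := h 0 isT; rewrite addn0.
by move=> j jc; have := h j.+1; rewrite addnS; apply.
Qed.

Lemma runs_step pc i c m d v t pc' m' : code_at pc (i :: c) ->
  weff i m = Some (d, v) -> v < 2 ^ w ->
  (code_at pc.+1 c -> runs pc.+1 (upd m d v) t pc' m') -> runs pc m t.+1 pc' m'.
Proof.
move=> /code_at_cons[E hc] ef vw h; rewrite -add1n; apply: runs_trans (h hc).
by apply: runs_write; rewrite ?E.
Qed.

(* Variables live at addresses 0..47, temporaries at 48..63, and entry [i] of array [j] < 16 at
   address 64 + 16 i + j. *)
Definition rel s (m : nat -> nat) := (forall x, x < nv -> m x = va s x) /\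
  (forall j i, j < 16 -> m (64 + 16 * i + j) = ar s j i).

Definition bounded s := (forall x, x < nv -> va s x < V) /\
  (forall j i, j < 16 -> ar s j i < V).

Definition agree k (m m' : nat -> nat) := forall x, (x < nv + k) || (64 <= x) -> m' x = m x.

Lemma rel_agree k s m m' : rel s m -> agree k m m' -> rel s m'.
Proof.
move=> [h1 h2] h; split=> [x xn|j i j16].
  by rewrite h ?h1 // (leq_trans xn) ?leq_addr.
by rewrite h ?h2 //; apply/orP; right; lia.
Qed.

Lemma agree_trans k m1 m2 m3 : agree k m1 m2 -> agree k m2 m3 -> agree k m1 m3.
Proof. by move=> h1 h2 x hx; rewrite h2 // h1. Qed.

Lemma agree_weaken k k' m m' : k <= k' -> agree k' m m' -> agree k m m'.
Proof.
move=> kk h x hx; apply: h; case/orP: hx => [lt|->]; last by rewrite orbT.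
by rewrite (leq_trans lt) // leq_add2l.
Qed.

Lemma agree_upd k d v m m' : nv + k <= d < 64 -> agree k m m' -> agree k m (upd m' d v).
Proof.
move=> hd h x hx; rewrite /upd; case: eqP => [E|_]; last exact: h.
by exfalso; lia.
Qed.

Lemma V_gt1 : 1 < V. Proof. by apply: leq_trans V4096. Qed.
Lemma Vexp_gt0 k : 0 < V ^ k. Proof. by rewrite expn_gt0 (ltnW V_gt1). Qed.

Lemma deg_gt0 e : 0 < deg e.
Proof. by elim: e => [n|x|o a IHa b IHb|a IHa b IHb] /=; lia. Qed.

Lemma Vmono k k' : k <= k' -> V ^ k <= V ^ k'.
Proof. by move=> kk; rewrite leq_exp2l // V_gt1. Qed.

Lemma leV1 k : 0 < k -> V <= V ^ k.
Proof. by move=> k0; rewrite -{1}[V]expn1 Vmono. Qed.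

Lemma bop_lt o a b da db : 0 < da -> 0 < db -> a < V ^ da -> b < V ^ db -> bop o a b < V ^ (da + db).
Proof.
move=> da0 db0 ha hb.
have A : V ^ da <= V ^ (da + db) by apply: Vmono; lia.
have V1 : 1 < V ^ (da + db) by apply: leq_trans V_gt1 (leV1 _); lia.
have X := leq_trans V_gt1 (leV1 da0); have Y := leq_trans V_gt1 (leV1 db0).
have bb (c : bool) : c < V ^ (da + db) by apply: leq_ltn_trans (leq_b1 c) V1.
case: o => //=.
- rewrite expnD; move: (V ^ da) (V ^ db) ha hb X Y; clear; nia.
- by apply: leq_ltn_trans (leq_subr _ _) _; apply: leq_trans ha A.
- by rewrite expnD ltn_mul.
- by apply: leq_ltn_trans (leq_div _ _) _; apply: leq_trans ha A.
- by apply: leq_ltn_trans (leq_mod _ _) _; apply: leq_trans ha A.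
Qed.

Lemma ev_lt s e : wfe e -> bounded s -> ev s e < V ^ deg e.
Proof.
move=> + [hv ha]; elim: e => [n|x|o a IHa b IHb|a IHa b IHb] /=.
- by rewrite expn1 => h; apply: leq_trans h V4096.
- by rewrite expn1 => /hv.
- by move=> /andP[/IHa h1 /IHb h2]; apply: bop_lt => //; apply: deg_gt0.
- move=> _; apply: leq_trans (ha _ _ _) (leV1 _); first by rewrite ltn_mod.
  by rewrite addn2.
Qed.

Lemma weff_bop o m d a b : weff (iop o d a b) m = Some (d, bop o (m a) (m b)).
Proof. by case: o. Qed.

Lemma upd_same m d v : upd m d v d = v.
Proof. by rewrite /upd eqxx. Qed.

Lemma upd_other m d v x : x != d -> upd m d v x = m x.
Proof. by rewrite /upd => /negbTE->. Qed.

Lemma comp_ok e k pc s m : wfe e -> V ^ deg e <= 2 ^ w -> depth e + k <= 16 ->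
  rel s m -> bounded s -> code_at pc (comp e k) ->
  exists m', [/\ runs pc m (size (comp e k)) (pc + size (comp e k)) m',
    m' (nv + k) = ev s e & agree k m m'].
Proof.
elim: e k pc m => [n|x|o a IHa b IHb|a IHa b IHb] k pc m wf hd dp rl bd cd.
- exists (upd m (nv + k) n); split.
  + rewrite addn1; apply: runs_step cd _ _ _ => //=; last by move=> _; apply: runs0.
    by apply: leq_trans hd; rewrite expn1; apply: leq_trans wf V4096.
  + by rewrite upd_same.
  + by apply: agree_upd => //; move: dp => /=; lia.
- exists (upd (upd m (nv + k) 0) (nv + k) (va s x)); split.
  + rewrite addn2; apply: runs_step cd _ _ _ => //=; first by rewrite expn_gt0.
    move=> cd2; have xk : x < nv by [].
    apply: (@runs_step _ _ _ _ (nv + k) (va s x)) cd2 _ _ _; last by move=> _; apply: runs0.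
      by rewrite /= upd_same add0n upd_other ?(proj1 rl) //; lia.
    by apply: leq_trans hd; rewrite expn1; case: bd => h _; apply: h.
  + by rewrite upd_same.
  + by do 2 (apply: agree_upd; first by move: dp => /=; lia).
- move: wf hd dp cd => /= /andP[wa wb] hd dp.
  move=> /code_at_cat[ca /code_at_cat[cb cc]].
  have [||m1 [r1 v1 g1]] := IHa k pc m wa _ _ rl bd ca.
  + by apply: leq_trans (Vmono _) hd; lia.
  + by lia.
  have rl1 := rel_agree rl g1.
  have [||m2 [r2 v2 g2]] := IHb k.+1 _ m1 wb _ _ rl1 bd cb.
  + by apply: leq_trans (Vmono _) hd; lia.
  + by lia.
  exists (upd m2 (nv + k) (bop o (ev s a) (ev s b))); split.
  + rewrite !size_cat !addnA; apply: (runs_trans (runs_trans r1 r2)).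
    rewrite addn1; apply: runs_step cc _ _ _.
    * by rewrite weff_bop v2 (g2 (nv + k)) ?v1 //; lia.
    * by apply: leq_trans hd; apply: bop_lt; rewrite ?deg_gt0 ?ev_lt.
    * by move=> _; apply: runs0.
  + by rewrite upd_same.
  + apply: agree_upd; first by lia.
    by apply: agree_trans g1 (agree_weaken _ g2).
- move: wf hd dp cd => /= /andP[wa wb] hd dp.
  move=> /code_at_cat[ca /code_at_cat[cb cc]].
  have [||m1 [r1 v1 g1]] := IHa k pc m wa _ _ rl bd ca.
  + by apply: leq_trans (Vmono _) hd; lia.
  + by lia.
  have rl1 := rel_agree rl g1.
  have [||m2 [r2 v2 g2]] := IHb k.+1 _ m1 wb _ _ rl1 bd cb.
  + by apply: leq_trans (Vmono _) hd; lia.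
  + by lia.
  have rl2 := rel_agree rl1 g2.
  have v1' : m2 (nv + k) = ev s a by rewrite g2 //; lia.
  have la := ev_lt wa bd; have lb := ev_lt wb bd.
  have big : 64 + (ev s a %% 16 + ev s b * 16) < 2 ^ w.
    apply: leq_trans hd; have -> : deg a + deg b + 2 = deg b + 2 + deg a by clear; lia.
    rewrite expnD.
    have d0 : V ^ 2 * ev s b + V ^ 2 <= V ^ (deg b + 2).
      by rewrite -mulnSr expnD mulnC leq_mul2r lb orbT.
    have : V ^ (deg b + 2) * 1 <= V ^ (deg b + 2) * V ^ deg a by rewrite leq_mul2l Vexp_gt0 orbT.
    rewrite muln1 => d1; apply: leq_trans d1; apply: leq_trans d0.
    have : ev s a %% 16 < 16 by rewrite ltn_mod.
    have : 64 * 64 <= V ^ 2 by rewrite -mulnn leq_mul // (leq_trans _ V4096).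
    by move: (_ %% 16) (ev s b) (V ^ 2); clear; nia.
  set q := ev s a %% 16 in big.
  set p := ev s b in big.
  pose m3 := upd m2 (nv + k.+2) 16.
  pose m4 := upd m3 (nv + k) q.
  pose m5 := upd m4 (nv + k.+1) (p * 16).
  pose m6 := upd m5 (nv + k) (q + p * 16).
  pose m7 := upd m6 (nv + k.+1) 64.
  pose m8 := upd m7 (nv + k) (q + p * 16 + 64).
  have dp1 : k.+2 < 16 by lia.
  have e0 : (nv + k == nv + k.+1) = false by apply/negP => /eqP; lia.
  have e1 : (nv + k == nv + k.+2) = false by apply/negP => /eqP; lia.
  have e2 : (nv + k.+1 == nv + k) = false by apply/negP => /eqP; lia.
  have e3 : (nv + k.+1 == nv + k.+2) = false by apply/negP => /eqP; lia.
  have e4 : (nv + k.+2 == nv + k) = false by apply/negP => /eqP; lia.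
  have g8 : agree k m2 m8.
    by do 6 (apply: agree_upd; first by lia).
  exists (upd m8 (nv + k) (ar s q p)); split.
  + rewrite !size_cat !addnA; apply: (runs_trans (runs_trans r1 r2)).
    rewrite /= !addnS addn0.
    apply: (@runs_step _ _ _ _ (nv + k.+2) 16) cc _ _ _ => //; first by lia.
    move=> cc; apply: (@runs_step _ _ _ _ (nv + k) q) cc _ _ _; last move=> cc.
    * by rewrite /= /upd eqxx e1 v1'.
    * by lia.
    apply: (@runs_step _ _ _ _ (nv + k.+1) (p * 16)) cc _ _ _; last move=> cc.
    * by rewrite /= /upd eqxx e2 e3 e4 v2.
    * by lia.
    apply: (@runs_step _ _ _ _ (nv + k) (q + p * 16)) cc _ _ _; last move=> cc.
    * by rewrite /= /upd !eqxx e0.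
    * by lia.
    apply: (@runs_step _ _ _ _ (nv + k.+1) 64) cc _ _ _; last move=> cc.
    * by [].
    * by lia.
    apply: (@runs_step _ _ _ _ (nv + k) (q + p * 16 + 64)) cc _ _ _; last move=> cc.
    * by rewrite /= /upd !eqxx e0.
    * by lia.
    apply: (@runs_step _ _ _ _ (nv + k) (ar s q p)) cc _ _ _; last by move=> _; apply: runs0.
    * rewrite /= upd_same; congr (Some (_, _)); apply: etrans (g8 (q + p * 16 + 64) _) _.
        by apply/orP; right; lia.
      have q16 : q < 16 by rewrite /q ltn_mod.
      have -> : q + p * 16 + 64 = 64 + 16 * p + q by clear; lia.
      by rewrite (proj2 rl2).
    * apply: leq_trans hd; apply: leq_trans (proj2 bd _ _ _) (leV1 _); first by rewrite ltn_mod.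
      by rewrite addn2.
  + by rewrite upd_same.
  + apply: agree_upd; first by lia.
    apply: agree_trans g1 (agree_trans (agree_weaken _ g2) g8); lia.
Qed.

Lemma rel_setv s m x v : x < nv -> rel s m -> rel (setv s x v) (upd m x v).
Proof.
move=> xn [h1 h2]; split=> [y yn|j i j16] /=.
  by rewrite /upd eqnE; case: eqP => // _; apply: h1.
by rewrite upd_other ?h2 //; lia.
Qed.

Lemma rel_seta s m j i v : j < 16 -> rel s m -> rel (seta s j i v) (upd m (64 + 16 * i + j) v).
Proof.
move=> jn [h1 h2]; split=> [y yn|j' i' j16] /=.
  by rewrite upd_other ?h1 //; lia.
rewrite /upd eqnE; have [->|nj] := eqVneq j' j.
  by rewrite eqn_add2r eqn_add2l eqn_pmul2l //; case: eqP => // _; apply: h2.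
case: eqP => [E|_]; last exact: h2.
by case/eqP: nj; lia.
Qed.

Lemma bounded_setv s x v : v < V -> bounded s -> bounded (setv s x v).
Proof. by move=> vV [h1 h2]; split=> //= y yn; case: eqn => //; apply: h1. Qed.

Lemma bounded_seta s j i v : v < V -> bounded s -> bounded (seta s j i v).
Proof.
move=> vV [h1 h2]; split=> //= j' i' jn; case: eqn; last exact: h2.
by case: eqP => // _; apply: h2.
Qed.

Lemma runs_jz pc a lb m : nth IHalt P pc = IJz a lb ->
  runs pc m 1 (if m a == 0 then lb else pc.+1) m.
Proof. by move=> E fuel bits; rewrite add1n /= E. Qed.

(** Simulation by induction on the command, with an inner induction on the iteration count that [wp]
    supplies for a loop. Each counted step accounts for at most [B] instructions. *)
Lemma compc_ok c pc s m (Q : state -> nat -> Prop) : wfc D B c -> rel s m -> bounded s ->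
  wp V c s Q -> code_at pc (compc c pc) ->
  exists s' m' t k, [/\ runs pc m t (pc + size (compc c pc)) m', rel s' m', bounded s',
    Q s' k & t <= B * k].
Proof.
have expr_ok e k pc' s' m' : oke D B e -> k + depth e <= 15 -> rel s' m' -> bounded s' ->
    code_at pc' (comp e k) -> exists m2, [/\ runs pc' m' (size (comp e k)) (pc' + size (comp e k)) m2,
    m2 (nv + k) = ev s' e & agree k m' m2].
  move=> /and4P[we de _ _] dk rl bd cd; apply: comp_ok => //; last by lia.
  exact: leq_trans (Vmono de) VD.
have size0 e k : size (comp e k) = size (comp e 0).
  elim: e k => [n|x|o a IHa b IHb|a IHa b IHb] k //=; rewrite !size_cat /= (IHa k) (IHb k.+1) (IHb 1) //.
have oked e : oke D B e -> 0 + depth e <= 15 by case/and4P => _ _ h _; lia.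
have okeB e : oke D B e -> size (comp e 0) + 10 <= B by case/and4P.
elim: c pc s m Q => [|x e|j e1 e2|a IHa b IHb|e a IHa b IHb|e b IHb] pc s m Q wf rl bd.
- by move=> h cd; exists s, m, 0, 0; split=> //; rewrite addn0; apply: runs0.
- case/andP: wf => xn oe [vV q] /= /code_at_cat[ca cc].
  have [m1 [r1 v1 g1]] := expr_ok _ _ _ _ _ oe (oked _ oe) rl bd ca.
  have Vw : V <= 2 ^ w.
    apply: leq_trans VD; apply: leV1; case/and4P: oe => _ de _ _; apply: leq_trans (deg_gt0 _) de.
  exists (setv s x (ev s e)), (upd (upd m1 (nv + 1) 0) x (ev s e)), (size (comp e 0) + 2), 1; split=> //.
  + rewrite size_cat addnA; apply: runs_trans r1 _; rewrite /= !addnS addn0.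
    apply: (@runs_step _ _ _ _ (nv + 1) 0) cc _ _ _; rewrite ?expn_gt0 // => cc.
    apply: (@runs_step _ _ _ _ x (ev s e)) cc _ _ _; last by move=> _; apply: runs0.
      by rewrite /= upd_same addn0 upd_other ?v1 //; lia.
    exact: leq_trans vV Vw.
  + apply: rel_setv => //; apply: rel_agree (rel_agree rl g1) _.
    by apply: (@agree_upd 0) => //; lia.
  + exact: bounded_setv.
  + by have := okeB _ oe; lia.
- case/and5P: wf => jn oe1 oe2 dp2 /andP[dg sz] [vV q] /= /code_at_cat[c1 /code_at_cat[c2 cc]].
  have [m1 [r1 v1 g1]] := expr_ok _ _ _ _ _ oe1 (oked _ oe1) rl bd c1.
  have [|m2 [r2 v2 g2]] := expr_ok e2 1 _ s m1 oe2 _ (rel_agree rl g1) bd c2; first by lia.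
  have Vw : V <= 2 ^ w by apply: leq_trans VD; apply: leV1; lia.
  have bi : 64 + j + ev s e1 * 16 < 2 ^ w.
    apply: leq_trans VD; apply: leq_trans (Vmono dg).
    have we1 : wfe e1 by case/and4P: oe1.
    have := ev_lt we1 bd; rewrite expnD; have : 64 * 64 <= V ^ 2.
      by rewrite -mulnn leq_mul // (leq_trans _ V4096).
    move: jn; move: (ev s e1) (V ^ 2) (V ^ deg e1); clear; nia.
  have v1' : m2 (nv + 0) = ev s e1 by rewrite g2.
  set p := ev s e1 in bi v1' *; set q' := ev s e2 in v2 *.
  pose m3 := upd m2 (nv + 2) 16; pose m4 := upd m3 (nv + 0) (p * 16).
  pose m5 := upd m4 (nv + 2) (64 + j); pose m6 := upd m5 (nv + 0) (p * 16 + (64 + j)).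
  have [ad Ead] : exists ad, ad = 64 + 16 * p + j by exists (64 + 16 * p + j).
  exists (seta s j p q'), (upd m6 ad q'), (size (comp e1 0) + size (comp e2 1) + 5), 1.
  have g6 : agree 0 m m6.
    do 4 (apply: agree_upd; first by []).
    exact: agree_trans g1 (agree_weaken _ g2).
  split=> //.
  + rewrite !size_cat !addnA; apply: runs_trans (runs_trans r1 r2) _.
    rewrite /= !addnS addn0.
    apply: (@runs_step _ _ _ _ (nv + 2) 16) cc _ _ _; last move=> cc.
    * by [].
    * by lia.
    apply: (@runs_step _ _ _ _ (nv + 0) (p * 16)) cc _ _ _; last move=> cc.
    * by rewrite /= upd_same upd_other ?v1'.
    * by lia.
    apply: (@runs_step _ _ _ _ (nv + 2) (64 + j)) cc _ _ _; last move=> cc.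
    * by [].
    * by lia.
    apply: (@runs_step _ _ _ _ (nv + 0) (p * 16 + (64 + j))) cc _ _ _; last move=> cc.
    * by rewrite /= upd_same upd_other // upd_same.
    * by lia.
    apply: (@runs_step _ _ _ _ ad q') cc _ _ _; last by move=> _; apply: runs0.
    * rewrite /= upd_same; have -> : p * 16 + (64 + j) = ad by rewrite Ead; clear; lia.
      by rewrite /m6 /m5 /m4 /m3 !upd_other ?v2.
    * exact: leq_trans vV Vw.
  + by rewrite Ead; apply: rel_seta => //; apply: rel_agree rl g6.
  + exact: bounded_seta.
  + by rewrite (size0 e2 1); lia.
- case/andP: wf => wa wb /= h /code_at_cat[ca cb].
  have [s1 [m1 [t1 [k1 [r1 rl1 bd1 h1 le1]]]]] := IHa _ _ _ _ wa rl bd h ca.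
  have [s2 [m2 [t2 [k2 [r2 rl2 bd2 h2 le2]]]]] := IHb _ _ _ _ wb rl1 bd1 h1 cb.
  exists s2, m2, (t1 + t2), (k1 + k2); split=> //.
    by rewrite size_cat addnA; apply: runs_trans r1 r2.
  by rewrite mulnDr leq_add.
- case/and3P: wf => oe wa wb h cd.
  have {cd} /= /code_at_cat[ce /code_at_cons[ej /code_at_cat[ca]]] := cd.
  set la := size (compc a _) => /code_at_cons[e0 /code_at_cons[e1 cb]].
  have [m1 [r1 v1 g1]] := expr_ok _ _ _ _ _ oe (oked _ oe) rl bd ce.
  have rl1 := rel_agree rl g1; have := okeB _ oe => oB.
  rewrite !size_cat /= size_cat /= -/la.
  set lb := size (compc b _) in e1 *.
  have j1 := runs_jz m1 ej; rewrite v1 in j1.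
  move: h => /=; case Ee: (ev s e) => [|z] h; rewrite Ee /= in j1.
    have cb' : code_at (pc + size (comp e 0) + 1 + la + 2) (compc b (pc + size (comp e 0) + 1 + la + 2)).
      by move: cb; congr (code_at _ _); lia.
    have [s2 [m2 [t2 [k2 [r2 rl2 bd2 h2 le2]]]]] := IHb _ _ _ _ wb rl1 bd h cb'.
    exists s2, m2, (size (comp e 0) + 1 + t2), k2.+1; split=> //; last by rewrite mulnS; lia.
    have -> : pc + (size (comp e 0) + (la + lb.+2).+1) = pc + size (comp e 0) + 1 + la + 2 + lb by lia.
    exact: runs_trans (runs_trans r1 j1) r2.
  have [s2 [m2 [t2 [k2 [r2 rl2 bd2 h2 le2]]]]] := IHa _ _ _ _ wa rl1 bd h ca.
  have w0 : 0 < 2 ^ w by rewrite expn_gt0.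
  have r3 : runs ((pc + size (comp e 0)).+1 + la) m2 1 ((pc + size (comp e 0)).+1 + la).+1 (upd m2 (nv + 0) 0).
    by apply: runs_write; rewrite ?e0.
  have r4 := runs_jz (upd m2 (nv + 0) 0) e1; rewrite upd_same eqxx in r4.
  exists s2, (upd m2 (nv + 0) 0), (size (comp e 0) + 1 + t2 + 1 + 1), k2.+1; split=> //.
  + have -> : pc + (size (comp e 0) + (la + lb.+2).+1) = pc + size (comp e 0) + 1 + la + 2 + lb by lia.
    exact: runs_trans (runs_trans (runs_trans (runs_trans r1 j1) r2) r3) r4.
  + by apply: rel_agree rl2 _; apply: (@agree_upd 0).
  + by rewrite mulnS; lia.
- case/andP: wf => oe wb; rewrite wp_while => -[n h] cd.
  have {cd} /= /code_at_cat[ce /code_at_cons[ej /code_at_cat[cb]]] := cd.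
  set lb := size (compc b _) in ej * => /code_at_cons[e0 /code_at_cons[e1 _]].
  rewrite !size_cat /= size_cat /= -/lb.
  have w0 : 0 < 2 ^ w by rewrite expn_gt0.
  have oB := okeB _ oe.
  elim: n s m Q rl bd h => [|n IH] s m Q rl bd /= [hc h].
    have [m1 [r1 v1 g1]] := expr_ok _ _ _ _ _ oe (oked _ oe) rl bd ce.
    have j1 := runs_jz m1 ej; rewrite v1 hc eqxx in j1.
    exists s, m1, (size (comp e 0) + 1), 1; split=> //; last by lia.
      have -> : pc + (size (comp e 0) + (lb + 2).+1) = pc + size (comp e 0) + 1 + lb + 2 by lia.
      exact: runs_trans r1 j1.
    exact: rel_agree rl g1.
  have [m1 [r1 v1 g1]] := expr_ok _ _ _ _ _ oe (oked _ oe) rl bd ce.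
  have j1 := runs_jz m1 ej; rewrite v1 in j1.
  have {}j1 : runs (pc + size (comp e 0)) m1 1 (pc + size (comp e 0)).+1 m1.
    by move: j1; case: eqP hc.
  have [s2 [m2 [t2 [k2 [r2 rl2 bd2 h2 le2]]]]] := IHb _ _ _ _ wb (rel_agree rl g1) bd h cb.
  have r3 : runs ((pc + size (comp e 0)).+1 + lb) m2 1 ((pc + size (comp e 0)).+1 + lb).+1 (upd m2 (nv + 0) 0).
    by apply: runs_write; rewrite ?e0.
  have r4 := runs_jz (upd m2 (nv + 0) 0) e1; rewrite upd_same eqxx in r4.
  have rl3 : rel s2 (upd m2 (nv + 0) 0) by apply: rel_agree rl2 _; apply: (@agree_upd 0).
  have [s4 [m4 [t4 [k4 [r5 rl4 bd4 h4 le4]]]]] := IH _ _ _ rl3 bd2 h2.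
  exists s4, m4, (size (comp e 0) + 1 + t2 + 1 + 1 + t4), (k2 + k4).+1; split=> //.
    exact: runs_trans (runs_trans (runs_trans (runs_trans (runs_trans r1 j1) r2) r3) r4) r5.
  by rewrite mulnS mulnDr; lia.
Qed.

End Compile.

(* Program notation and derived proof rules *)
Declare Scope prog_scope.
Delimit Scope prog_scope with P.
Coercion Cst : nat >-> expr.
Notation "# x" := (Var x) (at level 2, x at level 1, format "# x") : prog_scope.
Notation "a [+] b" := (Bin OAdd a b) (at level 50, left associativity) : prog_scope.
Notation "a [-] b" := (Bin OSub a b) (at level 50, left associativity) : prog_scope.
Notation "a [*] b" := (Bin OMul a b) (at level 40, left associativity) : prog_scope.
Notation "a [/] b" := (Bin ODiv a b) (at level 40, left associativity) : prog_scope.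
Notation "a [%] b" := (Bin OMod a b) (at level 40, left associativity) : prog_scope.
Notation "a [<] b" := (Bin OLt a b) (at level 70) : prog_scope.
Notation "a [=] b" := (Bin OEq a b) (at level 70) : prog_scope.
Notation "j @ e" := (Ld (Cst j) e) (at level 30, e at level 2) : prog_scope.
Notation "x ::= e" := (Asg x e) (at level 75) : prog_scope.
Notation "j @@ e ::= e'" := (St j e e') (at level 75, e at level 2) : prog_scope.
Notation "a ;; b" := (Seq a b) (at level 80, right associativity) : prog_scope.
Notation "'IF' e 'THEN' a 'ELSE' b 'FI'" := (If e a b) (at level 79, e at level 75, a at level 80, b at level 80) : prog_scope.
Notation "'WHILE' e 'DO' a 'OD'" := (While e a) (at level 79, e at level 75, a at level 80) : prog_scope.
Notation "'FOR' x 'TO' e 'DO' a 'OD'" :=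
  (Seq (Asg x (Cst 0)) (While (Bin OLt (Var x) e) (Seq a (Asg x (Bin OAdd (Var x) (Cst 1))))))
  (at level 79, x at level 1, e at level 75, a at level 80) : prog_scope.
Open Scope prog_scope.

Arguments wp : simpl never.
Arguments modv : simpl nomatch.

Lemma nz (b : bool) : b -> (b : nat) <> 0. Proof. by case: b. Qed.
Lemma zb (b : bool) : ~~ b -> (b : nat) = 0. Proof. by case: b. Qed.
Lemma nzE (b : bool) : (b : nat) <> 0 -> b. Proof. by case: b. Qed.
Lemma zbE (b : bool) : (b : nat) = 0 -> ~~ b. Proof. by case: b. Qed.

Section Rules.
Variable V : nat.
Local Notation wp := (wp V).

Lemma wp_seqE a b s Q :
  wp (a ;; b) s Q = wp a s (fun s1 t1 => wp b s1 (fun s2 t2 => Q s2 (t1 + t2))).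
Proof. by []. Qed.

Lemma wp_seq a b s (R : state -> nat -> Prop) Q : wp a s R ->
  (forall s' t, R s' t -> frame a s s' -> wp b s' (fun s2 t2 => Q s2 (t + t2))) ->
  wp (a ;; b) s Q.
Proof. by move=> h1 h2; rewrite wp_seqE; apply: wp_mono (wp_frame h1) => s' t [/h2]. Qed.

Lemma wp_assoc a b c s Q : wp (a ;; (b ;; c)) s Q -> wp ((a ;; b) ;; c) s Q.
Proof.
rewrite !wp_seqE => h; apply: wp_mono h => s1 t1; rewrite wp_seqE.
by apply: wp_mono => s2 t2; apply: wp_mono => s3 t3; rewrite addnA.
Qed.

Lemma wp_asg x e s Q : ev s e < V -> Q (setv s x (ev s e)) 1 -> wp (x ::= e) s Q.
Proof. by []. Qed.

Lemma wp_st j e1 e2 s Q : ev s e2 < V -> Q (seta s j (ev s e1) (ev s e2)) 1 -> wp (j @@ e1 ::= e2) s Q.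
Proof. by []. Qed.

Lemma wp_asgS x e c s (Q : state -> nat -> Prop) : ev s e < V ->
  wp c (setv s x (ev s e)) (fun s2 t2 => Q s2 t2.+1) -> wp (x ::= e ;; c) s Q.
Proof. by []. Qed.

Lemma wp_stS j e1 e2 c s (Q : state -> nat -> Prop) : ev s e2 < V ->
  wp c (seta s j (ev s e1) (ev s e2)) (fun s2 t2 => Q s2 t2.+1) -> wp (j @@ e1 ::= e2 ;; c) s Q.
Proof. by []. Qed.

Lemma wp_if e a b s (Q : state -> nat -> Prop) :
  (ev s e <> 0 -> wp a s (fun s' t => Q s' t.+1)) ->
  (ev s e = 0 -> wp b s (fun s' t => Q s' t.+1)) -> wp (IF e THEN a ELSE b FI) s Q.
Proof.
change (wp (IF e THEN a ELSE b FI) s Q) with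
  (if ev s e is 0 then wp b s (fun s' t => Q s' t.+1) else wp a s (fun s' t => Q s' t.+1)).
by case: (ev s e) => [_|n +  _]; apply.
Qed.

Lemma wp_ifS e a b c s (Q : state -> nat -> Prop) :
  (ev s e <> 0 -> wp (a ;; c) s (fun s' t => Q s' t.+1)) ->
  (ev s e = 0 -> wp (b ;; c) s (fun s' t => Q s' t.+1)) -> wp (IF e THEN a ELSE b FI ;; c) s Q.
Proof.
move=> h1 h2; rewrite wp_seqE.
by apply: wp_if => [/h1|/h2]; rewrite wp_seqE; apply: wp_mono => s1 t1; apply: wp_mono.
Qed.

Lemma wp_skipS c s Q : wp c s Q -> wp (Skip ;; c) s Q.
Proof. by move=> h; apply: wp_mono h. Qed.

Lemma wp_skip s (Q : state -> nat -> Prop) : Q s 0 -> wp Skip s Q.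
Proof. by []. Qed.

(** The bound [y] is evaluated afresh in each round, so it has to be constant on all states that the
    loop can reach; [frame] describes these states. *)
Lemma wp_for x y c s n (I : nat -> state -> nat -> Prop) (Q : state -> nat -> Prop) :
  modv c x = false -> n < V ->
  (forall s', frame (FOR x TO y DO c OD) s s' -> ev s' y = n) ->
  I 0 (setv s x 0) 0 ->
  (forall i s' t, i < n -> I i s' t -> va s' x = i -> frame (FOR x TO y DO c OD) s s' ->
     wp c s' (fun s2 t2 => I i.+1 (setv s2 x i.+1) (t + t2).+2)) ->
  (forall s' t, I n s' t -> va s' x = n -> frame (FOR x TO y DO c OD) s s' -> Q s' t.+2) ->
  wp (FOR x TO y DO c OD) s Q.
Proof.
move=> xc nV Hy I0 Is Ie.
have fr s' : frame (c ;; x ::= #x [+] 1) (setv s x 0) s' -> frame (FOR x TO y DO c OD) s s'.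
  case=> fv fa; split=> [z|j] /= h; last by apply: fa.
  by rewrite fv /=; case: eqn h => //= ->.
apply: wp_asgS; first exact: leq_ltn_trans (leq0n n) nV.
apply: (@wp_loop V _ _ _ n (fun i s' t => I i s' t /\ va s' x = i)) => //.
- by split=> //=; rewrite eqnE eqxx.
- move=> i s' t lt [h hx] /fr f; split; first by rewrite /= (Hy _ f) hx lt.
  apply: wp_mono (wp_frame (Is _ _ _ lt h hx f)) => s2 t2 [h2 [fv _]].
  have Ex : va s2 x = i by rewrite fv.
  rewrite /= Ex !addn1 addnS; split; first exact: leq_ltn_trans lt nV.
  by split=> //; rewrite eqnE eqxx.
- move=> s' t [h hx] /fr f; split; first by rewrite /= (Hy _ f) hx ltnn.
  exact: Ie.
Qed.

Lemma wp_whl e c s n (I : nat -> state -> nat -> Prop) (Q : state -> nat -> Prop) :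
  I 0 s 0 ->
  (forall i s' t, i < n -> I i s' t -> frame c s s' ->
     ev s' e <> 0 /\ wp c s' (fun s2 t2 => I i.+1 s2 (t + t2).+1)) ->
  (forall s' t, I n s' t -> frame c s s' -> ev s' e = 0 /\ Q s' t.+1) ->
  wp (WHILE e DO c OD) s Q.
Proof. exact: wp_loop. Qed.

End Rules.

Lemma mod16E : ((0 %% 16 = 0) * (1 %% 16 = 1) * (2 %% 16 = 2) * (3 %% 16 = 3) * (4 %% 16 = 4) * (5 %% 16 = 5) * (6 %% 16 = 6) * (7 %% 16 = 7) * (8 %% 16 = 8) * (9 %% 16 = 9) * (10 %% 16 = 10) * (11 %% 16 = 11) * (12 %% 16 = 12) * (13 %% 16 = 13) * (14 %% 16 = 14) * (15 %% 16 = 15))%type.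
Proof. by []. Qed.

(* one symbolic execution step; bounds are left as goals *)
Ltac step := repeat apply: wp_assoc; first
  [ apply: wp_asgS | apply: wp_stS | apply: wp_ifS | apply: wp_skipS | apply: wp_asg
  | apply: wp_st | apply: wp_if | apply: wp_skip ]; rewrite /= ?mod16E.

(** * Monotone minima *)

Section Monge.
Variables (N Z : nat) (col G : nat -> nat).
Hypothesis NZ : N <= Z.
Hypothesis convex : forall j, 2 * G j.+1 <= G j + G j.+2.

(** The offset [Z >= N] keeps [Z + i - k] away from truncation for all rows and columns below
    [N]. *)
Definition mcost i k := col k + G (Z + i - k).

(** The leftmost minimiser. Fixing the choice among ties makes the positions of the optima monotone
    in the row. *)
Definition isopt i k := [/\ k < N, forall k', k' < N -> mcost i k <= mcost i k' &
  forall k', k' < k -> mcost i k < mcost i k'].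

Lemma convex_step p d : G p.+1 + G (p + d) <= G p + G (p + d).+1.
Proof.
elim: d => [|d IH]; first by rewrite addn0 addnC.
have := convex (p + d); rewrite addnS; lia.
Qed.

Lemma convex_monge p q d : p <= q -> G (p + d) + G q <= G p + G (q + d).
Proof.
move=> pq; elim: d => [|d IH]; first by rewrite !addn0.
have := convex_step (p + d) (q - p); have -> : p + d + (q - p) = q + d by lia.
rewrite !addnS; lia.
Qed.

(** Convexity of [G] makes [mcost] a Monge array: if row [i] strictly prefers [k] to an earlier
    [k'], then so does every later row. *)
Lemma isopt_mono i i' k k' : i <= i' -> isopt i k -> isopt i' k' -> k <= k'.
Proof.
move=> ii [kN kmin klt] [k'N k'min k'lt]; rewrite leqNgt; apply/negP => lt.
have := klt _ lt; have := k'min _ kN.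
have := @convex_monge (Z + i - k) (Z + i' - k) (k - k').
have -> : Z + i - k + (k - k') = Z + i - k' by lia.
have -> : Z + i' - k + (k - k') = Z + i' - k' by lia.
rewrite /mcost => /(_ ltac:(lia)); lia.
Qed.

Lemma isopt_exists i : 0 < N -> exists k, isopt i k.
Proof.
move=> N0; have [k _ kmin] := @arg_minnP _ (Ordinal N0) xpredT (fun k : 'I_N => mcost i k) isT.
have ex : exists k', (k' < N) && (mcost i k' <= mcost i k) by exists k; rewrite ltn_ord leqnn.
exists (ex_minn ex); case: ex_minnP => k0 /andP[k0N le0] min0; split=> //.
  by move=> k' k'N; apply: leq_trans le0 (kmin (Ordinal k'N) isT).
move=> k' lt; rewrite ltnNge; apply/negP => le.
have := min0 k'; rewrite (ltn_trans lt k0N) (leq_trans le le0) => /(_ isT); lia.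
Qed.

End Monge.

Notation aCol := 12. Notation aG := 13. Notation aOpt := 14. Notation aNd := 15.
Notation vN := 35. Notation vZ := 38. Notation vRow := 39. Notation vK := 40. Notation vHi := 41.
Notation vBest := 42. Notation vBK := 43. Notation vLo := 44. Notation vSt := 37. Notation vT := 6.

Definition scanrow : cmd :=
  vBest ::= (aCol @ (#vLo)) [+] (aG @ (#vZ [+] #vRow [-] #vLo)) ;;
  vBK ::= #vLo ;;
  vK ::= #vLo [+] 1 ;;
  WHILE #vK [<] (#vHi [+] 1) DO
    vT ::= (aCol @ (#vK)) [+] (aG @ (#vZ [+] #vRow [-] #vK)) ;;
    IF #vT [<] #vBest THEN vBest ::= #vT ;; vBK ::= #vK ELSE Skip FI ;;
    vK ::= #vK [+] 1
  OD ;;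
  aOpt @@ (#vRow) ::= #vBK ;;
  aNd @@ (#vRow) ::= #vBest.

(** Treats the rows at odd multiples of [vSt]. The optima of the two neighbouring even multiples are
    known and delimit the search. *)
Definition monorows : cmd :=
  vRow ::= #vSt ;;
  WHILE #vRow [<] #vN DO
    vLo ::= aOpt @ (#vRow [-] #vSt) ;;
    IF #vRow [+] #vSt [<] #vN THEN vHi ::= aOpt @ (#vRow [+] #vSt) ELSE vHi ::= #vN [-] 1 FI ;;
    scanrow ;;
    vRow ::= #vRow [+] 2 [*] #vSt
  OD.

Definition mono : cmd :=
  vRow ::= 0 ;; vLo ::= 0 ;; vHi ::= #vN [-] 1 ;; scanrow ;;
  vSt ::= 1 ;; WHILE #vSt [<] #vN DO vSt ::= #vSt [*] 2 OD ;;
  WHILE 0 [<] #vSt DO monorows ;; vSt ::= #vSt [/] 2 OD.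

Section Mono.
Variables (V N Z : nat) (col G : nat -> nat).
Hypothesis NZ : N <= Z.
Hypothesis N0 : 0 < N.
Hypothesis convex : forall j, 2 * G j.+1 <= G j + G j.+2.
Hypothesis costV : forall i k, i < N -> k < N -> mcost Z col G i k < V.
Hypothesis sizeV : 4 * Z < V.

Local Notation isopt := (isopt N Z col G).
Local Notation mcost := (mcost Z col G).

Definition mono_pre s := [/\ va s vN = N, va s vZ = Z, forall k, k < N -> ar s aCol k = col k &
  forall j, j < 2 * Z -> ar s aG j = G j].

Lemma mono_preE s i k : mono_pre s -> i < N -> k < N ->
  ar s aCol k + ar s aG (va s vZ + i - k) = mcost i k.
Proof. by case=> _ -> Ec EG iN kN; rewrite Ec ?EG //; lia. Qed.

Lemma scanrow_ok s i lo hi o : mono_pre s -> va s vRow = i -> va s vLo = lo -> va s vHi = hi ->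
  i < N -> isopt i o -> lo <= o <= hi -> hi < N ->
  wp V scanrow s (fun s' t => t <= 6 * (hi - lo) + 10 /\
    (forall i', ar s' aOpt i' = if i' == i then o else ar s aOpt i') /\
    (forall i', ar s' aNd i' = if i' == i then mcost i o else ar s aNd i')).
Proof.
move=> pre Ei El Eh iN [oN omin olt] /andP[lo_o o_hi] hiN.
have loN : lo < N by lia.
have [EN EZ _ _] := pre; have E0 := mono_preE pre iN loN.
rewrite /scanrow; step; first by rewrite Ei El E0; apply: costV.
step; first by rewrite El; lia.
step; first by rewrite El; lia.
apply: (@wp_seq _ _ _ _ (fun s' t => [/\ va s' vBK = o, va s' vBest = mcost i o & t <= 6 * (hi - lo) + 1])).
  apply: (@wp_whl _ _ _ _ (hi - lo) (fun j s' t => [/\ va s' vK = lo + j.+1,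
     va s' vBest = mcost i (va s' vBK), lo <= va s' vBK < lo + j.+1 &
     [/\ (forall k, lo <= k < lo + j.+1 -> mcost i (va s' vBK) <= mcost i k),
     (forall k, lo <= k < va s' vBK -> mcost i (va s' vBK) < mcost i k) &
     t <= 6 * j]])).
  - rewrite /= Ei El E0 ?addn1; split=> //; [by lia | split=> //].
    + by move=> k hk; have -> : k = lo by lia.
    + by move=> k hk; lia.
  - move=> j s' t jlt [EK EB bk [bmin blt tle]] [fv fa].
    have Eh' : va s' vHi = hi by rewrite fv.
    have Ei' : va s' vRow = i by rewrite fv.
    have pre' : mono_pre s'.
      case: pre => h1 h2 h3 h4; split; rewrite ?fv // => z hz; rewrite fa //=.
        exact: h3.
      exact: h4.
    split; first by rewrite /= EK Eh'; apply: nz; lia.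
    have kN : lo + j.+1 < N by lia.
    have E1 := mono_preE pre' iN kN.
    step; first by rewrite EK Ei' E1; apply: costV.
    rewrite EK Ei' E1; step => [/nzE cnd|/zbE cnd].
      step; first by apply: costV.
      step; first by rewrite EK; lia.
      step; first by rewrite EK; lia.
      rewrite EK; split=> //=; [by lia | by lia | split; last by lia].
      + move=> k hk; have [lt|ge] := ltnP k (lo + j.+1); last by have -> : k = lo + j.+1 by lia.
        have hk' : lo <= k < lo + j.+1 by lia.
        by have := bmin k hk'; lia.
      + by move=> k hk; have := bmin k hk; lia.
    step; step; first by rewrite EK; lia.
    rewrite EK; split=> //=; [by lia | by lia | split=> //; last by lia].
    move=> k hk; have [lt|ge] := ltnP k (lo + j.+1); first by apply: bmin; lia.
    have -> : k = lo + j.+1 by lia.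
    by lia.
  - move=> s' t [EK EB bk [bmin blt tle]] [fv fa]; split; first by rewrite /= EK fv //= Eh; apply: zb; lia.
    have Eo : va s' vBK = o.
      case: (ltngtP (va s' vBK) o) => // lt.
        have ho : lo <= o < lo + (hi - lo).+1 by lia.
        by have := olt _ lt; have := bmin o ho; lia.
      have ho : lo <= o < va s' vBK by lia.
      have hB : va s' vBK < N by lia.
      by have := blt o ho; have := omin _ hB; lia.
    by rewrite -Eo; split=> //; lia.
move=> s' t [EB Eb tle] [fv fa].
have Ei' : va s' vRow = i by rewrite fv.
step; first by rewrite EB; lia.
step; first by rewrite Eb; apply: costV.
rewrite Ei' EB Eb; split; first by lia.
by split=> i'; rewrite fa.
Qed.

Lemma mono_pre_frame c s s' : mono_pre s -> frame c s s' -> modv c vN = false -> modv c vZ = false ->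
  moda c aCol = false -> moda c aG = false -> mono_pre s'.
Proof.
move=> [h1 h2 h3 h4] [fv fa] m1 m2 m3 m4.
by split; rewrite ?fv ?fa.
Qed.

Definition rows_done s st := forall i, i < N -> st %| i ->
  isopt i (ar s aOpt i) /\ ar s aNd i = mcost i (ar s aOpt i).

Lemma monorows_ok s st : mono_pre s -> va s vSt = st -> 0 < st -> st <= 2 * N -> rows_done s (2 * st) ->
  wp V monorows s (fun s' t => t <= 30 * (N + 1) /\ rows_done s' st).
Proof.
move=> pre Est st0 stN dn; rewrite /monorows; step; first by rewrite Est; lia.
(* The number of odd multiples of [st] below [N]. *)
pose Q := (N - st + (2 * st).-1) %/ (2 * st).
have HQ q : (q < Q) = (st * (2 * q + 1) < N).
  rewrite /Q leq_divRL ?muln_gt0 //; apply/idP/idP; lia.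
have QN : Q <= N.
  rewrite leqNgt; apply/negP; rewrite HQ => h; have : N * 1 <= N * st by rewrite leq_mul2l st0 orbT.
  by lia.
(* The search costs telescope: what has been spent is bounded by the position of the optimum in the
   last even row, up to a constant per row. Past the last row that position is replaced by [N]. *)
apply: (@wp_whl _ _ _ _ Q (fun q s' t => [/\ va s' vRow = st * (2 * q + 1), rows_done s' (2 * st),
   (forall q', q' < q -> isopt (st * (2 * q' + 1)) (ar s' aOpt (st * (2 * q' + 1))) /\
      ar s' aNd (st * (2 * q' + 1)) = mcost (st * (2 * q' + 1)) (ar s' aOpt (st * (2 * q' + 1)))) &
   t <= 20 * q + 6 * (if st * (2 * q) < N then ar s' aOpt (st * (2 * q)) else N)])).
- by split=> //=; rewrite Est; lia.
- move=> q s' t; rewrite HQ => lt [Er dn' odd' tle] f.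
  have pre' : mono_pre s' by apply: mono_pre_frame f _ _ _ _.
  have [EN EZ _ _] := pre'; have [fv fa] := f.
  have Est' : va s' vSt = st by rewrite fv.
  split; first by rewrite /= Er EN; apply: nz.
  have lt0 : st * (2 * q) < N by lia.
  rewrite lt0 in tle.
  have e1 : st * (2 * q + 1) - st = st * (2 * q) by lia.
  have e2 : st * (2 * q + 1) + st = st * (2 * q.+1) by lia.
  have [|opt1 nd1] := dn' _ lt0; first by rewrite mulnA dvdn_mulr // mulnC.
  have [l1N _ _] := opt1.
  step; first by rewrite Er Est' e1; lia.
  rewrite Er Est' e1; set lo := ar s' 14 (st * (2 * q)) in opt1 tle l1N *.
  have [o oopt] := isopt_exists col G NZ (st * (2 * q + 1)) N0.
  have loo : lo <= o by apply: (isopt_mono NZ convex _ opt1 oopt); lia.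
  have main hi s1 (Q' : state -> nat -> Prop) : mono_pre s1 -> va s1 vRow = st * (2 * q + 1) ->
      va s1 vLo = lo -> va s1 vHi = hi -> va s1 vSt = st -> ar s1 aOpt = ar s' aOpt -> ar s1 aNd = ar s' aNd ->
      o <= hi < N -> (st * (2 * q.+1) < N -> ar s' aOpt (st * (2 * q.+1)) = hi) ->
      (forall s2 t2, t2 <= 6 * (hi - lo) + 11 -> va s2 vRow = st * (2 * q.+1 + 1) ->
        rows_done s2 (2 * st) ->
        (forall q', q' < q.+1 -> isopt (st * (2 * q' + 1)) (ar s2 aOpt (st * (2 * q' + 1))) /\
          ar s2 aNd (st * (2 * q' + 1)) = mcost (st * (2 * q' + 1)) (ar s2 aOpt (st * (2 * q' + 1)))) ->
        (st * (2 * q.+1) < N -> ar s2 aOpt (st * (2 * q.+1)) = hi) -> Q' s2 t2) ->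
      wp V (scanrow ;; vRow ::= #vRow [+] 2 [*] #vSt) s1 Q'.
    move=> p1 r1 l1 h1 st1 o1 n1 /andP[oh hN] Ehi HQ'.
    have ok := scanrow_ok p1 r1 l1 h1 lt oopt _ hN.
    apply: wp_seq (ok _) _; first by rewrite loo oh.
    move=> s2 t2 [t2le [Eo En]] [fv2 fa2].
    have r2 : va s2 vRow = st * (2 * q + 1) by rewrite fv2.
    have st2 : va s2 vSt = st by rewrite fv2.
    step; first by rewrite r2 st2; lia.
    rewrite r2 st2; apply: HQ' => //=; first by lia.
    + by lia.
    + move=> i iN di /=; rewrite Eo En o1 n1; case: eqP => [E|_]; last exact: dn'.
      case/dvdnP: di => z Ez; move: E; rewrite Ez => E; exfalso.
      have {}E : st * (2 * z) = st * (2 * q + 1) by lia.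
      by move/eqP: E; rewrite eqn_pmul2l // => /eqP; lia.
    + move=> q' q'q; rewrite Eo En o1 n1 eqn_pmul2l //.
      case: eqP => [E|ne]; first by have -> : q' = q by lia.
      by apply: odd'; lia.
    + move=> h; rewrite Eo o1 eqn_pmul2l //; case: eqP => [|_]; [by lia | exact: Ehi].
  step => [/nzE|/zbE]; rewrite Er EN Est' e2 => cnd.
    have [|opt2 nd2] := dn' _ cnd; first by rewrite mulnA dvdn_mulr // mulnC.
    have [l2N _ _] := opt2.
    step; first by rewrite Er Est' e2; lia.
    rewrite Er Est' e2; apply: (main (ar s' aOpt (st * (2 * q.+1)))) => //.
      by rewrite l2N andbT; apply: (isopt_mono NZ convex _ oopt opt2); lia.
    move=> s2 t2 t2le r2 d2 od2 Eh2; split=> //.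
    by rewrite cnd Eh2 //; have := isopt_mono NZ convex _ opt1 opt2; rewrite leq_mul2l; lia.
  step; first by rewrite EN; lia.
  rewrite EN; apply: (main (N - 1)) => //.
  - by case: oopt => oN _ _; lia.
  - by move=> h; rewrite h in cnd.
  - move=> s2 t2 t2le r2 d2 od2 Eh2; split=> //.
    by rewrite (negbTE cnd); lia.
- move=> s' t [Er dn' odd' tle] f; have [fv fa] := f.
  have EN : va s' vN = N by case: pre => EN _ _ _; rewrite fv.
  split; first by rewrite /= Er EN -HQ ltnn.
  split.
    have : (if st * (2 * Q) < N then ar s' aOpt (st * (2 * Q)) else N) <= N.
      by case: ifP => // h; have [|[h1 _ _] _] := dn' _ h; [rewrite mulnA dvdn_mulr // mulnC | apply: ltnW].
    by lia.
  move=> i iN /dvdnP[z Ez]; have := odd_double_half z; case: (odd z) => /= E.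
    have -> : i = st * (2 * z./2 + 1) by rewrite Ez; lia.
    by apply: odd'; rewrite HQ; have <- : i = st * (2 * z./2 + 1) by rewrite Ez; lia.
  by apply: dn' => //; apply/dvdnP; exists z./2; rewrite Ez; lia.
Qed.

Lemma mono_ok s E : mono_pre s -> N <= 2 ^ E -> wp V mono s (fun s' t =>
  t <= 40 * (E + 2) * (N + 1) /\
  forall i, i < N -> ar s' aNd i < V /\ (exists2 k, k < N & ar s' aNd i = mcost i k) /\
    forall k, k < N -> ar s' aNd i <= mcost i k).
Proof.
move=> pre NE; rewrite /mono; have [EN EZ Ec EG] := pre.
step; first by lia.
step; first by lia.
step; first by rewrite EN; lia.
rewrite EN.
have [o oopt] := isopt_exists col G NZ 0 N0.
set s1 := setv _ vHi _.
have pre1 : mono_pre s1 by [].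
have [oN _ _] := oopt.
apply: wp_seq (scanrow_ok pre1 erefl erefl erefl N0 oopt _ _) _ => /=; [by lia | by lia |].
move=> s2 t2 [t2le [Eo En]] f2; have [fv2 fa2] := f2.
have pre2 : mono_pre s2 by apply: mono_pre_frame f2 _ _ _ _.
have ex : exists e, N <= 2 ^ e by exists E.
case: (ex_minnP ex) => e Ne emin.
have eE : e <= E by apply: emin.
have e2N : 2 ^ e < 2 * N.
  case: (posnP e) => [->|e0]; first by rewrite expn0; lia.
  have : ~~ (N <= 2 ^ e.-1) by apply/negP => /emin; lia.
  by rewrite -{2}(prednK e0) expnS; lia.
step; first by lia.
apply: (@wp_seq _ _ _ _ (fun s' t => va s' vSt = 2 ^ e /\ t <= 2 * e + 1)).
  apply: (@wp_whl _ _ _ _ e (fun j s' t => va s' vSt = 2 ^ j /\ t <= 2 * j)) => //.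
  - move=> j s' t je [Es tle] [fv fa].
    have EN' : va s' vN = N by rewrite fv //=; case: pre2.
    split.
      rewrite /= Es EN'; apply: nz; rewrite ltnNge; apply/negP => /emin; lia.
    step; rewrite Es.
      have : 2 ^ j.+1 <= 2 ^ e by rewrite leq_exp2l.
      by rewrite expnS; lia.
    by rewrite expnS; split; lia.
  - move=> s' t [Es tle] [fv fa].
    have EN' : va s' vN = N by rewrite fv //=; case: pre2.
    split; first by rewrite /= Es EN' ltnNge Ne.
    by split=> //; lia.
move=> s3 t3 [Es3 t3le] f3; have [fv3 fa3] := f3.
have pre2' : mono_pre (setv s2 vSt 1) by case: pre2 => *; split.
have pre3 : mono_pre s3.
  by apply: (mono_pre_frame pre2' f3).
(* As [N <= 2 ^ e], row [0] is the only multiple of [2 ^ e.+1], and it has just been scanned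
   completely. *)
have dn3 : rows_done s3 (2 ^ e.+1).
  move=> i iN di; have i0 : i = 0.
    by case: (posnP i) => // ip; have := dvdn_leq ip di; rewrite expnS; lia.
  by rewrite !fa3 //= Eo En i0 eqxx.
apply: (@wp_whl _ _ _ _ e.+1 (fun j s' t => [/\ va s' vSt = (if j <= e then 2 ^ (e - j) else 0),
   rows_done s' (2 ^ (e.+1 - j)) & t <= (30 * (N + 1) + 4) * j])).
- by rewrite /= subn0; split.
- move=> j s' t je [Es dn' tle] f; have [fv fa] := f.
  rewrite ltnS in je; rewrite je in Es.
  have pre' : mono_pre s' by apply: (mono_pre_frame pre3 f).
  split; first by rewrite /= Es; apply: nz; rewrite expn_gt0.
  have ej : e.+1 - j = (e - j).+1 by lia.
  rewrite ej expnS in dn'.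
  have pb : 2 ^ (e - j) <= 2 ^ e by rewrite leq_exp2l //; lia.
  apply: wp_seq (monorows_ok pre' Es _ _ dn') _; rewrite ?expn_gt0 //; first by lia.
  move=> s4 t4 [t4le dn4] [fv4 fa4].
  have Es4 : va s4 vSt = 2 ^ (e - j) by rewrite fv4.
  step; first by rewrite Es4; apply: leq_ltn_trans (leq_div _ _) _; lia.
  rewrite Es4; split=> //; last by rewrite mulnS; lia.
  case: ltngtP je => // [lt _|<- _]; last by rewrite subnn.
  have -> : e - j = (e - j.+1).+1 by lia.
  by rewrite expnS mulKn.
- move=> s' t [Es dn' tle] f; rewrite ltnn in Es; rewrite subnn in dn'.
  split; first by rewrite /= Es.
  split.
    have : (30 * (N + 1) + 4) * e.+1 <= (30 * (N + 1) + 4) * E.+1 by rewrite leq_mul2l ltnS eE orbT.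
    by lia.
  move=> i iN; have [|opt nd] := dn' i iN; first by rewrite dvd1n.
  have [oN' omin _] := opt; rewrite nd; split; first exact: costV.
  by split=> //; exists (ar s' aOpt i).
Qed.

End Mono.

(** * Adding one class to the dynamic program *)

Notation aPS := 10. Notation aDp := 11.
Notation vJ := 5. Notation vInf := 25. Notation vOm := 26. Notation vA := 30. Notation vWb := 31.
Notation vS := 32. Notation vCn := 33. Notation vCc := 34. Notation vRho := 36. Notation vB0 := 45.

(* Multiplicities outside [0, vCn] are penalised with slope vInf, which keeps the class cost convex
   so that the (min,+) convolution can use monotone minima. *)
Definition fillG : cmd :=
  FOR vJ TO #vZ [*] 2 DO
    IF (#vCc [+] #vJ) [<] #vZ THEN aG @@ (#vJ) ::= #vInf [*] (#vZ [-] (#vCc [+] #vJ))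
    ELSE 7 ::= #vCc [+] #vJ [-] #vZ ;;
      IF #vCn [<] #7 THEN
        aG @@ (#vJ) ::= aPS @ (#vS [+] #vCn) [-] aPS @ (#vS) [+] #vInf [*] (#7 [-] #vCn)
      ELSE aG @@ (#vJ) ::= aPS @ (#vS [+] #7) [-] aPS @ (#vS) FI FI
  OD.

(** Taking items of size [a] moves a table index within its residue class modulo [a]. Along one
    class, with columns as old and rows as new indices, the update is a row-minimum problem for
    [mcost]. Rows are written back only after all minima are known, capped at [vInf]. *)
Definition residue : cmd :=
  vN ::= (#vWb [*] 2 [-] #vRho) [/] #vA [+] 1 ;;
  8 ::= #vB0 [+] #vRho ;;
  FOR vJ TO #vN DO aCol @@ (#vJ) ::= aDp @ (#8 [+] #vA [*] #vJ) OD ;;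
  mono ;;
  FOR vJ TO #vN DO
    IF aNd @ (#vJ) [<] #vInf THEN aDp @@ (#8 [+] #vA [*] #vJ) ::= aNd @ (#vJ)
    ELSE aDp @@ (#8 [+] #vA [*] #vJ) ::= #vInf FI
  OD.

Definition classstep : cmd :=
  vZ ::= (#vWb [*] 2) [/] #vA [+] 1 ;;
  vB0 ::= #vOm [-] #vWb ;;
  fillG ;;
  FOR vRho TO #vA DO residue OD.

Lemma residue_index x Lo a : Lo <= x -> x = Lo + (x - Lo) %% a + a * ((x - Lo) %/ a).
Proof. by move=> h; rewrite -addnA [_ %% a + _]addnC [a * _]mulnC -divn_eq subnKC. Qed.

Section ClassStep.
Variables (V INF a wb OM cn cc E : nat) (P : nat -> nat).
Hypothesis a0 : 0 < a.
Hypothesis awb : a <= wb.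
Hypothesis wbO : wb <= OM.
Hypothesis INF0 : 0 < INF.
Hypothesis ccn : cc <= cn.
Hypothesis P0 : P 0 = 0.
Hypothesis Pinf : forall t, t <= cn -> P t <= INF.
Hypothesis Pmono : forall t, t < cn -> P t <= P t.+1.
Hypothesis Pstep : forall t, t < cn -> P t.+1 <= P t + INF.
Hypothesis Pconv : forall t, t.+2 <= cn -> 2 * P t.+1 <= P t + P t.+2.
Hypothesis HV : INF * (6 * wb + 6) < V.
Hypothesis HV2 : 8 * OM + 8 + 2 * cn < V.
Hypothesis HE : 2 * wb + 1 <= 2 ^ E.

Variables (Z Lo : nat).
Hypothesis EZdef : Z = (wb * 2) %/ a + 1.
Hypothesis ELo : Lo = OM - wb.

(** Argument [j] stands for the multiplicity [cc + j - Z], so that [j = Z] leaves the greedy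
    multiplicity [cc] unchanged. *)
Definition Gf j := if cc + j < Z then INF * (Z - (cc + j)) else
  if cn < cc + j - Z then P cn + INF * (cc + j - Z - cn) else P (cc + j - Z).

(** The slopes are [- INF] below multiplicity [0], then those of [P], nondecreasing and at most
    [INF], then [INF] beyond [cn]. *)
Lemma Gf_convex j : 2 * Gf j.+1 <= Gf j + Gf j.+2.
Proof.
rewrite /Gf; clear -P0 Pstep Pconv; move: Z => z.
have [h1|h1] := ltnP (cc + j) z; last first.
  have -> : (cc + j.+1 < z) = false by lia.
  have -> : (cc + j.+2 < z) = false by lia.
  have e1 : cc + j.+1 - z = (cc + j - z).+1 by lia.
  have e2 : cc + j.+2 - z = (cc + j - z).+2 by lia.
  rewrite e1 e2; set t := cc + j - z.
  have [h2|h2] := ltnP cn t.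
    have -> : (cn < t.+1) by lia.
    have -> : (cn < t.+2) by lia.
    have -> : t.+1 - cn = (t - cn).+1 by lia.
    have -> : t.+2 - cn = (t - cn).+2 by lia.
    by rewrite !mulnS; lia.
  have [h3|h3] := ltnP cn t.+1.
    have -> : (cn < t.+2) by lia.
    have Et : t = cn by lia.
    rewrite Et; have -> : cn.+1 - cn = 1 by lia.
    have -> : cn.+2 - cn = 2 by lia.
    by lia.
  have [h4|h4] := ltnP cn t.+2; last exact: Pconv.
  have Et : cn = t.+1 by lia.
  have -> : t.+2 - cn = 1 by lia.
  have := @Pstep t; rewrite Et ltnSn => /(_ isT); lia.
have [h2|h2] := ltnP (cc + j.+1) z.
  have [h3|h3] := ltnP (cc + j.+2) z.
    have -> : z - (cc + j) = (z - (cc + j.+2)).+2 by lia.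
    have -> : z - (cc + j.+1) = (z - (cc + j.+2)).+1 by lia.
    by rewrite !mulnS; lia.
  have -> : z - (cc + j.+1) = 1 by lia.
  have -> : z - (cc + j) = 2 by lia.
  by lia.
have -> : (cc + j.+2 < z) = false by lia.
have -> : cc + j.+1 - z = 0 by lia.
have -> : cc + j.+2 - z = 1 by lia.
by rewrite ltn0 P0.
Qed.

Lemma Gf_bound j : j <= 2 * Z -> Gf j <= INF * (Z + 1).
Proof.
rewrite /Gf; clear -Pinf ccn; move: Z => z jz.
case: ifP => h1; first by rewrite leq_mul2l; lia.
case: ifP => h2; last first.
  apply: leq_trans (Pinf _) _; first by lia.
  by rewrite leq_pmulr // addn1.
have -> : z + 1 = z.+1 by lia.
by rewrite mulnS leq_add ?Pinf // leq_mul2l; lia.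
Qed.

Definition cls_pre s := [/\ va s vInf = INF, va s vA = a, va s vWb = wb & va s vOm = OM] /\
  [/\ va s vCn = cn, va s vCc = cc & forall t, t <= cn ->
     ar s aPS (va s vS + t) - ar s aPS (va s vS) = P t].

Lemma cls_pre_frame c s s' : cls_pre s -> frame c s s' ->
  modv c vInf = false -> modv c vA = false -> modv c vWb = false -> modv c vOm = false ->
  modv c vCn = false -> modv c vCc = false -> modv c vS = false -> moda c aPS = false -> cls_pre s'.
Proof.
move=> [[h1 h2 h3 h4] [h5 h6 h7]] [fv fa] m1 m2 m3 m4 m5 m6 m7 m8.
by split; split; rewrite ?fv ?fa.
Qed.

Lemma Zle : Z <= 2 * wb + 1.
Proof. by rewrite EZdef leq_add2r; apply: leq_trans (leq_div _ _) _; rewrite mulnC. Qed.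

Lemma Zbnd : INF * (Z + 3) < V.
Proof. by apply: leq_ltn_trans HV; rewrite leq_mul2l; have := Zle; lia. Qed.

Lemma fillG_ok s : cls_pre s -> va s vZ = Z ->
  wp V fillG s (fun s' t => t <= 12 * Z + 2 /\ forall j, j < 2 * Z -> ar s' aG j = Gf j).
Proof.
move=> pre EZ; have zb := Zbnd; have zl := Zle.
have zV : 2 * Z < V by lia.
apply: (@wp_for _ _ _ _ _ (2 * Z) (fun i s' t => t <= 6 * i /\ forall j, j < i -> ar s' aG j = Gf j)) => //.
- by move=> s' [fv fa]; rewrite /= fv //= EZ mulnC.
- move=> i s' t iZ [tle h] Ei f; have [fv fa] := f.
  have EZ' : va s' vZ = Z by rewrite fv.
  have := cls_pre_frame pre f; move/(_ erefl erefl erefl erefl erefl erefl erefl erefl).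
  move=> [[EI Ea Ew EO] [Ecn Ecc EP]].
  have gb := Gf_bound (ltnW iZ).
  have gV : Gf i < V by apply: leq_ltn_trans gb _; apply: leq_ltn_trans zb; rewrite leq_mul2l; lia.
  have fin v : v = Gf i -> forall j, j < i.+1 -> (if j == i then v else ar s' aG j) = Gf j.
    by move=> e2 j ji; case: eqP => [->//|ne]; apply: h; lia.
  have EG : Gf i = if cc + i < Z then INF * (Z - (cc + i)) else
    if cn < cc + i - Z then P cn + INF * (cc + i - Z - cn) else P (cc + i - Z) by [].
  step => [/nzE|/zbE]; rewrite Ecc Ei EZ' => c1.
    rewrite c1 in EG.
    step; first by rewrite EI EZ' Ecc Ei -EG.
    rewrite EI EZ' Ecc Ei; split; first by lia.
    exact: fin.
  rewrite (negbTE c1) in EG.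
  step; first by rewrite Ecc Ei EZ'; lia.
  rewrite Ecc Ei EZ'; step => [/nzE|/zbE]; rewrite Ecn => c2.
    rewrite c2 in EG; have Pc := EP cn (leqnn _).
    step; first by rewrite Ecn EI Pc -EG.
    rewrite Ecn EI Pc Ei; split; first by lia.
    exact: fin.
  rewrite (negbTE c2) in EG; have Pc := EP (cc + i - Z).
  step; first by rewrite Pc ?EG // -?EG //; lia.
  rewrite Pc; last by lia.
  rewrite Ei; split; first by lia.
  exact: fin.
move=> s' t [tle h] _ _; split=> //; lia.
Qed.

Definition inwin x := Lo <= x <= Lo + 2 * wb.

(** A (min,+) convolution restricted to the window and capped: a value of [INF] certifies no choice,
    but the lower bound against all choices still holds. *)
Definition conv_ok (dp : nat -> nat) x v :=
  [/\ v <= INF,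
    v < INF -> exists y t, [/\ inwin y, t <= cn, y + t * a = x + cc * a & v = dp y + P t] &
    forall y t, inwin y -> t <= cn -> y + t * a = x + cc * a -> v <= dp y + P t].

Lemma residue_ok s rho dp : cls_pre s -> va s vZ = Z -> va s vB0 = Lo -> va s vRho = rho -> rho < a ->
  (forall j, j < 2 * Z -> ar s aG j = Gf j) -> (forall x, dp x <= INF) ->
  (forall x, inwin x -> (x - Lo) %% a = rho -> ar s aDp x = dp x) ->
  wp V residue s (fun s' t => t <= 60 * (E + 2) * (Z + 1) /\
    forall x, if inwin x && ((x - Lo) %% a == rho) then conv_ok dp x (ar s' aDp x)
              else ar s' aDp x = ar s aDp x).
Proof.
move=> pre EZ EB Er ra HG dpI Hdp; have zb := Zbnd; have zl := Zle.
have [[EI Ea Ew EO] [Ecn Ecc EP]] := pre.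
pose N := (wb * 2 - rho) %/ a + 1.
have NZ : N <= Z by rewrite EZdef leq_add2r; apply: leq_div2r; lia.
have HN k : (k < N) = (rho + a * k <= 2 * wb).
  rewrite /N addn1 ltnS leq_divRL // mulnC; apply/idP/idP; lia.
have N0 : 0 < N by rewrite /N addn1.
have EN : (wb * 2 - rho) %/ a + 1 = N by [].
have ELo' : OM - wb = Lo by [].
clearbody N.
have Imul : INF <= INF * (Z + 3) by rewrite leq_pmulr // addn3.
have INFV : INF < V by apply: leq_ltn_trans Imul zb.
step; first by rewrite Ew Er Ea EN; lia.
rewrite Ew Er Ea EN.
step; first by rewrite EB Er; lia.
rewrite EB Er.
set s0 := setv _ 8 _.
have pre0 : cls_pre s0 by [].
pose col k := dp (Lo + rho + a * k).
have dpx k : k < N -> ar s aDp (Lo + rho + a * k) = col k.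
  rewrite HN => h; apply: Hdp; first by rewrite /inwin; lia.
  have -> : Lo + rho + a * k - Lo = k * a + rho by lia.
  by rewrite modnMDl modn_small.
apply: (@wp_seq _ _ _ _ (fun s' t => t <= 3 * N + 2 /\ forall k, k < N -> ar s' aCol k = col k)).
  apply: (@wp_for _ _ _ _ _ N (fun i s' t => t <= 3 * i /\ forall k, k < i -> ar s' aCol k = col k)) => //.
  - by lia.
  - by move=> s' [fv fa]; rewrite /= fv.
  - move=> i s' t iN [tle h] Ei f; have [fv fa] := f.
    have E8 : va s' 8 = Lo + rho by rewrite fv.
    have Ea' : va s' vA = a by rewrite fv.
    have Ed : ar s' aDp = ar s aDp by rewrite fa.
    step; first by rewrite E8 Ea' Ei Ed dpx //; apply: leq_ltn_trans (dpI _) INFV.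
    rewrite E8 Ea' Ei Ed dpx //; split; first by lia.
    by move=> k ki; case: eqP => [->//|ne]; apply: h; lia.
  - by move=> s' t [tle h] _ _; split=> //; lia.
move=> s1 t1 [t1le Hcol] f1; have [fv1 fa1] := f1.
have pre1 : cls_pre s1 by apply: (cls_pre_frame pre0 f1).
have mp : mono_pre N Z col Gf s1.
  split; rewrite ?fv1 //= => j jZ; rewrite fa1 //=; exact: HG.
have NE : N <= 2 ^ E by apply: leq_trans HE; lia.
have cV i k : i < N -> k < N -> mcost Z col Gf i k < V.
  move=> iN kN; apply: leq_ltn_trans zb; rewrite /mcost.
  have -> : Z + 3 = (Z + 1) + 2 by lia.
  rewrite mulnDr addnC leq_add ?Gf_bound //; first by lia.
  by apply: leq_trans (dpI _) _; rewrite leq_pmulr.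
apply: wp_seq (mono_ok NZ N0 Gf_convex cV _ mp NE) _; first by lia.
move=> s2 t2 [t2le Hnd] f2; have [fv2 fa2] := f2.
have pre2 : cls_pre s2 by apply: (cls_pre_frame pre1 f2).
have [[EI2 Ea2 Ew2 EO2] _] := pre2.
have E82 : va s2 8 = Lo + rho by rewrite fv2 // fv1.
have EN2 : va s2 vN = N by rewrite fv2 // fv1.
have Ed2 : ar s2 aDp = ar s aDp by rewrite fa2 // fa1.
pose val k := minn (ar s2 aNd k) INF.
apply: (@wp_for _ _ _ _ _ N (fun i s' t => t <= 4 * i /\
   forall x, ar s' aDp x = if [&& inwin x, (x - Lo) %% a == rho & (x - Lo) %/ a < i]
     then val ((x - Lo) %/ a) else ar s aDp x)) => //.
- by lia.
- by move=> s' [fv fa]; rewrite /= fv.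
- by split=> // x; rewrite ltn0 !andbF Ed2.
- move=> i s' t iN [tle h] Ei f; have [fv fa] := f.
  have E8 : va s' 8 = Lo + rho by rewrite fv.
  have Ea' : va s' vA = a by rewrite fv.
  have EI' : va s' vInf = INF by rewrite fv.
  have En : ar s' aNd = ar s2 aNd by rewrite fa.
  have fin x : (if x == Lo + rho + a * i then val i else ar s' aDp x) =
     if [&& inwin x, (x - Lo) %% a == rho & (x - Lo) %/ a < i.+1] then val ((x - Lo) %/ a) else ar s aDp x.
    case: eqP => [->|ne].
      have -> : Lo + rho + a * i - Lo = i * a + rho by lia.
      rewrite modnMDl modn_small // eqxx divnMDl // divn_small // addn0 ltnSn /=.
      by have -> // : inwin (Lo + rho + a * i) by move: iN; rewrite HN /inwin; lia.
    rewrite h ltnS; case wx: (inwin x) => //=; case: eqP => //= mx.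
    have -> // : ((x - Lo) %/ a < i) = ((x - Lo) %/ a <= i).
    rewrite [in RHS]leq_eqVlt; case: eqP => [dx|//]; case: ne.
    by case/andP: wx => wx _; have := residue_index a wx; rewrite mx dx.
  have vi : val i < V by apply: leq_ltn_trans (geq_minr _ _) INFV.
  step => [/nzE|/zbE]; rewrite En Ei EI' => c1.
    have Ev : ar s2 aNd i = val i by rewrite /val; apply/esym/minn_idPl/ltnW.
    step; first by rewrite En Ei Ev.
    rewrite En Ei E8 Ea' Ev; split; first by lia.
    exact: fin.
  have Ev : INF = val i by rewrite /val; apply/esym/minn_idPr; lia.
  step; first by rewrite EI'.
  rewrite Ei E8 Ea' EI' Ev; split; first by lia.
  exact: fin.
move=> s' t [tle h] _ _; split.
  have : 40 * (E + 2) * (N + 1) <= 40 * (E + 2) * (Z + 1) by rewrite leq_mul2l leq_add2r NZ orbT.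
  have : 20 * (E + 2) * (Z + 1) >= 40 * (Z + 1) by clear; nia.
  have -> : 60 * (E + 2) * (Z + 1) = 40 * (E + 2) * (Z + 1) + 20 * (E + 2) * (Z + 1) by clear; lia.
  by move: t1le t2le tle NZ; clear; lia.
move=> x; rewrite h; clear h tle t1le t2le.
case wx: (inwin x) => //=; case: eqP => //= mx.
set i := (x - Lo) %/ a.
have Ex : x = Lo + rho + a * i.
  by case/andP: (wx) => wx' _; have := residue_index a wx'; rewrite mx.
have iN : i < N by move: wx; rewrite HN /inwin Ex; lia.
rewrite iN; have [_ [[k kN Ek] kmin]] := Hnd _ iN; clearbody i.
clear fv1 fa1 fv2 fa2 f1 f2 HV HV2 HE zb zl NE cV Hcol Hnd dpx Hdp mp pre pre0 pre1 pre2 t t1 t2 E82 EN2 Ed2 EI2 Ea2 Ew2 EO2 INFV Imul EN EP HG.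
split; first exact: geq_minr.
- rewrite /val gtn_min ltnn orbF => lt; rewrite (minn_idPl (ltnW lt)).
  move: lt; rewrite Ek /mcost /Gf => lt.
  exists (Lo + rho + a * k), (cc + i - k).
  (* A multiplicity outside [[0, cn]] carries a penalty of at least [INF], contrary to [lt]; so the
     minimum is attained at a genuine one. *)
  have c1 : (cc + (Z + i - k) < Z) = false.
    apply/negP => c; move: lt; rewrite c ltnNge => /negP; apply.
    by apply: leq_trans (leq_addl _ _); rewrite leq_pmulr //; lia.
  have Et : cc + (Z + i - k) - Z = cc + i - k by lia.
  rewrite c1 Et in lt *.
  have c2 : (cn < cc + i - k) = false.
    apply/negP => c; move: lt; rewrite c ltnNge => /negP; apply.
    by apply: leq_trans (leq_addl _ _); apply: leq_trans (leq_addl _ _); rewrite leq_pmulr //; lia.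
  rewrite c2; split=> //.
  + by move: kN; rewrite HN /inwin; lia.
  + by lia.
  + have kc : k <= cc + i by lia.
    by rewrite mulnBl Ex; have : k * a <= (cc + i) * a by [rewrite leq_mul2r kc orbT]; lia.
- move=> y t wy tn Ey; apply: leq_trans (geq_minl _ _) _.
  (* [x] and [y] differ by a multiple of [a], so [y] is one of the columns of this residue class. *)
  have my : (y - Lo) %% a = rho.
    rewrite -mx; apply/eqP; rewrite -(eqn_modDr (t * a)).
    have -> : y - Lo + t * a = x - Lo + cc * a by move: wx wy; rewrite /inwin; lia.
    by rewrite eqn_modDl modnMl modnMl.
  pose k2 := (y - Lo) %/ a.
  have Ey' : y = Lo + rho + a * k2.
    by case/andP: (wy) => wy' _; have := residue_index a wy'; rewrite my.
  clearbody k2.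
  have kN' : k2 < N by move: wy; rewrite HN /inwin Ey'; clear; lia.
  apply: leq_trans (kmin _ kN') _; rewrite /mcost /col -Ey' leq_add2l /Gf.
  have Ekt : k2 + t = i + cc.
    apply/eqP; rewrite -(eqn_pmul2r a0); apply/eqP; move: Ey; rewrite Ey' Ex; clear; lia.
  move: Ekt (leq_trans kN' NZ) tn ccn; clear => Ekt k2Z tn ccn.
  have -> : (cc + (Z + i - k2) < Z) = false by lia.
  have -> : cc + (Z + i - k2) - Z = t by lia.
  by rewrite ltnNge tn.
Qed.

Lemma classstep_ok s dp : cls_pre s -> (forall x, dp x <= INF) ->
  (forall x, inwin x -> ar s aDp x = dp x) ->
  wp V classstep s (fun s' t => t <= 500 * (E + 2) * (wb + 1) /\
    forall x, if inwin x then conv_ok dp x (ar s' aDp x) else ar s' aDp x = ar s aDp x).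
Proof.
move=> pre dpI Hdp; have zb := Zbnd; have zl := Zle.
have [[EI Ea Ew EO] [Ecn Ecc EP]] := pre.
step; first by rewrite Ew Ea -EZdef; lia.
step; first by rewrite EO Ew; lia.
rewrite Ew Ea -EZdef EO -ELo.
set s0 := setv _ vB0 _.
have pre0 : cls_pre s0 by [].
apply: wp_seq (fillG_ok pre0 erefl) _ => s1 t1 [t1le HG] f1; have [fv1 fa1] := f1.
have pre1 : cls_pre s1 by apply: (cls_pre_frame pre0 f1).
apply: (@wp_for _ _ _ _ _ a (fun i s' t => t <= (60 * (E + 2) * (Z + 1) + 2) * i /\
   forall x, if inwin x && ((x - Lo) %% a < i) then conv_ok dp x (ar s' aDp x) else ar s' aDp x = ar s aDp x)) => //.
- by lia.
- by move=> s' [fv fa]; rewrite /= fv //= fv1.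
- by split=> // x; rewrite ltn0 andbF /= fa1.
- move=> i s' t ia [tle h] Ei f; have [fv fa] := f.
  have pre' : cls_pre s' by apply: (cls_pre_frame pre1 f).
  have ok := @residue_ok s' i dp pre' _ _ Ei ia _ dpI _.
  apply: wp_mono (ok _ _ _ _).
  + move=> s2 t2 [t2le h2]; split; first by rewrite mulnS; lia.
    move=> x /=; have := h2 x; have := h x; rewrite ltnS.
    case wx: (inwin x) => //=; last by move=> -> ->.
    by case: ltngtP => //= _ h3 ->.
  + by rewrite fv // fv1.
  + by rewrite fv // fv1.
  + by move=> j jZ; rewrite fa // HG.
  + by move=> x wx mx; have := h x; rewrite wx mx ltnn /= => ->; apply: Hdp.
- move=> s' t [tle h] _ _; split; last first.
    by move=> x; have := h x; rewrite ltn_mod a0 andbT.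
  (* All residue classes together have about as many columns as the window has entries; hence the
     cost of a class step is linear in [wb] up to the logarithm [E]. *)
  have aZ : a * Z <= 3 * wb.
    by rewrite EZdef mulnDr muln1 mulnC; have := leq_divM (wb * 2) a; lia.
  have e1 : 60 * (E + 2) * (Z + 1) * a <= 240 * (E + 2) * wb.
    have -> : 60 * (E + 2) * (Z + 1) * a = 60 * (E + 2) * (a * Z + a) by clear; lia.
    have -> : 240 * (E + 2) * wb = 60 * (E + 2) * (4 * wb) by clear; lia.
    by rewrite leq_mul2l; apply/orP; right; lia.
  have e2 : 260 * (wb + 1) <= 130 * (E + 2) * (wb + 1) by clear; nia.
  have e3 : 500 * (E + 2) * (wb + 1) = 370 * (E + 2) * (wb + 1) + 130 * (E + 2) * (wb + 1) by clear; lia.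
  have e4 : 240 * (E + 2) * wb <= 370 * (E + 2) * (wb + 1) by clear; nia.
  move: tle; rewrite mulnDl => tle.
  by move: t1le tle awb zl e1 e2 e3 e4; clear; lia.
Qed.

End ClassStep.

(** * The dynamic program *)

Notation aCnt := 6. Notation aAl := 7. Notation aStart := 8. Notation aCpre := 9. Notation aWn := 0.
Notation vMM := 14. Notation vNL := 27. Notation vLv := 28. Notation vII := 46.

Definition dpinit : cmd :=
  FOR vJ TO #vOm [*] 2 [+] 1 DO aDp @@ (#vJ) ::= #vInf OD ;; aDp @@ (#vOm) ::= 0.

Definition oneclass : cmd :=
  IF aCnt @ (#vA) THEN
    IF aAl @ (#vA) [=] #vLv THEN
      vS ::= aStart @ (#vA) ;; vCn ::= aCnt @ (#vA) ;; vCc ::= aCpre @ (#vA) ;; classstep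
    ELSE Skip FI
  ELSE Skip FI.

Definition onelevel : cmd :=
  vLv ::= #vNL [-] #vII ;; vWb ::= aWn @ (#vLv) ;; FOR vA TO #vMM [+] 1 DO oneclass OD.

Definition dploop : cmd := FOR vII TO #vNL DO onelevel OD.

Section Dp.
Variables (INF OM NL m : nat) (cnt cpre alpha wn : nat -> nat) (P : nat -> nat -> nat).
Hypothesis cpre_le : forall a, cpre a <= cnt a.
Hypothesis alphaNL : forall a, a <= m -> 0 < cnt a -> 0 < alpha a <= NL.
Hypothesis wn_mono : forall b b', b <= b' <= NL -> 0 < b -> wn b' <= wn b.
Hypothesis wnO : forall b, 0 < b <= NL -> m <= wn b <= OM.
Hypothesis cnt0 : cnt 0 = 0.
Hypothesis P0 : forall a, P a 0 = 0.
Implicit Types (p : pred nat).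

Definition tot p (t : nat -> nat) := \sum_(a < m.+1 | p a) t a * a.
Definition val p (t : nat -> nat) := \sum_(a < m.+1 | p a) P a (t a).
Definition dev (t : nat -> nat) a := (t a - cpre a + (cpre a - t a)) * a.
Definition feas (t : nat -> nat) := forall a, t a <= cnt a.
Definition live b a := (0 < cnt a) && (b <= alpha a).
Definition inside (t : nat -> nat) := forall b, 0 < b <= NL -> \sum_(a < m.+1 | live b a) dev t a <= wn b.

(* [dp x] is the least v-sum of class multiplicities [t] whose u-sum differs from that of [cpre]
   by [x - OM]; optimality is only claimed against choices with small deviations ([inside]). *)
Definition dp_inv p w (dp : nat -> nat) := [/\ forall x, dp x <= INF,
  forall x, dp x < INF -> OM - w <= x <= OM + w,
  forall x, dp x < INF -> exists t, [/\ feas t, x + tot p cpre = OM + tot p t & dp x = val p t] &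
  forall t x, feas t -> inside t -> x + tot p cpre = OM + tot p t -> dp x <= val p t].

Lemma tot_dev p t : tot p t <= tot p cpre + \sum_(a < m.+1 | p a) dev t a /\
  tot p cpre <= tot p t + \sum_(a < m.+1 | p a) dev t a.
Proof.
rewrite /tot -!big_split /=; split; apply: leq_sum => a _; rewrite /dev -mulnDl leq_mul2r; lia.
Qed.

Lemma inside_sub p b t : 0 < b <= NL -> inside t -> (forall a, a <= m -> p a -> live b a) ->
  \sum_(a < m.+1 | p a) dev t a <= wn b.
Proof.
move=> bN ins sub; apply: leq_trans (ins b bN).
rewrite [leqLHS]big_mkcond [leqRHS]big_mkcond; apply: leq_sum => a _.
by case: ifP => // pa; rewrite sub // -ltnS.
Qed.

Definition setf (t : nat -> nat) i v := fun a => if a == i then v else t a.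

Lemma tot_setf p t i v : ~~ p i -> tot p (setf t i v) = tot p t.
Proof. by move=> pi; apply: eq_bigr => a pa; rewrite /setf; case: eqP pa pi => // -> ->. Qed.

Lemma val_setf p t i v : ~~ p i -> val p (setf t i v) = val p t.
Proof. by move=> pi; apply: eq_bigr => a pa; rewrite /setf; case: eqP pa pi => // -> ->. Qed.

Lemma sum_add p i (f : nat -> nat) : ~~ p i -> i <= m ->
  \sum_(a < m.+1 | p a || (a == i :> nat)) f a = \sum_(a < m.+1 | p a) f a + f i.
Proof.
move=> pi im; have im' : i < m.+1 by [].
rewrite (bigD1 (Ordinal im')) /= ?eqxx ?orbT // addnC; congr (_ + _); apply: eq_bigl => a.
rewrite -val_eqE /=; case: (a =P i :> nat) => [->|_] /=; last by rewrite orbF andbT.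
by rewrite orbT (negbTE pi).
Qed.

(** For an [inside] choice the deviations on the classes done so far add up to at most [wn b], both
    with and without class [i]. Hence the old index and the new index both lie in the window, and
    restricting the convolution to it loses no such choice. *)
Lemma dp_inv_add p i b w dp dp' : dp_inv p w dp -> w <= wn b -> 0 < b <= NL -> i <= m -> ~~ p i ->
  live b i -> (forall a, a <= m -> p a -> live b a) ->
  (forall x, if inwin (wn b) (OM - wn b) x then conv_ok INF i (wn b) (cnt i) (cpre i) (P i) (OM - wn b) dp x (dp' x)
             else dp' x = dp x) ->
  dp_inv (fun a => p a || (a == i)) (wn b) dp'.
Proof.
move=> [bd supp snd cmp] wb bN im pi li sub conv.
have /andP[mw wO] := wnO bN.
have win x : inwin (wn b) (OM - wn b) x = (OM - wn b <= x <= OM + wn b).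
  by rewrite /inwin; congr (_ && (_ <= _)); lia.
have out x : ~~ inwin (wn b) (OM - wn b) x -> dp x = INF.
  move=> nw; apply/eqP; rewrite eqn_leq bd leqNgt; apply/negP => /supp h.
  by case/negP: nw; rewrite win; lia.
have Tadd t : tot (fun a => p a || (a == i)) t = tot p t + t i * i.
  by rewrite /tot (@sum_add p i (fun a => t a * a)).
have Vadd t : val (fun a => p a || (a == i)) t = val p t + P i (t i).
  by rewrite /val (@sum_add p i (fun a => P a (t a))).
split.
- by move=> x; have := conv x; case: ifP => _ => [[]|->].
- move=> x; rewrite -win; have := conv x; case: ifP => // nw -> lt.
  by rewrite (out x) ?nw // ltnn in lt.
- move=> x lt; have := conv x; case wx: (inwin _ _ x) => h; last first.
    by rewrite h (out x) ?wx // ltnn in lt.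
  have [_ /(_ lt)[y [t0 [wy t0c Ey Edp]]] _] := h.
  have ylt : dp y < INF by apply: leq_ltn_trans lt; rewrite Edp leq_addr.
  have [t [ft Et Ev]] := snd y ylt.
  exists (setf t i t0); split.
  + by move=> a; rewrite /setf; case: eqP => [->|].
  + rewrite !Tadd tot_setf // /setf eqxx; move: Et Ey; clear; lia.
  + by rewrite Vadd val_setf // /setf eqxx Edp Ev.
- move=> t x ft ins; rewrite !Tadd Vadd => Ex.
  have d1 := inside_sub bN ins sub; have [d2 d3] := tot_dev p t.
  have sub' a : a <= m -> p a || (a == i) -> live b a.
    by move=> am /orP[/(sub _ am)|/eqP->].
  have d4 := inside_sub bN ins sub'; have [d5 d6] := tot_dev (fun a => p a || (a == i)) t.
  rewrite !Tadd in d5 d6.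
  pose y := OM + tot p t - tot p cpre.
  have Ey : y + tot p cpre = OM + tot p t by rewrite /y; lia.
  have wy : inwin (wn b) (OM - wn b) y by rewrite win /y; lia.
  have wx : inwin (wn b) (OM - wn b) x by rewrite win; lia.
  have := conv x; rewrite wx => -[_ _ cp].
  apply: leq_trans (cp y (t i) wy (ft i) _) _; first by lia.
  by rewrite leq_add2r cmp.
Qed.

Lemma dp_inv_ext p p' w dp dp' : (forall a, a <= m -> p a = p' a) -> dp =1 dp' ->
  dp_inv p w dp -> dp_inv p' w dp'.
Proof.
move=> E Ed [bd supp snd cmp].
have T t : tot p' t = tot p t by apply: eq_bigl => a; rewrite E // -ltnS.
have W t : val p' t = val p t by apply: eq_bigl => a; rewrite E // -ltnS.
split=> [x|x|x|t x]; rewrite -?Ed.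
- exact: bd.
- exact: supp.
- by move=> /snd[t [ft Et Ev]]; exists t; rewrite !T W.
- by rewrite !T W; apply: cmp.
Qed.

Lemma dp_inv_weaken p w w' dp : w <= w' -> dp_inv p w dp -> dp_inv p w' dp.
Proof.
by move=> ww [bd supp snd cmp]; split=> // x /supp; lia.
Qed.

Variables (V E N : nat).
Hypothesis INF0 : 0 < INF.
Hypothesis Pinf : forall a j, j <= cnt a -> P a j <= INF.
Hypothesis Pstep : forall a j, j < cnt a -> P a j.+1 <= P a j + INF.
Hypothesis Pconv : forall a j, j.+2 <= cnt a -> 2 * P a j.+1 <= P a j + P a j.+2.
Hypothesis HV : INF * (6 * OM + 6) < V.
Hypothesis HV2 : 8 * OM + 8 + 2 * N + NL < V.
Hypothesis HE : 2 * OM + 1 <= 2 ^ E.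
Hypothesis cntN : forall a, cnt a <= N.

Definition dp_pre s := [/\ va s vInf = INF, va s vOm = OM, va s vNL = NL & va s vMM = m] /\
  [/\ forall a, a <= m -> ar s aCnt a = cnt a, forall a, a <= m -> ar s aCpre a = cpre a,
      forall a, a <= m -> ar s aAl a = alpha a &
      (forall b, 0 < b <= NL -> ar s aWn b = wn b) /\
      forall a, a <= m -> ar s aStart a <= N /\ forall j, j <= cnt a ->
        ar s aPS (ar s aStart a + j) - ar s aPS (ar s aStart a) = P a j].

Definition dpf s x := if x <= 2 * OM then ar s aDp x else INF.

Lemma dp_pre_frame c s s' : dp_pre s -> frame c s s' ->
  modv c vInf = false -> modv c vOm = false -> modv c vNL = false -> modv c vMM = false ->
  [/\ moda c aCnt = false, moda c aCpre = false, moda c aAl = false, moda c aWn = false &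
     moda c aStart = false /\ moda c aPS = false] -> dp_pre s'.
Proof.
move=> [[h1 h2 h3 h4] [h5 h6 h7 [h8 h9]]] [fv fa] m1 m2 m3 m4 [m5 m6 m7 m8 [m9 m10]].
split; first by split; rewrite fv.
by split; rewrite ?fa.
Qed.

Lemma INFV : INF < V.
Proof. by apply: leq_ltn_trans HV; rewrite leq_pmulr // addnS. Qed.

Lemma dpinit_ok s : dp_pre s -> wp V dpinit s (fun s' t => t <= 6 * OM + 6 /\
  dp_inv pred0 0 (dpf s')).
Proof.
move=> pre; have [[EI EO _ _] _] := pre; have iv := INFV.
apply: (@wp_seq _ _ _ _ (fun s' t => t <= 3 * (OM * 2 + 1) + 2 /\ forall x, x <= 2 * OM -> ar s' aDp x = INF)).
  apply: (@wp_for _ _ _ _ _ (OM * 2 + 1) (fun i s' t => t <= 3 * i /\ forall x, x < i -> ar s' aDp x = INF)) => //.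
  - by lia.
  - by move=> s' [fv _]; rewrite /= fv //= EO.
  - move=> i s' t iO [tle h] Ei [fv fa].
    have EI' : va s' vInf = INF by rewrite fv.
    step; first by rewrite EI'.
    rewrite EI' Ei; split; first by lia.
    by move=> x xi; case: eqP => // ne; apply: h; lia.
  - by move=> s' t [tle h] _ _; split; [lia | move=> x xO; apply: h; lia].
move=> s1 t1 [t1le h1] [fv1 fa1].
have EO1 : va s1 vOm = OM by rewrite fv1.
step; first exact: leq_ltn_trans (leq0n _) iv.
rewrite EO1; split; first by lia.
have T0 t : tot pred0 t = 0 by rewrite /tot big_pred0.
have V0 t : val pred0 t = 0 by rewrite /val big_pred0.
have D x : (if x <= 2 * OM then if x == OM then 0 else ar s1 aDp x else INF) = if x == OM then 0 else INF.
  case: leqP => h; first by case: eqP => // _; apply: h1.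
  by case: eqP => // E'; lia.
split=> [x|x|x|t x]; rewrite /dpf /= D.
- by case: ifP.
- by case: eqP => [->|]; rewrite ?ltnn //; lia.
- case: eqP => [->|]; rewrite ?ltnn // => _.
  by exists (fun=> 0); split=> //; rewrite ?T0 ?V0.
- by rewrite !T0 V0 !addn0 => _ _ ->; rewrite eqxx.
Qed.

Definition done_upto b i a := (0 < cnt a) && ((b < alpha a) || (alpha a == b) && (a < i)).

Definition nclass b := \sum_(a < m.+1) ((0 < cnt a) && (alpha a == b)).

Lemma onelevel_ok s ii w : dp_pre s -> va s vII = ii -> ii < NL -> let b := NL - ii in w <= wn b ->
  dp_inv (done_upto b 0) w (dpf s) ->
  wp V onelevel s (fun s' t => t <= 20 + 10 * (m + 1) + nclass b * (510 * (E + 2) * (wn b + 1)) /\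
    dp_inv (done_upto b m.+1) (wn b) (dpf s')).
Proof.
move=> pre Eii iiN b wb inv; have [[EI EO EN EM] [Hc Hp Ha [Hw Hs]]] := pre.
have iv := INFV.
have bN : 0 < b <= NL by rewrite /b; lia.
have /andP[mw wO] := wnO bN.
step; first by rewrite EN; lia.
rewrite EN Eii -/b; step; first by rewrite Hw //; lia.
rewrite Hw //.
apply: (@wp_for _ _ _ _ _ (m + 1) (fun i s' t =>
   t <= 10 * i + (\sum_(a < i) ((0 < cnt a) && (alpha a == b))) * (510 * (E + 2) * (wn b + 1)) /\
   dp_inv (done_upto b i) (wn b) (dpf s'))) => //.
- by lia.
- by move=> s' [fv _]; rewrite /= fv //= EM.
- split=> //; exact: dp_inv_weaken inv.
- move=> i s' t im [tle inv'] Ei f; have [fv fa] := f.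
  have pre' : dp_pre s'.
    apply: (@dp_pre_frame _ (setv (setv s vLv b) vWb (wn b)) s' _ f) => //; by split.
  have Eb : va s' vLv = b by rewrite fv.
  have Ew : va s' vWb = wn b by rewrite fv.
  have [[EI' EO' EN' EM'] [Hc' Hp' Ha' [Hw' Hs']]] := pre'.
  have im' : i <= m by lia.
  rewrite big_ord_recr /=.
  step => [c1|c1]; rewrite Ei Hc' // in c1.
    step => [/nzE|/zbE]; rewrite Ei Ha' // Eb => c2.
      have cN := cntN i; have cc := cpre_le i.
      have [sN HP] := Hs' _ im'.
      step; first by rewrite Ei; lia.
      step; first by rewrite Ei Hc' //; lia.
      step; first by rewrite Ei Hp' //; lia.
      rewrite Ei Hc' // Hp' //.
      have i0 : 0 < i by case: (i) c1 => //; rewrite cnt0.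
      have li : live b i by rewrite /live (eqP c2) leqnn andbT; lia.
      have h1 : i <= wn b := leq_trans im' mw.
      have h3 : INF * (6 * wn b + 6) < V by apply: leq_ltn_trans HV; rewrite leq_mul2l; lia.
      have h4 : 8 * OM + 8 + 2 * cnt i < V by lia.
      have h5 : 2 * wn b + 1 <= 2 ^ E by apply: leq_trans HE; lia.
      set st1 := setv _ vCc _.
      have cp : cls_pre INF i (wn b) OM (cnt i) (cpre i) (P i) st1 by split; split.
      have dpI : forall x, dpf s' x <= INF by case: inv'.
      have dpE : forall x, inwin (wn b) (OM - wn b) x -> ar st1 aDp x = dpf s' x.
        by move=> x /andP[_ h]; rewrite /dpf; case: ifP => //; lia.
      apply: wp_mono (classstep_ok i0 h1 wO INF0 cc (P0 i) (@Pinf i) (@Pstep i) (@Pconv i)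
        h3 h4 h5 erefl erefl cp dpI dpE).
      move=> s2 t2 [t2le conv]; split.
          rewrite c2 /= (_ : (0 < cnt i)) /=; last by lia.
          rewrite mulnDl mul1n.
          have e1 : 10 <= 10 * (E + 2) * (wn b + 1) by clear; nia.
          have e2 : 510 * (E + 2) * (wn b + 1) = 500 * (E + 2) * (wn b + 1) + 10 * (E + 2) * (wn b + 1).
            by clear; lia.
          move: tle t2le e1 e2; move: (\sum_(j < i) _) (510 * _ * _) (500 * _ * _) (10 * _ * _).
          by clear => sm A B C; lia.
        apply: dp_inv_ext (dp_inv_add (dp' := dpf s2) inv' (leqnn _) bN im' _ li _ _) => //.
        -- move=> a am; rewrite /done_upto ltnS (leq_eqVlt a i).
           case: (a =P i) => [->|_] /=; last by rewrite orbF.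
           by rewrite orbT c2 /= orbT andbT lt0n; apply/esym/eqP.
        -- by rewrite /done_upto ltnn andbF orbF (eqP c2) ltnn andbF.
        -- move=> a am; rewrite /done_upto /live => /andP[-> /orP[/ltnW->//|/andP[/eqP-> _]]].
           by rewrite leqnn.
        -- move=> x; have := conv x; rewrite /dpf; case wx: (inwin _ _ x).
             by case: leqP => // h; move: wx; rewrite /inwin; lia.
           by move=> ->.
    step; rewrite (negbTE c2) andbF addn0; split.
      by move: tle; move: (_ * (510 * _ * _)); clear; lia.
    apply: dp_inv_ext inv' => // a am; rewrite /done_upto ltnS (leq_eqVlt a i).
    by case: (a =P i) => [->|//]; rewrite (negbTE c2).
  step; rewrite c1 /= addn0; split.
    by move: tle; move: (_ * (510 * _ * _)); clear; lia.
  apply: dp_inv_ext inv' => // a am; rewrite /done_upto ltnS (leq_eqVlt a i).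
  by case: (a =P i) => [->|//]; rewrite c1.
- move=> s' t [tle inv'] _ _; rewrite addn1 in tle inv' *; split=> //.
  by move: tle; rewrite -/(nclass b); move: (nclass b * _); clear; lia.
Qed.

(** [CW] bounds the number of classes of a level times the width of its window, which is the cost of
    that level up to logarithms. *)
Lemma dploop_ok s CW : dp_pre s -> dp_inv pred0 0 (dpf s) ->
  (forall b, 0 < b <= NL -> nclass b * (wn b + 1) <= CW) -> 0 < NL ->
  wp V dploop s (fun s' t => t <= NL * (30 + 10 * (m + 1) + 510 * (E + 2) * CW) + 2 /\
    dp_inv (fun a => 0 < cnt a) OM (dpf s')).
Proof.
move=> pre inv HC NL0.
(* Before the first level only the index [vOm] is occupied, hence the window [0]; afterwards the
   window is that of the last level treated. Starting at class [1] instead of [0] makes no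
   difference because [cnt 0 = 0]. *)
apply: (@wp_for _ _ _ _ _ NL (fun i s' t => t <= i * (30 + 10 * (m + 1) + 510 * (E + 2) * CW) /\
   dp_inv (done_upto (NL - i) 1) (if i is 0 then 0 else wn (NL - i).+1) (dpf s'))) => //.
- by lia.
- by move=> s' [fv _]; rewrite /= fv //=; case: pre => -[].
- split=> //; apply: dp_inv_ext inv => // a am; rewrite subn0 /done_upto /=.
  have [//|ca] := posnP (cnt a).
  have := alphaNL am ca => /andP[_]; rewrite leqNgt => /negbTE-> /=.
  case: a am ca => [|a] am ca; last by rewrite ltnS ltn0 andbF.
  by rewrite cnt0 in ca.
- move=> i s' t iN [tle inv'] Ei f; have [fv fa] := f.
  have pre' : dp_pre s' by apply: (dp_pre_frame pre f).
  have bN : 0 < NL - i <= NL by lia.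
  have zero b a : done_upto b 0 a = done_upto b 1 a.
    rewrite /done_upto ltn0 andbF orbF; case: a => [|a]; last by rewrite ltnS ltn0 andbF orbF.
    by rewrite cnt0.
  apply: wp_mono (onelevel_ok pre' Ei iN (w := if i is 0 then 0 else wn (NL - i).+1) _ _).
  + move=> s2 t2 [t2le inv2]; split.
      have h : nclass (NL - i) * (510 * (E + 2) * (wn (NL - i) + 1)) <= 510 * (E + 2) * CW.
        have -> : nclass (NL - i) * (510 * (E + 2) * (wn (NL - i) + 1)) =
           510 * (E + 2) * (nclass (NL - i) * (wn (NL - i) + 1)) by clear; lia.
        by rewrite leq_mul2l HC ?orbT.
      rewrite mulSn; move: tle t2le h; move: (nclass _ * _) (510 * _ * _) => X Y.
      by move: (i * _); clear; lia.
    have -> : (NL - i.+1).+1 = NL - i by lia.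
    apply: dp_inv_ext inv2 => // a am; rewrite -zero /done_upto ltnS am andbT ltn0 andbF orbF.
    congr (_ && _); have -> : NL - i = (NL - i.+1).+1 by lia.
    by rewrite [RHS]leq_eqVlt orbC eq_sym.
  + by case: i {tle inv' Ei f fv fa} iN bN => // i iN bN; apply: wn_mono; lia.
  + by apply: dp_inv_ext inv' => // a _; rewrite zero.
- move=> s' t [tle inv'] _ _; split; first by lia.
  rewrite subnn in inv'; case: NL NL0 inv' wnO alphaNL => // n _ inv' wO aN.
  apply: dp_inv_weaken (_ : wn 1 <= OM) _; first by have := wO 1 isT => /andP[].
  apply: dp_inv_ext inv' => // a am; rewrite /done_upto.
  have [//|ca] := posnP (cnt a).
  by have := aN _ am ca => /andP[-> _].
Qed.

End Dp.

(** * Radix sort *)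

Notation aX := 2. Notation aY := 3. Notation vI := 4. Notation vC := 18. Notation vPw := 19. Notation vXM := 20.

Definition getbit : expr := (aX @ (#vI) [/] #vPw) [%] 2.

Definition radixpass : cmd :=
  7 ::= 0 ;;
  FOR vI TO #vC DO IF getbit THEN Skip ELSE aY @@ (#7) ::= aX @ (#vI) ;; 7 ::= #7 [+] 1 FI OD ;;
  FOR vI TO #vC DO IF getbit THEN aY @@ (#7) ::= aX @ (#vI) ;; 7 ::= #7 [+] 1 ELSE Skip FI OD ;;
  FOR vI TO #vC DO aX @@ (#vI) ::= aY @ (#vI) OD.

Definition radix : cmd :=
  vPw ::= 1 ;; WHILE #vPw [<] (#vXM [+] 1) DO radixpass ;; vPw ::= #vPw [*] 2 OD.

Definition bitof p x := (x %/ p) %% 2 == 1.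

Definition radix_step p (s : seq nat) := filter (predC (bitof p)) s ++ filter (bitof p) s.

Lemma radix_step_perm p s : perm_eq (radix_step p s) s.
Proof. by rewrite /radix_step perm_catC perm_filterC. Qed.

Lemma modn_double p x : 0 < p -> x %% (2 * p) = bitof p x * p + x %% p.
Proof.
move=> p0; have h := divn_eq x p; have h2 := divn_eq (x %/ p) 2.
have b2 : (x %/ p) %% 2 = bitof p x.
  by rewrite /bitof; have := ltn_pmod (x %/ p) (isT : 0 < 2); case: (_ %% 2) => [|[|]].
rewrite b2 in h2; rewrite {1}h {1}h2 mulnDl -addnA -mulnA modnMDl modn_small //.
have := ltn_pmod x p0; case: (bitof p x); lia.
Qed.

(** A stable partition by the binary digit worth [p] refines an order modulo [p] to one modulo
    [2 * p]. *)
Lemma radix_step_sorted p s : 0 < p ->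
  pairwise (fun x y => x %% p <= y %% p) s ->
  pairwise (fun x y => x %% (2 * p) <= y %% (2 * p)) (radix_step p s).
Proof.
move=> p0 ps; rewrite /radix_step pairwise_cat; apply/and3P; split.
- apply/allrelP => x y; rewrite !mem_filter /= => /andP[bx _] /andP[by_ _].
  rewrite !modn_double // (negbTE bx) by_; have := ltn_pmod x p0; lia.
- apply: (@sub_in_pairwise _ (predC (bitof p)) _ _ _ _ (filter_all _ _) (pairwise_filter _ ps)).
  by move=> x y bx by_ h; rewrite !modn_double // (negbTE bx) (negbTE by_).
- apply: (@sub_in_pairwise _ (bitof p) _ _ _ _ (filter_all _ _) (pairwise_filter _ ps)).
  by move=> x y bx by_ h; rewrite !modn_double // [bitof p x]bx [bitof p y]by_ leq_add2l.
Qed.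

Section Radix.
Variables (V N XM E : nat).
Hypothesis HV : 4 * XM + 4 < V.
Hypothesis NV : N + 1 < V.
Hypothesis HE : XM < 2 ^ E.

(** One statement for both halves of the partition: [q] selects the digit, and [F0] is what an
    earlier pass has already written. *)
Lemma filter_pass (q : bool) (s : state) (F0 : seq nat) (x : nat -> nat) :
  va s vC = N -> va s 7 = size F0 -> (forall i, i < N -> ar s aX i = x i) ->
  (forall i, i < N -> x i <= XM) ->
  (forall j, j < size F0 -> ar s aY j = nth 0 F0 j) ->
  let P := fun y => bitof (va s vPw) y == q in
  size F0 + count P (mkseq x N) <= N ->
  wp V (FOR vI TO #vC DO
    (if q then IF getbit THEN aY @@ (#7) ::= aX @ (#vI) ;; 7 ::= #7 [+] 1 ELSE Skip FI
     else IF getbit THEN Skip ELSE aY @@ (#7) ::= aX @ (#vI) ;; 7 ::= #7 [+] 1 FI) OD) s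
  (fun s' t => let F := F0 ++ filter P (mkseq x N) in
    [/\ t <= 5 * N + 2, va s' 7 = size F, forall j, j < size F -> ar s' aY j = nth 0 F j,
        va s' vPw = va s vPw & va s' vC = N] /\ ar s' aX = ar s aX).
Proof.
move=> EN E7 Ex xle EY P; set body := (if q then _ else _) => szN.
have [mv7 mvI mvC mvP mX] : [/\ modv body 7 = true, modv body vI = false, modv body vC = false,
    modv body vPw = false & moda body aX = false] by rewrite /body; case: (q).
apply: (@wp_for _ _ _ _ _ N (fun i s' t => let F := F0 ++ filter P (mkseq x i) in
    [/\ t <= 5 * i, va s' 7 = size F & forall j, j < size F -> ar s' aY j = nth 0 F j])) => //.
- by lia.
- by move=> s' [fv _]; rewrite /= fv //= mvC.
- by rewrite /= cats0; split.
- move=> i s' t iN [tle E7' EY'] Ei [fv fa].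
  have EX' : ar s' aX = ar s aX by rewrite fa //= mX.
  have EP : va s' vPw = va s vPw by rewrite fv //= mvP.
  set F := F0 ++ filter P (mkseq x i) in E7' EY'.
  have bl : (x i %/ va s vPw) %% 2 = bitof (va s vPw) (x i).
    by rewrite /bitof; have := ltn_pmod (x i %/ va s vPw) (isT : 0 < 2); case: (_ %% 2) => [|[|]].
  rewrite mkseqS filter_rcons.
  have szF : size F <= N.
    apply: leq_trans szN; rewrite size_cat leq_add2l size_filter.
    have -> : mkseq x N = mkseq x i ++ [seq x j | j <- iota i (N - i)].
      by rewrite /mkseq -{1}(subnKC (ltnW iN)) iotaD map_cat.
    by rewrite count_cat leq_addr.
  have put (Q : state -> nat -> Prop) :
      (forall s2, va s2 7 = (size F).+1 ->
        (forall j, j < (size F).+1 -> ar s2 aY j = nth 0 (rcons F (x i)) j) -> Q s2 2) ->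
      wp V (aY @@ (#7) ::= aX @ (#vI) ;; 7 ::= #7 [+] 1) s' Q.
    move=> HQ; step; first by rewrite EX' Ei Ex //; have := xle _ iN; lia.
    step; first by rewrite E7'; lia.
    rewrite E7'; apply: HQ => /=; first by rewrite addn1.
    move=> j jF; rewrite EX' Ei Ex // nth_rcons; case: ltngtP => // [lt|gt]; first exact: EY'.
    by lia.
  have put' (b : bool) (Q : state -> nat -> Prop) : P (x i) = b ->
      (forall s2 t2, t2 <= 2 -> (let F' := F0 ++ (if b then rcons (filter P (mkseq x i)) (x i) else filter P (mkseq x i)) in
         va s2 7 = size F' /\ forall j, j < size F' -> ar s2 aY j = nth 0 F' j) -> Q s2 t2) ->
      wp V (if b then aY @@ (#7) ::= aX @ (#vI) ;; 7 ::= #7 [+] 1 else Skip) s' Q.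
    move=> Pb; case: b {Pb} => HQ.
      by apply: put => s2 h1 h2; apply: HQ => //=; rewrite -rcons_cat -/F size_rcons.
    by step; apply: HQ.
  pose R2 (s2 : state) := let F' := F0 ++ (if P (x i) then rcons (filter P (mkseq x i)) (x i) else filter P (mkseq x i)) in
         va s2 7 = size F' /\ forall j, j < size F' -> ar s2 aY j = nth 0 F' j.
  have fin b : P (x i) = b ->
      wp V (if b then aY @@ (#7) ::= aX @ (#vI) ;; 7 ::= #7 [+] 1 else Skip) s' (fun s2 t2 => t2.+1 <= 3 /\ R2 s2).
    by move=> Pb; apply: (put' b) => // s2 t2 t2le h; split=> //; rewrite /R2 Pb.
  have main : wp V body s' (fun s2 t2 => t2 <= 3 /\ R2 s2).
    clearbody R2; rewrite /body; case Eq: q; rewrite /getbit; step => c;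
      rewrite EX' Ei Ex // EP bl in c.
    + by apply: (fin true); rewrite /P Eq; case: (bitof _ _) c.
    + by apply: (fin false); rewrite /P Eq; case: (bitof _ _) c.
    + by apply: (fin false); rewrite /P Eq; case: (bitof _ _) c.
    + by apply: (fin true); rewrite /P Eq; case: (bitof _ _) c.
  apply: wp_mono main => s2 t2 [t2le [h1 h2]]; split=> //.
  by move: t2le tle; clear; lia.
- move=> s' t [tle E7' EY'] _ [fv fa]; split; last by rewrite fa //= mX.
  by split=> //; [lia | rewrite fv //= mvP | rewrite fv //= mvC].
Qed.

Lemma radixpass_ok s p : va s vC = N -> va s vPw = p -> (forall i, i < N -> ar s aX i <= XM) ->
  wp V radixpass s (fun s' t => t <= 15 * N + 10 /\
    mkseq (ar s' aX) N = radix_step p (mkseq (ar s aX) N)).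
Proof.
move=> EN Ep xle; set xs := mkseq (ar s aX) N.
have szx : size xs = N by rewrite size_mkseq.
have csum : count (fun y => bitof p y == false) xs + count (fun y => bitof p y == true) xs = N.
  rewrite -[RHS]szx -(count_predC (fun y => bitof p y == false)); congr (_ + _).
  by apply: eq_count => y /=; case: (bitof p y).
step; first by lia.
have h1 := @filter_pass false (setv s 7 0) [::] (ar s aX) EN erefl (fun _ _ => erefl) xle.
apply: wp_seq (h1 _ _) _ => //=; first by rewrite Ep; apply: leq_trans (count_size _ _) _; rewrite szx.
rewrite Ep -/xs; set F1 := filter _ xs => s1 t1 [[t1le E71 EY1 EP1 EN1] EX1] _.
have h2 := @filter_pass true s1 F1 (ar s aX) EN1 E71 _ xle EY1.
apply: wp_seq (h2 _ _) _ => //=; first by move=> i _; rewrite EX1.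
  by rewrite EP1 size_filter -/xs csum.
rewrite EP1 -/xs; set F2 := F1 ++ _ => s2 t2 [[t2le E72 EY2 EP2 EN2] EX2] _.
have szF2 : size F2 = N by rewrite size_cat !size_filter csum.
apply: (@wp_for _ _ _ _ _ N (fun i s' t => t <= 3 * i /\ forall j, j < i -> ar s' aX j = nth 0 F2 j)) => //.
- by lia.
- by move=> s' [fv _]; rewrite /= fv.
- move=> i s' t iN [tle h] Ei [fv fa].
  have EY' : ar s' aY = ar s2 aY by rewrite fa.
  have e : ar s2 aY i = nth 0 F2 i by rewrite EY2 ?szF2.
  step.
    rewrite EY' Ei e; have : nth 0 F2 i \in xs.
      have : nth 0 F2 i \in F2 by rewrite mem_nth ?szF2.
      by rewrite mem_cat !mem_filter => /orP[/andP[]|/andP[]].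
    by case/mapP => k; rewrite mem_iota add0n => /andP[_ kN] ->; have := xle _ kN; lia.
  rewrite EY' Ei e; split; first by lia.
  by move=> j ji; case: eqP => [->//|ne]; apply: h; lia.
- move=> s' t [tle h] _ _; split; first by lia.
  have -> : radix_step p xs = F2.
    rewrite /radix_step /F2 /F1; congr (_ ++ _); apply: eq_filter => y /=; by case: (bitof p y).
  apply: (@eq_from_nth _ 0); rewrite size_mkseq ?szF2 // => j jN.
  by rewrite nth_mkseq // h.
Qed.

Lemma radix_ok s : va s vC = N -> va s vXM = XM -> (forall i, i < N -> ar s aX i <= XM) ->
  wp V radix s (fun s' t => [/\ t <= (15 * N + 15) * E + 2,
    perm_eq (mkseq (ar s' aX) N) (mkseq (ar s aX) N) & sorted leq (mkseq (ar s' aX) N)]).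
Proof.
move=> EN EXM xle; step; first by lia.
have ex : exists e, XM < 2 ^ e by exists E.
case: (ex_minnP ex) => e Xe emin.
have eE : e <= E by apply: emin.
apply: (@wp_whl _ _ _ _ e (fun j s' t => [/\ va s' vPw = 2 ^ j, t <= (15 * N + 15) * j,
   perm_eq (mkseq (ar s' aX) N) (mkseq (ar s aX) N) &
   pairwise (fun x y => x %% 2 ^ j <= y %% 2 ^ j) (mkseq (ar s' aX) N)])).
- rewrite /= muln0; split=> //; rewrite expn0; elim: (mkseq _ _) => //= x l ->.
  by rewrite andbT; apply/allP => y _; rewrite !modn1.
- move=> j s' t je [Ep tle pm pw] [fv fa].
  have EN' : va s' vC = N by rewrite fv.
  have EX' : va s' vXM = XM by rewrite fv.
  have pX : 2 ^ j <= XM by rewrite leqNgt; apply/negP => /emin; lia.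
  split; first by rewrite /= Ep EX' addn1 ltnS pX.
  have xle' i : i < N -> ar s' aX i <= XM.
    move=> iN; have : ar s' aX i \in mkseq (ar s' aX) N by apply: map_f; rewrite mem_iota.
    by rewrite (perm_mem pm) => /mapP[k]; rewrite mem_iota add0n => /andP[_ kN] ->; apply: xle.
  apply: wp_seq (radixpass_ok EN' Ep xle') _ => s2 t2 [t2le E2] [fv2 fa2].
  have Ep2 : va s2 vPw = 2 ^ j by rewrite fv2.
  step; first by rewrite Ep2; lia.
  rewrite Ep2 E2 -expnSr; split=> //; first by rewrite mulnS; lia.
    exact: perm_trans (radix_step_perm _ _) pm.
  by rewrite expnS; apply: radix_step_sorted; rewrite ?expn_gt0.
- move=> s' t [Ep tle pm pw] [fv fa].
  split; first by rewrite /= Ep fv //= EXM addn1 ltnS leqNgt Xe.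
  have xle' x : x \in mkseq (ar s' aX) N -> x < 2 ^ e.
    rewrite (perm_mem pm) => /mapP[k]; rewrite mem_iota add0n => /andP[_ kN] ->.
    by apply: leq_ltn_trans Xe; apply: xle.
  split=> //.
    by have := leq_mul (leqnn (15 * N + 15)) eE; lia.
  rewrite sorted_pairwise; last exact: leq_trans.
  apply: (@sub_in_pairwise _ (fun x => x < 2 ^ e) _ _ _ _ _ pw); last by apply/allP => x /xle'.
  by move=> x y xl yl; rewrite !modn_small.
Qed.

End Radix.

(** * Reading the optimum off the table *)

Section ModeD.
Variables (ks : seq (nat * nat)) (m W INF SP z : nat) (dp : nat -> nat).
Hypothesis km : all (fun x => 0 < x.1 <= m) ks.
Hypothesis kINF : sum2 ks < INF.
Hypothesis ub : forall e, sub_ms e ks -> sum1 ks <= W + sum1 e -> SP <= z + sum2 e.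
Hypothesis ex : exists e, [/\ sub_ms e ks, sum1 ks <= W + sum1 e & SP = z + sum2 e].
Hypothesis inv : dp_inv INF W 1 m (ccount ks) (ccount ks) (fun=> 1) (fun=> W) (pfx ks)
  (fun a => 0 < ccount ks a) W dp.

Let totc : tot m (fun a => 0 < ccount ks a) (ccount ks) = sum1 ks.
Proof. by have [_ -> _] := @select_complete ks m km ks (fun x => leqnn _). Qed.

(** The multiplicities count items left out, and [x] is [W] minus the weight that stays. Having an
    index at all, a natural number, is therefore feasibility. *)
Lemma excluded_ge x : dp x < INF -> x <= W -> SP <= z + dp x.
Proof.
have [_ _ snd _] := inv; move=> /snd[t [ft Et ->]] xW.
have [e [es e1 e2]] := select_sound m ft.
rewrite /val -e2; apply: ub => //; move: Et; rewrite totc /tot -e1; lia.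
Qed.

Lemma excluded_ex : exists x, [/\ x <= W, dp x < INF & SP = z + dp x].
Proof.
have [_ _ _ cmp] := inv; have [e [es le E]] := ex.
pose t a := count (fun x => x.1 == a) e.
have [ft e1 e2] : [/\ forall a, t a <= ccount ks a, sum1 e = \sum_(a < m.+1 | 0 < ccount ks a) t a * a &
  \sum_(a < m.+1 | 0 < ccount ks a) pfx ks a (t a) <= sum2 e] := select_complete km es.
have les : sum1 e <= sum1 ks by apply: sub_ms_sum.
have Etot : W + sum1 e - sum1 ks + tot m (fun a => 0 < ccount ks a) (ccount ks) =
    W + tot m (fun a => 0 < ccount ks a) t by rewrite totc /tot -e1; lia.
(* The deviation from leaving out everything is the weight that stays, which is at most [W], the
   width of the single window. *)
have ins : inside 1 m (ccount ks) (ccount ks) (fun=> 1) (fun=> W) t.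
  move=> b bN; have -> : b = 1 by lia.
  rewrite (eq_bigl (fun a : 'I_m.+1 => 0 < ccount ks a)); last by move=> a; rewrite /live andbT.
  rewrite -(leq_add2r (tot m (fun a => 0 < ccount ks a) t)) /tot -big_split /=.
  rewrite (eq_bigr (fun a : 'I_m.+1 => ccount ks a * a)); last first.
    by move=> a _; rewrite /dev -mulnDl; have := ft a; move: (t a) (ccount ks a) => p q h; congr (_ * _); lia.
  by have := totc; rewrite /tot => ->; rewrite -e1.
have h := cmp t _ ft ins Etot.
have h2 : dp (W + sum1 e - sum1 ks) <= sum2 e := leq_trans h e2.
have h3 : sum2 e <= sum2 ks by apply: sub_ms_sum.
exists (W + sum1 e - sum1 ks).
have h4 : dp (W + sum1 e - sum1 ks) < INF by lia.
have h5 : W + sum1 e - sum1 ks <= W by lia.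
split=> //; have := excluded_ge h4 h5; lia.
Qed.

End ModeD.

Section ModeB.
Variables (N m k W NL INF OM z : nat) (u v alpha : nat -> nat) (dp : nat -> nat).
Hypothesis um : forall i, i < N -> 0 < u i <= m.
Hypothesis m_gt0 : 0 < m.
Hypothesis ratio : forall i j, i <= j < N -> v i * u j <= v j * u i.
Hypothesis kN : k <= N.
Hypothesis fits : \sum_(i < k) v i <= W.
Hypothesis breaks : k < N -> W < \sum_(i < k.+1) v i.
Hypothesis scans : forall lv, lv <= NL -> exists mR mL,
  [/\ @scanned_right N m k u mR (2 ^ lv) (copies m lv), @scanned_left N m k u mL (2 ^ lv) (copies m lv) &
      forall a, a <= m -> (alpha a == 0) || (lv < alpha a) -> ~~ mR a /\ ~~ mL a].
Hypothesis marked : forall lv, 0 < lv <= NL -> \sum_(a < m.+1) (alpha a == lv) <= 2 * (2 ^ lv).-1.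
Hypothesis alpha_le : forall a, a <= m -> alpha a <= NL.
Hypothesis densityNL : density m < 2 ^ NL.
Let ks := mkseq (fun i => (u i, v i)) N.
Hypothesis opt : is_opt ks W z.
Hypothesis WINF : W < INF.
Let cnt a := count_all N u a.
Hypothesis inv : dp_inv INF OM NL m cnt (count_pre k u) alpha (width m NL) (pfx ks)
  (fun a => 0 < cnt a) OM dp.
Let ZU := \sum_(i < k) u i.

Let km : all (fun x => 0 < x.1 <= m) ks.
Proof. by apply/allP => x /mapP[i]; rewrite mem_iota => /andP[_ iN] ->; apply: um. Qed.

Lemma cntE a : cnt a = ccount ks a.
Proof.
rewrite /cnt /count_all /ccount /ks -sum1_count big_map.
have -> : iota 0 N = index_iota 0 N by rewrite /index_iota subn0.
rewrite big_mkord.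
by rewrite [RHS]big_mkcond /=; apply: eq_bigr => i _; case: eqP.
Qed.

Lemma sum_mset (S : {set 'I_N}) (F : nat * nat -> nat) :
  \sum_(x <- [seq (u (nat_of_ord i), v (nat_of_ord i)) | i : 'I_N <- enum S]) F x = \sum_(i in S) F (u i, v i).
Proof. by rewrite big_map big_enum. Qed.

Lemma ksE : ks = [seq (u (nat_of_ord i), v (nat_of_ord i)) | i : 'I_N <- enum 'I_N].
Proof. by rewrite /ks /mkseq -val_enum_ord -map_comp. Qed.

Let tot_pre : tot m (fun a => 0 < cnt a) (count_pre k u) = ZU.
Proof.
rewrite /tot /ZU; transitivity (\sum_(a < m.+1) \sum_(i < k) (u i == a) * a).
  rewrite [LHS]big_mkcond; apply: eq_bigr => a _; rewrite -big_distrl /= -/(count_pre k u a).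
  case: posnP => // c0; have := count_pre_le u kN a; rewrite -/(cnt a) c0 leqn0 => /eqP->.
  by rewrite mul0n.
rewrite exchange_big; apply: eq_bigr => i _.
have /um/andP[_ uim] : i < N by apply: leq_trans kN.
have um' : u i < m.+1 by [].
rewrite (bigD1 (Ordinal um')) //= eqxx mul1n big1 ?addn0 // => a; rewrite -val_eqE /= => /negbTE.
by rewrite eq_sym => ->.
Qed.

Lemma chosen_le j : dp (OM + j) <= W -> ZU + j <= z.
Proof.
have [_ _ snd _] := inv; move=> le; have /snd[t [ft Et Ev]] := leq_ltn_trans le WINF.
have ft' a : t a <= ccount ks a by rewrite -cntE.
have [e [es e1 e2]] := select_sound m ft'.
have [ub _] := opt; have := ub e es; rewrite e2 e1.
have -> : \sum_(a < m.+1 | 0 < ccount ks a) pfx ks a (t a) = dp (OM + j).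
  by rewrite Ev; apply: eq_bigl => a; rewrite cntE.
have -> : \sum_(a < m.+1 | 0 < ccount ks a) t a * a = tot m (fun a => 0 < cnt a) t.
  by apply: eq_bigl => a; rewrite cntE.
by move=> /(_ le); move: Et; rewrite tot_pre; clear; lia.
Qed.

(** An optimal set is replaced by a [tight] one with the same profit and no more weight. For that
    one [window_bound] gives the [inside] condition, so the table accounts for it. *)
Lemma chosen_ex : exists j, [/\ j <= OM, dp (OM + j) <= W & ZU + j = z].
Proof.
have [ub [e [es eW ez]]] := opt.
have [S0 p] : exists S0 : {set 'I_N}, perm_eq e [seq (u (nat_of_ord i), v (nat_of_ord i)) | i : 'I_N <- enum S0].
  by apply: set_of_ms; rewrite -ksE.
have suE (S : {set 'I_N}) : su u S = sum1 [seq (u (nat_of_ord i), v (nat_of_ord i)) | i : 'I_N <- enum S].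
  by rewrite /sum1 sum_mset.
have svE (S : {set 'I_N}) : sv v S = sum2 [seq (u (nat_of_ord i), v (nat_of_ord i)) | i : 'I_N <- enum S].
  by rewrite /sum2 sum_mset.
have E1 : su u S0 = z by rewrite suE -ez /sum1 (perm_big _ p).
have E2 : sv v S0 <= W by rewrite svE; apply: leq_trans eW; rewrite /sum2 (perm_big _ p).
have [x tx [Ex xv]] := tight_exists u v S0.
have xW : sv v x <= W := leq_trans xv E2.
(* The greedy prefix is itself feasible. *)
have zx : ZU <= su u x.
  pose pre := [set i : 'I_N | i < k].
  have pe (f : nat -> nat) : \sum_(i < k) f i = \sum_(i in pre) f i.
    by rewrite (big_ord_widen _ f kN); apply: eq_bigl => i; rewrite inE.
  rewrite Ex E1 /ZU (pe u) -/(su u pre) suE; apply: ub; first by rewrite ksE; apply: sub_ms_set.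
  by rewrite -svE /sv -(pe v).
pose t := count_in u x.
have ft a : t a <= cnt a by apply: count_in_le.
have totx : tot m (fun a => 0 < cnt a) t = su u x.
  pose ex := [seq (u (nat_of_ord i), v (nat_of_ord i)) | i : 'I_N <- enum x].
  have exs : sub_ms ex ks by rewrite ksE; apply: sub_ms_set.
  have [_ e1 _] := select_complete km exs.
  rewrite suE e1 /tot; apply: eq_big => a; first by rewrite cntE.
  move=> _; congr (_ * _); rewrite /t /count_in /ex count_map -sum1_card -sum1_count big_enum_cond /=.
  by apply: eq_bigl => i; rewrite !inE.
have ins : inside NL m cnt (count_pre k u) alpha (width m NL) t.
  move=> b bN; rewrite /dev /live; have hh := window_bound um m_gt0 ratio kN fits breaks scans marked alpha_le densityNL tx xW zx bN; exact: hh.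
have [_ supp _ cmp] := inv.
have Etot : OM + (z - ZU) + tot m (fun a => 0 < cnt a) (count_pre k u) = OM + tot m (fun a => 0 < cnt a) t.
  by rewrite tot_pre totx Ex E1; move: zx; rewrite Ex E1; lia.
have h := cmp t _ ft ins Etot.
have hW : dp (OM + (z - ZU)) <= W.
  apply: leq_trans h _; apply: leq_trans xW.
  pose ex := [seq (u (nat_of_ord i), v (nat_of_ord i)) | i : 'I_N <- enum x].
  have exs : sub_ms ex ks by rewrite ksE; apply: sub_ms_set.
  have [_ _ e2] := select_complete km exs.
  rewrite svE; apply: leq_trans e2; apply: eq_leq; rewrite /val; apply: eq_big => a; first by rewrite cntE.
  move=> _; congr pfx; rewrite /t /count_in /ex count_map -sum1_card -sum1_count big_enum_cond /=.
  by apply: eq_bigl => i; rewrite !inE.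
exists (z - ZU); split=> //.
  by have := supp _ (leq_ltn_trans hW WINF); lia.
by move: zx; rewrite Ex E1; lia.
Qed.

End ModeB.

(** * Loading the input *)

Notation vn := 1. Notation vW := 2. Notation vSave := 3.
Notation vSP := 9. Notation vSW := 10. Notation vPM := 11. Notation vWM := 12.
Notation aP := 0. Notation aW := 1.

(* Compiled code overwrites the cells below 64; the prologue has moved cell [a] < 64 to [S + a - 1]. *)
Definition home (S a : nat) := if a < 64 then S + a - 1 else a.

Definition rawaddr (a : expr) : expr := a [+] (a [<] 64) [*] (#vSave [-] 1) [-] 64.
Definition raw (a : expr) : expr := Ld (rawaddr a) (rawaddr a [/] 16).

(** Items are read from the last to the first: entry [d] of an array lies above the cells of items
    [0] to [d], so no unread input is overwritten, and the moved cells lie beyond all entries. The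
    bit in variable [6] clips an item heavier than the capacity to [(0, 0)]. A running maximum is
    [x + (y - x)] with truncated subtraction. *)
Definition load : cmd :=
  vSave ::= #0 [-] 62 ;; vn ::= #vSave [/] 1024 ;; vW ::= raw 1 ;;
  vSP ::= 0 ;; vSW ::= 0 ;; vPM ::= 0 ;; vWM ::= 0 ;;
  FOR vI TO #vn DO
    7 ::= #vn [-] 1 [-] #vI ;;
    8 ::= raw (#7 [*] 2 [+] 2) ;; 5 ::= raw (#7 [*] 2 [+] 3) ;;
    6 ::= #5 [<] (#vW [+] 1) ;; 8 ::= #8 [*] #6 ;; 5 ::= #5 [*] #6 ;;
    aP @@ (#7) ::= #8 ;; aW @@ (#7) ::= #5 ;;
    vSP ::= #vSP [+] #8 ;; vSW ::= #vSW [+] #5 ;;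
    vPM ::= #vPM [+] (#8 [-] #vPM) ;; vWM ::= #vWM [+] (#5 [-] #vWM)
  OD.

Lemma home_cell N d a j x : d < N -> 0 < a <= 2 * d + 3 -> j < 16 ->
  x * 16 + j + 64 = home (1024 * N) a -> (x < d.+1) || (N <= x).
Proof. by rewrite /home; case: ifP => *; lia. Qed.

Section Load.
Variables (V W : nat) (items : seq (nat * nat)).
Let n := size items.
Let S := 1024 * n.
Let pf i := (clip W (nth (0, 0) items i)).1.
Let wf i := (clip W (nth (0, 0) items i)).2.
Hypothesis n_gt0 : 0 < n.
Hypothesis HS : S + 64 < V.
Hypothesis HW : W < V.
Hypothesis Hp : \sum_(i < n) (nth (0, 0) items i).1 < V.
Hypothesis Hw : \sum_(i < n) (nth (0, 0) items i).2 < V.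

Lemma S_ge : 1024 * 1 <= S. Proof. by rewrite leq_mul2l. Qed.

Definition init_state s := va s 0 = S + 62 /\ forall a, 0 < a < n * 2 + 2 ->
  let b := home S a - 64 in ar s (b %% 16) (b %/ 16) = init_mem items W a.

Lemma pf_sum : \sum_(i < n) pf i < V.
Proof.
apply: leq_ltn_trans Hp; apply: leq_sum => i _; rewrite /pf /clip; case: ifP => //.
Qed.

Lemma wf_sum : \sum_(i < n) wf i < V.
Proof.
apply: leq_ltn_trans Hw; apply: leq_sum => i _; rewrite /wf /clip; case: ifP => //.
Qed.

Lemma term_le (f : nat -> nat) i : i < n -> f i <= \sum_(i < n) f i.
Proof. by move=> iN; rewrite (bigD1 (Ordinal iN)) //= leq_addr. Qed.

Lemma raw_ok s' s e a : init_state s -> va s' vSave = S -> ev s' e = a -> 0 < a < n * 2 + 2 ->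
  (forall j x, j < 16 -> x * 16 + j + 64 = home S a -> ar s' j x = ar s j x) ->
  ev s' (raw e) = init_mem items W a.
Proof.
move=> [_ H] E3 Ee an same; have := H a an; rewrite /raw /rawaddr /= Ee E3.
have -> : a + (a < 64) * (S - 1) - 64 = home S a - 64.
  by rewrite /home; case: ifP => /= h; lia.
move=> <-; apply: same; first by rewrite ltn_mod.
have : 64 <= home S a by rewrite /home; case: ifP => h; move: S_ge an h; move: S (n * 2 + 2) => T z; clear; lia.
by have := divn_eq (home S a - 64) 16; lia.
Qed.

Lemma init_p i : i < n -> init_mem items W (i * 2 + 2) = (nth (0, 0) items i).1.
Proof.
move=> iN; rewrite /init_mem addn2 /= !subSS subn0 muln2 ltn_double iN odd_double doubleK.
by [].
Qed.

Lemma init_w i : i < n -> init_mem items W (i * 2 + 3) = (nth (0, 0) items i).2.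
Proof.
move=> iN; rewrite /init_mem addn3 /= !subSS subn0 muln2.
have -> : i.*2.+1 < n.*2 by move: iN; clear; lia.
by rewrite /= odd_double /= uphalf_double.
Qed.

Lemma load_ok s : init_state s -> wp V load s (fun s' t => t <= 20 * n + 20 /\
  [/\ va s' vn = n, va s' vW = W & forall i, i < n -> ar s' aP i = pf i /\ ar s' aW i = wf i] /\
  [/\ va s' vSP = \sum_(0 <= i < n) pf i, va s' vSW = \sum_(0 <= i < n) wf i,
      va s' vPM = \max_(0 <= i < n) pf i & va s' vWM = \max_(0 <= i < n) wf i]).
Proof.
move=> ini; have [E0 _] := ini.
have V1 : 1 < V by move: HS; move: (S); clear; lia.
step; first by rewrite E0; lia.
have ES : va s 0 - 62 = S by rewrite E0 addnK.
step; first by rewrite ES; apply: leq_ltn_trans (leq_div _ _) _; lia.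
have En : S %/ 1024 = n by rewrite /S mulKn.
rewrite ES En; set s1 := setv _ _ _.
have ev1 : ev s1 (raw 1) = W.
  change (ev s1 (raw 1) = init_mem items W 1); apply: (raw_ok ini) => //; lia.
rewrite /= in ev1; step; first by rewrite ev1.
rewrite ev1; do 4 (step; first by lia).
apply: (@wp_for _ _ _ _ _ n (fun i s' t => [/\ t <= 16 * i,
   (forall j x, j < 16 -> (x < n - i) || (n <= x) -> ar s' j x = ar s j x),
   (forall x, n - i <= x < n -> ar s' aP x = pf x /\ ar s' aW x = wf x) &
   [/\ va s' vSP = \sum_(n - i <= i < n) pf i, va s' vSW = \sum_(n - i <= i < n) wf i,
      va s' vPM = \max_(n - i <= i < n) pf i & va s' vWM = \max_(n - i <= i < n) wf i]])) => //.
- by lia.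
- by move=> s' [fv _]; rewrite /= fv.
- by rewrite subn0; split=> //; [move=> x; lia | split; rewrite big_geq].
- move=> i s' t iN [tle old new [ESP ESW EPM EWM]] Ei [fv fa].
  have E3 : va s' vSave = S by rewrite fv.
  have E1 : va s' vn = n by rewrite fv.
  have E2 : va s' vW = W by rewrite fv.
  set d := n - i.+1; have dN : d < n by lia.
  have En1 : n - 1 - i = d by lia.
  have Ed1 : n - i = d.+1 by lia.
  step; first by rewrite E1; lia.
  rewrite E1 Ei En1; set s2 := setv _ 7 d.
  have cells a j x : 0 < a <= 2 * d + 3 -> j < 16 -> x * 16 + j + 64 = home S a -> ar s2 j x = ar s j x.
    by move=> ha j16 hx; apply: old => //; rewrite Ed1; exact: home_cell dN ha j16 hx.
  have v1 : ev s2 (raw (#7 [*] 2 [+] 2)) = (nth (0, 0) items d).1.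
    rewrite -init_p //; apply: (raw_ok ini) => //; first by lia.
    by move=> j x; apply: cells; lia.
  have p1 := term_le (fun i => (nth (0, 0) items i).1) dN.
  have p2 := term_le (fun i => (nth (0, 0) items i).2) dN.
  rewrite /= in v1; step; first by rewrite v1; apply: leq_ltn_trans Hp.
  rewrite v1; set s3 := setv _ 8 _.
  have v2 : ev s3 (raw (#7 [*] 2 [+] 3)) = (nth (0, 0) items d).2.
    rewrite -init_w //; apply: (raw_ok ini) => //; first by lia.
    by move=> j x; apply: cells; lia.
  rewrite /= in v2; step; first by rewrite v2; apply: leq_ltn_trans Hw.
  rewrite v2; set pd := (nth _ _ d).1 in v1 p1 *; set wd := (nth _ _ d).2 in v2 p2 *.
  have fl : wd < W + 1 = (wd <= W) by rewrite addn1.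
  have epf : pd * (wd <= W) = pf d by rewrite /pf /clip -/wd -/pd; case: ifP; rewrite ?muln1 ?muln0.
  have ewf : wd * (wd <= W) = wf d by rewrite /wf /clip -/wd -/pd; case: ifP; rewrite ?muln1 ?muln0.
  have q1 := term_le pf dN; have q2 := term_le wf dN; have q3 := pf_sum; have q4 := wf_sum.
  have pV : pf d < V by lia.
  have wV : wf d < V by lia.
  have sumle (f : nat -> nat) : f d + \sum_(d.+1 <= i0 < n) f i0 <= \sum_(i0 < n) f i0.
    by rewrite -big_ltn // -[leqRHS](big_mkord xpredT f) [leqRHS](big_cat_nat (n := d)) //= ?leq_addl // ltnW.
  have s1le := sumle pf; have s2le := sumle wf.
  have maxle (f : nat -> nat) : \max_(d.+1 <= i0 < n) f i0 <= \sum_(d.+1 <= i0 < n) f i0.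
    by elim/big_ind2: _ => // *; lia.
  have m1le := maxle pf; have m2le := maxle wf.
  step; first exact: leq_ltn_trans (leq_b1 _) V1.
  rewrite E2 fl; step; first by rewrite epf.
  rewrite epf; step; first by rewrite ewf.
  rewrite ewf; step => //; step => //.
  step; first by rewrite ESP Ed1; lia.
  step; first by rewrite ESW Ed1; lia.
  step; first by rewrite EPM Ed1; lia.
  step; first by rewrite EWM Ed1; lia.
  rewrite ESP ESW EPM EWM Ed1; split.
  + by lia.
  + move=> j x j16 hx; have xd : x != d by rewrite -/d in hx; lia.
    rewrite -old //; last by move: hx; rewrite Ed1 -/d; clear; lia.
    by case: (eqn j 1) => /=; case: (eqn j 0); rewrite /= ?(negbTE xd).
  + move=> x hx; case: (x =P d) => [->//|xd]; apply: new; move: hx xd; rewrite Ed1 -/d; clear; lia.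
  + rewrite !(big_ltn dN); split; rewrite 1?addnC //; rewrite maxnE; lia.
- move=> s' t [tle _ new [ESP ESW EPM EWM]] _ [fv fa]; rewrite subnn in new ESP ESW EPM EWM.
  split; first by lia.
  by split; split=> //; rewrite fv.
Qed.

End Load.

(** * Moving the input out of the working cells *)

Definition saves lo cnt : program := flatten [seq [:: IAdd 0 0 1; IStore 0 a] | a <- iota lo cnt].

(** Every low cell may hold input, so the target address [1024 * n] is computed by doubling cell [0]
    in place. Once cell [1] has been stored there, it is free to hold the increment [1] for the
    remaining cells. *)
Definition prologue : program :=
  nseq 10 (IAdd 0 0 0) ++ [:: IStore 0 1; IConst 1 1] ++ saves 2 62.

Section Prologue.
Variables (w : nat) (P : program) (items : seq (nat * nat)) (W : nat).
Let n := size items.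
Let S := 1024 * n.
Let m0 := init_mem items W.
Hypothesis n_gt0 : 0 < n.
Hypothesis HS : S + 64 < 2 ^ w.
Hypothesis mw : forall x, m0 x < 2 ^ w.

Lemma doublings pc j m : code_at P pc (nseq j (IAdd 0 0 0)) -> m 0 * 2 ^ j < 2 ^ w ->
  exists m', [/\ runs w P pc m j (pc + j) m', m' 0 = m 0 * 2 ^ j & forall x, x != 0 -> m' x = m x].
Proof.
elim: j pc m => [|j IH] pc m cd lt.
  by exists m; rewrite addn0 muln1; split=> //; apply: runs0.
have [E cd'] := code_at_cons cd.
have E1 : m 0 + m 0 = m 0 * 2 by rewrite muln2 addnn.
have lt1 : m 0 * 2 * 2 ^ j < 2 ^ w by rewrite -mulnA -expnS.
have [|m' [r e0 ex]] := IH pc.+1 (upd m 0 (m 0 * 2)) cd'; first by rewrite /upd eqxx.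
exists m'; split.
- rewrite -addn1 addnC -addSnnS; apply: runs_trans r.
  apply: runs_write; first by rewrite E /= E1.
  by apply: leq_ltn_trans lt1; rewrite leq_pmulr ?expn_gt0.
- by rewrite e0 /upd eqxx expnS mulnA.
- by move=> x x0; rewrite ex // /upd (negbTE x0).
Qed.

Definition saved b (m : nat -> nat) := [/\ m 0 = S + b - 1, m 1 = 1,
  forall a, 0 < a <= b -> m (S + a - 1) = m0 a &
  forall x, 1 < x -> (x < S) || (S + b - 1 < x) -> m x = m0 x].

Lemma saves_ok cnt b pc m : code_at P pc (saves b.+1 cnt) -> 0 < b -> b + cnt < 64 -> saved b m ->
  exists m', runs w P pc m (2 * cnt) (pc + 2 * cnt) m' /\ saved (b + cnt) m'.
Proof.
have S1 : 1024 * 1 <= S by rewrite leq_mul2l.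
elim: cnt b pc m => [|cnt IH] b pc m cd b0 bc [h0 h1 h2 h3].
  by exists m; rewrite !addn0; split=> //; apply: runs0.
have [E1 cd1] := code_at_cons cd; have [E2 cd2] := code_at_cons cd1.
pose m1 := upd m 0 (S + b); pose m2 := upd m1 (S + b) (m0 b.+1).
have e1 : m 0 + m 1 = S + b by rewrite h0 h1; lia.
have e2 : m1 b.+1 = m0 b.+1.
  by rewrite /m1 /upd /= h3 //; apply/orP; left; lia.
have sv : saved b.+1 m2.
  have Sb0 : S + b != 0 by lia.
  have Sb1 : S + b != 1 by lia.
  split.
  - by rewrite /m2 /upd eq_sym (negbTE Sb0) /m1 /upd eqxx; lia.
  - by rewrite /m2 /upd eq_sym (negbTE Sb1) /m1 /upd.
  - move=> a ab; rewrite /m2 /upd; case: eqP => [e|ne].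
      by have -> : a = b.+1 by lia.
    rewrite /m1 /upd; have -> : (S + a - 1 == 0) = false by lia.
    by apply: h2; lia.
  - move=> x x1 hx; rewrite /m2 /upd; have -> : (x == S + b) = false by lia.
    rewrite /m1 /upd; have -> : (x == 0) = false by lia.
    by apply: h3; lia.
have [|m' [r sv']] := IH b.+1 pc.+2 m2 cd2 isT _ sv; first by lia.
exists m'; split; last by rewrite addnS -addSn.
have -> : 2 * cnt.+1 = 1 + (1 + 2 * cnt) by lia.
have -> : pc + (1 + (1 + 2 * cnt)) = pc.+2 + 2 * cnt by lia.
apply: runs_trans (runs_trans _ r).
  by apply: (@runs_write _ _ _ _ 0 (S + b)); rewrite ?E1 /= ?e1 //; lia.
apply: (@runs_write _ _ _ _ (S + b) (m0 b.+1)); last exact: mw.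
rewrite E2; change (Some (m1 0, m1 b.+1) = Some (S + b, m0 b.+1)).
by rewrite e2 /m1 /upd eqxx.
Qed.

(** [136 = 10 + 2 + 2 * 62]: the doublings, the treatment of cell [1], and two instructions for each
    of the cells [2] to [63]. *)
Lemma prologue_ok : code_at P 0 prologue -> exists m s,
  [/\ runs w P 0 m0 136 136 m, rel s m, init_state W items s &
    forall V, S + 64 < V -> (forall x, m0 x < V) -> bounded V s].
Proof.
have S1 : 1024 * 1 <= S by rewrite leq_mul2l.
move=> cd; have [cd1 cd'] := code_at_cat cd; have [cd2 cd3] := code_at_cat cd'; rewrite !size_nseq !add0n /= in cd2 cd3.
have E0 : m0 0 * 2 ^ 10 = S by rewrite /m0 /init_mem eqxx mulnC.
have [|m1 [r1 e1 x1]]   := @doublings 0 10 m0 cd1; first by rewrite E0; lia.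
rewrite E0 in e1.
have [F1 cd2'] := code_at_cons cd2; have [F2 _] := code_at_cons cd2'.
pose m2 := upd m1 S (m0 1); pose m3 := upd m2 1 1.
have r2 : runs w P 10 m1 1 11 m2.
  by apply: runs_write; rewrite ?F1 /= ?e1 ?x1.
have r3 : runs w P 11 m2 1 12 m3.
  by apply: runs_write; rewrite ?F2 //=; lia.
have sv : saved 1 m3.
  split.
  - rewrite /m3 /upd /= /m2 /upd; have -> : (0 == S) = false by lia.
    by rewrite e1; lia.
  - by rewrite /m3 /upd eqxx.
  - move=> a a1; have -> : a = 1 by lia.
    rewrite /m3 /upd; have -> : (S + 1 - 1 == 1) = false by lia.
    by rewrite /m2 /upd addnK eqxx.
  - move=> x x1' hx; rewrite /m3 /upd; have -> : (x == 1) = false by lia.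
    rewrite /m2 /upd; have -> : (x == S) = false by lia.
    by rewrite x1 //; lia.
have [m [r4 [h0 h1 h2 h3]]] := saves_ok cd3 isT isT sv.
exists m, (State m (fun j i => m (64 + 16 * i + j))); split.
- have := runs_trans r1 (runs_trans r2 (runs_trans r3 r4)).
  by [].
- by [].
- split=> /=; first by rewrite h0 -/n -/S; lia.
  move=> a an; rewrite -/n -/S.
  have hm : 64 <= home S a by rewrite /home; case: ifP => hh; move: S1 hh an; move: (S) (n) => x y; clear; lia.
  have -> : 64 + 16 * ((home S a - 64) %/ 16) + (home S a - 64) %% 16 = home S a.
    by have := divn_eq (home S a - 64) 16; lia.
  rewrite /home; case: ifP => hh; first by apply: h2; move: an hh; clear; lia.
  by apply: h3; move: an hh n_gt0; rewrite -/n /S; move: (n) => y; clear; lia.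
- move=> V SV mV.
  suff mb x : m x < V by split=> *; apply: mb.
  case: (posnP x) => [->|x0]; first by rewrite h0; lia.
  case: (x =P 1) => [->|ne]; first by rewrite h1; lia.
  case: (boolP ((x < S) || (S + 63 - 1 < x))) => hx; first by rewrite h3 //; lia.
  have -> : x = S + (x - S).+1 - 1 by lia.
  by rewrite h2 //; lia.
Qed.

End Prologue.

(** * Sorting by efficiency *)

Notation vMode := 13. Notation vBB := 16. Notation vQQ := 17. Notation aU := 4. Notation aV := 5.

Notation gK := 21. Notation vZU := 22. Notation vZV := 23. Notation vG := 24.

Lemma sum_bool_le h (p : nat -> bool) : \sum_(j < h) p j <= h.
Proof. by elim: h => [|h IH]; rewrite ?big_ord0 // big_ord_recr /= -addn1 leq_add // leq_b1. Qed.

(** [vMode] decides which input array plays [u]. Entries with [u = 0] are dropped: profitless items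
    need not be chosen, and weightless items need not be left out. *)
Definition compact : cmd :=
  vC ::= 0 ;;
  FOR vI TO #vn DO
    7 ::= Ld (Cst 1 [-] #vMode) (#vI) ;; 8 ::= Ld (#vMode) (#vI) ;;
    IF #7 THEN aX @@ (#vC) ::= ((#8 [*] #vQQ) [/] #7 [*] #vBB [+] #7) [*] #vBB [+] #8 ;; vC ::= #vC [+] 1
    ELSE Skip FI
  OD.

Definition unpack : cmd :=
  FOR vI TO #vC DO
    7 ::= aX @ (#vI) ;; aU @@ (#vI) ::= (#7 [/] #vBB) [%] #vBB ;; aV @@ (#vI) ::= #7 [%] #vBB
  OD.

Definition sortitems : cmd :=
  compact ;; vXM ::= #vBB [*] #vBB [*] #vBB [*] #vQQ ;; radix ;; unpack.

Lemma div_step u1 v1 u2 v2 Q : 0 < u1 -> 0 < u2 -> u1 * u2 <= Q ->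
  v1 * Q %/ u1 <= v2 * Q %/ u2 -> v1 * u2 <= v2 * u1.
Proof.
move=> p1 p2 h le; rewrite leqNgt; apply/negP => lt.
set q := v2 * Q %/ u2 in le.
have h2 : q * u2 <= v2 * Q := leq_trunc_div _ _.
have : q.+1 <= v1 * Q %/ u1; last by lia.
rewrite leq_divRL // -(leq_pmul2r p2) mulSn mulnDl.
have e1 : q * u1 * u2 <= v2 * Q * u1 by rewrite mulnAC leq_mul2r h2 orbT.
have e2 : v2 * Q * u1 + Q <= v1 * Q * u2.
  have -> : v2 * Q * u1 + Q = (v2 * u1).+1 * Q by clear; lia.
  by rewrite mulnAC leq_mul2r lt orbT.
by apply: leq_trans e2; rewrite addnC leq_add.
Qed.

Section Sort.
Variables (V n m BB E : nat) (uf vf : nat -> nat).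
Let QQ := (m + 1) * (m + 1).
Let XM := BB * BB * BB * QQ.
Hypothesis um : forall i, i < n -> uf i <= m.
Hypothesis mBB : m < BB.
Hypothesis vBB' : forall i, i < n -> vf i < BB.
Hypothesis HV : 4 * XM + 4 < V.
Hypothesis nV : n + 1 < V.
Hypothesis HE : XM < 2 ^ E.

(* Distinct ratios v/u with u <= m differ by more than 1/QQ, so their rounded keys differ. *)
Definition key (x : nat * nat) := (x.2 * QQ %/ x.1 * BB + x.1) * BB + x.2.
Definition dec x := ((x %/ BB) %% BB, x %% BB).
Definition kept := [seq x <- mkseq (fun i => (uf i, vf i)) n | 0 < x.1].

Lemma kept_ok x : x \in kept -> [/\ 0 < x.1 <= m & x.2 < BB].
Proof.
rewrite mem_filter => /andP[x0 /mapP[i]]; rewrite mem_iota => /andP[_ iN] e.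
by move: x0; rewrite e /= => ->; rewrite um // vBB'.
Qed.

Lemma BB0 : 0 < BB. Proof. by apply: leq_trans mBB. Qed.

Lemma key_lt x : 0 < x.1 <= m -> x.2 < BB -> key x < XM.
Proof.
case: x => u v /= /andP[u0 um'] vB; rewrite /key /=.
have h1 : v * QQ %/ u < BB * QQ.
  apply: leq_ltn_trans (leq_div _ _) _; rewrite ltn_mul2r vB andbT /QQ addn1 muln_gt0 //.
have b := BB0.
have h2 : v * QQ %/ u * BB + u < BB * QQ * BB.
  apply: leq_trans (_ : (v * QQ %/ u).+1 * BB <= _); first by rewrite mulSn; lia.
  by rewrite leq_mul2r h1 orbT.
apply: leq_trans (_ : (v * QQ %/ u * BB + u).+1 * BB <= _); first by rewrite mulSn; lia.
by apply: leq_trans (_ : BB * QQ * BB * BB <= _); [rewrite leq_mul2r h2 orbT | rewrite /XM; lia].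
Qed.

Lemma keyK x : 0 < x.1 <= m -> x.2 < BB -> dec (key x) = x.
Proof.
case: x => u v /= /andP[_ um'] vB; rewrite /dec /key /=; congr pair.
  by rewrite divnMDl ?BB0 // (divn_small vB) addn0 modnMDl modn_small //; lia.
by rewrite modnMDl modn_small.
Qed.

Lemma key_top x : 0 < x.1 <= m -> x.2 < BB -> key x %/ BB %/ BB = x.2 * QQ %/ x.1.
Proof.
case: x => u v /= /andP[_ um'] vB; rewrite /key /= divnMDl ?BB0 // (divn_small vB) addn0.
by rewrite divnMDl ?BB0 // [u %/ BB]divn_small ?addn0 //; lia.
Qed.

Lemma key_ratio x y : 0 < x.1 <= m -> x.2 < BB -> 0 < y.1 <= m -> y.2 < BB ->
  key x <= key y -> x.2 * y.1 <= y.2 * x.1.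
Proof.
move=> hx vx hy vy le; have := leq_div2r BB (leq_div2r BB le); rewrite !key_top //.
case/andP: hx => x0 xm; case/andP: hy => y0 ym.
by apply: div_step => //; rewrite /QQ leq_mul // addn1 ltnW.
Qed.

Definition sort_pre s := [/\ va s vn = n, va s vBB = BB, va s vQQ = QQ &
  forall i, i < n -> ar s ((1 - va s vMode) %% 16) i = uf i /\ ar s (va s vMode %% 16) i = vf i] /\ va s vMode <= 1.

Lemma compact_ok s : sort_pre s -> wp V compact s (fun s' t => [/\ t <= 10 * n + 10,
  va s' vC = size kept & mkseq (ar s' aX) (size kept) = map key kept]).
Proof.
move=> [[En EB EQ EA] md].
pose F i := [seq x <- mkseq (fun i => (uf i, vf i)) i | 0 < x.1].
step; first by lia.
apply: (@wp_for _ _ _ _ _ n (fun i s' t => [/\ t <= 8 * i, va s' vC = size (F i) &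
   forall j, j < size (F i) -> ar s' aX j = nth 0 (map key (F i)) j])) => //.
- by lia.
- by move=> s' [fv _]; rewrite /= fv.
- move=> i s' t iN [tle EC EX] Ei [fv fa].
  have Em : va s' vMode = va s vMode by rewrite fv.
  have EB' : va s' vBB = BB by rewrite fv.
  have EQ' : va s' vQQ = QQ by rewrite fv.
  have [E1 E2] := EA i iN.
  have e1 : ar s' ((1 - va s vMode) %% 16) i = uf i by rewrite fa //; case: (va s vMode) md => [|[]].
  have e2 : ar s' (va s vMode %% 16) i = vf i by rewrite fa //; case: (va s vMode) md => [|[]].
  have uV : uf i < V by have := um iN; have := BB0; move: mBB HV; rewrite /XM /QQ; nia.
  have bV : BB < V by have := BB0; move: HV; rewrite /XM /QQ; clear; nia.
  have szF : size (F i) <= i by rewrite size_filter; apply: leq_trans (count_size _ _) _; rewrite size_mkseq.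
  step; first by rewrite Em Ei e1.
  rewrite Em Ei e1; step; first by rewrite Em Ei e2; apply: ltn_trans (vBB' iN) bV.
  rewrite Em Ei e2 /F mkseqS filter_rcons.
  step => [/eqP|] u0; rewrite -?lt0n in u0.
    have hu : 0 < (uf i, vf i).1 <= m by rewrite /= u0 um.
    have kl := key_lt hu (vBB' iN).
    step; first by rewrite EQ' EB'; move: kl HV; rewrite /key /=; clear; lia.
    step; first by rewrite EC; lia.
    rewrite u0 map_rcons EC EQ' EB' size_rcons addn1; split=> //; first by lia.
    move=> j jF; rewrite nth_rcons size_map; case: ltngtP => // [lt|gt].
      exact: EX.
    by move: jF gt; rewrite ltnS leqNgt => /negbTE->.
  step; rewrite u0 /=; split=> //; by lia.
- move=> s' t [tle EC EX] _ _; split=> //; first by lia.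
  apply: (@eq_from_nth _ 0); rewrite size_mkseq ?size_map // => j jF.
  by rewrite nth_mkseq // EX.
Qed.

Lemma sortitems_ok s : sort_pre s -> let C := size kept in
  wp V sortitems s (fun s' t => [/\ t <= (15 * n + 15) * E + 20 * n + 20, va s' vC = C,
    va s' vXM = XM, perm_eq (mkseq (fun i => (ar s' aU i, ar s' aV i)) C) kept &
    forall i j, i <= j < C -> ar s' aV i * ar s' aU j <= ar s' aV j * ar s' aU i]).
Proof.
move=> pre C; have [[En EB EQ EA] md] := pre.
have Cn : C <= n by rewrite /C size_filter; apply: leq_trans (count_size _ _) _; rewrite size_mkseq.
apply: wp_seq (compact_ok pre) _ => s1 t1 [t1le EC1 EX1] [fv1 fa1]; rewrite -/C in EC1 EX1.
have EB1 : va s1 vBB = BB by rewrite fv1.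
have EQ1 : va s1 vQQ = QQ by rewrite fv1.
step; first by rewrite EB1 EQ1 -/XM; move: HV; clear; lia.
rewrite EB1 EQ1 -/XM; set s2 := setv _ _ _.
have xle i : i < C -> ar s2 aX i <= XM.
  move=> iC; have : ar s1 aX i \in map key kept by rewrite -EX1; apply: map_f; rewrite mem_iota.
  by case/mapP => x /kept_ok[h1 h2] /= ->; apply: ltnW; apply: key_lt.
have CV : C + 1 < V by apply: leq_ltn_trans nV; rewrite leq_add2r.
have HN : 4 * XM + 4 < V := HV.
apply: wp_seq (radix_ok HV CV HE (_ : va s2 vC = C) (_ : va s2 vXM = XM) xle) _ => //.
move=> s3 t3 [t3le pm so] [fv3 fa3]; rewrite EX1 in pm.
have EB3 : va s3 vBB = BB by rewrite fv3.
have EC3 : va s3 vC = C by rewrite fv3.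
have EM3 : va s3 vXM = XM by rewrite fv3.
have BV : BB < V by have := BB0; move: HV; rewrite /XM /QQ; clear; nia.
have inX i : i < C -> exists2 x, x \in kept & ar s3 aX i = key x.
  move=> iC; have : ar s3 aX i \in map key kept.
    by rewrite -(perm_mem pm); apply: map_f; rewrite mem_iota.
  by case/mapP => x xk e; exists x.
apply: (@wp_for _ _ _ _ _ C (fun i s' t => t <= 5 * i /\
   forall j, j < i -> ar s' aU j = (dec (ar s3 aX j)).1 /\ ar s' aV j = (dec (ar s3 aX j)).2)) => //.
- by lia.
- by move=> s' [fv _]; rewrite /= fv.
- move=> i s' t iC [tle H] Ei [fv fa].
  have [x xk ex] := inX i iC; have [h1 h2] := kept_ok xk.
  have EX' : ar s' aX i = key x by rewrite fa.
  have EB' : va s' vBB = BB by rewrite fv.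
  step; first by rewrite Ei EX'; apply: leq_trans (key_lt h1 h2) _; move: HV; clear; lia.
  rewrite Ei EX'; step; first by rewrite EB'; apply: leq_trans (ltn_pmod _ BB0) (ltnW BV).
  rewrite EB'; step; first by rewrite EB'; apply: leq_trans (ltn_pmod _ BB0) (ltnW BV).
  rewrite EB' Ei; split; first by lia.
  move=> j ji; case: (j =P i) => [->|ne]; first by rewrite /dec ex.
  by apply: H; lia.
- move=> s' t [tle H] _ [fv fa].
  have pk : mkseq (fun i => (ar s' aU i, ar s' aV i)) C = map dec (mkseq (ar s3 aX) C).
    rewrite /mkseq -map_comp; apply/eq_in_map => i; rewrite mem_iota => /andP[_ iC].
    by have [-> ->] := H i iC; rewrite /dec.
  split.
  + have : (15 * C + 15) * E <= (15 * n + 15) * E by rewrite leq_mul2r; apply/orP; right; lia.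
    move: t1le t3le tle Cn; move: (_ * E) (_ * E) => a b; clear; lia.
  + by rewrite fv.
  + by rewrite fv.
  + rewrite pk; apply: perm_trans (perm_map dec pm) _; rewrite -map_comp.
    by rewrite map_id_in // => x /kept_ok[h1 h2]; apply: keyK.
  + move=> i j /andP[ij jC]; have iC := leq_ltn_trans ij jC.
    have [x xk ex] := inX i iC; have [y yk ey] := inX j jC.
    have [h1 h2] := kept_ok xk; have [h3 h4] := kept_ok yk.
    have [-> ->] := H i iC; have [-> ->] := H j jC; rewrite ex ey !keyK //.
    apply: key_ratio => //; rewrite -ex -ey.
    have := sorted_leq_nth leq_trans leqnn 0 so; move=> /(_ i j).
    by rewrite !inE size_mkseq !nth_mkseq //; apply.
Qed.

End Sort.

(** * Greedy prefix and class tables *)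

Definition clearcounts : cmd :=
  FOR vI TO #vMM [+] 1 DO aCnt @@ (#vI) ::= 0 ;; aCpre @@ (#vI) ::= 0 ;; aAl @@ (#vI) ::= 0 OD.

(** [gK] equals the loop index exactly as long as every item has been accepted, so the flag in
    variable [6] selects a prefix and never skips over an item that does not fit. [vInf] ends up
    above every [v]-sum and above the capacity. *)
Definition greedy : cmd :=
  gK ::= 0 ;; vZU ::= 0 ;; vZV ::= 0 ;; vInf ::= 0 ;;
  FOR vI TO #vC DO
    7 ::= aU @ (#vI) ;; 8 ::= aV @ (#vI) ;;
    aX @@ (#vI) ::= #7 [*] #vBB [+] #8 ;;
    vInf ::= #vInf [+] #8 ;;
    aCnt @@ (#7) ::= aCnt @ (#7) [+] 1 ;;
    6 ::= (#vI [=] #gK) [*] (#vZV [+] #8 [<] #vG [+] 1) ;;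
    vZV ::= #vZV [+] #6 [*] #8 ;; vZU ::= #vZU [+] #6 [*] #7 ;; gK ::= #gK [+] #6 ;;
    aCpre @@ (#7) ::= aCpre @ (#7) [+] #6
  OD ;;
  vInf ::= #vInf [+] #vW [+] 1.

(** After sorting by [key2] each class is a block in increasing order of [v]. A single array of
    prefix sums then serves all classes: [pfx] is the difference of two entries, counted from the
    start of the block. *)
Definition prefixes : cmd :=
  8 ::= 0 ;; aPS @@ 0 ::= 0 ;;
  FOR vI TO #vC DO 8 ::= #8 [+] (aX @ (#vI)) [%] #vBB ;; aPS @@ (#vI [+] 1) ::= #8 OD ;;
  8 ::= 0 ;;
  FOR vI TO #vMM [+] 1 DO aStart @@ (#vI) ::= #8 ;; 8 ::= #8 [+] aCnt @ (#vI) OD.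

Definition tally : cmd := clearcounts ;; greedy ;; radix ;; prefixes.

Lemma sum_iota M (F : nat -> nat) : \sum_(j <- iota 0 M) F j = \sum_(j < M) F j.
Proof. by rewrite -(big_mkord xpredT F) /index_iota subn0. Qed.

Lemma sumn_block (f : nat -> seq nat) M a t : a < M -> t <= size (f a) ->
  let L := flatten [seq f i | i <- iota 0 M] in
  sumn (take (\sum_(i < a) size (f i) + t) L) = sumn (take (\sum_(i < a) size (f i)) L) + sumn (take t (f a)).
Proof.
move=> aM tf L.
have -> : L = flatten [seq f i | i <- iota 0 a] ++ f a ++ flatten [seq f i | i <- iota a.+1 (M - a.+1)].
  rewrite /L; have -> : iota 0 M = iota 0 a ++ a :: iota a.+1 (M - a.+1).
    by have := iotaD 0 a (M - a.+1).+1; rewrite /= add0n => <-; congr iota; lia.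
  by rewrite map_cat flatten_cat.
have sz : \sum_(i < a) size (f i) = size (flatten [seq f i | i <- iota 0 a]).
  rewrite size_flatten sumnE /shape -map_comp big_map.
  by rewrite sum_iota.
rewrite sz; set A := flatten [seq f i | i <- iota 0 a]; set B := flatten _.
rewrite (take_size_cat _ (erefl (size A))) take_cat ltnNge leq_addr /= addKn take_cat.
case: ltnP => h; first by rewrite sumn_cat.
have -> : t = size (f a) by apply/eqP; rewrite eqn_leq tf h.
by rewrite subnn take0 cats0 sumn_cat take_size.
Qed.

Section Tally.
Variables (V N m W G BB XM E : nat) (u v : nat -> nat).
Hypothesis um : forall i, i < N -> u i <= m.
Hypothesis mBB : m < BB.
Hypothesis vB : forall i, i < N -> v i < BB.
Hypothesis XMB : BB * BB <= XM.
Hypothesis HV : 4 * XM + 4 < V.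
Hypothesis HE : XM < 2 ^ E.
Hypothesis NV : N + 1 < V.
Hypothesis HSv : \sum_(i < N) v i + W + G + 2 < V.
Hypothesis HSu : \sum_(i < N) u i < V.
Let ks := mkseq (fun i => (u i, v i)) N.

Definition key2 (x : nat * nat) := x.1 * BB + x.2.

Lemma key2_lt i : i < N -> key2 (u i, v i) < XM.
Proof.
move=> iN; apply: leq_trans XMB; rewrite /key2 /=.
apply: leq_trans (_ : (u i).+1 * BB <= _); first by rewrite mulSn addnC ltn_add2r vB.
by rewrite leq_mul2r (leq_ltn_trans (um iN) mBB) orbT.
Qed.

(** Listing the classes in increasing order, each one sorted, also enumerates the items in
    increasing order of [key2]; two sorted lists with the same elements are equal. *)
Lemma flatten_classes xs : sorted leq xs -> perm_eq xs (map key2 ks) ->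
  map (modn^~ BB) xs = flatten [seq scls ks a | a <- iota 0 m.+1].
Proof.
move=> so pm.
pose D := flatten [seq [seq (a, y) | y <- scls ks a] | a <- iota 0 m.+1].
have inD a y : a <= m -> y \in scls ks a -> y < BB.
  move=> am; rewrite mem_sort => /mapP[x]; rewrite mem_filter => /andP[_ /mapP[i]].
  by rewrite mem_iota => /andP[_ iN] -> ->; apply: vB.
have pD : perm_eq D ks.
  apply/allP => x _ /=; apply/eqP; rewrite /D count_flatten -map_comp sumnE big_map sum_iota /=.
  rewrite (eq_bigr (fun a : 'I_m.+1 => if x.1 == a then count_mem x.2 (scls ks a) else 0)); last first.
    by move=> a _; rewrite count_pair.
  have [xm|mx] := leqP x.1 m.
    have xm' : x.1 < m.+1 by [].
    rewrite (bigD1 (Ordinal xm')) //= eqxx big1 ?addn0.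
      by rewrite (permP (permEl (perm_sort leq _)) (pred1 x.2)) count_cls.
    by move=> a ne; case: eqP => // e; case/eqP: ne; apply: val_inj.
  rewrite big1; last by move=> a _; case: eqP => // e; have := ltn_ord a; rewrite -e ltnS leqNgt mx.
  apply/esym/count_memPn; apply/negP => /mapP[i]; rewrite mem_iota => /andP[_ iN] e.
  by move: mx; rewrite e /= ltnNge um.
have sD : sorted leq (map key2 D).
  have main j : j <= m.+1 -> let Dj := [seq key2 i | i <- flatten [seq [seq (a, y) | y <- scls ks a] | a <- iota 0 j]] in
      sorted leq Dj /\ all (fun z => z < j * BB) Dj; last by have [] := main _ (leqnn m.+1).
  elim: j => [|j IH] jm; first by [].
  have [s1 a1] := IH (ltnW jm).
  rewrite -[in iota _ _]addn1 iotaD /= add0n map_cat flatten_cat map_cat /= cats0 -map_comp.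
  have jle : j <= m by [].
  split.
    rewrite sorted_pairwise; last exact: leq_trans.
    rewrite pairwise_cat -!(sorted_pairwise leq_trans) s1 /=; apply/andP; split.
      apply/allrelP => x y /(allP a1) xj /mapP[z _ ->]; rewrite /key2 /=.
      by apply: leq_trans (ltnW xj) (leq_addr _ _).
    apply: (homo_sorted (e := leq)); last exact: scls_sorted.
    by move=> x y xy; rewrite /key2 /= leq_add2l.
  rewrite all_cat; apply/andP; split.
    by apply: sub_all a1 => x /leq_trans; apply; rewrite leq_mul2r leqnSn orbT.
  apply/allP => _ /mapP[y yj ->]; rewrite /key2 /= mulSn addnC ltn_add2r.
  exact: inD yj.
have -> : xs = map key2 D.
  apply: (sorted_eq leq_trans anti_leq) => //; apply: perm_trans pm _.
  by rewrite perm_sym; apply: perm_map.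
rewrite /D map_flatten map_flatten -!map_comp; congr flatten.
apply/eq_in_map => a; rewrite mem_iota add0n ltnS => /andP[_ am] /=.
rewrite -!map_comp -[RHS]map_id; apply/eq_in_map => y ya /=.
by rewrite /key2 /= modnMDl modn_small // (inD a).
Qed.

Definition tally_pre s := [/\ va s vMM = m, va s vW = W, va s vG = G, va s vBB = BB & va s vC = N] /\
  [/\ va s vXM = XM, forall i, i < N -> ar s aU i = u i & forall i, i < N -> ar s aV i = v i].

Lemma mV : m + 2 < V.
Proof. have : BB <= BB * BB by rewrite leq_pmulr //; lia. by move: mBB XMB HV; lia. Qed.

Definition greedy_post k s := [/\ va s gK = k, k <= N, va s vZU = \sum_(i < k) u i,
   \sum_(i < k) v i <= G & k < N -> G < \sum_(i < k.+1) v i].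

Lemma sum_le (f : nat -> nat) i j : i <= j -> \sum_(k < i) f k <= \sum_(k < j) f k.
Proof.
move=> ij; rewrite (big_ord_widen _ f ij) [leqLHS]big_mkcond /=.
by apply: leq_sum => k _; case: ifP.
Qed.

Lemma greedy_ok s : tally_pre s -> (forall a, a <= m -> ar s aCnt a = 0 /\ ar s aCpre a = 0) ->
  wp V greedy s (fun s' t => t <= 15 * N + 20 /\ exists k, [/\ greedy_post k s',
    va s' vInf = \sum_(i < N) v i + W + 1,
    forall a, a <= m -> ar s' aCnt a = count_all N u a /\ ar s' aCpre a = count_pre k u a &
    mkseq (ar s' aX) N = map key2 ks]).
Proof.
move=> [[EM EW EG EB EC] [EX EU EV]] z0; have mV' := mV.
do 4 (step; first by lia).
apply: (@wp_seq _ _ _ _ (fun s' t => t <= 13 * N + 2 /\ exists k, [/\ greedy_post k s',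
    va s' vInf = \sum_(i < N) v i,
    forall a, a <= m -> ar s' aCnt a = count_all N u a /\ ar s' aCpre a = count_pre k u a &
    mkseq (ar s' aX) N = map key2 ks])).
  apply: (@wp_for _ _ _ _ _ N (fun i s' t => t <= 13 * i /\ exists k,
    [/\ [/\ va s' gK = k, k <= i, va s' vZU = \sum_(i < k) u i, va s' vZV = \sum_(i < k) v i &
         \sum_(i < k) v i <= G /\ (k < i -> G < \sum_(i < k.+1) v i)],
    va s' vInf = \sum_(j < i) v j,
    forall a, a <= m -> ar s' aCnt a = count_all i u a /\ ar s' aCpre a = count_pre k u a &
    forall j, j < i -> ar s' aX j = key2 (u j, v j)])).
  - by [].
  - by lia.
  - by move=> s' [fv _]; rewrite /= fv.
  - split=> //; exists 0; split=> //=; rewrite ?big_ord0 //.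
    by move=> a am; rewrite /count_all /count_pre !big_ord0; apply: z0.
  - move=> i s' t iN [tle [k [[EK ki EZU EZV [fitk brk]] EI EA EXj]]] Ei [fv fa].
    have EU' : ar s' aU i = u i by rewrite fa //= EU.
    have EV' : ar s' aV i = v i by rewrite fa //= EV.
    have EG' : va s' vG = G by rewrite fv.
    have EB' : va s' vBB = BB by rewrite fv.
    have ui := um iN; have kl := key2_lt iN; rewrite /key2 /= in kl.
    have sv1 : \sum_(j < i) v j + v i <= \sum_(j < N) v j by have := sum_le v iN; rewrite big_ord_recr.
    have svk := sum_le v (leq_trans ki (ltnW iN)).
    have suk := sum_le u (leq_trans ki (ltnW iN)).
    have [EA1 EA2] := EA _ ui.
    have cle (h : nat) : h <= N -> count_all h u (u i) <= N.
      by move=> hN; apply: leq_trans hN; apply: (sum_bool_le _ (fun j => u j == u i)).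
    have c1 := cle i (ltnW iN); have c2 : count_pre k u (u i) <= N := cle k (leq_trans ki (ltnW iN)).
    set flag := ((i == k) * (\sum_(i < k) v i + v i < G + 1))%N.
    have flag1 : flag <= 1 by rewrite /flag; case: (_ == _); case: (_ < _).
    step; first by rewrite Ei EU'; lia.
    rewrite Ei EU'; step; first by rewrite Ei EV'; lia.
    rewrite Ei EV'; step; first by rewrite EB'; move: kl HV; clear; lia.
    rewrite EB' Ei; step; first by rewrite EI; move: sv1 HSv; clear; lia.
    rewrite EI; step; first by rewrite EA1; move: c1 NV; clear; lia.
    rewrite EA1; step; first by rewrite Ei EK EZV EG' -/flag; lia.
    rewrite Ei EK EZV EG' -/flag.
    have fv1 : flag * v i <= v i by rewrite -[leqRHS]mul1n leq_mul2r flag1 orbT.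
    have fu1 : flag * u i <= u i by rewrite -[leqRHS]mul1n leq_mul2r flag1 orbT.
    step; first by rewrite EZV; move: svk HSv sv1 fv1; clear; lia.
    have sux : \sum_(i0 < k) u i0 + u i <= \sum_(i0 < N) u i0.
      by have := sum_le u iN; rewrite big_ord_recr /=; apply: leq_trans; rewrite leq_add2r sum_le.
    step; first by rewrite EZU; move: sux fu1 HSu; clear; lia.
    step; first by rewrite EK; lia.
    step; first by rewrite EA2; move: c2 flag1 NV; clear; lia.
    rewrite EZV EZU EK EA2; split; first by lia.
    exists (k + flag).
    (* Either item [i] extends the prefix, or the prefix stays and its break item has been found. *)
    have cases : flag = 1 /\ k = i /\ \sum_(i < k.+1) v i <= G \/ flag = 0 /\ (k < i.+1 -> G < \sum_(i < k.+1) v i).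
      rewrite /flag; case: (i =P k) => [e|ne] /=; last by right; split=> // h; apply: brk; lia.
      rewrite mul1n e; have -> : \sum_(i0 < k.+1) v i0 = \sum_(i0 < k) v i0 + v k by rewrite big_ord_recr.
      rewrite addn1 ltnS; case: (leqP _ G) => h; [left | right]; first by split=> //; split.
      by split.
    split.
    + case: cases => [[-> [ek fk]]|[-> br]].
        rewrite !mul1n !addn1; split=> //.
        - by rewrite [RHS]big_ord_recr /= ek.
        - by rewrite [RHS]big_ord_recr /= ek.
        - by split=> //; rewrite ek ltnn.
      by rewrite !mul0n !addn0; split=> //; apply: leqW.
    + by rewrite big_ord_recr.
    + move=> a am; have [E1 E2] := EA a am.
      have -> : count_all i.+1 u a = count_all i u a + (u i == a) by rewrite /count_all big_ord_recr.
      have -> : count_pre (k + flag) u a = count_pre k u a + flag * (u i == a).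
        case: cases => [[-> [ek _]]|[-> _]]; last by rewrite !addn0.
        by rewrite addn1 /count_pre big_ord_recr /= mul1n ek.
      case: (a =P u i) => [->|ne]; first by rewrite eqxx muln1.
      by rewrite E1 E2; have -> : (u i == a) = false by [apply/eqP => e; case: ne]; rewrite muln0 !addn0.
    + by move=> j ji; case: (j =P i) => [->//|ne]; apply: EXj; lia.
  - move=> s' t [tle [k [[EK ki EZU EZV [fitk brk]] EI EA EXj]]] _ _; split; first by lia.
    exists k; split=> //.
    apply: (@eq_from_nth _ 0); rewrite size_mkseq ?size_map ?size_iota // => j jN.
    by rewrite nth_mkseq // EXj // (nth_map (0, 0)) ?size_mkseq // nth_mkseq.
move=> s1 t1 [t1le [k [[EK kN EZU fk bk] EI EA EXs]]] [fv1 fa1].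
have EW1 : va s1 vW = W by rewrite fv1.
step; first by rewrite EI EW1; move: HSv; clear; lia.
by rewrite EI EW1; split; [lia | exists k].
Qed.

Lemma prefixes_ok s : [/\ va s vMM = m, va s vBB = BB & va s vC = N] ->
  (forall a, a <= m -> ar s aCnt a = count_all N u a) ->
  sorted leq (mkseq (ar s aX) N) -> perm_eq (mkseq (ar s aX) N) (map key2 ks) ->
  wp V prefixes s (fun s' t => t <= 5 * N + 5 * m + 20 /\ forall a, a <= m -> ar s' aStart a <= N /\
    forall j, j <= count_all N u a -> ar s' aPS (ar s' aStart a + j) - ar s' aPS (ar s' aStart a) = pfx ks a j).
Proof.
move=> [EM EB EC] EA so pm; have mV' := mV; have EL := flatten_classes so pm.
set L := map _ _ in EL.
have cE a : count_all N u a = size (scls ks a).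
  rewrite size_scls /ccount /ks /count_all -sum1_count [RHS]big_map [RHS]big_mkcond [RHS]sum_iota.
  by rewrite /=; apply: eq_bigr => i _; case: eqP.
have szL : size L = N by rewrite size_map size_mkseq.
have nthL i : i < N -> nth 0 L i = ar s aX i %% BB.
  by move=> iN; rewrite (nth_map 0) ?size_mkseq // nth_mkseq.
have sumL : sumn L = \sum_(i < N) v i.
  rewrite (perm_sumn (perm_map _ pm)) sumnE /ks !big_map sum_iota.
  by apply: eq_bigr => i _; rewrite /key2 /= modnMDl modn_small // vB.
have takeL i : sumn (take i L) <= \sum_(i < N) v i.
  by rewrite -sumL -[in leqRHS](cat_take_drop i L) sumn_cat leq_addr.
do 2 (step; first by lia).
apply: (@wp_seq _ _ _ _ (fun s' t => t <= 4 * N + 2 /\ forall j, j <= N -> ar s' aPS j = sumn (take j L))).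
  apply: (@wp_for _ _ _ _ _ N (fun i s' t => [/\ t <= 4 * i, va s' 8 = sumn (take i L) &
     forall j, j <= i -> ar s' aPS j = sumn (take j L)])).
  - by [].
  - by lia.
  - by move=> s' [fv _]; rewrite /= fv.
  - split=> //=; first by rewrite take0.
    by move=> j; rewrite leqn0 => /eqP->; rewrite take0.
  - move=> i s' t iN [tle E8 H] Ei [fv fa].
    have EB' : va s' vBB = BB by rewrite fv.
    have EX' : ar s' aX i = ar s aX i by rewrite fa.
    have E8' : sumn (take i L) + ar s aX i %% BB = sumn (take i.+1 L).
      by rewrite (take_nth 0) ?szL // sumn_rcons nthL.
    have := takeL i.+1 => tl.
    step; first by rewrite E8 Ei EX' EB' E8'; move: tl HSv; clear; lia.
    rewrite E8 Ei EX' EB' E8'; step; first by move: tl HSv; clear; lia.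
    rewrite Ei addn1; split=> //; first by lia.
    by move=> j; case: (j =P i.+1) => [->//|ne] ji; apply: H; lia.
  - by move=> s' t [tle _ H] _ _; split=> //; lia.
move=> s1 t1 [t1le H1] [fv1 fa1].
step; first by lia.
apply: (@wp_for _ _ _ _ _ (m + 1) (fun i s' t => [/\ t <= 4 * i, va s' 8 = \sum_(j < i) size (scls ks j) &
     forall a, a < i -> ar s' aStart a = \sum_(j < a) size (scls ks j)])).
- by [].
- by lia.
- by move=> s' [fv _]; rewrite /= fv //= fv1 //= EM.
- by split=> //=; rewrite big_ord0.
- move=> i s' t im [tle E8 H] Ei [fv fa].
  have im' : i <= m by lia.
  have EA' : ar s' aCnt i = size (scls ks i) by rewrite fa //= fa1 //= EA.
  have sl : \sum_(j < i) size (scls ks j) + size (scls ks i) <= N.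
    rewrite -[leqRHS]szL EL size_flatten sumnE /shape -map_comp big_map sum_iota.
    by rewrite -(big_ord_recr i (fun j : 'I__ => size (scls ks j))) sum_le.
  have slV := leq_ltn_trans sl (ltnW (_ : N.+1 < V)); rewrite -addn1 in slV.
  step; first by rewrite E8; apply: leq_ltn_trans (slV NV); apply: leq_addr.
  rewrite Ei E8; step; first by rewrite Ei EA' E8; exact: slV NV.
  rewrite Ei EA' ?E8; split; first by lia.
    by rewrite big_ord_recr.
  by move=> a ai; case: (a =P i) => [->//|ne]; apply: H; lia.
- move=> s' t [tle E8 H] _ [fv fa]; split; first by move: t1le tle; clear; lia.
  move=> a am; rewrite H; last by lia.
  have EP j : j <= N -> ar s' aPS j = sumn (take j L) by move=> jN; rewrite fa //= H1.
  have sl : \sum_(j < a) size (scls ks j) + size (scls ks a) <= N.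
    rewrite -[leqRHS]szL EL size_flatten sumnE /shape -map_comp big_map sum_iota.
    by rewrite -(big_ord_recr a (fun j : 'I__ => size (scls ks j))) sum_le.
  split; first by move: sl; clear; lia.
  move=> j; rewrite cE => jc; rewrite !EP; try (move: sl jc; clear; lia).
  by rewrite EL sumn_block // addKn.
Qed.

Lemma tally_ok s : tally_pre s ->
  wp V tally s (fun s' t => t <= (15 * N + 15) * E + 30 * N + 20 * m + 100 /\ exists k, [/\ greedy_post k s',
    va s' vInf = \sum_(i < N) v i + W + 1,
    forall a, a <= m -> ar s' aCnt a = count_all N u a /\ ar s' aCpre a = count_pre k u a,
    forall a, a <= m -> ar s' aAl a = 0 &
    forall a, a <= m -> ar s' aStart a <= N /\
    forall j, j <= count_all N u a -> ar s' aPS (ar s' aStart a + j) - ar s' aPS (ar s' aStart a) = pfx ks a j]).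
Proof.
move=> pre; have [[EM EW EG EB EC] [EX EU EV]] := pre; have mV' := mV.
apply: (@wp_seq _ _ _ _ (fun s' t => t <= 5 * (m + 1) + 2 /\ forall a, a <= m ->
   [/\ ar s' aCnt a = 0, ar s' aCpre a = 0 & ar s' aAl a = 0])).
  apply: (@wp_for _ _ _ _ _ (m + 1) (fun i s' t => t <= 5 * i /\ forall a, a < i ->
   [/\ ar s' aCnt a = 0, ar s' aCpre a = 0 & ar s' aAl a = 0])).
  - by [].
  - by lia.
  - by move=> s' [fv _]; rewrite /= fv //= EM.
  - by [].
  - move=> i s' t im [tle H] Ei _; do 3 (step; first by lia).
    rewrite Ei; split; first by lia.
    by move=> a ai; case: (a =P i) => [//|ne]; apply: H; lia.
  - by move=> s' t [tle H] _ _; split; [lia | move=> a am; apply: H; lia].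
move=> s1 t1 [t1le H1] [fv1 fa1].
have pre1 : tally_pre s1.
  split; first by split; rewrite fv1.
  by split; [rewrite fv1 | move=> i iN; rewrite fa1 //= EU | move=> i iN; rewrite fa1 //= EV].
apply: wp_seq (greedy_ok pre1 _) _; first by move=> a /H1[].
move=> s2 t2 [t2le [k [gp EI EA EXs]]] [fv2 fa2].
have [EK kN EZU fk bk] := gp.
have EC2 : va s2 vC = N by rewrite fv2 //= fv1.
have EX2 : va s2 vXM = XM by rewrite fv2 //= fv1.
have xle i : i < N -> ar s2 aX i <= XM.
  move=> iN; have : ar s2 aX i \in map key2 ks by rewrite -EXs; apply: map_f; rewrite mem_iota.
  case/mapP => x /mapP[j]; rewrite mem_iota => /andP[_ jN] -> ->; exact: ltnW (key2_lt jN).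
apply: wp_seq (radix_ok HV NV HE EC2 EX2 xle) _ => s3 t3 [t3le pm so] [fv3 fa3].
rewrite EXs in pm.
have pre3 : [/\ va s3 vMM = m, va s3 vBB = BB & va s3 vC = N].
  by split; rewrite fv3 //= ?EC2 // fv2 //= fv1.
apply: wp_mono (wp_frame (prefixes_ok pre3 _ so pm)); last first.
  by move=> a am; rewrite fa3 //; have [] := EA a am.
move=> s4 t4 [[t4le H4] [fv4 fa4]]; split.
  by move: t1le t2le t3le t4le; move: (_ * E) => z; clear; lia.
exists k; split=> //.
- by split=> //; rewrite fv4 //= fv3.
- by rewrite fv4 //= fv3.
- by move=> a am; rewrite !fa4 //= !fa3 //=; apply: EA.
- by move=> a am; rewrite fa4 //= fa3 //= fa2 //=; have [] := H1 a am.
Qed.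

End Tally.

(** * Assigning levels to classes *)

Notation vLL := 15. Notation vDen := 29. Notation vTwo := 30. Notation vReq := 31. Notation vMk := 32.

(** A value is marked on its [vReq]-th copy, provided fewer than [vTwo] values are marked
    afterwards. The first refusal freezes the marks although counting goes on, so the marks are
    those of a scan that stopped there. A class keeps the first level at which it is marked. *)
Definition scanstep (e : expr) : cmd :=
  7 ::= aU @ e ;; aCol @@ (#7) ::= aCol @ (#7) [+] 1 ;;
  6 ::= (aCol @ (#7) [=] #vReq) [*] (#vMk [+] 1 [<] #vTwo) ;; vMk ::= #vMk [+] #6 ;;
  aAl @@ (#7) ::= aAl @ (#7) [+] #6 [*] (aAl @ (#7) [=] 0) [*] #vLv.

Definition scan (e len : expr) : cmd :=
  FOR vI TO #vMM [+] 1 DO aCol @@ (#vI) ::= 0 OD ;; vMk ::= 0 ;;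
  FOR vI TO len DO scanstep e OD.

Definition level : cmd :=
  vReq ::= #vDen [/] (#vTwo [*] #vTwo) [+] 1 ;;
  scan (#gK [+] #vI) (#vC [-] #gK) ;; scan (#gK [-] 1 [-] #vI) (#gK) ;;
  vTwo ::= #vTwo [*] 2.

Definition loglen_cmd : cmd :=
  vLL ::= 0 ;; 8 ::= 1 ;; WHILE #8 [<] #vMM [+] 2 DO 8 ::= #8 [*] 2 ;; vLL ::= #vLL [+] 1 OD.

Definition nlevels_cmd : cmd :=
  vNL ::= 0 ;; 8 ::= 1 ;; WHILE #8 [<] #vDen [+] 1 DO 8 ::= #8 [*] 2 ;; vNL ::= #vNL [+] 1 OD.

Definition windows : cmd :=
  8 ::= 342 [*] 1000 [*] (#vLL [*] #vLL [*] #vLL) [*] (#vMM [*] #vMM) ;; 6 ::= 1 ;;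
  FOR vI TO #vNL DO
    6 ::= #6 [*] 2 ;; aWn @@ (#vI [+] 1) ::= #vNL [*] (#8 [/] #6 [+] 4 [*] #vMM)
  OD ;;
  vOm ::= aWn @ 1.

Definition levels : cmd :=
  loglen_cmd ;;
  vDen ::= 8 [*] 2600 [*] (#vLL [*] #vLL [*] #vLL) [*] #vMM ;;
  nlevels_cmd ;; vTwo ::= 1 ;;
  FOR vLv TO #vNL [+] 1 DO level OD ;;
  windows.

Lemma frame_seq a b s s1 s2 : frame a s s1 -> frame b s1 s2 -> frame (a ;; b) s s2.
Proof.
move=> [v1 a1] [v2 a2]; split=> [x|j] /= /negbT; rewrite negb_or => /andP[/negbTE n1 /negbTE n2].
  by rewrite v2 // v1.
by rewrite a2 // a1.
Qed.

Lemma frame_asg x e s v : frame (x ::= e) s (setv s x v).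
Proof. by split=> //= y ->. Qed.

Section Scan.
Variables (V m L lv sz r : nat) (f A : nat -> nat).
Hypothesis fm : forall i, i < L -> f i <= m.
Hypothesis sz0 : 0 < sz.
Hypothesis r0 : 0 < r.
Hypothesis LV : L + sz + lv + m + 4 < V.
Hypothesis Alv : forall a, a <= m -> A a <= lv.

Definition cntf i a := \sum_(j < i) (f j == a).

Lemma cntfS i a : cntf i.+1 a = cntf i a + (f i == a).
Proof. by rewrite /cntf big_ord_recr. Qed.

Lemma cntf_le i a : cntf i a <= i.
Proof. exact: (sum_bool_le _ (fun j => f j == a)). Qed.

Definition saturated (M : pred nat) tau := (forall a, a <= m -> M a = (r <= cntf tau a)) /\
  (tau < L -> sz <= \sum_(a < m.+1) (r <= cntf tau.+1 a)).

Definition mark (M : pred nat) a := if (A a == 0) && M a then lv else A a.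

Lemma scan_ok e len s : va s vMM = m -> va s vReq = r -> va s vTwo = sz -> va s vLv = lv ->
  (forall s', frame (scan e len) s s' -> ev s' len = L /\
     forall i, i < L -> va s' vI = i -> ar s' aU (ev s' e) = f i) ->
  (forall a, a <= m -> ar s aAl a = A a) ->
  wp V (scan e len) s (fun s' t => t <= 5 * m + 10 * L + 20 /\ exists M tau,
    [/\ tau <= L, saturated M tau, \sum_(a < m.+1) M a < sz & forall a, a <= m -> ar s' aAl a = mark M a]).
Proof.
move=> EM ER ET EL He EA.
apply: (@wp_seq _ _ _ _ (fun s' t => t <= 3 * (m + 1) + 2 /\ forall a, a <= m -> ar s' aCol a = 0)).
  apply: (@wp_for _ _ _ _ _ (m + 1) (fun i s' t => t <= 3 * i /\ forall a, a < i -> ar s' aCol a = 0)).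
  - by [].
  - by lia.
  - by move=> s' [fv _]; rewrite /= fv //= EM.
  - by [].
  - move=> i s' t im [tle H] Ei _; step; first by lia.
    rewrite Ei; split; first by lia.
    by move=> a ai; case: (a =P i) => [//|ne]; apply: H; lia.
  - by move=> s' t [tle H] _ _; split; [lia | move=> a am; apply: H; lia].
move=> s1 t1 [t1le H1] f1; have [fv1 fa1] := f1.
step; first by lia.
have fr s' : frame (FOR vI TO len DO scanstep e OD) (setv s1 vMk 0) s' -> frame (scan e len) s s'.
  by move=> f2; apply: frame_seq f1 (frame_seq (frame_asg _ _ _ _) f2).
(* Either no mark has been refused and the marks are exactly the rich values, or [tau] is the
   position of the first refusal and the marks number [sz - 1] for good. *)
apply: (@wp_for _ _ _ _ _ L (fun i s' t => t <= 8 * i /\ exists (M : pred nat),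
  [/\ forall a, a <= m -> ar s' aCol a = cntf i a, va s' vMk = \sum_(a < m.+1) M a, va s' vMk < sz,
   forall a, a <= m -> ar s' aAl a = mark M a &
   (forall a, a <= m -> M a = (r <= cntf i a)) \/
   exists tau, [/\ tau < i, saturated M tau & (va s' vMk).+1 = sz]])).
- by [].
- by lia.
- by move=> s' /fr/He[].
- split=> //; exists pred0; split=> //=.
  + by move=> a am; rewrite /cntf big_ord0 H1.
  + by rewrite big1.
  + by move=> a am; rewrite /mark andbF fa1 //= EA.
  + by left=> a _; rewrite /cntf big_ord0 leqNgt r0.
- move=> i s' t iL [tle [M [EC EMk Mksz EAl st]]] Ei fr'; have [fv fa] := fr'.
  have [_ /(_ i iL Ei) Eu] := He _ (fr _ fr').
  have ui := fm iL.
  have ER' : va s' vReq = r by rewrite fv //= fv1.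
  have ET' : va s' vTwo = sz by rewrite fv //= fv1.
  have EL' : va s' vLv = lv by rewrite fv //= fv1.
  have cl := cntf_le i (f i).
  step; first by rewrite Eu; lia.
  rewrite Eu; step; first by rewrite EC //; move: cl iL LV; clear; lia.
  rewrite EC // addn1.
  set flag := (((cntf i (f i)).+1 == r) * (va s' vMk + 1 < sz))%N.
  have flagE : flag = ((cntf i (f i)).+1 == r) && (va s' vMk + 1 < sz) :> nat by rewrite /flag mulnb.
  have flag1 : flag <= 1 by rewrite flagE leq_b1.
  step; first by rewrite eqxx ER' ET' -/flag; move: flag1 LV; clear; lia.
  rewrite eqxx ER' ET' -/flag; step; first by move: flag1 Mksz LV; clear; lia.
  have Al := Alv ui.
  have mkA : mark M (f i) <= lv by rewrite /mark; case: ifP.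
  have new : mark M (f i) + flag * (mark M (f i) == 0) * lv =
     mark (fun a => M a || ((a == f i) && (flag == 1))) (f i).
    rewrite /mark eqxx /=; move: flag1; case: (flag) => [|[|]] // _; rewrite ?orbF ?orbT ?andbT.
      by rewrite !mul0n addn0.
    by rewrite mul1n; case: (A (f i) =P 0) => [->|] /=; case: (M (f i)) => //=; case: (lv); lia.
  have new_le : mark (fun a => M a || ((a == f i) && (flag == 1))) (f i) <= lv by rewrite /mark; case: ifP.
  step; first by rewrite EL' EAl // new; move: new_le LV; clear; lia.
  rewrite EL' EAl // new; split; first by move: tle; clear; lia.
  exists (fun a => M a || ((a == f i) && (flag == 1))).
  have cnew a : cntf i.+1 a = cntf i a + (a == f i) by rewrite cntfS eq_sym.
  have sumnew : (flag == 1 -> M (f i) = false) ->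
     \sum_(a < m.+1) (M a || ((a == f i :> nat) && (flag == 1))) = \sum_(a < m.+1) M a + flag.
    move=> nM; have um' : f i < m.+1 by [].
    rewrite (bigD1 (Ordinal um')) // [in RHS](bigD1 (Ordinal um')) //= eqxx /=.
    have -> : \sum_(a < m.+1 | a != Ordinal um') (M a || ((a == f i :> nat) && (flag == 1))) =
              \sum_(a < m.+1 | a != Ordinal um') M a.
      by apply: eq_bigr => a; rewrite -val_eqE /= => /negbTE->; rewrite orbF.
    have -> : (M (f i) || (flag == 1)) = M (f i) + flag :> nat.
      by move: flag1 nM; case: (flag) => [|[|]] //=; case: (M (f i)) => // _ /(_ isT).
    by rewrite addnAC.
  have nM : flag == 1 -> M (f i) = false.
    rewrite flagE eqb1 => /andP[/eqP cr lt].
    case: st => [st'|[tau [_ _ e1]]]; first by rewrite st' //; apply/negbTE; rewrite -ltnNge -cr.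
    by move: lt; rewrite -e1 addn1 ltnn.
  split.
  + by move=> a am; rewrite cnew; case: (a =P f i) => [->|_]; rewrite ?addn1 ?addn0 // EC.
  + by rewrite sumnew // EMk.
  + by rewrite flagE; case: (_ == _); rewrite /= ?addn0 //; case: (ltnP (va s' vMk + 1) sz); rewrite ?addn0.
  + move=> a am; case: (a =P f i) => [->//|ne]; rewrite EAl // /mark.
    by have -> : (a == f i) = false by [apply/eqP]; rewrite orbF.
  + case: st => [st|[tau [ti sat e1]]]; last first.
      right; exists tau; have f0 : flag = 0.
        by rewrite flagE -e1 addn1 ltnn andbF.
      split; [by lia| | by rewrite f0 addn0].
      have [s2 s3] := sat; split=> // a am; rewrite f0 andbF orbF; exact: s2.
    case: (boolP (((cntf i (f i)).+1 == r) && (flag == 0))) => [/andP[/eqP cr /eqP f0]|nsat].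
      right; exists i; split=> //.
        split=> [a am|_]; first by rewrite f0 andbF orbF st.
        have : \sum_(a < m.+1) (r <= cntf i.+1 a) = (\sum_(a < m.+1) M a).+1.
          have um' : f i < m.+1 by [].
          rewrite (bigD1 (Ordinal um')) // [in RHS](bigD1 (Ordinal um')) //= cnew eqxx addn1 cr leqnn.
          rewrite st // -cr ltnn add0n add1n; congr S; apply: eq_bigr => a; rewrite -val_eqE /= => /negbTE ne.
          by rewrite (st a (ltn_ord a)) cnew ne addn0 cr.
        move=> ->; rewrite -EMk; move/eqP: f0; rewrite flagE cr eqxx eqb0 addn1 -leqNgt.
        by [].
      rewrite f0 addn0; move/eqP: f0; rewrite flagE cr eqxx eqb0 addn1 -leqNgt => h.
      by apply/eqP; rewrite eqn_leq Mksz.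
    left=> a am; rewrite cnew st //; case: (a =P f i) => [->|ne] /=; last by rewrite orbF addn0.
    rewrite addn1; case: (ltngtP r (cntf i (f i)).+1) => h.
    * by rewrite (_ : r <= cntf i (f i)) //= ; lia.
    * have -> : flag == 1 = false by rewrite flagE eqb1; case: eqP => // e'; move: h; rewrite e' ltnn.
      by rewrite orbF leqNgt; apply/negbTE/negPn; lia.
    * by move: nsat flag1; rewrite h eqxx /=; case: (flag) => [|[|]] //; rewrite orbT.
- move=> s' t [tle [M [EC EMk Mksz EAl st]]] _ _; split; first by move: t1le tle; clear; lia.
  exists M; case: st => [st|[tau [ti sat _]]].
    by exists L; split; rewrite -?EMk //; split=> //; rewrite ltnn.
  by exists tau; split; rewrite -?EMk //; apply: ltnW.
Qed.

End Scan.

Lemma cntf_above m f i a : (forall j, j < i -> f j <= m) -> m < a -> cntf f i a = 0.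
Proof.
move=> fm ma; rewrite /cntf big1 // => j _; case: eqP => // e.
by have := fm j (ltn_ord j); rewrite e leqNgt ma.
Qed.

Section Ranges.
Variables (N k m : nat) (u : nat -> nat).
Hypothesis kN : k <= N.

Lemma card_range lo hi a : hi <= N ->
  #|[set i : 'I_N | (lo <= i < hi) && (u i == a)]| = \sum_(lo <= i < hi) (u i == a).
Proof.
move=> hN; rewrite (big_nat_widenl _ 0) // (big_nat_widen _ _ _ _ _ hN) big_mkord.
rewrite -sum1dep_card [LHS]big_mkcond [RHS]big_mkcond; apply: eq_bigr => i _.
by case: (lo <= i); case: (i < hi); case: eqP.
Qed.

Lemma card_right t a : k + t <= N ->
  #|[set i : 'I_N | (k <= i < k + t) && (u i == a)]| = cntf (fun i => u (k + i)) t a.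
Proof.
move=> /card_range->; rewrite /cntf; elim: t => [|t IH]; first by rewrite addn0 big_geq // big_ord0.
by rewrite addnS big_nat_recr ?leq_addr //= IH big_ord_recr.
Qed.

Lemma card_left t a : t <= k ->
  #|[set i : 'I_N | (k - t <= i < k) && (u i == a)]| = cntf (fun i => u (k - 1 - i)) t a.
Proof.
move=> tk; rewrite card_range // /cntf; elim: t tk => [|t IH] tk; first by rewrite subn0 big_geq // big_ord0.
rewrite big_ltn ?subn1; last by lia.
have -> : (k - t.+1).+1 = k - t by lia.
rewrite IH ?(ltnW tk) // big_ord_recr /= addnC subn1; congr (_ + (u _ == a)); lia.
Qed.

Lemma card_rich r (A : {set 'I_N}) (p : pred 'I_N) (g : nat -> nat) :
  (forall a, #|[set i : 'I_N | p i && (u i == a)]| = g a) -> A = [set i | p i] ->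
  #|rich (fun i : 'I_N => u i) m r A| = \sum_(a < m.+1) (r <= g a).
Proof.
move=> E ->; rewrite /rich -sum1dep_card big_mkcond /=; apply: eq_bigr => a _.
rewrite -E; have -> : [set i in [set i | p i] | u i == a] = [set i | p i && (u i == a)].
  by apply/setP => i; rewrite !inE.
by case: leqP.
Qed.

Hypothesis um : forall i, i < N -> u i <= m.

Lemma saturated_right M s r tau : 0 < r -> saturated m (N - k) s r (fun i => u (k + i)) M tau -> tau <= N - k ->
  @scanned_right N m k u M s r.
Proof.
move=> r0 [h1 h2] tN; have ktN : k + tau <= N by lia.
exists (k + tau); first exact: leq_addr.
split=> [a Ma|lt].
  rewrite card_right //; have [am|ma] := leqP a m; first by rewrite ltnNge -h1.
  by rewrite (@cntf_above m) // => j jt; apply: um; lia.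
have lt' : tau < N - k by lia.
apply: leq_trans (h2 lt') _; apply: eq_leq.
rewrite (@card_rich r _ (fun i : 'I_N => k <= i < k + tau.+1) (cntf (fun i => u (k + i)) tau.+1)) //.
  by move=> a; rewrite card_right //; lia.
by apply/setP => i; rewrite !inE addnS ltnS.
Qed.

Lemma saturated_left M s r tau : 0 < r -> saturated m k s r (fun i => u (k - 1 - i)) M tau -> tau <= k ->
  @scanned_left N m k u M s r.
Proof.
move=> r0 [h1 h2] tk; exists (k - tau); first exact: leq_subr.
split=> [a Ma|lt].
  rewrite card_left //; have [am|ma] := leqP a m; first by rewrite ltnNge -h1.
  by rewrite (@cntf_above m) // => j jt; apply: um; lia.
have lt' : tau < k by lia.
apply: leq_trans (h2 lt') _; apply: eq_leq.
rewrite (@card_rich r _ (fun i : 'I_N => k - tau.+1 <= i < k) (cntf (fun i => u (k - 1 - i)) tau.+1)) //.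
  by move=> a; rewrite card_left.
by apply/setP => i; rewrite !inE; congr (_ <= _ < _); lia.
Qed.

End Ranges.

Section Levels.
Variables (V N k m : nat) (u : nat -> nat).
Hypothesis m_gt0 : 0 < m.
Hypothesis um : forall i, i < N -> u i <= m.
Hypothesis kN : k <= N.
Hypothesis HV : 2 * density m * (342 * 1000 * loglen m ^ 3 * m ^ 2 + 4 * m) + 6 * density m + N + 10 < V.

Definition lev_pre s := [/\ va s vMM = m, va s gK = k, va s vC = N & forall i, i < N -> ar s aU i = u i].

Lemma dV : 6 * density m + N + 10 < V.
Proof. by move: HV; move: (2 * _ * _) => X; clear; lia. Qed.

Lemma sum_lt1 (M : pred nat) : \sum_(a < m.+1) M a < 1 -> forall a, a <= m -> M a = false.
Proof.
rewrite ltnS leqn0 sum_nat_eq0 => /forallP h a am; have am' : a < m.+1 by [].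
by have /= := h (Ordinal am'); rewrite eqb0 => /negbTE.
Qed.

Lemma level_ok s lv A : lev_pre s -> va s vDen = density m -> va s vTwo = 2 ^ lv -> va s vLv = lv ->
  2 ^ lv <= 2 * density m -> (forall a, a <= m -> ar s aAl a = A a) -> (forall a, a <= m -> A a <= lv) ->
  wp V level s (fun s' t => [/\ t <= 10 * m + 20 * N + 50, va s' vTwo = 2 ^ lv.+1 & exists A',
    [/\ forall a, a <= m -> ar s' aAl a = A' a,
     forall a, a <= m -> A' a = A a \/ A a = 0 /\ A' a = lv,
     exists mR mL, [/\ @scanned_right N m k u mR (2 ^ lv) (copies m lv),
       @scanned_left N m k u mL (2 ^ lv) (copies m lv) &
       forall a, a <= m -> (A' a == 0) || (lv < A' a) -> ~~ mR a /\ ~~ mL a] &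
     0 < lv -> (forall a, a <= m -> A a < lv) -> \sum_(a < m.+1) (A' a == lv) <= 2 * (2 ^ lv).-1]]).
Proof.
move=> pre ED ET EL le2 EA Ale; have [EM EK EC EU] := pre; have dv := dV.
have s0 : 0 < 2 ^ lv by rewrite expn_gt0.
have lvs : lv < 2 ^ lv by apply: ltn_expl.
have md : m <= density m by apply: m_density.
have r0 : 0 < copies m lv by rewrite /copies addn1.
have rd : copies m lv <= density m + 1 by rewrite /copies leq_add2r leq_div.
step; first by rewrite ED ET -/(copies m lv); lia.
rewrite ED ET -/(copies m lv).
set s1 := setv _ _ _.
have b1 : N - k + 2 ^ lv + lv + m + 4 < V by lia.
have b2 : k + 2 ^ lv + lv + m + 4 < V by lia.
have um1 i : i < N - k -> u (k + i) <= m by move=> h; apply: um; lia.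
have um2 i : i < k -> u (k - 1 - i) <= m by move=> h; apply: um; lia.
apply: wp_seq (@scan_ok V m (N - k) lv (2 ^ lv) (copies m lv) (fun i => u (k + i)) A um1 s0 r0 b1 Ale
   (#gK [+] #vI) (#vC [-] #gK) s1 EM erefl ET EL _ EA) _.
  move=> s' [fv fa]; split; first by rewrite /= !fv //= EC EK.
  by move=> i iN Ei; rewrite /= fv //= EK Ei fa //= EU //; lia.
move=> s2 t2 [t2le [M1 [tau1 [tl1 sat1 sum1 EA1]]]] [fv2 fa2].
have Ale1 a : a <= m -> mark lv A M1 a <= lv by move=> am; rewrite /mark; case: ifP => // _; apply: Ale.
apply: wp_seq (@scan_ok V m k lv (2 ^ lv) (copies m lv) (fun i => u (k - 1 - i)) (mark lv A M1) um2 s0 r0 b2 Ale1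
   (#gK [-] 1 [-] #vI) (#gK) s2 _ _ _ _ _ EA1) _; try by rewrite fv2.
  move=> s' [fv fa]; split; first by rewrite /= !fv //= fv2.
  by move=> i iN Ei; rewrite /= fv //= fv2 //= EK Ei fa //= fa2 //= EU //; lia.
move=> s3 t3 [t3le [M2 [tau2 [tl2 sat2 sum2 EA2]]]] [fv3 fa3].
step; first by rewrite fv3 //= fv2 //= ET; lia.
rewrite fv3 //= fv2 //= ET expnSr; split=> //; first by lia.
exists (mark lv (mark lv A M1) M2); split=> //.
- move=> a am; rewrite /mark; case: (A a) => [|x]; case: (M1 a); case: (M2 a); case: (lv) => [|l] /=;
    first [by left | by right].
- exists M1, M2; split.
  + exact: saturated_right sat1 tl1.
  + exact: saturated_left sat2 tl2.
  + move=> a am h; have h2 : mark lv (mark lv A M1) M2 a <= lv.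
      by rewrite /mark; case: ifP => // _; apply: Ale1.
    (* At level [0] the limit is [1], so nothing is marked; this keeps the value [0] of [alpha] free
       to mean unmarked. *)
    case: (posnP lv) => [lv0|lv0].
      rewrite lv0 in sum1 sum2; have := sum_lt1 sum1 am; have := sum_lt1 sum2 am.
      by case: (M1 a); case: (M2 a).
    move: h; rewrite orbC ltnNge h2 /= /mark; case: (A a) => [|x]; case: (M1 a); case: (M2 a);
      by case: (lv) lv0.
- move=> lv0 Alt; apply: leq_trans (_ : \sum_(a < m.+1) (M1 a + M2 a) <= _); last first.
    rewrite big_split /=; move: sum1 sum2 s0; move: (\sum_(a < _) _) (\sum_(a < _) _) (2 ^ lv) => x y z.
    by clear; lia.
  apply: leq_sum => a _; have := Alt a (ltn_ord a); rewrite /mark; clear -lv0.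
  by case: (A a) => [|x] al; case: (M1 a); case: (M2 a); case: (lv) lv0 al => [|l] //= _ al;
    rewrite ?eqxx //; case: eqP => // e; rewrite e ltnn in al.
Qed.

End Levels.

Section Levels.
Variables (V N k m : nat) (u : nat -> nat).
Hypothesis m_gt0 : 0 < m.
Hypothesis um : forall i, i < N -> u i <= m.
Hypothesis kN : k <= N.
Let WC := 342 * 1000 * loglen m ^ 3 * m ^ 2.
Hypothesis HV : 2 * density m * (WC + 4 * m) + 6 * density m + N + 10 < V.

Definition log_loop x e : cmd := x ::= 0 ;; 8 ::= 1 ;; WHILE #8 [<] e DO 8 ::= #8 [*] 2 ;; x ::= #x [+] 1 OD.

Lemma log_loop_ok x e T n s : 8 <> x -> (forall s', (forall z, z <> 8 -> z <> x -> va s' z = va s z) -> ev s' e = T) ->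
  (forall i, i < n -> 2 ^ i < T) -> T <= 2 ^ n -> 2 * T + 2 < V ->
  wp V (log_loop x e) s (fun s' t => t <= 3 * n + 3 /\ va s' x = n).
Proof.
move=> /eqP x8 He lo hi TV; rewrite /log_loop; have x8' : eqn 8 x = false by rewrite eqnE (negbTE x8).
have x8'' : eqn x 8 = false by rewrite eqnE eq_sym (negbTE x8).
do 2 (step; first by lia).
apply: (@wp_whl _ _ _ _ n (fun i s' t => [/\ t <= 3 * i, va s' x = i & va s' 8 = 2 ^ i])).
- by rewrite /= x8'' eqnE eqxx.
- move=> i s' t iN [tle Ex E8] [fv fa].
  have Ee : ev s' e = T.
    apply: He => z /eqP z8 /eqP zx; rewrite fv /= ?eqnE ?(negbTE z8) ?(negbTE zx) //.
  have l2 := lo i iN.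
  split; first by rewrite /= E8 Ee l2.
  step; first by rewrite E8; lia.
  rewrite E8; step; first by rewrite ?x8'' Ex; have := @ltn_expl 2 i isT; lia.
  by rewrite ?x8'' ?x8' Ex eqnE eqxx addn1 expnSr; split=> //; lia.
- move=> s' t [tle Ex E8] [fv fa].
  have Ee : ev s' e = T.
    by apply: He => z /eqP z8 /eqP zx; rewrite fv /= ?eqnE ?(negbTE z8) ?(negbTE zx).
  split; first by rewrite /= E8 Ee ltnNge hi.
  by split; [lia | ].
Qed.

Definition windows_pre s NL := [/\ va s vMM = m, va s vLL = loglen m & va s vNL = NL].

Lemma windows_ok s NL : windows_pre s NL -> 0 < NL -> 2 ^ NL <= 2 * density m ->
  wp V windows s (fun s' t => [/\ t <= 4 * NL + 10,
    forall b, 0 < b <= NL -> ar s' aWn b = width m NL b & va s' vOm = width m NL 1]).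
Proof.
move=> [EM EL EN] N0 le2.
have NLs : NL < 2 ^ NL by apply: ltn_expl.
have wV b : width m NL b < V.
  apply: leq_ltn_trans (_ : 2 * density m * (WC + 4 * m) < V).
    apply: leq_mul; first exact: leq_trans (ltnW NLs) le2.
    by rewrite leq_add2r leq_div.
  by move: HV; move: (_ * (WC + _)) => X; clear; lia.
have d0 : 0 < density m by apply: leq_trans (m_density m).
have WCV : WC < V.
  apply: leq_ltn_trans (_ : 2 * density m * (WC + 4 * m) < V).
    apply: leq_trans (leq_addr (4 * m) _) _; rewrite leq_pmull //; lia.
  by move: HV; move: (_ * (WC + _)) => X; clear; lia.
have dV' : 6 * density m + N + 10 < V by move: HV; move: (2 * _ * _) => X; clear; lia.
have EWC : 342 * 1000 * (loglen m * loglen m * loglen m) * (m * m) = WC.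
  by rewrite /WC -!mulnn !expnS expn0 muln1 !mulnA.
step; first by rewrite EL EM EWC.
rewrite EL EM EWC; step; first by lia.
apply: (@wp_seq _ _ _ _ (fun s' t => t <= 4 * NL + 2 /\ forall b, 0 < b <= NL -> ar s' aWn b = width m NL b)).
  apply: (@wp_for _ _ _ _ _ NL (fun i s' t => [/\ t <= 4 * i, va s' 6 = 2 ^ i &
      forall b, 0 < b <= i -> ar s' aWn b = width m NL b])).
  - by [].
  - by lia.
  - by move=> s' [fv _]; rewrite /= fv.
  - by split=> // b; lia.
  - move=> i s' t iN [tle E6 H] Ei [fv fa].
    have E8 : va s' 8 = WC by rewrite fv.
    have EM' : va s' vMM = m by rewrite fv.
    have EN' : va s' vNL = NL by rewrite fv.
    have p2 : 2 ^ i * 2 <= 2 ^ NL by rewrite -expnSr leq_exp2l.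
    step; first by rewrite E6; lia.
    rewrite E6 -expnSr.
    have Ew : NL * (WC %/ 2 ^ i.+1 + 4 * m) = width m NL i.+1 by [].
    step; first by rewrite E8 EM' EN' Ew.
    rewrite E8 EM' EN' Ei addn1 Ew; split=> //; first by lia.
    by move=> b bi; case: (b =P i.+1) => [->//|ne]; apply: H; lia.
  - by move=> s' t [tle _ H] _ _; split=> //; lia.
move=> s1 t1 [t1le H1] _.
step; first by rewrite H1.
by rewrite H1 //; split=> //; lia.
Qed.

Lemma levels_ok s : lev_pre N k m u s -> (forall a, a <= m -> ar s aAl a = 0) ->
  wp V levels s (fun s' t => exists NL alpha,
   [/\ [/\ va s' vNL = NL, 0 < NL, density m < 2 ^ NL, 2 ^ NL <= 2 * density m &
        t <= (NL + 1) * (10 * m + 20 * N + 60) + 10 * NL + 3 * loglen m + 50],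
    va s' vOm = width m NL 1 /\ (forall b, 0 < b <= NL -> ar s' aWn b = width m NL b),
    forall a, a <= m -> ar s' aAl a = alpha a /\ alpha a <= NL,
    forall lv, lv <= NL -> exists mR mL, [/\ @scanned_right N m k u mR (2 ^ lv) (copies m lv),
       @scanned_left N m k u mL (2 ^ lv) (copies m lv) &
       forall a, a <= m -> (alpha a == 0) || (lv < alpha a) -> ~~ mR a /\ ~~ mL a] &
    forall lv, 0 < lv <= NL -> \sum_(a < m.+1) (alpha a == lv) <= 2 * (2 ^ lv).-1]).
Proof.
move=> pre EA; have [EM EK EC EU] := pre.
have md : m <= density m by apply: m_density.
have d0 : 0 < density m by apply: leq_trans md.
have dV' : 6 * density m + N + 10 < V by move: HV; move: (2 * _ * _) => X; clear; lia.
have /andP[tl1 tl2] := @trunc_log_bounds 2 m.+1 isT isT.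
apply: (@wp_seq _ _ _ _ (fun s' t => t <= 3 * loglen m + 3 /\ va s' vLL = loglen m)).
  apply: (@log_loop_ok vLL (#vMM [+] 2) (m + 2)) => //.
  - by move=> s' H; rewrite /= H //= EM.
  - move=> i; rewrite ltnS => h; rewrite addn2 ltnS; apply: leq_trans tl1.
    by rewrite leq_exp2l.
  - by rewrite addn2.
  - by lia.
move=> s1 t1 [t1le EL1] f1; have [fv1 fa1] := f1.
have ED : 8 * 2600 * (loglen m * loglen m * loglen m) * m = density m.
  by rewrite /density !expnS expn0 muln1 !mulnA.
step; first by rewrite EL1 fv1 //= EM ED; lia.
rewrite EL1 fv1 //= EM ED; set s2 := setv _ _ _.
(* The number of levels is the least [NL] with [density m < 2 ^ NL]. Minimality gives
   [2 ^ NL <= 2 * density m], so [NL] is logarithmic. *)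
have ex : exists e, density m < 2 ^ e by exists (density m); apply: ltn_expl.
case: (ex_minnP ex) => NL dNL NLmin.
have lo i : i < NL -> 2 ^ i <= density m by move=> iN; rewrite leqNgt; apply/negP => /NLmin; lia.
have N0 : 0 < NL by case: (NL) dNL => //; rewrite expn0; lia.
have le2 : 2 ^ NL <= 2 * density m by case: (NL) N0 lo => // z _ h; rewrite expnS leq_mul2l h.
apply: (@wp_seq _ _ _ _ (fun s' t => t <= 3 * NL + 3 /\ va s' vNL = NL)).
  apply: (@log_loop_ok vNL (#vDen [+] 1) (density m + 1)) => //.
  - by move=> s' H; rewrite /= H.
  - by move=> i iN; rewrite addn1 ltnS lo.
  - by rewrite addn1.
  - by lia.
move=> s3 t3 [t3le EN3] f3; have [fv3 fa3] := f3.
step; first by lia.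
set s4 := setv s3 _ _.
have NLs : NL < 2 ^ NL by apply: ltn_expl.
apply: (@wp_seq _ _ _ _ (fun s' t => t <= (NL + 1) * (10 * m + 20 * N + 60) + 2 /\ exists alpha,
   [/\ forall a, a <= m -> ar s' aAl a = alpha a /\ alpha a <= NL,
    forall lv, lv <= NL -> exists mR mL, [/\ @scanned_right N m k u mR (2 ^ lv) (copies m lv),
       @scanned_left N m k u mL (2 ^ lv) (copies m lv) &
       forall a, a <= m -> (alpha a == 0) || (lv < alpha a) -> ~~ mR a /\ ~~ mL a] &
    forall lv, 0 < lv <= NL -> \sum_(a < m.+1) (alpha a == lv) <= 2 * (2 ^ lv).-1])).
  apply: (@wp_for _ _ _ _ _ (NL + 1) (fun i s' t => [/\ t <= i * (10 * m + 20 * N + 60), va s' vTwo = 2 ^ i & exists alpha,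
   [/\ forall a, a <= m -> ar s' aAl a = alpha a /\ alpha a <= i.-1,
    forall lv, lv < i -> exists mR mL, [/\ @scanned_right N m k u mR (2 ^ lv) (copies m lv),
       @scanned_left N m k u mL (2 ^ lv) (copies m lv) &
       forall a, a <= m -> (alpha a == 0) || (lv < alpha a) -> ~~ mR a /\ ~~ mL a] &
    forall lv, 0 < lv < i -> \sum_(a < m.+1) (alpha a == lv) <= 2 * (2 ^ lv).-1]])).
  - by [].
  - by lia.
  - by move=> s' [fv _]; rewrite /= fv //= EN3.
  - split=> //; exists (fun=> 0); split=> //.
    + by move=> a am; rewrite /= fa3 //= fa1 //= EA.
    + by move=> lv; lia.
  - move=> i s' t iN [tle E2 [al [EAl sc mk]]] Ei [fv fa].
    have pre' : lev_pre N k m u s'.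
      split; rewrite ?fv //= ?fv3 //= ?fv1 //.
      by move=> j jN; rewrite fa //= fa3 //= fa1 //= EU.
    have EDn : va s' vDen = density m by rewrite fv //= fv3.
    have le2' : 2 ^ i <= 2 * density m by apply: leq_trans le2; rewrite leq_exp2l //; lia.
    have EA1 a : a <= m -> ar s' aAl a = al a by move=> /EAl[].
    have EA2 a : a <= m -> al a <= i by move=> /EAl[_]; lia.
    have hl := level_ok m_gt0 um kN HV pre' EDn E2 Ei le2' EA1 EA2.
    apply: wp_mono hl => s5 t5 [t5le E5 [al' [EA' ch sc' mk']]].
    split=> //; first by rewrite mulSn; move: tle t5le; move: (i * _) => X; clear; lia.
    exists al'; split.
    + move=> a am; split; first exact: EA'.
      by have [_ h] := EAl a am; case: (ch a am) => [->|[_ ->]] //; lia.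
    (* A later scan only fills entries that were [0], so the conclusion about unmarked classes at
       earlier levels survives. *)
    + move=> lv; rewrite ltnS leq_eqVlt => /orP[/eqP->//|lt].
      have [mR [mL [h1 h2 h3]]] := sc lv lt; exists mR, mL; split=> // a am h; apply: h3 => //.
      by case: (ch a am) => [<-//|[-> _]].
    + move=> lv /andP[lv0]; rewrite ltnS leq_eqVlt => /orP[/eqP e|lt].
        by rewrite e; apply: mk'; [lia | move=> a am; have [_ h] := EAl a am; lia].
      apply: leq_trans (mk lv (introT andP (conj lv0 lt))); apply: leq_sum => a _.
      case: (ch a (ltn_ord a)) => [->|[-> ->]] //.
      by case: eqP => // e; rewrite e ltnn in lt.
  - move=> s' t [tle _ [al [EAl sc mk]]] _ _; split; first by rewrite !addn2 !ltnS.
    rewrite addn1 in EAl sc mk; exists al; split.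
    + exact: EAl.
    + by move=> lv h; apply: sc.
    + by move=> lv h; apply: mk.
move=> s5 t5 [t5le [al [EAl sc mk]]] [fv5 fa5].
have wpre : windows_pre s5 NL.
  by split; rewrite fv5 //= ?EN3 // fv3 //= ?EL1 // fv1 //= EM.
apply: wp_mono (wp_frame (windows_ok wpre N0 le2)) => s6 t6 [[t6le H1 H2] [fv6 fa6]].
exists NL, al; split=> //.
- split=> //; first by rewrite fv6 //= fv5 //= EN3.
  by move: t1le t3le t5le t6le; move: (_ * (10 * m + _ + _)) => X; clear; lia.
- by move=> a am; rewrite fa6 //; apply: EAl.
Qed.

End Levels.

(** * The complete algorithm *)

(** The table is read from [vOm] upwards because the optimum is at least the greedy profit [vZU].
    Truncated subtraction computes the maximum here, and the minimum in [answerD]. *)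
Definition answerB : cmd :=
  8 ::= 0 ;;
  FOR vI TO #vOm [+] 1 DO
    6 ::= aDp @ (#vOm [+] #vI) [<] #vW [+] 1 ;; 8 ::= #8 [+] #6 [*] (#vI [-] #8)
  OD ;;
  0 ::= #vZU [+] #8.

Definition answerD : cmd :=
  8 ::= #vInf ;;
  FOR vI TO #vOm [+] 1 DO 6 ::= aDp @ (#vI) ;; 8 ::= #8 [-] (#8 [-] #6) OD ;;
  0 ::= #vSP [-] #8.

(** For the weight table all classes have level [1] and one window of width [W], as the weight that
    stays never exceeds [W]. *)
Definition onewindow : cmd :=
  vNL ::= 1 ;; FOR vI TO #vMM [+] 1 DO aAl @@ (#vI) ::= 1 OD ;; aWn @@ 1 ::= #vW ;; vOm ::= #vW.

Definition finish : cmd :=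
  (sortitems ;; tally) ;;
  IF #vMode THEN levels ELSE onewindow FI ;;
  (dpinit ;; dploop) ;;
  IF #vMode THEN answerB ELSE answerD FI.

Section Answers.
Variables (V OM INF W z ZU : nat).

Lemma answerB_ok s : va s vOm = OM -> va s vW = W -> va s vZU = ZU -> 2 * OM + 2 < V -> z < V ->
  (forall j, j <= OM -> ar s aDp (OM + j) <= W -> ZU + j <= z) ->
  (exists j, [/\ j <= OM, ar s aDp (OM + j) <= W & ZU + j = z]) ->
  wp V answerB s (fun s' t => t <= 4 * OM + 10 /\ va s' 0 = z).
Proof.
move=> EO EW EZ OV zV ub [j0 [j0O dj0 ej0]].
step; first by lia.
apply: (@wp_seq _ _ _ _ (fun s' t => t <= 4 * OM + 7 /\ va s' 8 = j0)).
  apply: (@wp_for _ _ _ _ _ (OM + 1) (fun i s' t => [/\ t <= 4 * i, va s' 8 <= i.-1, va s' 8 <= j0 &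
     j0 < i -> va s' 8 = j0])).
  - by [].
  - by lia.
  - by move=> s' [fv _]; rewrite /= fv //= EO.
  - by split.
  - move=> i s' t iO [tle h1 h2 h3] Ei [fv fa].
    have EO' : va s' vOm = OM by rewrite fv.
    have EW' : va s' vW = W by rewrite fv.
    have Ed : ar s' aDp = ar s aDp by rewrite fa.
    step; first by apply: leq_ltn_trans (leq_b1 _) _; lia.
    rewrite EO' EW' Ei Ed addn1 ltnS.
    have iO' : i <= OM by lia.
    have ubi : ar s aDp (OM + i) <= W -> i <= j0 by move=> h; have := ub i iO' h; lia.
    case: (boolP (ar s aDp (OM + i) <= W)) => c.
      have ij := ubi c; step; first by rewrite Ei; lia.
      rewrite Ei mul1n subnKC; last by lia.
      by split=> //=; lia.
    have ij : i != j0 by apply: contraNneq c => ->.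
    step; first by rewrite mul0n addn0; lia.
    rewrite mul0n addn0; split; [lia | lia | by [] | ].
    by move=> h; apply: h3; lia.
  - by move=> s' t [tle _ h2 h3] _ _; split; [lia | apply: h3; lia].
move=> s1 t1 [t1le E8] [fv1 _].
have EZ1 : va s1 vZU = ZU by rewrite fv1.
step; first by rewrite EZ1 E8 ej0.
by rewrite EZ1 E8 ej0; split=> //; lia.
Qed.

Lemma answerD_ok SP s : va s vOm = OM -> va s vInf = INF -> va s vSP = SP -> OM + 2 < V -> INF < V -> SP < V ->
  (forall x, x <= OM -> ar s aDp x < V) ->
  (forall x, x <= OM -> ar s aDp x < INF -> SP <= z + ar s aDp x) ->
  (exists x, [/\ x <= OM, ar s aDp x < INF & SP = z + ar s aDp x]) ->
  wp V answerD s (fun s' t => t <= 4 * OM + 10 /\ va s' 0 = z).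
Proof.
move=> EO EI ES OV IV SV dV lb [x0 [x0O dx0 ex0]].
step; first by rewrite EI.
rewrite EI.
apply: (@wp_seq _ _ _ _ (fun s' t => t <= 4 * OM + 7 /\ va s' 8 = ar s aDp x0)).
  apply: (@wp_for _ _ _ _ _ (OM + 1) (fun i s' t => [/\ t <= 4 * i, ar s aDp x0 <= va s' 8 <= INF &
     x0 < i -> va s' 8 = ar s aDp x0])).
  - by [].
  - by lia.
  - by move=> s' [fv _]; rewrite /= fv //= EO.
  - by split=> //=; rewrite ltnW /=.
  - move=> i s' t iO [tle h1 h2] Ei [fv fa].
    have Ed : ar s' aDp = ar s aDp by rewrite fa.
    have iO' : i <= OM by lia.
    step; first by rewrite Ed Ei dV.
    rewrite Ed Ei; step; first by lia.
    have li : ar s aDp x0 <= ar s aDp i.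
      case: (ltnP (ar s aDp i) INF) => [h|]; last by lia.
      by have := lb i iO' h; lia.
    split; [lia | lia | ].
    by rewrite ltnS leq_eqVlt => /orP[/eqP <-|/h2 ->]; lia.
  - by move=> s' t [tle _ h2] _ _; split; [lia | apply: h2; lia].
move=> s1 t1 [t1le E8] [fv1 _].
have ES1 : va s1 vSP = SP by rewrite fv1.
step; first by rewrite ES1 E8; lia.
by rewrite ES1 E8; split; lia.
Qed.

End Answers.

Section Kept.
Variables (C : nat) (u v : nat -> nat).
Let ks := mkseq (fun i => (u i, v i)) C.

Lemma sum1_ks : sum1 ks = \sum_(i < C) u i.
Proof. by rewrite /sum1 big_map sum_iota. Qed.

Lemma sum2_ks : sum2 ks = \sum_(i < C) v i.
Proof. by rewrite /sum2 big_map sum_iota. Qed.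

Lemma count_all_le a : count_all C u a <= C.
Proof. exact: (sum_bool_le _ (fun i => u i == a)). Qed.

Lemma count_all0 : (forall i, i < C -> 0 < u i) -> count_all C u 0 = 0.
Proof. by move=> u0; rewrite /count_all big1 // => i _; case: eqP => // e; have := u0 i (ltn_ord i); rewrite e. Qed.

Lemma nclass_le M b (al : nat -> nat) : (forall i, i < C -> u i <= M) ->
  nclass M (count_all C u) al b <= C.
Proof.
move=> um; rewrite /nclass; apply: leq_trans (_ : \sum_(a < M.+1) count_all C u a <= _).
  by apply: leq_sum => a _; case: (count_all C u a) => //= c; case: (_ == _).
rewrite /count_all exchange_big /=; rewrite -[leqRHS]card_ord -sum1_card; apply: leq_sum => i _.
have ui : u i < M.+1 by rewrite ltnS um.
rewrite (bigD1 (Ordinal ui)) //= eqxx big1 // => a ne; case: eqP => // e.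
by case/eqP: ne; apply: val_inj.
Qed.

Lemma nclass_le_m M b (al cn : nat -> nat) : cn 0 = 0 -> nclass M cn al b <= M.
Proof.
by move=> c0; rewrite /nclass big_ord_recl /= c0 add0n; apply: (sum_bool_le _ (fun i => (0 < cn i.+1) && (al i.+1 == b))).
Qed.

End Kept.

Section Finish.
Variables (V E n m BB W SP z : nat) (uf vf : nat -> nat).
Let XM := BB * BB * BB * ((m + 1) * (m + 1)).
Let ks0 := kept n uf vf.
Hypothesis um0 : forall i, i < n -> uf i <= m.
Hypothesis vB0 : forall i, i < n -> vf i < BB.
Hypothesis m_gt0 : 0 < m.
Hypothesis mBB : m < BB.
Hypothesis HE : V = 2 ^ E.
Hypothesis HX : 4 * XM + 4 < V.
Hypothesis nV : n + 1 < V.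
Hypothesis Hu : sum1 ks0 < V.
Hypothesis WV : W < V.

Lemma XME : XM < 2 ^ E. Proof. by move: HX; rewrite HE; lia. Qed.
Lemma BBXM : BB * BB <= XM. Proof. by rewrite /XM -mulnA leq_pmulr // !muln_gt0 addn1 andbT; lia. Qed.

Lemma kept_size : size ks0 <= n.
Proof. by rewrite size_filter; apply: leq_trans (count_size _ _) _; rewrite size_mkseq. Qed.

Lemma kept_perm C (u v : nat -> nat) : C = size ks0 -> perm_eq (mkseq (fun i => (u i, v i)) C) ks0 ->
  forall i, i < C -> 0 < u i <= m /\ v i < BB.
Proof.
move=> _ p i iC; have : (u i, v i) \in ks0.
  by rewrite -(perm_mem p); apply/mapP; exists i; rewrite ?mem_iota.
by move/(kept_ok um0 vB0).
Qed.

Definition sorted_items C (u v : nat -> nat) :=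
  [/\ C = size ks0, perm_eq (mkseq (fun i => (u i, v i)) C) ks0,
   forall i, i < C -> 0 < u i <= m /\ v i < BB &
   forall i j, i <= j < C -> v i * u j <= v j * u i].

Definition tallied G C u v k s :=
  [/\ greedy_post C G u v k s, va s vInf = \sum_(i < C) v i + W + 1,
    forall a, a <= m -> ar s aCnt a = count_all C u a /\ ar s aCpre a = count_pre k u a,
    forall a, a <= m -> ar s aAl a = 0 &
    forall a, a <= m -> ar s aStart a <= C /\ forall j, j <= count_all C u a ->
      ar s aPS (ar s aStart a + j) - ar s aPS (ar s aStart a) = pfx (mkseq (fun i => (u i, v i)) C) a j].

Lemma prepare_ok md G s : sort_pre n m BB uf vf s -> va s vMode = md -> va s vMM = m -> va s vW = W ->
  va s vG = G -> sum2 ks0 + W + G + 2 < V ->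
  wp V (sortitems ;; tally) s (fun s' t => t <= (30 * n + 30) * E + 50 * n + 20 * m + 130 /\
    exists C u v k, [/\ sorted_items C u v, tallied G C u v k s', va s' vC = C,
      forall i, i < C -> ar s' aU i = u i & [/\ va s' vMode = md, va s' vMM = m, va s' vW = W & va s' vSP = va s vSP]]).
Proof.
move=> pre Emd EM EW EG Hv; have [[En EB EQ EA] md1] := pre.
have hX := XME.
apply: wp_seq (sortitems_ok um0 mBB vB0 HX nV hX pre) _ => s1 t1 [t1le EC EX pm rt] [fv1 fa1].
set C := size ks0 in EC pm rt *; set u := ar s1 aU in pm rt; set v := ar s1 aV in pm rt.
have Cn : C <= n := kept_size.
have kp := kept_perm (erefl : C = size ks0) pm.
have um1 i : i < C -> u i <= m by move=> /kp[/andP[]].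
have vm1 i : i < C -> v i < BB by move=> /kp[].
have S1 : \sum_(i < C) u i = sum1 ks0 by rewrite -(sum1_ks C u v) /sum1 (perm_big _ pm).
have S2 : \sum_(i < C) v i = sum2 ks0 by rewrite -(sum2_ks C u v) /sum2 (perm_big _ pm).
have CV : C + 1 < V by lia.
have Hv' : \sum_(i < C) v i + W + G + 2 < V by rewrite S2.
have Hu' : \sum_(i < C) u i < V by rewrite S1.
have tp : tally_pre C m W G BB XM u v s1.
  by split; split=> //; rewrite fv1.
have T := tally_ok um1 mBB vm1 BBXM HX hX CV Hv' Hu' tp.
apply: wp_mono (wp_frame T) => s2 t2 [[t2le [k [h1 h2 h3 h4 h5]]] [fv2 fa2]]; split.
  have : (15 * C + 15) * E <= (15 * n + 15) * E by rewrite leq_mul2r; apply/orP; right; lia.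
  have -> : (30 * n + 30) * E = (15 * n + 15) * E + (15 * n + 15) * E by clear; lia.
  by move: t1le t2le Cn; move: (_ * E) (_ * E) => x y; clear; lia.
exists C, u, v, k; split=> //.
- by rewrite fv2.
- by move=> i iC; rewrite fa2.
- by split; rewrite fv2 //= fv1.
Qed.

Lemma pfx_facts C (u v : nat -> nat) INF : \sum_(i < C) v i <= INF ->
  let P := pfx (mkseq (fun i => (u i, v i)) C) in
  [/\ forall a, P a 0 = 0, forall a j, j <= count_all C u a -> P a j <= INF,
   forall a j, j < count_all C u a -> P a j.+1 <= P a j + INF &
   forall a j, j.+2 <= count_all C u a -> 2 * P a j.+1 <= P a j + P a j.+2].
Proof.
move=> le P; have kI : sum2 (mkseq (fun i => (u i, v i)) C) <= INF by rewrite sum2_ks.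
split=> [a|a j|a j|a j]; rewrite ?(cntE C u v) => *.
- exact: pfx0.
- exact: pfx_inf kI _ _.
- by apply: pfx_step.
- by apply: pfx_convex.
Qed.

Lemma dp_run s C u v k NL OM INF alpha wn CW (P := pfx (mkseq (fun i => (u i, v i)) C)) :
  sorted_items C u v -> k <= C -> \sum_(i < C) v i < INF ->
  [/\ va s vInf = INF, va s vOm = OM, va s vNL = NL & va s vMM = m] ->
  (forall a, a <= m -> ar s aCnt a = count_all C u a /\ ar s aCpre a = count_pre k u a) ->
  (forall a, a <= m -> ar s aAl a = alpha a) ->
  (forall b, 0 < b <= NL -> ar s aWn b = wn b) ->
  (forall a, a <= m -> ar s aStart a <= C /\ forall j, j <= count_all C u a ->
      ar s aPS (ar s aStart a + j) - ar s aPS (ar s aStart a) = P a j) ->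
  (forall a, a <= m -> 0 < count_all C u a -> 0 < alpha a <= NL) ->
  (forall b b', b <= b' <= NL -> 0 < b -> wn b' <= wn b) ->
  (forall b, 0 < b <= NL -> m <= wn b <= OM) -> 0 < NL ->
  INF * (6 * OM + 6) < V -> 8 * OM + 8 + 2 * n + NL < V ->
  (forall b, 0 < b <= NL -> nclass m (count_all C u) alpha b * (wn b + 1) <= CW) ->
  wp V (dpinit ;; dploop) s (fun s' t => t <= NL * (30 + 10 * (m + 1) + 510 * (E + 2) * CW) + 6 * OM + 8 /\
    dp_inv INF OM NL m (count_all C u) (count_pre k u) alpha wn P (fun a => 0 < count_all C u a) OM (dpf INF OM s')).
Proof.
move=> [EC pm kp rt] kC SI [EI EO EN EM] Hc Ha Hw Hs aN wm wO N0 H1 H2 HC.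
have Cn : C <= n by rewrite EC; exact: kept_size.
have cpl : forall a, count_pre k u a <= count_all C u a by move=> a; apply: count_pre_le.
have c0 : count_all C u 0 = 0 by apply: count_all0 => i /kp[/andP[]].
have [P0 Pinf Pstep Pconv] := @pfx_facts C u v INF (ltnW SI).
have I0 : 0 < INF by lia.
have HEb : 2 * OM + 1 <= 2 ^ E by rewrite -HE; lia.
have H2' : 8 * OM + 8 + 2 * C + NL < V by lia.
have cN a : count_all C u a <= C := count_all_le C u a.
have pre : dp_pre INF OM NL m (count_all C u) (count_pre k u) alpha wn P C s.
  split=> //; split=> //; try by move=> a am; have [] := Hc a am.
have I := dpinit_ok c0 I0 H1 H2' HEb pre.
apply: wp_seq I _ => s1 t1 [t1le inv1] f1.
have pre1 : dp_pre INF OM NL m (count_all C u) (count_pre k u) alpha wn P C s1.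
  by apply: dp_pre_frame pre f1 _ _ _ _ _.
have D := dploop_ok cpl aN wm wO c0 P0 I0 Pinf Pstep Pconv H1 H2' HEb cN pre1 inv1 HC N0.
apply: wp_mono D => s2 t2 [t2le inv2]; split=> //.
by move: t1le t2le; move: (NL * _) => X; clear; lia.
Qed.


Definition winbound := 2 * density m * (342 * 1000 * loglen m ^ 3 * m ^ 2 + 4 * m).

Lemma width_le NL b : 2 ^ NL <= 2 * density m -> width m NL b <= winbound.
Proof.
move=> le2; apply: leq_mul; last by rewrite leq_add2r leq_div.
by apply: leq_trans le2; apply: ltnW; apply: ltn_expl.
Qed.

Lemma width_mono NL b b' : b <= b' -> width m NL b' <= width m NL b.
Proof.
move=> bb; rewrite /width leq_mul2l leq_add2r; apply/orP; right.
by rewrite leq_div2l ?expn_gt0 // leq_exp2l.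
Qed.

Definition classcost NL := 2 * NL * (342 * 1000 * loglen m ^ 3 * m ^ 2) + 5 * (m * m) * NL.

(** In the number of classes times the window the powers [2 ^ b] cancel, which leaves the first
    summand of [classcost]. The second pays for the part [4 * m] of the width, using that a level
    has at most [m] classes. *)
Lemma classcost_ok NL b q : 0 < NL -> q <= 2 * 2 ^ b -> q <= m -> q * (width m NL b + 1) <= classcost NL.
Proof.
move=> N0 q2 qm; rewrite /width /classcost; set X := 342 * 1000 * _ * _.
have h := leq_trunc_div X (2 ^ b); move: h; set D := X %/ _ => h.
have e1 : q * (NL * D) <= 2 * NL * X.
  apply: leq_trans (_ : 2 * 2 ^ b * (NL * D) <= _); first by rewrite leq_mul2r q2 orbT.
  have -> : 2 * 2 ^ b * (NL * D) = 2 * NL * (D * 2 ^ b) by clear; lia.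
  by rewrite leq_mul2l h orbT.
have e2 : q * (NL * (4 * m) + 1) <= m * (NL * (4 * m) + 1) by rewrite leq_mul2r qm orbT.
have e3 : m * (NL * (4 * m) + 1) <= 5 * (m * m) * NL.
  have -> : m * (NL * (4 * m) + 1) = 4 * (m * m) * NL + m by clear; lia.
  have -> : 5 * (m * m) * NL = 4 * (m * m) * NL + m * m * NL by clear; lia.
  by rewrite leq_add2l -mulnA leq_pmulr // muln_gt0 m_gt0.
have -> : q * (NL * (D + 4 * m) + 1) = q * (NL * D) + q * (NL * (4 * m) + 1) by clear; lia.
by apply: leq_add e1 (leq_trans e2 e3).
Qed.

Lemma finishB_ok s : sort_pre n m BB uf vf s -> va s vMode = 1 -> va s vMM = m -> va s vW = W ->
  va s vG = W -> sum2 ks0 + W + W + 2 < V -> is_opt ks0 W z -> z < V ->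
  winbound + 6 * density m + n + 10 < V ->
  (sum2 ks0 + W + 1) * (6 * winbound + 6) < V -> 8 * winbound + 8 + 2 * n + 2 * density m < V ->
  wp V finish s (fun s' t => va s' 0 = z /\ exists NL, 2 ^ NL <= 2 * density m /\
    t <= (30 * n + 30) * E + 50 * n + 20 * m + 200 + (NL + 1) * (10 * m + 20 * n + 60) + 10 * NL + 3 * loglen m
      + NL * (30 + 10 * (m + 1) + 510 * (E + 2) * classcost NL) + 10 * width m NL 1).
Proof.
move=> pre Emd EM EW EG Hs opt zV V1 V2 V3.
apply: wp_seq (prepare_ok pre Emd EM EW EG Hs) _.
move=> s1 t1 [t1le [C [u [v [k [si [gp EI Hc Hal Hst] EC1 EU [Emd1 EM1 EW1 _]]]]]]] _.
have [EC pm kp rt] := si; have [EK kC EZU fit brk] := gp.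
have Cn : C <= n by rewrite EC; exact: kept_size.
have um1 i : i < C -> u i <= m by move=> /kp[/andP[]].
have um2 i : i < C -> 0 < u i <= m by move=> /kp[].
have S2 : \sum_(i < C) v i = sum2 ks0 by rewrite -(sum2_ks C u v) /sum2 (perm_big _ pm).
apply: wp_ifS => [_|c]; last by rewrite /= Emd1 in c.
have lp : lev_pre C k m u s1 by split.
have V1' : 2 * density m * (342 * 1000 * loglen m ^ 3 * m ^ 2 + 4 * m) + 6 * density m + C + 10 < V.
  by apply: leq_ltn_trans V1; rewrite leq_add2r leq_add2l.
apply: wp_seq (levels_ok m_gt0 um1 kC V1' lp Hal) _.
move=> s2 t2 [NL [al [[EN N0 dNL le2 t2le] [EO HW] EAl sc mk]]] [fv2 fa2].
have alL a : a <= m -> al a <= NL by move=> /EAl[].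
set OM := width m NL 1 in EO; set INF := \sum_(i < C) v i + W + 1 in EI.
have OMb : OM <= winbound := width_le 1 le2.
have NLd : NL < 2 * density m by apply: leq_trans le2; apply: ltn_expl.
have r1 : [/\ va s2 vInf = INF, va s2 vOm = OM, va s2 vNL = NL & va s2 vMM = m].
  by split=> //; rewrite fv2.
have r2 a : a <= m -> ar s2 aCnt a = count_all C u a /\ ar s2 aCpre a = count_pre k u a.
  by move=> am; rewrite !fa2 //; apply: Hc.
have r3 a : a <= m -> ar s2 aAl a = al a by move=> /EAl[].
have r4 a : a <= m -> ar s2 aStart a <= C /\ forall j, j <= count_all C u a ->
      ar s2 aPS (ar s2 aStart a + j) - ar s2 aPS (ar s2 aStart a) = pfx (mkseq (fun i => (u i, v i)) C) a j.
  by move=> am; rewrite !fa2 //; apply: Hst.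
have r5 a : a <= m -> 0 < count_all C u a -> 0 < al a <= NL.
  move=> am ca; rewrite alL // andbT.
  exact: (alpha_gt0 um2 m_gt0 kC fit brk sc dNL am ca).
have r6 b b' : b <= b' <= NL -> 0 < b -> width m NL b' <= width m NL b.
  by move=> /andP[bb _] _; apply: width_mono.
have r7 b : 0 < b <= NL -> m <= width m NL b <= OM.
  move=> /andP[b0 _]; rewrite (width_mono NL b0) andbT /width.
  by apply: leq_trans (leq_pmull _ N0); rewrite addnC; apply: leq_trans (leq_addr _ _); rewrite leq_pmull.
have r8 : INF * (6 * OM + 6) < V.
  apply: leq_ltn_trans V2; rewrite /INF S2 leq_mul2l; apply/orP; right; move: OMb; clear; lia.
have r9 : 8 * OM + 8 + 2 * n + NL < V by move: OMb NLd V3; clear; lia.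
have r10 b : 0 < b <= NL -> nclass m (count_all C u) al b * (width m NL b + 1) <= classcost NL.
  move=> bN; apply: classcost_ok => //; last by apply: nclass_le_m; apply: count_all0 => i /um2/andP[].
  apply: leq_trans (_ : \sum_(a < m.+1) (al a == b) <= _).
    by rewrite /nclass; apply: leq_sum => a _; case: (0 < _) => //=.
  by apply: leq_trans (mk b bN) _; rewrite leq_mul2l leq_pred.
have SI : \sum_(i < C) v i < INF by rewrite /INF; lia.
apply: wp_seq (dp_run si kC SI r1 r2 r3 HW r4 r5 r6 r7 N0 r8 r9 r10) _.
move=> s3 t3 [t3le inv] [fv3 fa3].
have opt' : is_opt (mkseq (fun i => (u i, v i)) C) W z by apply: is_opt_perm opt; rewrite perm_sym.
have WI : W < INF by rewrite /INF; lia.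
apply: wp_if => [_|c]; last by rewrite /= fv3 //= fv2 //= Emd1 in c.
have A1 : va s3 vOm = OM by rewrite fv3.
have A2 : va s3 vW = W by rewrite fv3 //= fv2.
have A3 : va s3 vZU = \sum_(i < k) u i by rewrite fv3 //= fv2.
have A4 : 2 * OM + 2 < V by move: OMb V3; clear; lia.
have dE j : j <= OM -> dpf INF OM s3 (OM + j) = ar s3 aDp (OM + j).
  by move=> jO; rewrite /dpf; case: ifP => //; lia.
have A5 j : j <= OM -> ar s3 aDp (OM + j) <= W -> \sum_(i < k) u i + j <= z.
  by move=> jO; rewrite -dE // => h; exact: (chosen_le um2 kC opt' WI inv h).
have A6 : exists j, [/\ j <= OM, ar s3 aDp (OM + j) <= W & \sum_(i < k) u i + j = z].
  have [j [j1 j2 j3]] := chosen_ex um2 m_gt0 rt kC fit brk sc mk alL dNL opt' WI inv.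
  by exists j; split=> //; rewrite -dE.
apply: wp_mono (answerB_ok A1 A2 A3 A4 zV A5 A6) => s4 t4 [t4le E0]; split=> //.
exists NL; split=> //; rewrite -/OM.
have X1 : (NL + 1) * (10 * m + 20 * C + 60) <= (NL + 1) * (10 * m + 20 * n + 60).
  by rewrite leq_mul2l; apply/orP; right; lia.
move: t1le t2le t3le t4le X1; move: (_ * E) (_ * (10 * m + 20 * C + 60)) (_ * (10 * m + 20 * n + 60)) (NL * (30 + _ + _)).
by clear => x y w1 w2; lia.
Qed.

Lemma finishD_ok s : sort_pre n m BB uf vf s -> va s vMode = 0 -> va s vMM = m -> va s vW = W ->
  va s vG = SP -> va s vSP = SP -> sum2 ks0 + W + SP + 2 < V -> sum2 ks0 <= SP ->
  (forall e, sub_ms e ks0 -> sum1 ks0 <= W + sum1 e -> SP <= z + sum2 e) ->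
  (exists e, [/\ sub_ms e ks0, sum1 ks0 <= W + sum1 e & SP = z + sum2 e]) ->
  m <= W -> m + 2 < V -> (sum2 ks0 + W + 1) * (6 * W + 6) < V -> 8 * W + 8 + 2 * n + 1 < V ->
  wp V finish s (fun s' t => va s' 0 = z /\
    t <= (30 * n + 30) * E + 50 * n + 40 * m + 300 + 510 * (E + 2) * (minn n m * (W + 1)) + 10 * W).
Proof.
move=> pre Emd EM EW EG ES Hs sSP ub ex mW mV V2 V3.
apply: wp_seq (prepare_ok pre Emd EM EW EG Hs) _.
move=> s1 t1 [t1le [C [u [v [k [si [gp EI Hc Hal Hst] EC1 EU [Emd1 EM1 EW1 ES1]]]]]]] _.
have [EC pm kp rt] := si; have [EK kC EZU fit brk] := gp; rewrite ES in ES1.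
have Cn : C <= n by rewrite EC; exact: kept_size.
have um2 i : i < C -> 0 < u i <= m by move=> /kp[].
have um1 i : i < C -> u i <= m by move=> /kp[/andP[]].
have S2 : \sum_(i < C) v i = sum2 ks0 by rewrite -(sum2_ks C u v) /sum2 (perm_big _ pm).
(* The capacity is the total profit, so no break item exists and the greedy prefix is everything. *)
have kE : k = C.
  apply/eqP; rewrite eqn_leq kC leqNgt; apply/negP => kl; have := brk kl; rewrite ltnNge => /negP; apply.
  by apply: leq_trans sSP; rewrite -S2; apply: sum_le.
apply: wp_ifS => [c|_]; first by rewrite /= Emd1 in c.
apply: (@wp_seq _ _ _ _ (fun s' t => [/\ t <= 3 * m + 10, va s' vNL = 1, va s' vOm = W, ar s' aWn 1 = W &
   forall a, a <= m -> ar s' aAl a = 1])).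
  step; first by lia.
  apply: (@wp_seq _ _ _ _ (fun s' t => t <= 3 * (m + 1) + 2 /\ forall a, a <= m -> ar s' aAl a = 1)).
    apply: (@wp_for _ _ _ _ _ (m + 1) (fun i s' t => t <= 3 * i /\ forall a, a < i -> ar s' aAl a = 1)).
    - by [].
    - by lia.
    - by move=> s' [fv _]; rewrite /= fv //= EM1.
    - by [].
    - move=> i s' t im [tle H] Ei _; step; first by lia.
      rewrite Ei; split; first by lia.
      by move=> a ai; case: (a =P i) => [//|ne]; apply: H; lia.
    - by move=> s' t [tle H] _ _; split; [lia | move=> a am; apply: H; lia].
  move=> s2 t2 [t2le H2] [fv2 fa2].
  have EW2 : va s2 vW = W by rewrite fv2.
  step; first by rewrite EW2.
  step; first by rewrite EW2.
  rewrite EW2; split=> //; first by lia.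
  by rewrite fv2.
move=> s2 t2 [t2le EN EO HW1 HA] [fv2 fa2].
set INF := \sum_(i < C) v i + W + 1 in EI.
have r1 : [/\ va s2 vInf = INF, va s2 vOm = W, va s2 vNL = 1 & va s2 vMM = m].
  by split=> //; rewrite fv2.
have r2 a : a <= m -> ar s2 aCnt a = count_all C u a /\ ar s2 aCpre a = count_pre k u a.
  by move=> am; rewrite !fa2 //; apply: Hc.
have r4 a : a <= m -> ar s2 aStart a <= C /\ forall j, j <= count_all C u a ->
      ar s2 aPS (ar s2 aStart a + j) - ar s2 aPS (ar s2 aStart a) = pfx (mkseq (fun i => (u i, v i)) C) a j.
  by move=> am; rewrite !fa2 //; apply: Hst.
have HW b : 0 < b <= 1 -> ar s2 aWn b = W by move=> b1; have -> : b = 1 by lia.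
have r5 a : a <= m -> 0 < count_all C u a -> 0 < 1 <= 1 by [].
have r6 (b b' : nat) : b <= b' <= 1 -> 0 < b -> W <= W by [].
have r7 b : 0 < b <= 1 -> m <= W <= W by rewrite mW leqnn.
have r8 : INF * (6 * W + 6) < V by rewrite /INF S2.
have SI : \sum_(i < C) v i < INF by rewrite /INF; lia.
have r10 b : 0 < b <= 1 -> nclass m (count_all C u) (fun=> 1) b * (W + 1) <= minn n m * (W + 1).
  move=> _; rewrite leq_mul2r leq_min; apply/orP; right.
  rewrite (leq_trans (nclass_le b (fun=> 1) um1) Cn) /=.
  by apply: nclass_le_m; apply: count_all0 => i /um2/andP[].
apply: wp_seq (dp_run (alpha := fun=> 1) (wn := fun=> W) si kC SI r1 r2 HA HW r4 r5 r6 r7 isT r8 V3 r10) _.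
move=> s3 t3 [t3le inv] [fv3 fa3].
set ks := mkseq (fun i => (u i, v i)) C in pm inv.
have cE : count_all C u = ccount ks by apply: functional_extensionality => a; apply: cntE.
have cE2 : count_pre k u = ccount ks by rewrite kE -cE.
rewrite cE cE2 in inv.
have km : all (fun x => 0 < x.1 <= m) ks.
  by apply/allP => x /mapP[i]; rewrite mem_iota => /andP[_ iC] ->; apply: um2.
have kI : sum2 ks < INF by rewrite sum2_ks.
have s1E : sum1 ks = sum1 ks0 by rewrite /sum1 (perm_big _ pm).
have ub' e : sub_ms e ks -> sum1 ks <= W + sum1 e -> SP <= z + sum2 e.
  by rewrite s1E => /(sub_ms_perm pm); apply: ub.
have ex' : exists e, [/\ sub_ms e ks, sum1 ks <= W + sum1 e & SP = z + sum2 e].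
  have [e [e1 e2 e3]] := ex; exists e; split; rewrite ?s1E //.
  by apply: sub_ms_perm e1; rewrite perm_sym.
apply: wp_if => [c|_]; first by rewrite /= fv3 //= fv2 //= Emd1 in c.
have dE x : x <= W -> dpf INF W s3 x = ar s3 aDp x.
  by move=> xW; rewrite /dpf; case: ifP => //; lia.
have A1 : va s3 vOm = W by rewrite fv3.
have A2 : va s3 vInf = INF by rewrite fv3 //= fv2.
have A3 : va s3 vSP = SP by rewrite fv3 //= fv2.
have IV : INF < V by rewrite /INF S2; move: Hs; clear; lia.
have A4 x : x <= W -> ar s3 aDp x < V.
  by move=> xW; rewrite -dE //; have [bd _ _ _] := inv; apply: leq_ltn_trans (bd x) IV.
have A5 x : x <= W -> ar s3 aDp x < INF -> SP <= z + ar s3 aDp x.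
  by move=> xW; rewrite -dE // => h; exact: (excluded_ge km kI ub' inv h xW).
have A6 : exists x, [/\ x <= W, ar s3 aDp x < INF & SP = z + ar s3 aDp x].
  have [x [x1 x2 x3]] := excluded_ex km kI ub' ex' inv.
  by exists x; split; rewrite -?dE.
have WV2 : W + 2 < V by move: V3; clear; lia.
have SV : SP < V by move: Hs; clear; lia.
apply: wp_mono (answerD_ok A1 A2 A3 WV2 IV SV A4 A5 A6) => s4 t4 [t4le E0]; split=> //.
move: t1le t2le t3le t4le; rewrite mul1n; move: (_ * E) (_ * (minn n m * _)).
by clear => x y; lia.
Qed.

End Finish.

(* Mode 1 runs the dynamic program over the profits of the chosen items, mode 0 over the weights
   of the excluded ones. *)
Definition setup : cmd :=
  7 ::= #vn [-] (#vn [-] #vWM) ;;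
  vMode ::= #vPM [*] #vPM [<] #7 [*] #vW [+] 1 ;;
  vMM ::= #vMode [*] (#vPM [+] 1) [+] (1 [-] #vMode) [*] #vWM ;;
  vG ::= #vMode [*] #vW [+] (1 [-] #vMode) [*] #vSP ;;
  vBB ::= #vPM [+] #vWM [+] 2 ;;
  vQQ ::= (#vMM [+] 1) [*] (#vMM [+] 1).

(** If all clipped items fit together, their total profit is the answer. Otherwise their weight
    exceeds [W], which yields [W < n * wmax] for the second time bound. *)
Definition knapsack : cmd :=
  load ;; IF #vW [<] #vSW THEN setup ;; finish ELSE 0 ::= #vSP FI.

(** * Size bounds as powers of [T] and [L] *)

Section Powers.
Variables (T c0 : nat).
Hypothesis T2 : 2 <= T.
Hypothesis Tc : 4096 <= T ^ c0.
Variable Y : nat.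
Hypothesis Y0 : 0 < Y.

Lemma pwW i j a : a <= T ^ i -> i <= j -> a <= T ^ j.
Proof. by move=> h ij; apply: leq_trans h _; apply: leq_pexp2l => //; apply: ltnW. Qed.

Lemma pwM i j a b : a <= T ^ i -> b <= T ^ j -> a * b <= T ^ (i + j).
Proof. by move=> ha hb; rewrite expnD leq_mul. Qed.

Lemma pwD i j a b : a <= T ^ i -> b <= T ^ j -> a + b <= T ^ (maxn i j).+1.
Proof.
move=> ha hb; rewrite expnS; apply: leq_trans (leq_mul T2 (leqnn _)); rewrite mul2n -addnn.
by apply: leq_add; [apply: pwW ha _; rewrite leq_maxl | apply: pwW hb _; rewrite leq_maxr].
Qed.

Lemma pwc a : a <= 4096 -> a <= T ^ c0. Proof. by move=> h; apply: leq_trans Tc. Qed.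

Lemma pwX i a k : a <= T ^ i -> a ^ k <= T ^ (i * k).
Proof. by move=> h; rewrite expnM; case: k => // k; rewrite leq_exp2r. Qed.

Lemma pyW i j a : a <= T ^ i * Y -> i <= j -> a <= T ^ j * Y.
Proof. by move=> h ij; apply: leq_trans h _; rewrite leq_mul2r leq_pexp2l ?orbT //; apply: ltnW. Qed.

Lemma pyD i j a b : a <= T ^ i * Y -> b <= T ^ j * Y -> a + b <= T ^ (maxn i j).+1 * Y.
Proof.
move=> ha hb; rewrite expnS -mulnA; apply: leq_trans (leq_mul T2 (leqnn _)); rewrite mul2n -addnn.
by apply: leq_add; [apply: pyW ha _; rewrite leq_maxl | apply: pyW hb _; rewrite leq_maxr].
Qed.

Lemma pyL i j a b : a <= T ^ i -> b <= T ^ j * Y -> a * b <= T ^ (i + j) * Y.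
Proof. by move=> ha hb; rewrite expnD -mulnA leq_mul. Qed.

Lemma pyR i j a b : a <= T ^ i * Y -> b <= T ^ j -> a * b <= T ^ (j + i) * Y.
Proof. by move=> ha hb; rewrite mulnC; apply: pyL. Qed.

Lemma pyS i a : a <= T ^ i -> a <= T ^ i * Y.
Proof. by move=> h; apply: leq_trans h _; rewrite leq_pmulr. Qed.

End Powers.

(** Follows the shape of the expression and collects an exponent in an existential variable;
    comparing it with the target exponent is then a computation. [py] does the same for bounds that
    are linear in a factor [Y]. *)
Ltac pw T2 Tc := lazymatch goal with
  | |- is_true (leq (addn _ _) _) => eapply (pwD T2); pw T2 Tc
  | |- is_true (leq (muln _ _) _) => eapply pwM; pw T2 Tc
  | |- is_true (leq (expn _ _) _) => eapply pwX; pw T2 Tc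
  | H : is_true (leq ?a (expn ?t _)) |- is_true (leq ?a (expn ?t _)) => exact H
  | |- _ => eapply (pwc Tc); exact isT end.

Ltac py T2 Tc Y0 := lazymatch goal with
  | H : is_true (leq ?a (muln (expn ?t _) ?y)) |- is_true (leq ?a (muln (expn ?t _) ?y)) => exact H
  | |- is_true (leq (addn _ _) _) => eapply (pyD T2); py T2 Tc Y0
  | |- is_true (leq (muln _ _) _) => first
      [ eapply pyL; [solve [pw T2 Tc] | solve [py T2 Tc Y0]]
      | eapply pyR; [solve [py T2 Tc Y0] | solve [pw T2 Tc]]
      | eapply (pyS Y0); solve [pw T2 Tc] ]
  | |- _ => eapply (pyS Y0); pw T2 Tc end.

Section Sizes.
Variables (L T n m NL : nat).
Hypothesis L4 : 4 <= L.
Hypothesis TE : T = 2 ^ L.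
Hypothesis mT : m <= T.
Hypothesis m0 : 0 < m.

Let T16 : 16 <= T. Proof. by rewrite TE; apply: (@leq_pexp2l 2 4). Qed.
Let T2 : 2 <= T. Proof. exact: leq_trans T16. Qed.
Let Tc : 4096 <= T ^ 3.
Proof. by apply: (@leq_trans (16 ^ 3)) => //; rewrite leq_exp2r. Qed.
Let L2 : 2 <= L. Proof. exact: leq_trans L4. Qed.
Let Lc : 4096 <= L ^ 6.
Proof. by apply: (@leq_trans (4 ^ 6)) => //; rewrite leq_exp2r. Qed.

Lemma loglen_L : loglen m <= L ^ 2.
Proof.
have : trunc_log 2 m.+1 < L.+1.
  rewrite -(ltn_exp2l _ _ (isT : 1 < 2)); apply: leq_ltn_trans (@trunc_logP 2 m.+1 isT isT) _.
  by rewrite expnS -TE; lia.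
by rewrite /loglen -mulnn; nia.
Qed.

Lemma loglen_T : loglen m <= T ^ 2.
Proof.
have := @trunc_logP 2 m.+1 isT isT; have := @ltn_expl 2 (trunc_log 2 m.+1) isT.
by rewrite /loglen -mulnn; nia.
Qed.

Lemma density_T : density m <= T ^ 13.
Proof.
have h1 := loglen_T; have h2 : m <= T ^ 1 by rewrite expn1.
rewrite /density; eapply (pwW T2); first by pw T2 Tc.
by [].
Qed.

Lemma winbound_T : winbound m <= T ^ 40.
Proof.
have h1 := loglen_T; have h2 : m <= T ^ 1 by rewrite expn1.
have h3 := density_T; rewrite /winbound; eapply (pwW T2); first by pw T2 Tc.
by [].
Qed.

Hypothesis le2 : 2 ^ NL <= 2 * density m.

Lemma NL_L : NL <= L ^ 3.
Proof.
have : 2 ^ NL <= T ^ 14.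
  by apply: leq_trans le2 _; rewrite (expnS T 13) leq_mul ?density_T.
rewrite TE -expnM leq_exp2l // => h; apply: leq_trans h _.
by rewrite expnS leq_mul2l -mulnn; nia.
Qed.

Variable E : nat.
Hypothesis EL : E <= L ^ 4.

Lemma costB_L : (30 * n + 30) * E + 50 * n + 20 * m + 200 + (NL + 1) * (10 * m + 20 * n + 60) + 10 * NL + 3 * loglen m
      + NL * (30 + 10 * (m + 1) + 510 * (E + 2) * classcost m NL) + 10 * width m NL 1 <= L ^ 80 * (n + 1 + m * m).
Proof.
set Y := n + 1 + m * m.
have Y0 : 0 < Y by rewrite /Y addn1.
have h1 := loglen_L; have h2 := NL_L.
have h3 : n <= L ^ 0 * Y by rewrite mul1n /Y; lia.
have h4 : m * m <= L ^ 0 * Y by rewrite mul1n /Y; lia.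
have h5 : m <= L ^ 0 * Y by apply: leq_trans h4; rewrite leq_pmulr.
have h6 : classcost m NL <= L ^ 40 * Y.
  rewrite /classcost -mulnn; eapply (pyW L2); first by py L2 Lc Y0.
  by [].
have h7 : width m NL 1 <= L ^ 40 * Y.
  apply: leq_trans (_ : NL * (342 * 1000 * loglen m ^ 3 * (m * m) + 4 * m) <= _).
    by rewrite /width mulnn leq_mul2l leq_add2r leq_div orbT.
  eapply (pyW L2); first by py L2 Lc Y0.
  by [].
eapply (pyW L2); first by py L2 Lc Y0.
by [].
Qed.

Lemma costD_L q W : 0 < W -> 0 < q ->
  (30 * n + 30) * E + 50 * n + 40 * m + 300 + 510 * (E + 2) * (q * (W + 1)) + 10 * W <= L ^ 40 * (n + 1 + m + q * W).
Proof.
move=> W0 q0; set Y := n + 1 + m + q * W.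
have Y0 : 0 < Y by rewrite /Y addn1.
have h3 : n <= L ^ 0 * Y by rewrite mul1n /Y; lia.
have h4 : q * W <= L ^ 0 * Y by rewrite mul1n /Y; lia.
have h5 : m <= L ^ 0 * Y by rewrite mul1n /Y; lia.
have h6 : W <= L ^ 0 * Y by apply: leq_trans h4; rewrite leq_pmull.
have h7 : q * (W + 1) <= L ^ 6 * Y.
  apply: leq_trans (_ : 2 * (q * W) <= _).
    by rewrite mulnCA leq_mul2l; apply/orP; right; lia.
  by rewrite leq_mul //; [apply: leq_trans Lc | rewrite -[Y]mul1n].
eapply (pyW L2); first by py L2 Lc Y0.
by [].
Qed.

End Sizes.

Lemma pwlt T i j a : 2 <= T -> a <= T ^ i -> i < j -> a < T ^ j.
Proof. by move=> T2 h ij; apply: leq_ltn_trans h _; rewrite ltn_exp2l. Qed.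

Lemma sum_bound n (f : nat -> nat) b : (forall i, i < n -> f i <= b) -> \sum_(i < n) f i <= n * b.
Proof.
move=> h; rewrite -[n in n * b]card_ord -sum_nat_const.
by apply: leq_sum => i _; apply: h.
Qed.

Lemma bigmax_iota n (f : nat -> nat) i : i < n -> f i <= \max_(0 <= j < n) f j.
Proof. by move=> iN; rewrite big_mkord (leq_bigmax (Ordinal iN)). Qed.

Lemma bigmax_bound n (f : nat -> nat) b : (forall i, i < n -> f i <= b) -> \max_(0 <= j < n) f j <= b.
Proof. by move=> h; rewrite big_mkord; apply/bigmax_leqP => i _; apply: h. Qed.

Definition swap (x : nat * nat) := (x.2, x.1).

Lemma swapK : involutive swap. Proof. by case. Qed.

Lemma sub_ms_swap e r : sub_ms e (map swap r) -> sub_ms (map swap e) r.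
Proof.
case/sub_ms_compl => q p; apply: (@sub_ms_cat _ _ (map swap q)).
by rewrite -map_cat -{1}(mapK swapK r); apply: perm_map.
Qed.

Lemma sum_swap e : sum1 (map swap e) = sum2 e /\ sum2 (map swap e) = sum1 e.
Proof. by rewrite /sum1 /sum2 !big_map. Qed.

Lemma kept_sum n (uf vf : nat -> nat) :
  sum1 (kept n uf vf) <= \sum_(i < n) uf i /\ sum2 (kept n uf vf) <= \sum_(i < n) vf i.
Proof.
by split; [rewrite -(sum1_ks n uf vf) | rewrite -(sum2_ks n uf vf)]; apply: sub_ms_sum; apply: sub_ms_filter.
Qed.

(** * Correctness and cost of the whole program *)

Section Main.
Variables (items : seq (nat * nat)) (W : nat).
Let n := size items.
Let L := logNU items W.
Let T := 2 ^ L.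
(** All quantities of the algorithm are polynomial in [T]; the exponent [60] leaves room for the
    largest of the side conditions checked in [knapsack_ok]. *)
Let E := 60 * L.
Let V := T ^ 60.
Hypothesis n2 : 1 < n.
Let pf i := (clip W (nth (0, 0) items i)).1.
Let wf i := (clip W (nth (0, 0) items i)).2.

Lemma NU_lt : (n * 2 + 1) * Ubound items W < T.
Proof.
rewrite /T /L /logNU /Ubound addn1 muln2; apply: trunc_log_ltn.
by [].
Qed.

Lemma U2 : 2 <= Ubound items W. Proof. by rewrite /Ubound leq_maxl. Qed.

Lemma UT : Ubound items W < T.
Proof. by apply: leq_ltn_trans NU_lt; rewrite leq_pmull // addn1. Qed.

Lemma nT : n < T.
Proof. have := NU_lt; have := U2; move: (Ubound _ _) T => U t; clear -n2; nia. Qed.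

Lemma L_ge4 : 4 <= L.
Proof.
rewrite -(ltn_exp2l 3 L (isT : 1 < 2)) -/T.
have := NU_lt; have := U2; move: (Ubound _ _) T n2 => U t; move: n => N; clear; nia.
Qed.

Lemma WT : W < T.
Proof. by apply: leq_ltn_trans UT; rewrite /Ubound 2!leq_max leqnn !orbT. Qed.

Lemma p_le i : i < n -> (nth (0, 0) items i).1 <= pmax items.
Proof. by move=> iN; rewrite /pmax (big_nth (0, 0)) (@bigmax_iota n (fun i => (nth (0, 0) items i).1)). Qed.

Lemma w_le i : i < n -> (nth (0, 0) items i).2 <= wmax items.
Proof. by move=> iN; rewrite /wmax (big_nth (0, 0)) (@bigmax_iota n (fun i => (nth (0, 0) items i).2)). Qed.

Lemma pmaxT : pmax items < T.
Proof. by apply: leq_ltn_trans UT; rewrite /Ubound !leq_max leqnn !orbT. Qed.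

Lemma wmaxT : wmax items < T.
Proof. by apply: leq_ltn_trans UT; rewrite /Ubound !leq_max leqnn !orbT. Qed.

Lemma pf_le i : i < n -> pf i <= pmax items.
Proof. by move=> /p_le h; rewrite /pf /clip; case: ifP. Qed.

Lemma wf_le i : i < n -> wf i <= wmax items.
Proof. by move=> /w_le h; rewrite /wf /clip; case: ifP. Qed.

Lemma wf_W i : wf i <= W.
Proof. by rewrite /wf /clip; case: ifP. Qed.

Lemma clip_items : map (clip W) items = mkseq (fun i => (pf i, wf i)) n.
Proof.
apply: (@eq_from_nth _ (0, 0)); rewrite size_map ?size_mkseq // => i iN.
by rewrite nth_mkseq // (nth_map (0, 0)) // /pf /wf -surjective_pairing.
Qed.

Let T16 : 16 <= T. Proof. exact: (@leq_pexp2l 2 4 L isT L_ge4). Qed.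
Let T2 : 2 <= T. Proof. exact: leq_trans T16. Qed.
Let Tc : 4096 <= T ^ 3. Proof. by apply: (@leq_trans (16 ^ 3)) => //; rewrite leq_exp2r. Qed.
Let L2 : 2 <= L. Proof. exact: leq_trans L_ge4. Qed.
Let Lc : 4096 <= L ^ 6. Proof. by apply: (@leq_trans (4 ^ 6)) => //; rewrite leq_exp2r // L_ge4. Qed.

Lemma fitsV a i : a <= T ^ i -> i < 60 -> a < V. Proof. exact: pwlt. Qed.

Lemma VE : V = 2 ^ E. Proof. by rewrite /V /E /T -expnM mulnC. Qed.

Lemma E_L : E <= L ^ 4.
Proof. by rewrite /E expnSr leq_mul2r; apply/orP; right; apply: leq_trans (_ : 60 <= 4 ^ 3) _ => //; rewrite leq_exp2r // L_ge4. Qed.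

Lemma sum_T (f : nat -> nat) : (forall i, i < n -> f i <= T) -> \sum_(i < n) f i <= T ^ 2.
Proof. by move=> /sum_bound h; apply: leq_trans h _; rewrite -mulnn leq_mul2r ltnW ?orbT // nT. Qed.

Definition work X := L ^ 90 * (n + 1 + wmax items + X).
(** The case [X = 0] belongs to instances in which everything fits. In all others the capacity is
    below [n * wmax], as the second time bound requires. *)
Definition workload X := X = 0 \/ [/\ W < n * wmax items, X <= pmax items ^ 2 & X <= minn n (wmax items) * W].

Lemma knapsack_ok s : init_state W items s ->
  wp V knapsack s (fun s' t => va s' 0 = OPT items W /\ exists2 X, workload X & t <= work X).
Proof.
move=> ini; have opt0 := is_opt_clip (is_opt_OPT items W); rewrite clip_items in opt0.
set z := OPT items W in opt0 *.
have hn : n <= T ^ 1 by rewrite expn1 ltnW // nT.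
have hW : W <= T ^ 1 by rewrite expn1 ltnW // WT.
have pT i : i < n -> pf i <= T by move=> /pf_le h; apply: leq_trans h (ltnW pmaxT).
have wT i : i < n -> wf i <= T by move=> /wf_le h; apply: leq_trans h (ltnW wmaxT).
have n0 : 0 < size items by apply: ltnW.
have b1 : 1024 * size items + 64 < V.
  apply: (@fitsV _ 10) => //; eapply (pwW T2); first by rewrite -/n; pw T2 Tc.
  by [].
have b2 : W < V by apply: fitsV hW _.
have b3 : \sum_(i < size items) (nth (0, 0) items i).1 < V.
  by apply: (@fitsV _ 2) => //; apply: (@sum_T (fun i => (nth (0, 0) items i).1)) => i /p_le h; apply: leq_trans h (ltnW pmaxT).
have b4 : \sum_(i < size items) (nth (0, 0) items i).2 < V.
  by apply: (@fitsV _ 2) => //; apply: (@sum_T (fun i => (nth (0, 0) items i).2)) => i /w_le h; apply: leq_trans h (ltnW wmaxT).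
have hsp : \sum_(i < n) pf i <= T ^ 2 := sum_T pT.
have hsw : \sum_(i < n) wf i <= T ^ 2 := sum_T wT.
apply: wp_seq (load_ok n0 b1 b2 b3 b4 ini) _.
move=> s1 t1 [t1le [[En EW EA] [ESP ESW EPM EWM]]] [fv1 fa1]; rewrite -/n in t1le En EA ESP ESW EPM EWM.
rewrite !big_mkord in ESP ESW.
set SP := \sum_(i < n) _ in ESP; set SW := \sum_(i < n) _ in ESW.
set PM := \max_(0 <= i < n) _ in EPM; set WM := \max_(0 <= i < n) _ in EWM.
have hSP : SP <= T ^ 2 := hsp.
have hSW : SW <= T ^ 2 := hsw.
have PMl : PM <= pmax items by apply: bigmax_bound => i; apply: pf_le.
have WMl : WM <= wmax items by apply: bigmax_bound => i; apply: wf_le.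
have WMW : WM <= W by apply: bigmax_bound => i _; apply: wf_W.
have pPM i : i < n -> pf i <= PM by apply: bigmax_iota.
have wWM i : i < n -> wf i <= WM by apply: bigmax_iota.
have hPM : PM <= T ^ 1 by rewrite expn1; apply: leq_trans PMl (ltnW pmaxT).
have hWM : WM <= T ^ 1 by rewrite expn1; apply: leq_trans WMl (ltnW wmaxT).
have Z0 X : 0 < n + 1 + wmax items + X by rewrite addn1 !addSn.
have low X : 20 * n + 40 <= L ^ 12 * (n + 1 + wmax items + X).
  have Y0 := Z0 X; have h : n <= L ^ 0 * (n + 1 + wmax items + X) by rewrite mul1n -!addnA leq_addr.
  eapply (pyW L2); first by py L2 Lc Y0.
  by [].
have total X k t : t <= 20 * n + 40 + k -> k <= L ^ 85 * (n + 1 + wmax items + X) -> t <= work X.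
  move=> h1 h2; apply: leq_trans h1 _; have h3 := low X; rewrite /work.
  apply: leq_trans (pyD L2 h3 h2) _; rewrite leq_mul2r leq_pexp2l ?orbT //; exact: ltnW.
apply: wp_if => [/nzE|/zbE]; rewrite EW ESW => c; last first.
  have zSP : z = SP.
    have [ub [t [h1 h2 h3]]] := opt0.
    have e1 := sum1_ks n pf wf; have e2 := sum2_ks n pf wf.
    apply/eqP; rewrite eqn_leq -h3; apply/andP; split.
      by rewrite /SP -[\sum_(i < n) _]e1; apply: sub_ms_sum.
    by rewrite h3 /SP -[\sum_(i < n) _]e1; apply: ub => //; rewrite e2 leqNgt.
  step; first by rewrite ESP; apply: fitsV hSP _.
  rewrite ESP zSP; split=> //; exists 0; first by left.
  by apply: (@total 0 0) => //; move: t1le; clear; lia.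
have WM0 : 0 < WM.
  rewrite lt0n; apply/negP => /eqP w0; move: c; rewrite /SW big1 // => i _.
  by have := wWM i (ltn_ord i); rewrite w0 leqn0 => /eqP.
have W0 : 0 < W := leq_trans WM0 WMW.
have Wn : W < n * wmax items.
  apply: leq_trans c _; apply: leq_trans (leq_mul (leqnn n) WMl).
  exact: (@sum_bound n wf WM wWM).
(* A minimum by truncated subtraction, computed from the clipped weights. Comparing [PM * PM] with
   [q * W] selects the cheaper table. *)
have qE : n - (n - WM) = minn n WM by move: (n) (WM) => a b; clear; lia.
set q := minn n WM in qE.
have hq : q <= T ^ 1 by apply: leq_trans (geq_minl _ _) hn.
have h1 : 1 <= T ^ 1 by rewrite expn1; apply: ltnW.
set BB := PM + WM + 2.
have hBB : BB <= T ^ 6 by eapply (pwW T2); [rewrite /BB; pw T2 Tc | ].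
set mode := (PM * PM < q * W + 1)%N.
(* [PM + 1] instead of [PM] makes [m] positive even if every clipped profit is [0]. *)
set m := mode * (PM + 1) + (1 - mode) * WM.
set G := mode * W + (1 - mode) * SP.
have mB : m < BB.
  by rewrite /m /BB; case: (mode); rewrite ?mul1n ?mul0n ?subnn ?subn0; move: (PM) (WM) => a b; clear; lia.
have m0 : 0 < m.
  by rewrite /m; case: (mode); rewrite ?mul1n ?mul0n ?subnn ?subn0 ?addn0 ?add0n ?addn1.
have mT : m <= T.
  have p1 := leq_ltn_trans PMl pmaxT; have w1 := leq_ltn_trans WMl wmaxT.
  by rewrite /m; case: (mode); rewrite ?mul1n ?mul0n ?subnn ?subn0 ?addn0 ?add0n ?addn1 // ltnW.
have hm : m <= T ^ 1 by rewrite expn1.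
have hG : G <= T ^ 2.
  rewrite /G; case: (mode); rewrite ?mul1n ?mul0n ?subnn ?subn0 ?addn0 ?add0n //.
  exact: (pwW T2 hW).
have V1 : 1 < V by apply: (@fitsV _ 1); rewrite ?expn1.
apply: (@wp_seq _ _ _ _ (fun s' t => t <= 10 /\ [/\ va s' vMode = mode, va s' vMM = m, va s' vG = G, va s' vBB = BB &
    va s' vQQ = (m + 1) * (m + 1)])).
  step; first by rewrite En EWM qE; apply: fitsV hq _.
  rewrite En EWM qE; step; first exact: leq_ltn_trans (leq_b1 _) V1.
  rewrite EPM EW -/mode; step; first by rewrite EPM EWM -/m; apply: fitsV hm _.
  rewrite EPM EWM -/m; step; first by rewrite EW ESP -/G; apply: fitsV hG _.
  rewrite EW ESP -/G; step; first by rewrite EPM EWM -/BB; apply: fitsV hBB _.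
  rewrite EPM EWM -/BB; step; last by [].
  by apply: (@fitsV _ 20) => //; eapply (pwW T2); [pw T2 Tc | ].
move=> s2 t2 [t2le [EMo EMM EG EBB EQQ]] [fv2 fa2].
have En2 : va s2 vn = n by rewrite fv2.
have EW2 : va s2 vW = W by rewrite fv2.
have ESP2 : va s2 vSP = SP by rewrite fv2.
have HX : 4 * (BB * BB * BB * ((m + 1) * (m + 1))) + 4 < V.
  by apply: (@fitsV _ 50) => //; eapply (pwW T2); [pw T2 Tc | ].
have nV : n + 1 < V by apply: (@fitsV _ 10) => //; eapply (pwW T2); [pw T2 Tc | ].
have hd := density_T L_ge4 (erefl T) mT m0.
have hwb := winbound_T L_ge4 (erefl T) mT m0.
have EL := E_L.
case Emode: mode.
- have mE : m = PM + 1 by rewrite /m Emode mul1n subnn mul0n addn0.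
  have GE : G = W by rewrite /G Emode mul1n subnn mul0n addn0.
  have [k1 k2] := kept_sum n pf wf.
  have hk1 : sum1 (kept n pf wf) <= T ^ 2 := leq_trans k1 hsp.
  have hk2 : sum2 (kept n pf wf) <= T ^ 2 := leq_trans k2 hsw.
  have um i : i < n -> pf i <= m by move=> /pPM h; rewrite mE; apply: leq_trans h (leq_addr _ _).
  have vB i : i < n -> wf i < BB by move=> /wWM; rewrite /BB; move: (PM) (WM) => a b; clear; lia.
  have sp : sort_pre n m BB pf wf s2.
    split; last by rewrite EMo Emode.
    by split=> // i iN; rewrite EMo Emode /= !fa2 //; apply: EA.
  have opt := is_opt_pos opt0.
  have zT : z <= T ^ 2.
    have [_ [t [h _ <-]]] := opt; exact: leq_trans (sub_ms_sum (fun x => x.1) h) hk1.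
  have EMo1 : va s2 vMode = 1 by rewrite EMo Emode.
  have EGW : va s2 vG = W by rewrite EG.
  have c1 : sum1 (kept n pf wf) < V by apply: fitsV hk1 _.
  have c2 : sum2 (kept n pf wf) + W + W + 2 < V.
    by apply: (@fitsV _ 20) => //; eapply (pwW T2); [pw T2 Tc | ].
  have c3 : z < V by apply: fitsV zT _.
  have c4 : winbound m + 6 * density m + n + 10 < V.
    by apply: (@fitsV _ 50) => //; eapply (pwW T2); [pw T2 Tc | ].
  have c5 : (sum2 (kept n pf wf) + W + 1) * (6 * winbound m + 6) < V.
    by apply: (@fitsV _ 55) => //; eapply (pwW T2); [pw T2 Tc | ].
  have c6 : 8 * winbound m + 8 + 2 * n + 2 * density m < V.
    by apply: (@fitsV _ 50) => //; eapply (pwW T2); [pw T2 Tc | ].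
  apply: wp_mono (finishB_ok um vB m0 mB VE HX nV c1 b2 sp EMo1 EMM EW2 EGW c2 opt c3 c4 c5 c6).
  move=> s3 t3 [E0 [NL [le2 t3le]]]; split=> //.
  exists (PM * PM).
    right; split=> //; first by rewrite -mulnn leq_mul.
    have : PM * PM <= q * W by move: Emode; rewrite /mode addn1 ltnS.
    move=> h; apply: leq_trans h _; rewrite leq_mul2r; apply/orP; right.
    by rewrite /q leq_min geq_minl (leq_trans (geq_minr _ _) WMl).
  apply: (@total _ t3); first by move: t1le t2le; clear; lia.
  apply: leq_trans t3le _; apply: leq_trans (costB_L n L_ge4 (erefl T) mT m0 le2 EL) _.
  apply: leq_trans (_ : L ^ 81 * (n + 1 + wmax items + PM * PM) <= _); last first.
    by rewrite leq_mul2r leq_pexp2l ?orbT //; exact: ltnW.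
  rewrite (expnSr L 80) -mulnA leq_mul2l; apply/orP; right.
  apply: leq_trans (_ : 4 * (n + 1 + wmax items + PM * PM) <= _).
    by rewrite mE; move: (wmax items) (PM) => a b; clear; nia.
  by rewrite leq_mul2r L_ge4 orbT.
- have mE : m = WM by rewrite /m Emode mul0n subn0 mul1n.
  have GE : G = SP by rewrite /G Emode mul0n subn0 mul1n.
  have [k1 k2] := kept_sum n wf pf.
  have hk1 : sum1 (kept n wf pf) <= T ^ 2 := leq_trans k1 hsw.
  have hk2 : sum2 (kept n wf pf) <= T ^ 2 := leq_trans k2 hsp.
  have um i : i < n -> wf i <= m by move=> /wWM; rewrite mE.
  have vB i : i < n -> pf i < BB by move=> /pPM; rewrite /BB; move: (PM) (WM) => a b; clear; lia.
  have sp : sort_pre n m BB wf pf s2.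
    split; last by rewrite EMo Emode.
    by split=> // i iN; rewrite EMo Emode /= !fa2 //; have [] := EA i iN.
  have EMo0 : va s2 vMode = 0 by rewrite EMo Emode.
  have EGW : va s2 vG = SP by rewrite EG.
  have c1 : sum1 (kept n wf pf) < V by apply: fitsV hk1 _.
  have c2 : sum2 (kept n wf pf) + W + SP + 2 < V.
    by apply: (@fitsV _ 20) => //; eapply (pwW T2); [pw T2 Tc | ].
  have c4 : m + 2 < V by apply: (@fitsV _ 20) => //; eapply (pwW T2); [pw T2 Tc | ].
  have c5 : (sum2 (kept n wf pf) + W + 1) * (6 * W + 6) < V.
    by apply: (@fitsV _ 55) => //; eapply (pwW T2); [pw T2 Tc | ].
  have c6 : 8 * W + 8 + 2 * n + 1 < V.
    by apply: (@fitsV _ 50) => //; eapply (pwW T2); [pw T2 Tc | ].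
  have c7 : m <= W by rewrite mE.
  have [xub [x [x1 x2 x3]]] := is_opt_excluded opt0.
  set r := [seq y <- _ | 0 < y.2] in xub x1 x2.
  have kr : kept n wf pf = map swap r.
    have e : mkseq (fun i => (wf i, pf i)) n = map swap (mkseq (fun i => (pf i, wf i)) n).
      by rewrite /mkseq -map_comp.
    by rewrite /kept e filter_map.
  have s1r : sum1 (kept n wf pf) = sum2 r by rewrite kr; have [] := sum_swap r.
  rewrite (sum1_ks n pf wf) -/SP in xub x3.
  have xub' e : sub_ms e (kept n wf pf) -> sum1 (kept n wf pf) <= W + sum1 e -> SP <= z + sum2 e.
    rewrite s1r kr => /sub_ms_swap h; have [e1 e2] := sum_swap e; rewrite -e1 -e2; exact: xub.
  have xex : exists e, [/\ sub_ms e (kept n wf pf), sum1 (kept n wf pf) <= W + sum1 e & SP = z + sum2 e].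
    have [e1 e2] := sum_swap x; exists (map swap x); rewrite e1 e2 s1r; split=> //.
    rewrite kr; case/sub_ms_compl: x1 => y p; apply: (@sub_ms_cat _ _ (map swap y)).
    by rewrite -map_cat; apply: perm_map.
  apply: wp_mono (finishD_ok um vB m0 mB VE HX nV c1 b2 sp EMo0 EMM EW2 EGW ESP2 c2 k2 xub' xex c7 c4 c5 c6).
  move=> s3 t3 [E0 t3le]; split=> //.
  have q0 : 0 < q by rewrite /q leq_min WM0 andbT ltnW.
  have qw : q <= minn n (wmax items) by rewrite /q leq_min geq_minl (leq_trans (geq_minr _ _) WMl).
  exists (q * W).
    right; split=> //; last by rewrite leq_mul2r qw orbT.
    apply: leq_trans (_ : PM * PM <= _); last by rewrite -mulnn leq_mul.
    by move/negbT: Emode; rewrite /mode -leqNgt addn1; apply: ltnW.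
  apply: (@total _ t3); first by move: t1le t2le; clear; lia.
  have d0 : 2 ^ 0 <= 2 * density m by rewrite expn0 muln_gt0; apply: leq_trans m0 (m_density m).
  have mq : minn n m = q by rewrite mE.
  apply: leq_trans t3le _; rewrite mq.
  apply: leq_trans (costD_L n L_ge4 (erefl T) mT m0 d0 EL W0 q0) _.
  have W1 : n + 1 + m + q * W <= n + 1 + wmax items + q * W by rewrite mE leq_add2r leq_add2l.
  by apply: leq_mul => //; apply: leq_pexp2l => //; apply: ltnW.
Qed.

End Main.

(** * Running time *)

Lemma cbrt_ge x a : a ^ 3 <= x -> a <= cbrt x.
Proof.
move=> h; rewrite /cbrt; have ax : a < x.+1.
  by rewrite ltnS; apply: leq_trans h; case: a => // a; rewrite -[leqLHS]expn1 leq_pexp2l.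
exact: (@leq_bigmax_cond _ (fun i : 'I_x.+1 => i ^ 3 <= x) (fun i => nat_of_ord i) (Ordinal ax)).
Qed.

Definition knapsack_program : program := prologue ++ compc knapsack 136.

Lemma size_prologue : size prologue = 136. Proof. by []. Qed.

Lemma size_prologue_cat b : size (prologue ++ b) = 136 + size b.
Proof. by rewrite size_cat. Qed.

Lemma code_prologue b : code_at (prologue ++ b) 136 b.
Proof.
move=> i ib; rewrite nth_cat size_prologue ltnNge leq_addr /=; congr nth; exact: addKn.
Qed.

Lemma code_prefix a b : code_at (a ++ b) 0 a.
Proof. by move=> i ia; rewrite add0n nth_cat ia. Qed.

Lemma exec_halt w P fuel pc m bits : size P <= pc -> exec w P fuel.+1 pc m bits = Some (m 0, 1).
Proof. by move=> h; rewrite /= nth_default. Qed.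

Section Final.
Variables (items : seq (nat * nat)) (W : nat).
Let n := size items.
Let L := logNU items W.
Let p := pmax items.
Let w := wmax items.

Lemma work_bound1 X : workload items W X -> X <= cbrt ((p * W) ^ 2 * (n * w)).
Proof.
move=> [->//|[_ Xp Xq]]; apply: cbrt_ge; rewrite expnS.
apply: leq_trans (leq_mul Xp (_ : X ^ 2 <= (minn n w * W) ^ 2)) _; first by rewrite leq_exp2r.
have h : minn n w ^ 2 <= n * w by rewrite -mulnn leq_mul // ?geq_minl ?geq_minr.
rewrite !expnMn -/p -mulnA leq_mul2l; apply/orP; right.
by rewrite mulnC leq_mul2l h orbT.
Qed.

(** Here [W] is bounded by [n * w], so [X ^ 3] is at most [p ^ 2 * (n * w) ^ 3]. The integer cube
    root bounds the quotient of [X] by [n * w], and the remainder costs one more [n * w]. *)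
Lemma work_bound2 X : workload items W X -> X <= n * w * cbrt (p ^ 2) + n * w.
Proof.
move=> [->//|[Wn Xp Xq]]; rewrite -/n -/w -/p in Wn Xp Xq.
have nw0 : 0 < n * w by apply: leq_ltn_trans Wn.
have h : X ^ 3 <= p ^ 2 * (n * w) ^ 3.
  rewrite (expnS X 2).
  apply: leq_trans (leq_mul Xp (_ : X ^ 2 <= (minn n w * W) ^ 2)) _; first by rewrite leq_exp2r.
  have e : minn n w ^ 2 <= n * w by rewrite -mulnn leq_mul // ?geq_minl ?geq_minr.
  rewrite leq_mul2l expnMn (expnS (n * w) 2) leq_mul ?orbT //.
  by rewrite leq_exp2r // ltnW.
have q3 : (X %/ (n * w)) ^ 3 <= p ^ 2.
  have nw3 : 0 < (n * w) ^ 3 by rewrite expn_gt0 nw0.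
  rewrite -(leq_pmul2r nw3) -expnMn; apply: leq_trans h.
  by rewrite leq_exp2r // leq_trunc_div.
have := cbrt_ge q3; have := divn_eq X (n * w); have := ltn_pmod X nw0.
move: (X %/ _) (X %% _) (cbrt _) => q r c rl -> qc.
rewrite [n * w * c]mulnC; apply: leq_add; last exact: ltnW.
by rewrite leq_mul2r qc orbT.
Qed.

Hypothesis n2 : 1 < n.

Lemma init_mem_lt x : init_mem items W x < 2 ^ L.
Proof.
rewrite /init_mem; case: ifP => _; first exact: nT.
case: ifP => _; first exact: WT.
case: ifP => h; last by rewrite expn_gt0.
have hi : (x - 2)./2 < n by move: h; rewrite -/n; lia.
case: ifP => _.
  by apply: leq_ltn_trans (w_le hi) _; apply: wmaxT.
by apply: leq_ltn_trans (p_le hi) _; apply: pmaxT.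
Qed.

Lemma knapsack_runs : exists t X, [/\ workload items W X, t <= 136 + 2000 * work items W X &
  forall fuel bits, exec (1800 * L) knapsack_program (t + fuel.+1) 0 (init_mem items W) bits =
    Some (OPT items W, t.+1)].
Proof.
have L4 := L_ge4 W n2; rewrite -/L in L4.
set V := (2 ^ L) ^ 60.
have T16 : 16 <= 2 ^ L by apply: (@leq_pexp2l 2 4).
have T2 : 2 <= 2 ^ L by apply: leq_trans T16.
have Tc : 4096 <= (2 ^ L) ^ 3 by apply: (@leq_trans (16 ^ 3)) => //; rewrite leq_exp2r.
have V4096 : 4096 <= V by apply: leq_trans Tc _; apply: leq_pexp2l; rewrite ?expn_gt0.
have e1800 : L * (60 * 30) = 1800 * L by rewrite mulnC.
(* Expressions of the program have degree at most [30] over [V = 2 ^ (60 * L)], hence the word size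
   [1800 * L]. *)
have VD : V ^ 30 <= 2 ^ (1800 * L) by rewrite /V -!expnM e1800.
have V0 : 0 < V by apply: leq_trans V4096.
have VW : V <= 2 ^ (1800 * L) by apply: leq_trans VD; rewrite -[leqLHS]expn1 leq_pexp2l.
have hn : n <= (2 ^ L) ^ 1 by rewrite expn1 ltnW // nT.
have SV : 1024 * n + 64 < V.
  by apply: (@pwlt (2 ^ L) 10) => //; eapply (pwW T2); [pw T2 Tc | ].
have mV x : init_mem items W x < V.
  by apply: (@pwlt (2 ^ L) 1) => //; rewrite expn1 ltnW // init_mem_lt.
have ca1 : code_at knapsack_program 0 prologue := @code_prefix _ _.
have ca2 : code_at knapsack_program 136 (compc knapsack 136).
  exact: code_prologue.
have n0 : 0 < size items by apply: ltnW.
have [m [s [r1 rl ini bd]]] := prologue_ok n0 (leq_trans SV VW) (fun x => leq_trans (mV x) VW) ca1.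
(* The degree bound [30] and the bound [2000] on instructions per step are verified by evaluating
   the program text. *)
have wf : wfc 30 2000 knapsack by vm_compute.
have [s' [m' [t [k [r2 rl' _ [EO [X wX kX]] tk]]]]] :=
  compc_ok V4096 VD wf rl (bd V SV mV) (knapsack_ok n2 ini) ca2.
exists (136 + t), X; split; first exact: wX.
  by rewrite leq_add2l; apply: leq_trans tk _; rewrite leq_mul2l kX orbT.
move=> fuel bits; have := runs_trans r1 r2; move=> /(_ fuel.+1 bits) ->.
have m0 : m' 0 = OPT items W by have [h _] := rl'; rewrite h.
rewrite exec_halt; first by rewrite m0 /= addn1.
exact: eq_leq (size_prologue_cat _).
Qed.

Lemma time_fits t X : workload items W X -> t <= 136 + 2000 * work items W X ->
  t.+1 <= minn (time_bound1 200 items W) (time_bound2 200 items W).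
Proof.
move=> wX tX; have b1 := work_bound1 wX; have b2 := work_bound2 wX.
have L4 := L_ge4 W n2; rewrite -/L in L4.
have L2 : 2 <= L by apply: leq_trans L4.
have Lc : 4096 <= L ^ 6 by apply: (@leq_trans (4 ^ 6)) => //; rewrite leq_exp2r.
have wn : w <= n * w by rewrite leq_pmull // ltnW.
(* The factor [2] accounts for [w] and [X] being absorbed separately into [F]. It and the constants
   [136] and [2000] are swallowed by powers of [L >= 4]; both exponents stay far below [200]. *)
have main F : 0 < F -> n + 1 + w + X <= 2 * F -> t.+1 <= 200 * L ^ 200 * F.
  move=> F0 hF.
  have h1 : n + 1 + w + X <= L ^ 1 * F by apply: leq_trans hF _; rewrite expn1 leq_mul2r L2 orbT.
  apply: leq_trans (_ : L ^ 150 * F <= _); last first.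
    rewrite leq_mul2r; apply/orP; right; apply: leq_trans (leq_pmull _ _) => //.
    by rewrite leq_pexp2l // ltnW.
  rewrite -[t.+1]add1n; apply: leq_trans (leq_add (leqnn 1) tX) _; rewrite addnA.
  have h2 : 1 + 136 <= L ^ 6 by apply: leq_trans Lc.
  have h3 : 2000 <= L ^ 6 by apply: leq_trans Lc.
  have h4 : L ^ 90 <= L ^ 90 by [].
  have h5 := pyL h3 (pyL h4 h1).
  have h6 := pyS F0 h2.
  exact: (pyW L2 (pyD L2 h6 h5)).
have arith z y a : w <= y -> X <= z -> a + 1 + w + X <= 2 * (z + y + a + 1) by move: (w); clear; lia.
have arith2 z y a : w <= y -> X <= z + y -> a + 1 + w + X <= 2 * (z + y + a + 1) by move: (w); clear; lia.
rewrite leq_min; apply/andP; split; apply: main; rewrite ?addn_gt0 ?orbT //.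
  exact: arith wn b1.
exact: arith2 wn b2.
Qed.

End Final.

Theorem theorem1 :
  forall c : nat,
  exists (P : program) (k K : nat),
  forall (items : seq (nat * nat)) (W : nat),
    let n := size items in
    let T := minn (time_bound1 K items W) (time_bound2 K items W) in
    (n ^ c - 1) * 2 ^ T <=
      #|[set bits : T.-tuple bool | succeeds P k items W bits]| * n ^ c.
Proof.
move=> c; exists knapsack_program; exists 1800; exists 200; move=> items W; cbv zeta.
set n := size items; set T := minn _ _.
have [n1|n2] := leqP n 1.
  (* For at most one item [n ^ c] is at most [1], and the required number of successes vanishes. *)
  have -> : n ^ c - 1 = 0; last by rewrite mul0n.
  case: n n1 => [|[|]] // _; last by rewrite exp1n.
  by case: c => // c; rewrite exp0n.
have [t [X [wX tX ex]]] := knapsack_runs W n2.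
have tT : t.+1 <= T := time_fits n2 wX tX.
have -> : [set bits : T.-tuple bool | succeeds knapsack_program 1800 items W bits] = setT.
  apply/setP => bits; rewrite !inE /succeeds.
  have eT : T = t + (T - t.+1).+1 by rewrite addnS -addSn subnKC.
  by move: (tval bits) => bs; rewrite eT ex eqxx.
rewrite cardsT card_tuple card_bool mulnC leq_mul2l leq_subr orbT //.
Qed.
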